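(* Let $r_0>0$ be the small constant, and $(\lambda_j(s),\psi_j(s,\omega))$, $j=-1,0,1,2,3$, the eigenvalues and eigenfunctions of $\hat B(\xi)$ for $\xi=s\omega$, $0<s=|\xi|\le r_0$, $\omega=\xi/|\xi|$, described in the context. Then the semigroup $S(t,\xi)=e^{t\hat B(\xi)}$ with $\xi=s\omega\in\mathbb R^3$, $s=|\xi|\neq0$, satisfies $$S(t,\xi)f=S_1(t,\xi)f+S_2(t,\xi)f,\qquad f\in L^2_\xi(\mathbb R^3_v),\ t>0,$$ where $$S_1(t,\xi)f=\sum_{j=-1}^3e^{t\lambda_j(s)}\big(f,\overline{\psi_j(s,\omega)}\big)_\xi\,\psi_j(s,\omega)\,1_{\{|\xi|\le r_0\}},$$ and $S_2(t,\xi)f:=S(t,\xi)f-S_1(t,\xi)f$ satisfies, for constants $C>0$ and $\sigma_0>0$ independent of $\xi$, $$\|S_2(t,\xi)f\|_\xi\le Ce^{-\sigma_0t}\|f\|_\xi,\qquad t\ge0.$$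
   Context: $L^2(\mathbb R^3_v)$ is the complex Hilbert space with $(f,g)=\int_{\mathbb R^3} f\bar g\,dv$ and norm $\|\cdot\|$. $M(v)=(2\pi)^{-3/2}e^{-|v|^2/2}$. The collision operator is $\mathcal Q(F,G)(v)=\int_{\mathbb R^3}\int_{\mathbb S^2}\mathcal B(|v-v_*|,\omega)\,(F(v_*')G(v')-F(v_* )G(v))\,dv_*d\omega$, with $v'=v-[(v-v_* )\cdot\omega]\omega$, $v'_*=v_*+[(v-v_* )\cdot\omega]\omega$, where the kernel is either hard sphere, $\mathcal B=|(v-v_* )\cdot\omega|$, or hard potential with angular cutoff, $\mathcal B=b(\cos\theta)|v-v_*|^\gamma$, $0\le\gamma<1$, $\cos\theta=|(v-v_* )\cdot\omega|/|v-v_*|$, $0\le b(\cos\theta)\le C|\cos\theta|$. The linearized collision operator is $Lf=M^{-1/2}[\mathcal Q(M,\sqrt Mf)+\mathcal Q(\sqrt Mf,M)]=Kf-\nu(v)f$, $D(L)=\{f\in L^2:\nu f\in L^2\}$, with $\nu(v)=\int\int \mathcal B M(v_* )\,d\omega dv_*$ and $K$ a self-adjoint compact operator on $L^2(\mathbb R^3_v)$. Standing facts: $\nu_0(1+|v|)^\gamma\le\nu(v)\le\nu_1(1+|v|)^\gamma$ ($\gamma=1$ for hard sphere); the null space $N_0$ of $L$ has orthonormal basis $\chi_0=\sqrt M$, $\chi_j=v_j\sqrt M$ ($j=1,2,3$), $\chi_4=(|v|^2-3)\sqrt M/\sqrt6$; $P_0$ is the orthogonal projection onto $N_0$, $P_1=I-P_0$;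 $(Lf,f)\le-\mu\|P_1f\|^2$ for $f\in D(L)$ with a constant $\mu>0$, and $\nu(0)\ge\nu_0\ge\mu>0$. $P_{\rm d}f=\sqrt M\int_{\mathbb R^3} f\sqrt M\,dv$. For $\xi\in\mathbb R^3\setminus\{0\}$: $(f,g)_\xi=(f,g)+|\xi|^{-2}(P_{\rm d}f,P_{\rm d}g)$, $\|f\|_\xi=\sqrt{(f,f)_\xi}$, $L^2_\xi(\mathbb R^3_v)$ is $L^2(\mathbb R^3_v)$ with this inner product, and $$\hat B(\xi)=L-\mathrm i(v\cdot\xi)-\frac{\mathrm i(v\cdot\xi)}{|\xi|^2}P_{\rm d}$$ with natural domain $\{f\in L^2:\nu f,\ (v\cdot\xi)f\in L^2\}$. $\hat B(\xi)$ generates a strongly continuous contraction semigroup $e^{t\hat B(\xi)}$ on $L^2_\xi(\mathbb R^3_v)$. Low-frequency eigen-data: $r_0>0$ denotes a fixed sufficiently small constant such that for $\xi=s\omega$, $0<s\le r_0$, $\omega\in\mathbb S^2$, the spectrum of $\hat B(\xi)$ in $\{\mathrm{Re}\,\lambda>-\mu/2\}$ consists of five eigenvalues (counted with multiplicity) $\lambda_j(s)$, $j=-1,0,1,2,3$, smooth in $s$, with $\lambda_{\pm1}(s)=\pm\mathrm i+(-a_1\pm\mathrm ib_1)s^2+o(s^2)$, $\lambda_0(s)=-a_0s^2+o(s^2)$, $\lambda_2(s)=\lambda_3(s)=-a_2s^2+o(s^2)$, where $a_0,a_1,a_2,b_1>0$ are constants, and with corresponding eigenfunctions $\psi_j(s,\omega)$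 ($\hat B(\xi)\psi_j=\lambda_j\psi_j$), smooth in $s$, normalized by $(\psi_j(s,\omega),\overline{\psi_k(s,\omega)})_\xi=\delta_{jk}$. *)

(* Defs.v *)
From HB Require Import structures.
From mathcomp Require Import all_boot all_order all_algebra.
From mathcomp Require Import all_classical all_reals all_analysis.
From mathcomp Require Import complex.

Set Implicit Arguments.
Unset Strict Implicit.
Unset Printing Implicit Defensive.

Import Order.TTheory GRing.Theory Num.Theory.
Import numFieldNormedType.Exports.

Local Open Scope classical_set_scope.
Local Open Scope ring_scope.
Local Open Scope complex_scope.

Notation vec3 R :=
  (measurableTypeR R * measurableTypeR R * measurableTypeR R)%type.

(* Elements of L^2(R^3_v) are represented by square-integrable functions (see
   [L2] below); equality in L^2 is equality almost everywhere,
   [f = g %[ae leb3 R]]. Operators act on representatives. *)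
Notation cfun R := (vec3 R -> R[i]).

Section Preliminaries.
Variable R : realType.
Implicit Types (u v : vec3 R) (f g : cfun R) (z : R[i]).

Definition dot u v : R := u.1.1 * v.1.1 + u.1.2 * v.1.2 + u.2 * v.2.

Definition vnorm u : R := Num.sqrt (dot u u).

Definition vscale (a : R) u : vec3 R := (a * u.1.1, a * u.1.2, a * u.2).

Definition leb3 : {measure set (vec3 R) -> \bar R} :=
  ((@lebesgue_measure R \x @lebesgue_measure R) \x @lebesgue_measure R)%E.

Definition cintegral d (T : measurableType d) (m : {measure set T -> \bar R})
    (D : set T) (h : T -> R[i]) : R[i] :=
  (\int[m]_(x in D) complex.Re (h x)) +i* (\int[m]_(x in D) complex.Im (h x)).

Definition cexp z : R[i] :=
  (expR (complex.Re z))%:C * (cos (complex.Im z) +i* sin (complex.Im z)).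

(* Integration over R^3 x S^2: S^2 is parametrized by spherical coordinates
   (theta, phi), with surface measure sin(theta) dtheta dphi. A point of the
   domain is (v_*, theta, phi). *)
Definition sphere_point (theta phi : R) : vec3 R :=
  (sin theta * cos phi, sin theta * sin phi, cos theta).

Definition leb3_angles :
    {measure set (vec3 R * measurableTypeR R * measurableTypeR R) -> \bar R} :=
  ((leb3 \x @lebesgue_measure R) \x @lebesgue_measure R)%E.

Definition angle_domain : set (vec3 R * measurableTypeR R * measurableTypeR R) :=
  [set p | 0 <= (p.1.2 : R) <= pi /\ 0 <= (p.2 : R) <= 2 * pi].

Definition int_vec_sphere (h : vec3 R -> vec3 R -> R[i]) : R[i] :=
  cintegral leb3_angles angle_domain
    (fun p => h p.1.1 (sphere_point p.1.2 p.2) * (sin (p.1.2 : R))%:C).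

End Preliminaries.

Section L2space.
Variable R : realType.
Implicit Types (f g : cfun R) (xi v : vec3 R).

Definition L2 f : Prop :=
  [/\ measurable_fun setT (fun v => complex.Re (f v) : measurableTypeR R),
      measurable_fun setT (fun v => complex.Im (f v) : measurableTypeR R) &
      (\int[@leb3 R]_v ((Normc.normc (f v)) ^+ 2)%:E < +oo)%E].

Definition cfconj f : cfun R := fun v => conjc (f v).

Definition inner f g : R[i] := cintegral (@leb3 R) setT (fun v => f v * conjc (g v)).

Definition L2norm f : R := Num.sqrt (complex.Re (inner f f)).

Definition maxwellian v : R :=
  (2 * pi) `^ (- (3 / 2)) * expR (- (vnorm v ^+ 2 / 2)).

Definition sqrtM v : R := Num.sqrt (maxwellian v).

Definition Pd f : cfun R := fun v =>
  (sqrtM v)%:C * cintegral (@leb3 R) setT (fun u => f u * (sqrtM u)%:C).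

Definition inner_xi xi f g : R[i] :=
  inner f g + ((vnorm xi ^+ 2)^-1)%:C * inner (Pd f) (Pd g).

Definition norm_xi xi f : R := Num.sqrt (complex.Re (inner_xi xi f f)).

Definition lincomb n (c : 'I_n -> R[i]) (e : 'I_n -> cfun R) : cfun R :=
  fun v => \sum_(i < n) c i * e i v.

Definition has_dim (W : cfun R -> Prop) (n : nat) : Prop :=
  exists e : 'I_n -> cfun R,
    [/\ forall i, W (e i),
        forall c, lincomb c e = (fun=> 0) %[ae @leb3 R] -> forall i, c i = 0 &
        forall f, W f -> exists c, f = lincomb c e %[ae @leb3 R]].

Definition orthonormal_basis (W : cfun R -> Prop) n (e : 'I_n -> cfun R) : Prop :=
  [/\ forall i, W (e i),
      forall i j, inner (e i) (e j) = (i == j)%:R &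
      forall f, W f -> exists c, f = lincomb c e %[ae @leb3 R]].

Definition bounded_linear (K : cfun R -> cfun R) : Prop :=
  [/\ forall f, L2 f -> L2 (K f),
      forall f g, L2 f -> L2 g -> f = g %[ae @leb3 R] ->
        K f = K g %[ae @leb3 R],
      forall (a : R[i]) f g, L2 f -> L2 g ->
        K (fun v => a * f v + g v) = (fun v => a * K f v + K g v) %[ae @leb3 R] &
      exists C : R, forall f, L2 f -> L2norm (K f) <= C * L2norm f].

Definition self_adjoint (K : cfun R -> cfun R) : Prop :=
  forall f g, L2 f -> L2 g -> inner (K f) g = inner f (K g).

Definition compact_op (K : cfun R -> cfun R) : Prop :=
  forall u : nat -> cfun R,
    (forall n, L2 (u n)) -> (exists C : R, forall n, L2norm (u n) <= C) ->
    exists (phi : nat -> nat) (g : cfun R),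
      [/\ forall n, (phi n < phi n.+1)%N, L2 g &
          (fun n => L2norm (K (u (phi n)) \- g)) @ \oo --> (0 : R)].

End L2space.

(* Unbounded operators are given by a domain D and an action A on
   representatives; N is the norm of the underlying Hilbert space. *)
Section Operators.
Variables (R : realType) (N : cfun R -> R).
Variables (D : cfun R -> Prop) (A : cfun R -> cfun R).
Implicit Types (f g : cfun R) (z : R[i]).

Definition resolvent_set z : Prop :=
  (exists C : R, forall f, D f -> N f <= C * N (fun v => z * f v - A f v)) /\
  (forall g, L2 g ->
    exists2 f, D f & (fun v => z * f v - A f v) = g %[ae @leb3 R]).

Definition spectrum z : Prop := ~ resolvent_set z.

Fixpoint ker_pow (z : R[i]) (k : nat) (f : cfun R) : Prop :=
  if k is k'.+1 then D f /\ ker_pow z k' (fun v => A f v - z * f v)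
  else f = (fun=> 0) %[ae @leb3 R].

Definition gen_eigenspace z f : Prop := L2 f /\ exists k, ker_pow z k f.

(* Algebraic multiplicity. *)
Definition multiplicity z (n : nat) : Prop := has_dim (gen_eigenspace z) n.

Definition eigenfunction z f : Prop :=
  [/\ D f, ~ (f = (fun=> 0) %[ae @leb3 R]) &
      A f = (fun v => z * f v) %[ae @leb3 R]].

Definition contraction_semigroup (S : R -> cfun R -> cfun R) : Prop :=
  [/\ forall t, 0 <= t ->
        [/\ forall f, L2 f -> L2 (S t f),
            forall f g, L2 f -> L2 g -> f = g %[ae @leb3 R] ->
              S t f = S t g %[ae @leb3 R],
            forall (a : R[i]) f g, L2 f -> L2 g ->
              S t (fun v => a * f v + g v)
                = (fun v => a * S t f v + S t g v) %[ae @leb3 R] &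
            forall f, L2 f -> N (S t f) <= N f],
      forall f, L2 f -> S 0 f = f %[ae @leb3 R],
      forall t s f, 0 <= t -> 0 <= s -> L2 f ->
        S (t + s) f = S t (S s f) %[ae @leb3 R] &
      forall f, L2 f -> N (S t f \- f) @[t --> 0^'+] --> (0 : R)].

Definition generator_of (S : R -> cfun R -> cfun R) : Prop :=
  forall f g, L2 f -> L2 g ->
    (D f /\ A f = g %[ae @leb3 R]) <->
    (N (fun v => (t^-1)%:C * (S t f v - f v) - g v) @[t --> 0^'+] --> (0 : R)).

End Operators.

(* u is infinitely differentiable on I, with difference quotients
   taken inside I; d n is its n-th derivative. The Hilbert space is
   the set of elements of E satisfying P. *)
Definition smooth_on (R : realType) (E : lmodType R[i]) (P : E -> Prop)
    (N : E -> R) (I : set R) (u : R -> E) : Prop :=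
  exists d : nat -> R -> E,
    (forall s, I s -> d 0%N s = u s) /\
    (forall n s, I s -> P (d n s) /\
      N (((s' - s)^-1)%:C *: (d n s' - d n s) - d n.+1 s)
        @[s' --> within I (dnbhs s)] --> (0 : R)).

Section Boltzmann.
Variable R : realType.
Implicit Types (f g F G : cfun R) (xi v u omega : vec3 R).

(* A kernel B is a function of the relative velocity v - v_* and of omega. *)
Definition hard_sphere (B : vec3 R -> vec3 R -> R) : Prop :=
  forall u omega, B u omega = `|dot u omega|.

Definition hard_potential (gamma : R) (B : vec3 R -> vec3 R -> R) : Prop :=
  exists b : R -> R,
    [/\ measurable_fun `[(0 : R), 1] b,
        exists C : R, forall x, 0 <= x <= 1 -> 0 <= b x <= C * `|x| &
        forall u omega,
          B u omega = b (`|dot u omega| / vnorm u) * vnorm u `^ gamma].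

Definition collision_kernel (gamma : R) (B : vec3 R -> vec3 R -> R) : Prop :=
  (gamma = 1 /\ hard_sphere B) \/ (0 <= gamma < 1 /\ hard_potential gamma B).

Variable B : vec3 R -> vec3 R -> R.

Definition Qcoll F G : cfun R := fun v =>
  int_vec_sphere (fun vs omega =>
    let v' : vec3 R := v - vscale (dot (v - vs) omega) omega in
    let vs' : vec3 R := vs + vscale (dot (v - vs) omega) omega in
    (B (v - vs) omega)%:C * (F vs' * G v' - F vs * G v)).

Definition Lop f : cfun R := fun v =>
  ((sqrtM v)^-1)%:C *
    (Qcoll (fun u => (maxwellian u)%:C) (fun u => (sqrtM u)%:C * f u) v
     + Qcoll (fun u => (sqrtM u)%:C * f u) (fun u => (maxwellian u)%:C) v).

Definition nu v : R :=
  complex.Re (int_vec_sphere (fun vs omega =>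
    (B (v - vs) omega * maxwellian vs)%:C)).

Definition domL f : Prop := L2 f /\ L2 (fun v => (nu v)%:C * f v).

Definition nullL f : Prop := domL f /\ Lop f = (fun=> 0) %[ae @leb3 R].

Definition chi (j : 'I_5) : cfun R := fun v =>
  match val j with
  | 0 => sqrtM v
  | 1 => v.1.1 * sqrtM v
  | 2 => v.1.2 * sqrtM v
  | 3 => v.2 * sqrtM v
  | _ => (vnorm v ^+ 2 - 3) * sqrtM v / Num.sqrt 6
  end%:C.

Definition P0 f : cfun R := lincomb (fun j => inner f (chi j)) chi.

Definition P1 f : cfun R := f \- P0 f.

Definition Bhat xi f : cfun R := fun v =>
  Lop f v - 'i%C * (dot v xi)%:C * f v
  - 'i%C * (dot v xi / vnorm xi ^+ 2)%:C * Pd f v.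

Definition domB xi f : Prop :=
  [/\ L2 f, L2 (fun v => (nu v)%:C * f v) & L2 (fun v => (dot v xi)%:C * f v)].

Definition L_splitting (K : cfun R -> cfun R) : Prop :=
  [/\ bounded_linear K, self_adjoint K, compact_op K &
      forall f, domL f -> Lop f = (fun v => K f v - (nu v)%:C * f v) %[ae @leb3 R]].

(* The order of R[i] forces (Lf, f) to be real. *)
Definition L_coercive (mu : R) : Prop :=
  forall f, domL f -> inner (Lop f) f <= (- (mu * L2norm (P1 f) ^+ 2))%:C.

Definition modes : seq int := [:: -1; 0; 1; 2; 3].

(* p(s) = q(s) + o(s^2) as s -> 0+ *)
Definition eq_upto_o2 (p q : R -> R[i]) : Prop :=
  Normc.normc (p s - q s) / s ^+ 2 @[s --> 0^'+] --> (0 : R).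

Record low_freq_eigendata (mu r0 a0 a1 a2 b1 : R) (lambda : int -> R -> R[i])
    (psi : int -> R -> vec3 R -> cfun R) : Prop := {
  lfe_spectrum : forall s omega z, 0 < s <= r0 -> vnorm omega = 1 ->
    - mu / 2 < complex.Re z ->
    let xi := vscale s omega in
    spectrum (norm_xi xi) (domB xi) (Bhat xi) z <->
      exists2 j, j \in modes & z = lambda j s;
  lfe_halfplane : forall j s, j \in modes -> 0 < s <= r0 ->
    - mu / 2 < complex.Re (lambda j s);
  lfe_multiplicity : forall s omega z, 0 < s <= r0 -> vnorm omega = 1 ->
    - mu / 2 < complex.Re z ->
    let xi := vscale s omega in
    multiplicity (domB xi) (Bhat xi) z (count (fun j => lambda j s == z) modes);
  lfe_lambda_smooth : forall j, j \in modes ->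
    smooth_on (E := R[i]^o) (fun=> True) (@Normc.normc R) `]0, r0] (lambda j);
  lfe_lambda1 :
    eq_upto_o2 (lambda 1) (fun s => 'i%C + (- a1 +i* b1) * (s ^+ 2)%:C);
  lfe_lambdaN1 :
    eq_upto_o2 (lambda (-1)) (fun s => - 'i%C + (- a1 -i* b1) * (s ^+ 2)%:C);
  lfe_lambda0 : eq_upto_o2 (lambda 0) (fun s => (- a0 * s ^+ 2)%:C);
  lfe_lambda2 : eq_upto_o2 (lambda 2) (fun s => (- a2 * s ^+ 2)%:C);
  lfe_lambda23 : forall s, 0 < s <= r0 -> lambda 2 s = lambda 3 s;
  lfe_psi_smooth : forall j omega, j \in modes -> vnorm omega = 1 ->
    smooth_on (E := vec3 R -> R[i]^o) (@L2 R) (@L2norm R) `]0, r0]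
      (fun s => psi j s omega);
  lfe_eigenfunction : forall j s omega, j \in modes -> 0 < s <= r0 ->
    vnorm omega = 1 ->
    let xi := vscale s omega in
    eigenfunction (domB xi) (Bhat xi) (lambda j s) (psi j s omega);
  lfe_normalized : forall j k s omega, j \in modes -> k \in modes ->
    0 < s <= r0 -> vnorm omega = 1 ->
    inner_xi (vscale s omega) (psi j s omega) (cfconj (psi k s omega))
      = (j == k)%:R }.

Variables (r0 : R) (lambda : int -> R -> R[i]) (psi : int -> R -> vec3 R -> cfun R).
Variable S : vec3 R -> R -> cfun R -> cfun R.

Definition S1 xi (t : R) f : cfun R := fun v =>
  let s := vnorm xi in
  let omega := vscale s^-1 xi in
  if s <= r0 then
    \sum_(j <- modes) cexp (t%:C * lambda j s)
      * inner_xi xi f (cfconj (psi j s omega)) * psi j s omega v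
  else 0.

Definition S2 xi (t : R) f : cfun R := S xi t f \- S1 xi t f.

End Boltzmann.

(* Main.v *)
Require Import Defs.
From HB Require Import structures.
From mathcomp Require Import all_boot all_order all_algebra.
From mathcomp Require Import all_classical all_reals all_analysis.
From mathcomp Require Import complex ring lra measurable_realfun.

(* With [P f = \sum_j (f, conj psi_j)_xi psi_j] one has [S_2(t) f = S(t) (f - P f)], because
   [S(t) psi_j = e^(t lambda_j) psi_j].  Three regimes of [s = |xi|] are combined.

   Small [s].  Gram-Schmidt turns the psi_j into an orthonormal basis e_k in which the generator
   is triangular with diagonal lambda_k, so coercivity gives
   [mu \sum_k |P_1 e_k|^2 <= - \sum_k Re lambda_k], which is small.  The span of the e_k is thus
   close to N_0; on the invariant kernel of [P] the fluid part [P_0 f] is small, so coercivity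
   yields the decay [e^(- mu t / 2)], and [P] is uniformly bounded.

   [s >= s_0].  The functional [|f|_xi^2] corrected by a small multiple of a bounded form coupling
   [P_0 f] to the transport terms [P_1 ((v . omega) chi_j)] is a Lyapunov functional: the Gram
   matrix of these functions for [j = 1, ..., 4] is positive definite (a computation of Gaussian
   moments), and the density component is controlled through the electric term.  Hence [S(t)]
   itself decays exponentially, uniformly in [s >= s_0].

   [s_0 <= s <= r_0].  It remains to bound [P] uniformly.  Otherwise there are triangular
   orthonormal bases at frequencies xi_n on whose span the bilinear form [(f, conj g)_xi]
   degenerates.  Since [e = (lambda + nu + i v . xi)^(-1) (K e - ...)] and [K] is compact, a
   subsequence of these bases converges to one at the limit frequency; by the multiplicity
   hypothesis the limit lies in the span of the psi_j, where the form is nondegenerate. *)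

Set Implicit Arguments.
Unset Strict Implicit.
Unset Printing Implicit Defensive.

Import Order.TTheory GRing.Theory Num.Theory.
Import numFieldNormedType.Exports.

Local Open Scope classical_set_scope.
Local Open Scope ring_scope.
Local Open Scope complex_scope.

Local Notation Re := complex.Re.
Local Notation Im := complex.Im.
Local Notation normc := Normc.normc.

(** * Complex numbers and inner product spaces *)

(** The generator is neither normal nor self-adjoint, and no contour integral of its resolvent is
    taken: the decay comes from energy inequalities on the domain, extended by density. What
    replaces orthogonality is a symmetry. Since [L] is real and self-adjoint, [Bhat xi] is symmetric
    for the bilinear pairing of [f] with the conjugate of [g], so the conjugates of the psi_j form
    the dual family and are eigenfunctions of the adjoint. The obstacle is the uniform bound on P.
    The psi_j are normalized for a pairing that is not positive, so the normalization does not bound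
    their norms, and their smoothness is in s > 0 for each fixed omega, with nothing uniform in
    omega or as s tends to 0. The estimates therefore work with orthonormal bases of their span:
    there the vectors have norm one, the diagonal entries are eigenvalues with real part above - mu
    / 2, and the other entries are controlled by the quadratic form of [L]. Operators act on
    functions while equality holds almost everywhere; passing to classes lets one abstract theory of
    inner products serve every frequency. *)

Section ComplexNumbers.
Variable R : realType.
Implicit Types (z w : R[i]) (a b : R).

Lemma Re_add z w : Re (z + w) = Re z + Re w.
Proof. by case: z w => [? ?] []. Qed.

Lemma Im_add z w : Im (z + w) = Im z + Im w.
Proof. by case: z w => [? ?] []. Qed.

Lemma Re_opp z : Re (- z) = - Re z.
Proof. by case: z. Qed.

Lemma Im_opp z : Im (- z) = - Im z.
Proof. by case: z. Qed.

Lemma Re_mul z w : Re (z * w) = Re z * Re w - Im z * Im w.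
Proof. by case: z w => [? ?] []. Qed.

Lemma Im_mul z w : Im (z * w) = Re z * Im w + Im z * Re w.
Proof. by case: z w => [? ?] []. Qed.

Lemma Re_scale a z : Re (a%:C * z) = a * Re z.
Proof. by rewrite Re_mul /= mul0r subr0. Qed.

Lemma Im_scale a z : Im (a%:C * z) = a * Im z.
Proof. by rewrite Im_mul /= mul0r addr0. Qed.

Lemma Re_conjc z : Re (conjc z) = Re z.
Proof. by case: z. Qed.

Lemma Im_conjc z : Im (conjc z) = - Im z.
Proof. by case: z. Qed.

Lemma Re_sum (I : Type) (r : seq I) (P : pred I) (F : I -> R[i]) :
  Re (\sum_(i <- r | P i) F i) = \sum_(i <- r | P i) Re (F i).
Proof. by elim/big_rec2: _ => // i x y _ <-; rewrite Re_add. Qed.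

Lemma complex_ext z w : Re z = Re w -> Im z = Im w -> z = w.
Proof. by case: z w => [? ?] [? ?] /= -> ->. Qed.

Lemma conjcM z w : conjc (z * w) = conjc z * conjc w.
Proof. exact: rmorphM. Qed.

Lemma conjcD z w : conjc (z + w) = conjc z + conjc w.
Proof. exact: rmorphD. Qed.

Lemma conjcN z : conjc (- z) = - conjc z.
Proof. exact: rmorphN. Qed.

Lemma sqr_normcE z : normc z ^+ 2 = Re z ^+ 2 + Im z ^+ 2.
Proof. by case: z => a b /=; rewrite sqr_sqrtr// addr_ge0// sqr_ge0. Qed.

Lemma normc_ge0 z : 0 <= normc z.
Proof. by case: z => a b; exact: sqrtr_ge0. Qed.

Lemma normc_conj z : normc (conjc z) = normc z.
Proof. by case: z => a b /=; rewrite sqrrN. Qed.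

Lemma mul_conjc z : z * conjc z = (normc z ^+ 2)%:C.
Proof.
by rewrite sqr_normcE; case: z => a b; apply: complex_ext; rewrite ?Re_mul ?Im_mul /=; ring.
Qed.

Lemma normcR a : normc a%:C = `|a|.
Proof. by rewrite /= expr0n addr0 sqrtr_sqr. Qed.

Lemma normc_i : normc 'i%C = 1 :> R.
Proof. by rewrite /= expr0n add0r expr1n sqrtr1. Qed.

Lemma normr_Re_le z : `|Re z| <= normc z.
Proof.
rewrite -(@ler_pXn2r _ 2) ?nnegrE ?normc_ge0// sqr_normcE real_normK ?num_real//.
by rewrite lerDl sqr_ge0.
Qed.

Lemma normr_Im_le z : `|Im z| <= normc z.
Proof.
rewrite -(@ler_pXn2r _ 2) ?nnegrE ?normc_ge0// sqr_normcE real_normK ?num_real//.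
by rewrite lerDr sqr_ge0.
Qed.

Lemma Re_le_normc z : Re z <= normc z.
Proof. exact: le_trans (ler_norm _) (normr_Re_le z). Qed.

Lemma normc_le_ReIm z : normc z <= `|Re z| + `|Im z|.
Proof.
rewrite -(@ler_pXn2r _ 2) ?nnegrE ?normc_ge0 ?addr_ge0// sqr_normcE sqrrD.
rewrite !real_normK ?num_real// -addrA (addrC (_ *+ 2)) addrA lerDl.
by rewrite mulrn_wge0// mulr_ge0.
Qed.

Lemma normc_eq0 z : (normc z == 0) = (z == 0).
Proof.
by apply/eqP/eqP => [/Normc.eq0_normc //|->]; rewrite Normc.normc0.
Qed.

Lemma normc_gt0 z : (0 < normc z) = (z != 0).
Proof. by rewrite lt_def normc_ge0 andbT normc_eq0. Qed.

Lemma realC_eq (z : R[i]) : conjc z = z -> z = (Re z)%:C.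
Proof.
move=> /(congr1 (@complex.Im R)); rewrite Im_conjc => h; apply: complex_ext => //=; lra.
Qed.

End ComplexNumbers.

(** The form is a parameter and not a structure on [E], because the one space [L2class] carries a
    different inner product [ipx xi] for each frequency. *)
Record inner_product (R : realType) (E : lmodType R[i]) (ip : E -> E -> R[i]) :
    Prop := {
  ip_linear : forall a f g h, ip (a *: f + g) h = a * ip f h + ip g h;
  ip_conj : forall f g, conjc (ip f g) = ip g f;
  ip_ge0 : forall f, 0 <= Re (ip f f);
  ip_definite : forall f, ip f f = 0 -> f = 0 }.

Definition ipnorm (R : realType) (E : lmodType R[i]) (ip : E -> E -> R[i]) (f : E) :=
  Num.sqrt (Re (ip f f)).

Section InnerProduct.
Variables (R : realType) (E : lmodType R[i]) (ip : E -> E -> R[i]).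
Hypothesis hip : inner_product ip.
Local Notation N := (ipnorm ip).
Implicit Types (f g h : E) (a : R[i]).

Lemma ip0l h : ip 0 h = 0.
Proof.
have := ip_linear hip 1 0 0 h; rewrite scaler0 addr0 mul1r => /eqP.
by rewrite addrC -subr_eq subrr eq_sym => /eqP.
Qed.

Lemma ipDl f g h : ip (f + g) h = ip f h + ip g h.
Proof. by have := ip_linear hip 1 f g h; rewrite scale1r mul1r. Qed.

Lemma ipZl a f h : ip (a *: f) h = a * ip f h.
Proof. by have := ip_linear hip a f 0 h; rewrite addr0 ip0l addr0. Qed.

Lemma ipNl f h : ip (- f) h = - ip f h.
Proof. by rewrite -scaleN1r ipZl mulN1r. Qed.

Lemma ipBl f g h : ip (f - g) h = ip f h - ip g h.
Proof. by rewrite ipDl ipNl. Qed.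

Lemma ipBZl (a b : R[i]) f g h k : ip (f - a *: g - b *: h) k = ip f k - a * ip g k - b * ip h k.
Proof. by rewrite !ipBl !ipZl. Qed.

Lemma ip_suml (I : Type) (r : seq I) (P : pred I) (F : I -> E) h :
  ip (\sum_(i <- r | P i) F i) h = \sum_(i <- r | P i) ip (F i) h.
Proof. by elim/big_rec2: _ => [|i x y _ <-]; rewrite ?ip0l ?ipDl. Qed.

Lemma ip0r f : ip f 0 = 0.
Proof. by rewrite -(ip_conj hip) ip0l conjc0. Qed.

Lemma ipDr f g h : ip f (g + h) = ip f g + ip f h.
Proof. by rewrite -(ip_conj hip) ipDl conjcD !(ip_conj hip). Qed.

Lemma ipZr a f h : ip f (a *: h) = conjc a * ip f h.
Proof. by rewrite -(ip_conj hip) ipZl conjcM !(ip_conj hip). Qed.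

Lemma ipNr f h : ip f (- h) = - ip f h.
Proof. by rewrite -(ip_conj hip) ipNl conjcN !(ip_conj hip). Qed.

Lemma ipBr f g h : ip f (g - h) = ip f g - ip f h.
Proof. by rewrite ipDr ipNr. Qed.

Lemma ip_sumr (I : Type) (r : seq I) (P : pred I) (F : I -> E) f :
  ip f (\sum_(i <- r | P i) F i) = \sum_(i <- r | P i) ip f (F i).
Proof. by elim/big_rec2: _ => [|i x y _ <-]; rewrite ?ip0r ?ipDr. Qed.

Lemma ipnorm_ge0 f : 0 <= N f.
Proof. exact: sqrtr_ge0. Qed.

Lemma sqr_ipnorm f : N f ^+ 2 = Re (ip f f).
Proof. by rewrite sqr_sqrtr// ip_ge0. Qed.

Lemma ipff f : ip f f = (N f ^+ 2)%:C.
Proof. by rewrite sqr_ipnorm; apply/realC_eq/(ip_conj hip). Qed.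

Lemma ipnorm0 : N 0 = 0.
Proof. by rewrite /ipnorm ip0l sqrtr0. Qed.

Lemma ipnorm_eq0 f : N f = 0 -> f = 0.
Proof. by move=> f0; apply: (ip_definite hip); rewrite ipff f0 expr0n. Qed.

Lemma sqr_ipnormD f g : N (f + g) ^+ 2 = N f ^+ 2 + N g ^+ 2 + 2 * Re (ip f g).
Proof.
rewrite !sqr_ipnorm ipDl !ipDr !Re_add -(ip_conj hip f g) Re_conjc; ring.
Qed.

Lemma ipnormZ a f : N (a *: f) = normc a * N f.
Proof.
rewrite /ipnorm ipZl ipZr mulrA mul_conjc Re_scale sqrtrM ?sqr_ge0//.
by rewrite sqrtr_sqr ger0_norm// normc_ge0.
Qed.

Lemma ipnormN f : N (- f) = N f.
Proof. by rewrite -scaleN1r ipnormZ normcN Normc.normc1 mul1r. Qed.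

Lemma ipnormB f g : N (f - g) = N (g - f).
Proof. by rewrite -ipnormN opprB. Qed.

Lemma cauchy_schwarz f g : normc (ip f g) <= N f * N g.
Proof.
have [g0|g0] := eqVneq (N g) 0.
  by rewrite (ipnorm_eq0 g0) ip0r Normc.normc0 mulr_ge0// ipnorm_ge0.
have gp : 0 < N g by rewrite lt_def g0 ipnorm_ge0.
(* The coefficient [c] is that of the projection of [f] on [g]; expanding the square of
   [N (f - c *: g)] gives the inequality. *)
have := ipnorm_ge0 (f - (ip f g / (N g ^+ 2)%:C) *: g).
set c := ip f g / _ => _.
have : 0 <= N (f - c *: g) ^+ 2 by rewrite sqr_ge0.
have cE : c = ((N g ^+ 2)^-1)%:C * ip f g by rewrite /c mulrC fmorphV.
rewrite sqr_ipnormD ipnormN ipNr Re_opp ipZr ipnormZ.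
rewrite {2}cE conjcM conjc_real -mulrA (mulrC (conjc _)) mul_conjc.
rewrite cE Normc.normcM normcR ger0_norm ?invr_ge0 ?sqr_ge0// => h.
rewrite -(@ler_pXn2r _ 2) ?nnegrE ?normc_ge0 ?mulr_ge0 ?ipnorm_ge0//.
have -> : normc (ip f g) ^+ 2 = N g ^+ 2 * (N f ^+ 2 -
  (N f ^+ 2 + ((N g ^+ 2)^-1 * normc (ip f g) * N g) ^+ 2 +
  2 * - Re (((N g ^+ 2)^-1)%:C * (normc (ip f g) ^+ 2)%:C))).
  by rewrite Re_scale /=; field.
by rewrite [leRHS]exprMn [leRHS]mulrC ler_wpM2l ?sqr_ge0// lerBlDr lerDl.
Qed.

Lemma ler_ipnormD f g : N (f + g) <= N f + N g.
Proof.
rewrite -(@ler_pXn2r _ 2) ?nnegrE ?addr_ge0 ?ipnorm_ge0// sqr_ipnormD.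
have := le_trans (Re_le_normc _) (cauchy_schwarz f g); nra.
Qed.

Lemma ler_ipnormB f g : N (f - g) <= N f + N g.
Proof. by rewrite -(ipnormN g) ler_ipnormD. Qed.

Lemma ler_ipnorm_sum (I : Type) (r : seq I) (P : pred I) (F : I -> E) :
  N (\sum_(i <- r | P i) F i) <= \sum_(i <- r | P i) N (F i).
Proof.
elim/big_rec2: _ => [|i x y _ yx]; first by rewrite ipnorm0.
by rewrite (le_trans (ler_ipnormD _ _))// lerD2l.
Qed.

(** Families are functions on [nat] with a bound, so that the initial segments occurring in
    triangular relations need no change of index type. *)
Definition orthonormal_family n (e : nat -> E) : Prop :=
  forall i j, (i < n)%N -> (j < n)%N -> ip (e i) (e j) = (i == j)%:R.

Section Orthonormal.
Variables (n : nat) (e : nat -> E).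
Hypothesis he : orthonormal_family n e.

Lemma ip_comb_orthonormal (c : nat -> R[i]) j : (j < n)%N ->
  ip (\sum_(i < n) c i *: e i) (e j) = c j.
Proof.
move=> jn; rewrite ip_suml (bigD1 (Ordinal jn))//= ipZl he// eqxx mulr1.
rewrite big1 ?addr0// => i ij; rewrite ipZl he// (_ : _ == _ = false) ?mulr0//.
by apply/negbTE; apply: contra ij => /eqP ij; apply/eqP/val_inj.
Qed.

Lemma sqr_ipnorm_comb (c : nat -> R[i]) :
  N (\sum_(i < n) c i *: e i) ^+ 2 = \sum_(i < n) normc (c i) ^+ 2.
Proof.
rewrite sqr_ipnorm ip_sumr Re_sum; apply: eq_bigr => i _.
by rewrite ipZr ip_comb_orthonormal// mulrC mul_conjc.
Qed.

Definition oproj f := \sum_(i < n) ip f (e i) *: e i.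

Lemma ip_oproj f j : (j < n)%N -> ip (oproj f) (e j) = ip f (e j).
Proof. by move=> jn; rewrite (ip_comb_orthonormal (fun i => ip f (e i))). Qed.

Lemma ip_oproj_orth f g : ip (f - oproj f) (oproj g) = 0.
Proof.
rewrite ip_sumr big1// => i _; rewrite ipZr ipBl ip_oproj// subrr mulr0 //.
Qed.

Lemma sqr_ipnorm_oproj f : N (oproj f) ^+ 2 = \sum_(i < n) normc (ip f (e i)) ^+ 2.
Proof. exact: (sqr_ipnorm_comb (fun i => ip f (e i))). Qed.

Lemma pythagoras f : N f ^+ 2 = N (oproj f) ^+ 2 + N (f - oproj f) ^+ 2.
Proof.
have := sqr_ipnormD (f - oproj f) (oproj f).
by rewrite subrK ip_oproj_orth mulr0 addr0 addrC.
Qed.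

Lemma bessel f : \sum_(i < n) normc (ip f (e i)) ^+ 2 <= N f ^+ 2.
Proof. by rewrite pythagoras -sqr_ipnorm_oproj lerDl sqr_ge0. Qed.

Lemma ipnorm_oproj_le f : N (oproj f) <= N f.
Proof.
rewrite -(@ler_pXn2r _ 2) ?nnegrE ?ipnorm_ge0//.
by rewrite (pythagoras f) lerDl sqr_ge0.
Qed.

Lemma ipnorm_oprojC_le f : N (f - oproj f) <= N f.
Proof.
rewrite -(@ler_pXn2r _ 2) ?nnegrE ?ipnorm_ge0//.
by rewrite (pythagoras f) lerDr sqr_ge0.
Qed.

Lemma oprojD f g : oproj (f + g) = oproj f + oproj g.
Proof. by rewrite /oproj -big_split; apply: eq_bigr => i _; rewrite ipDl scalerDl. Qed.

Lemma oprojZ a f : oproj (a *: f) = a *: oproj f.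
Proof. by rewrite /oproj scaler_sumr; apply: eq_bigr => i _; rewrite ipZl scalerA. Qed.

End Orthonormal.

(** The dual functionals [phi k] certify that no step degenerates: [phi m] kills the vectors built
    before step [m] and takes the value 1 on the remainder [w], which is therefore nonzero. *)
Lemma gram_schmidt n (psi : nat -> E) (phi : nat -> E -> R[i]) :
  (forall k, scalar (phi k)) ->
  (forall j k, (j < n)%N -> (k < n)%N -> phi k (psi j) = (j == k)%:R) ->
  exists e : nat -> E, exists t : nat -> R[i],
    orthonormal_family n e /\ forall k, (k < n)%N -> t k != 0 /\
      psi k = t k *: e k + \sum_(i < k) ip (psi k) (e i) *: e i.
Proof.
move=> phil; have phi0 k : phi k 0 = 0.
  by have := phil k (-1) 0 0; rewrite scaler0 addr0 mulN1r addNr.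
have phiD k f g : phi k (f + g) = phi k f + phi k g.
  by rewrite -[f]scale1r phil scale1r mul1r.
have phiZ k a f : phi k (a *: f) = a * phi k f.
  by rewrite -[a *: f]addr0 phil phi0 addr0.
have phi_sum k m (F : 'I_m -> E) : phi k (\sum_(i < m) F i) = \sum_(i < m) phi k (F i).
  by elim/big_rec2: _ => // i x y _ <-; rewrite phiD.
move=> phipsi.
suff: forall m, (m <= n)%N -> exists e : nat -> E, exists t : nat -> R[i],
    [/\ orthonormal_family m e, forall k, (k < m)%N -> t k != 0 /\
      psi k = t k *: e k + \sum_(i < k) ip (psi k) (e i) *: e i
     & forall i k, (i < m)%N -> (m <= k < n)%N -> phi k (e i) = 0].
  by move=> /(_ n (leqnn n)) [e [t [? ? _]]]; exists e, t.
elim=> [_|m IH mn]; first by exists (fun=> 0), (fun=> 1).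
have [e [t [eo et ephi]]] := IH (ltnW mn).
pose w := psi m - \sum_(i < m) ip (psi m) (e i) *: e i.
have phiw k : (m <= k < n)%N -> phi k w = (m == k)%:R.
  move=> /andP[mk kn]; rewrite /w phiD -scaleN1r phiZ phi_sum big1.
    by rewrite mulr0 addr0 phipsi.
  by move=> i _; rewrite phiZ ephi ?mulr0// mk.
have w0 : N w != 0.
  apply/eqP => /ipnorm_eq0 w0; have := phiw m; rewrite leqnn mn w0 phi0 eqxx.
  by move=> /(_ isT)/eqP; rewrite eq_sym oner_eq0.
have wo i : (i < m)%N -> ip w (e i) = 0.
  by move=> im; rewrite ipBl ip_oproj// subrr.
pose em := ((N w)^-1)%:C *: w.
exists (fun k => if k == m then em else e k), (fun k => if k == m then (N w)%:C else t k).
split.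
- move=> i j; rewrite !ltnS => im jm.
  have [->|im'] := eqVneq i m; have [jm'|jm'] := eqVneq j m; rewrite ?jm' ?eqxx.
  + rewrite ipZl ipZr conjc_real ipff -!rmorphM /=.
    by rewrite (_ : _ * _ = 1)//; field.
  + by rewrite ipZl wo ?mulr0 1?[m == j]eq_sym ?(negbTE jm')// ltn_neqAle jm'.
  + by rewrite (negbTE im') ipZr -(ip_conj hip) wo ?conjc0 ?mulr0// ltn_neqAle im'.
  + by apply: eo; rewrite ltn_neqAle ?im' ?jm'.
- move=> k; rewrite ltnS => km; case: (ltngtP k m) km => // [km|->] _.
    have [tk {1}->] := et _ km; split => //; congr (_ + _); apply: eq_bigr => i _.
    by rewrite ltn_eqF// (ltn_trans (ltn_ord i)).
  split; first by rewrite -normc_eq0 normcR normr_eq0.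
  rewrite scalerA -rmorphM /= divff// scale1r.
  rewrite [X in _ = _ + X](_ : _ = \sum_(i < m) ip (psi m) (e i) *: e i) ?subrK//.
  by apply: eq_bigr => i _; rewrite ltn_eqF.
- move=> i k; rewrite ltnS => im /andP[mk kn].
  have [_|im'] := eqVneq i m; last first.
    by rewrite ephi ?(ltnW mk)// ltn_neqAle im'.
  by rewrite phiZ phiw ?(ltnW mk)// ltn_eqF// mulr0.
Qed.

End InnerProduct.

(** * Square-integrable functions *)

Section Integrals.
Variable R : realType.
Local Notation mu := (@leb3 R).
Implicit Types (f g : cfun R) (h k : vec3 R -> R) (a : R[i]).

Definition cmeasurable f : Prop :=
  measurable_fun setT (fun v => Re (f v)) /\ measurable_fun setT (fun v => Im (f v)).

Definition integ h : Prop := mu.-integrable setT (EFin \o h).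

Definition cinteg f : Prop := integ (fun v => Re (f v)) /\ integ (fun v => Im (f v)).

Definition cint f : R[i] := cintegral mu setT f.

Lemma integ_le h k : measurable_fun setT h -> (forall v, `|h v| <= k v) ->
  integ k -> integ h.
Proof.
move=> mh hk; apply: le_integrable => //; first exact/measurable_EFinP.
by move=> v _ /=; rewrite lee_fin (le_trans (hk v))// ler_norm.
Qed.

Lemma integD h k : integ h -> integ k -> integ (fun v => h v + k v).
Proof. by move=> ih ik; have := integrableD measurableT ih ik. Qed.

Lemma integN h : integ h -> integ (fun v => - h v).
Proof. by move=> ih; exact: (integrableN ih). Qed.

Lemma integB h k : integ h -> integ k -> integ (fun v => h v - k v).
Proof. by move=> ih /integN; exact: integD. Qed.

Lemma integZ (c : R) h : integ h -> integ (fun v => c * h v).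
Proof. by move=> ih; have := integrableZl measurableT c ih. Qed.

Lemma integ0 : integ (fun=> 0).
Proof. exact: integrable0. Qed.

Lemma eq_integ h k : h =1 k -> integ h -> integ k.
Proof. by move=> hk ih; rewrite -(_ : h = k)//; exact/funext. Qed.

Lemma eq_cint f g : f =1 g -> cint f = cint g.
Proof. by move=> fg; congr cint; exact/funext. Qed.

Lemma cintegZ a f : cinteg f -> cinteg (fun v => a * f v).
Proof.
move=> [f1 f2]; split.
  by apply: eq_integ (integB (integZ (Re a) f1) (integZ (Im a) f2)) => v; rewrite Re_mul.
by apply: eq_integ (integD (integZ (Re a) f2) (integZ (Im a) f1)) => v; rewrite Im_mul.
Qed.

Lemma cintD f g : cinteg f -> cinteg g -> cint (fun v => f v + g v) = cint f + cint g.
Proof.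
move=> [f1 f2] [g1 g2]; apply: complex_ext; rewrite ?Re_add ?Im_add /=.
  by under eq_Rintegral do rewrite Re_add; rewrite RintegralD.
by under eq_Rintegral do rewrite Im_add; rewrite RintegralD.
Qed.

Lemma cintZ a f : cinteg f -> cint (fun v => a * f v) = a * cint f.
Proof.
move=> [f1 f2]; apply: complex_ext; rewrite ?Re_mul ?Im_mul /=.
  under eq_Rintegral do rewrite Re_mul.
  by rewrite RintegralB ?RintegralZl//; exact: integZ.
under eq_Rintegral do rewrite Im_mul.
by rewrite RintegralD ?RintegralZl//; exact: integZ.
Qed.

Lemma RintegralN (d : measure_display) (T : measurableType d)
    (m : {measure set T -> \bar R}) (D : set T) (h : T -> R) :
  (\int[m]_(x in D) - h x = - \int[m]_(x in D) h x)%R.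
Proof.
rewrite /Rintegral [in LHS]integralE [in RHS]integralE.
have -> : ((EFin \o (fun x => - h x)%R)^\+ = (EFin \o h)^\-)%E.
  by apply/funext => x; rewrite funeposE funenegE.
have -> : ((EFin \o (fun x => - h x)%R)^\- = (EFin \o h)^\+)%E.
  by apply/funext => x; rewrite funeposE funenegE /= opprK.
have pp : (0 <= \int[m]_(x in D) (EFin \o h)^\+ x)%E.
  by apply: integral_ge0 => x _; exact: funepos_ge0.
have nn : (0 <= \int[m]_(x in D) (EFin \o h)^\- x)%E.
  by apply: integral_ge0 => x _; exact: funeneg_ge0.
move: pp nn; case: (\int[m]_(x in D) _)%E => [r| |];
  case: (\int[m]_(x in D) _)%E => [s| |] //= _ _; rewrite ?oppr0 //.
by rewrite opprB.
Qed.

Lemma cintegral_conj (d : measure_display) (T : measurableType d)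
    (m : {measure set T -> \bar R}) (D : set T) (h : T -> R[i]) :
  cintegral m D (fun x => conjc (h x)) = conjc (cintegral m D h).
Proof.
apply: complex_ext; rewrite ?Re_conjc ?Im_conjc /=.
  by under eq_Rintegral do rewrite Re_conjc.
by under eq_Rintegral do rewrite Im_conjc; rewrite RintegralN.
Qed.

Lemma cintR h : cint (fun v => (h v)%:C) = (\int[mu]_v h v)%:C.
Proof.
apply: complex_ext => //=; rewrite /Rintegral integral0//.
Qed.

Lemma cmeasurableD f g : cmeasurable f -> cmeasurable g ->
  cmeasurable (fun v => f v + g v).
Proof.
move=> [f1 f2] [g1 g2]; split.
  by under eq_fun do rewrite Re_add; exact: measurable_funD.
by under eq_fun do rewrite Im_add; exact: measurable_funD.
Qed.

Lemma cmeasurableM f g : cmeasurable f -> cmeasurable g ->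
  cmeasurable (fun v => f v * g v).
Proof.
move=> [f1 f2] [g1 g2]; split.
  by under eq_fun do rewrite Re_mul; apply: measurable_funB; exact: measurable_funM.
by under eq_fun do rewrite Im_mul; apply: measurable_funD; exact: measurable_funM.
Qed.

Lemma cmeasurable_cst a : cmeasurable (fun=> a).
Proof. by split; exact: measurable_cst. Qed.

Lemma cmeasurable_conj f : cmeasurable f -> cmeasurable (cfconj f).
Proof.
move=> [f1 f2]; split; rewrite /cfconj.
  by under eq_fun do rewrite Re_conjc.
by under eq_fun do rewrite Im_conjc; exact: measurable_funN.
Qed.

Lemma cmeasurableR h : measurable_fun setT h -> cmeasurable (fun v => (h v)%:C).
Proof. by move=> mh; split => //; exact: measurable_cst. Qed.

Lemma measurable_sqr_normc f : cmeasurable f ->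
  measurable_fun setT (fun v => normc (f v) ^+ 2).
Proof.
move=> [f1 f2]; under eq_fun do rewrite sqr_normcE.
by apply: measurable_funD; exact: measurable_funX.
Qed.

Lemma L2E f : L2 f <-> cmeasurable f /\ integ (fun v => normc (f v) ^+ 2).
Proof.
suff H : cmeasurable f -> (\int[mu]_v ((normc (f v)) ^+ 2)%:E < +oo)%E <->
    integ (fun v => normc (f v) ^+ 2).
  split=> [[f1 f2 fi]|[mf fi]].
    by have mf : cmeasurable f by []; split => //; exact/H.
  by have [f1 f2] := mf; split => //; exact/H.
move=> mf; have mF : measurable_fun setT (fun v => (normc (f v) ^+ 2)%:E).
  by apply/measurable_EFinP; exact: measurable_sqr_normc.
have E : (\int[mu]_v `|(normc (f v) ^+ 2)%:E| = \int[mu]_v (normc (f v) ^+ 2)%:E)%E.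
  by apply: eq_integral => v _; rewrite gee0_abs// lee_fin sqr_ge0.
split=> [fi|/integrableP[_]]; last by rewrite E.
by apply/integrableP; split => //; rewrite E.
Qed.

Lemma L2_measurable f : L2 f -> cmeasurable f.
Proof. by case/L2E. Qed.

Lemma L2_integ f : L2 f -> integ (fun v => normc (f v) ^+ 2).
Proof. by case/L2E. Qed.

Lemma cinteg_le f h : cmeasurable f -> (forall v, normc (f v) <= h v) ->
  integ h -> cinteg f.
Proof.
move=> [f1 f2] fh ih; split; apply: integ_le ih => // v.
  exact: le_trans (normr_Re_le _) _.
exact: le_trans (normr_Im_le _) _.
Qed.

Lemma normc_mul_le (z w : R[i]) : normc (z * w) <= normc z ^+ 2 + normc w ^+ 2.
Proof.
rewrite Normc.normcM; have := sqr_ge0 (normc z - normc w).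
have := mulr_ge0 (normc_ge0 z) (normc_ge0 w); nra.
Qed.

Lemma sqr_normcD_le (z w : R[i]) :
  normc (z + w) ^+ 2 <= 2 * normc z ^+ 2 + 2 * normc w ^+ 2.
Proof.
have h1 := le_normcD z w; have h2 := normc_ge0 (z + w).
have := sqr_ge0 (normc z - normc w); nra.
Qed.

Lemma L2_mul_integ f g : L2 f -> L2 g -> cinteg (fun v => f v * conjc (g v)).
Proof.
move=> Lf Lg; apply: cinteg_le (integD (L2_integ Lf) (L2_integ Lg)).
  by apply: cmeasurableM; [exact: L2_measurable|exact/cmeasurable_conj/L2_measurable].
by move=> v; rewrite (le_trans (normc_mul_le _ _))// normc_conj.
Qed.

Lemma L2_le f h : cmeasurable f -> (forall v, normc (f v) ^+ 2 <= h v) -> integ h ->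
  L2 f.
Proof.
move=> mf fh ih; apply/L2E; split => //; apply: integ_le ih.
  exact: measurable_sqr_normc.
by move=> v; rewrite ger0_norm ?sqr_ge0.
Qed.

Lemma L2D f g : L2 f -> L2 g -> L2 (fun v => f v + g v).
Proof.
move=> Lf Lg; apply: L2_le (integD (integZ 2 (L2_integ Lf)) (integZ 2 (L2_integ Lg))).
  by apply: cmeasurableD; exact: L2_measurable.
by move=> v; exact: sqr_normcD_le.
Qed.

Lemma L2_mul (m : cfun R) (C : R) f : cmeasurable m -> (forall v, normc (m v) <= C) ->
  L2 f -> L2 (fun v => m v * f v).
Proof.
move=> mm mC Lf; apply: L2_le (integZ (C ^+ 2) (L2_integ Lf)).
  by apply: cmeasurableM => //; exact: L2_measurable.
move=> v; rewrite Normc.normcM exprMn ler_wpM2r ?sqr_ge0// ler_pXn2r ?nnegrE ?normc_ge0//.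
exact: le_trans (normc_ge0 _) (mC v).
Qed.

Lemma L2Z a f : L2 f -> L2 (fun v => a * f v).
Proof. by apply: (@L2_mul (fun=> a) (normc a)) => //; exact: cmeasurable_cst. Qed.

Lemma L2_0 : L2 (fun=> 0 : R[i]).
Proof.
apply/L2E; split; first exact: cmeasurable_cst.
by apply: eq_integ integ0 => v; rewrite Normc.normc0 expr0n.
Qed.

Lemma L2N f : L2 f -> L2 (fun v => - f v).
Proof. by move=> /(L2Z (-1)); congr L2; apply/funext => v; rewrite mulN1r. Qed.

Lemma L2B f g : L2 f -> L2 g -> L2 (fun v => f v - g v).
Proof. by move=> Lf /L2N; exact: L2D. Qed.

Lemma L2_conj f : L2 f -> L2 (cfconj f).
Proof.
move=> /L2E[mf fi]; apply/L2E; split; first exact: cmeasurable_conj.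
by apply: eq_integ fi => v; rewrite /cfconj normc_conj.
Qed.

Lemma inner_linear a f g (h : cfun R) : L2 f -> L2 g -> L2 h ->
  inner (fun v => a * f v + g v) h = a * inner f h + inner g h.
Proof.
move=> Lf Lg Lh.
have If := L2_mul_integ Lf Lh; have Ig := L2_mul_integ Lg Lh.
rewrite /inner -/(cint _) -(cintZ a If) -cintD//; last exact: cintegZ.
by apply: eq_cint => v; rewrite mulrDl mulrA.
Qed.

Lemma inner_conj f g : conjc (inner f g) = inner g f.
Proof.
rewrite /inner -cintegral_conj; apply: eq_cint => v.
by rewrite conjcM conjcK mulrC.
Qed.

Lemma inner_cfconj f g : inner (cfconj f) (cfconj g) = conjc (inner f g).
Proof.
rewrite /inner -cintegral_conj; apply: eq_cint => v.
by rewrite conjcM.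
Qed.

Lemma innerff f : inner f f = (\int[mu]_v (normc (f v) ^+ 2))%:C.
Proof. by rewrite -cintR; apply: eq_cint => v; rewrite mul_conjc. Qed.

Lemma inner_ge0 f : 0 <= Re (inner f f).
Proof. by rewrite innerff /=; apply: Rintegral_ge0 => v _; exact: sqr_ge0. Qed.

Lemma inner_eq0 f : L2 f -> inner f f = 0 -> f = (fun=> 0) %[ae mu].
Proof.
move=> /L2E[mf fi] /(congr1 (@complex.Re R)); rewrite innerff /= => f0.
have mF : measurable_fun setT (fun v => (normc (f v) ^+ 2)%:E).
  by apply/measurable_EFinP; exact: measurable_sqr_normc.
have : (\int[mu]_v `|(normc (f v) ^+ 2)%:E| = 0)%E.
  under eq_integral do rewrite gee0_abs ?lee_fin ?sqr_ge0//.
  rewrite -(fineK (integrable_fin_num measurableT fi)) /=.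
  by move: f0; rewrite /Rintegral => ->.
move=> /(ae_eq_integral_abs mu measurableT mF).1; apply: filterS => v /(_ I)/eqP.
by rewrite eqe sqrf_eq0 normc_eq0 => /eqP.
Qed.

Lemma ae_inner f f' g g' : L2 f -> L2 f' -> L2 g -> L2 g' ->
  f = f' %[ae mu] -> g = g' %[ae mu] -> inner f g = inner f' g'.
Proof.
move=> Lf Lf' Lg Lg' ff gg.
have [i1 i2] := L2_mul_integ Lf Lg; have [j1 j2] := L2_mul_integ Lf' Lg'.
apply: complex_ext; rewrite /= /Rintegral; congr fine;
  apply: ae_eq_integral => //; try exact: (measurable_int mu);
  by move: ff gg; apply: filterS2 => v /(_ I) + /(_ I) + _ => /= -> ->.
Qed.

Lemma ae_eqD f f' g g' : f = f' %[ae mu] -> g = g' %[ae mu] ->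
  (fun v => f v + g v) = (fun v => f' v + g' v) %[ae mu].
Proof. by apply: filterS2 => v /(_ I) + /(_ I) + _ => /= -> ->. Qed.

Lemma ae_eqZ a f f' : f = f' %[ae mu] ->
  (fun v => a * f v) = (fun v => a * f' v) %[ae mu].
Proof. by apply: filterS => v /(_ I) + _ => /= ->. Qed.

Lemma ae_refl f : f = f %[ae mu].
Proof. exact: ae_eq_refl. Qed.

Lemma ae_sym f g : f = g %[ae mu] -> g = f %[ae mu].
Proof. exact: ae_eq_sym. Qed.

Lemma ae_trans f g (h : cfun R) :
  f = g %[ae mu] -> g = h %[ae mu] -> f = h %[ae mu].
Proof. exact: ae_eq_trans. Qed.

End Integrals.
#[global] Hint Resolve ae_refl : core.

(** * The space of almost everywhere classes *)

Section L2Classes.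
Variable R : realType.
Local Notation mu := (@leb3 R).

Let reps (f : cfun R) : set (cfun R) := [set g | L2 g /\ f = g %[ae mu]].

(** A function without square-integrable representative is sent to the representative chosen for 0,
    which keeps the map total and idempotent. *)
Definition canonical_rep (f : cfun R) : cfun R :=
  xget (xget (fun=> 0) (reps (fun=> 0))) (reps f).

Lemma reps_eq (f g : cfun R) : f = g %[ae mu] -> reps f = reps g.
Proof.
move=> fg; apply/seteqP; split => h [Lh fh]; split => //.
  exact: ae_trans (ae_sym fg) fh.
exact: ae_trans fg fh.
Qed.

Let reps0 : reps (fun=> 0) (fun=> 0).
Proof. by split; [exact: L2_0|exact: ae_refl]. Qed.

Lemma canonical_rep_L2 (f : cfun R) : L2 (canonical_rep f).
Proof.
rewrite /canonical_rep; case: (pselect (exists g, reps f g)) => [h|h].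
  by have [] := xgetPex (xget (fun=> 0) (reps (fun=> 0))) h.
rewrite [xget _ (reps f)]xgetPN; last by move=> g gf; apply: h; exists g.
by have [] := xgetPex (fun=> 0) (ex_intro _ _ reps0).
Qed.

Lemma canonical_repE (f : cfun R) : L2 f -> canonical_rep f = f %[ae mu].
Proof.
move=> Lf; have h : exists g, reps f g by exists f; split => //; exact: ae_refl.
by have [_ /ae_sym] := xgetPex (xget (fun=> 0) (reps (fun=> 0))) h.
Qed.

Lemma eq_canonical_rep (f g : cfun R) : f = g %[ae mu] ->
  canonical_rep f = canonical_rep g.
Proof. by move=> fg; rewrite /canonical_rep (reps_eq fg). Qed.

Lemma canonical_repK (f : cfun R) : canonical_rep (canonical_rep f) = canonical_rep f.
Proof.
have [h|h] := pselect (exists g, reps f g).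
  have [_ fg] := xgetPex (xget (fun=> 0) (reps (fun=> 0))) h.
  by rewrite [in RHS](eq_canonical_rep fg).
have -> : canonical_rep f = canonical_rep (fun=> 0).
  rewrite /canonical_rep xgetPN; last by move=> g gf; apply: h; exists g.
  have h0 := ex_intro _ _ reps0.
  have [_ e] := xgetPex (fun=> 0) h0.
  by rewrite /xget; case: pselect.
have [_ e] := xgetPex (xget (fun=> 0) (reps (fun=> 0))) (ex_intro _ _ reps0).
by rewrite [in RHS](eq_canonical_rep e).
Qed.

(* L^2(R^3; C) as a genuine vector space: an almost-everywhere class is given by its
   canonical representative. *)
Record L2class := L2Class {
  rep : cfun R;
  rep_L2 : L2 rep;
  rep_canonical : canonical_rep rep = rep }.

HB.instance Definition _ := gen_eqMixin L2class.
HB.instance Definition _ := gen_choiceMixin L2class.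

Definition cls (f : cfun R) : L2class :=
  L2Class (canonical_rep_L2 f) (canonical_repK f).

Lemma rep_inj (f g : L2class) : rep f = rep g -> f = g.
Proof.
case: f g => [f fL fc] [g gL gc] /= fg; rewrite fg in fL fc *.
by rewrite (Prop_irrelevance fL gL) (Prop_irrelevance fc gc).
Qed.

Lemma repK (f : L2class) : cls (rep f) = f.
Proof. by apply: rep_inj; exact: rep_canonical. Qed.

Lemma rep_cls (f : cfun R) : L2 f -> rep (cls f) = f %[ae mu].
Proof. exact: canonical_repE. Qed.

Lemma cls_ae (f g : cfun R) : f = g %[ae mu] -> cls f = cls g.
Proof. by move=> fg; apply: rep_inj; exact: eq_canonical_rep. Qed.

Lemma ae_cls (f g : cfun R) : L2 f -> L2 g -> cls f = cls g -> f = g %[ae mu].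
Proof.
move=> Lf Lg fg; apply: ae_trans (ae_sym (rep_cls Lf)) _.
by rewrite fg; exact: rep_cls.
Qed.

Lemma rep_ae_inj (f g : L2class) : rep f = rep g %[ae mu] -> f = g.
Proof. by move=> /cls_ae; rewrite !repK. Qed.

Let zero := cls (fun=> 0).
Let add (f g : L2class) := cls (fun v => rep f v + rep g v).
Let opp (f : L2class) := cls (fun v => - rep f v).
Let scale (a : R[i]) (f : L2class) := cls (fun v => a * rep f v).

Let add_cls (f g : cfun R) : L2 f -> L2 g -> add (cls f) (cls g) = cls (fun v => f v + g v).
Proof.
move=> Lf Lg; apply: cls_ae; apply: ae_eqD; exact: rep_cls.
Qed.

Let scale_cls a (f : cfun R) : L2 f -> scale a (cls f) = cls (fun v => a * f v).
Proof. by move=> Lf; apply: cls_ae; apply: ae_eqZ; exact: rep_cls. Qed.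

Let opp_cls (f : cfun R) : L2 f -> opp (cls f) = cls (fun v => - f v).
Proof.
move=> Lf; apply: cls_ae; move: (rep_cls Lf); apply: filterS => v /(_ I) + _.
by move=> /= ->.
Qed.

Let addA : associative add.
Proof.
move=> f g h; rewrite -(repK f) -(repK g) -(repK h).
move: (rep_L2 f) (rep_L2 g) (rep_L2 h) => Lf Lg Lh.
rewrite !add_cls//; try exact: L2D.
by congr cls; apply/funext => v; rewrite addrA.
Qed.

Let addC : commutative add.
Proof. by move=> f g; congr cls; apply/funext => v; rewrite addrC. Qed.

Let add0 : left_id zero add.
Proof.
move=> f; rewrite -(repK f) add_cls; [|exact: L2_0|exact: rep_L2].
by congr cls; apply/funext => v; rewrite add0r.
Qed.

Let addN : left_inverse zero opp add.
Proof.
move=> f; rewrite -(repK f); have Lf := rep_L2 f.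
rewrite opp_cls// add_cls//; last exact: L2N.
by congr cls; apply/funext => v; rewrite addNr.
Qed.

HB.instance Definition _ := GRing.isZmodule.Build L2class addA addC add0 addN.

Let scaleA a b f : scale a (scale b f) = scale (a * b) f.
Proof.
rewrite -(repK f); have Lf := rep_L2 f; rewrite !scale_cls//; last exact: L2Z.
by congr cls; apply/funext => v; rewrite mulrA.
Qed.

Let scale1 : left_id 1 scale.
Proof.
move=> f; rewrite -[RHS](repK f); congr cls; apply/funext => v; exact: mul1r.
Qed.

Let scaleDr : right_distributive scale +%R.
Proof.
move=> a f g; rewrite -(repK f) -(repK g).
have Lf := rep_L2 f; have Lg := rep_L2 g.
change (scale a (add (cls (rep f)) (cls (rep g))) =
  add (scale a (cls (rep f))) (scale a (cls (rep g)))).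
rewrite add_cls// !scale_cls ?add_cls//; try exact: L2Z; try exact: L2D.
by congr cls; apply/funext => v; rewrite mulrDr.
Qed.

Let scaleDl f : {morph scale^~ f : a b / a + b}.
Proof.
move=> a b; rewrite -(repK f); have Lf := rep_L2 f.
change (scale (a + b) (cls (rep f)) = add (scale a (cls (rep f))) (scale b (cls (rep f)))).
rewrite !scale_cls ?add_cls//; try exact: L2Z.
by congr cls; apply/funext => v; rewrite mulrDl.
Qed.

HB.instance Definition _ :=
  GRing.Zmodule_isLmodule.Build R[i] L2class scaleA scale1 scaleDr scaleDl.

Lemma clsD (f g : cfun R) : L2 f -> L2 g -> cls (fun v => f v + g v) = cls f + cls g.
Proof. by move=> Lf Lg; rewrite -add_cls. Qed.

Lemma clsZ a (f : cfun R) : L2 f -> cls (fun v => a * f v) = a *: cls f.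
Proof. by move=> Lf; rewrite -scale_cls. Qed.

Lemma cls0 : cls (fun=> 0) = 0. Proof. by []. Qed.

Lemma clsN (f : cfun R) : L2 f -> cls (fun v => - f v) = - cls f.
Proof. by move=> Lf; rewrite -opp_cls. Qed.

Lemma clsB (f g : cfun R) : L2 f -> L2 g -> cls (fun v => f v - g v) = cls f - cls g.
Proof. by move=> Lf Lg; rewrite clsD ?clsN//; exact: L2N. Qed.

Lemma L2_sum n (c : 'I_n -> cfun R) : (forall i, L2 (c i)) ->
  L2 (fun v => \sum_(i < n) c i v).
Proof.
elim: n c => [|n IH] c Lc.
  by under eq_fun do rewrite big_ord0; exact: L2_0.
under eq_fun do rewrite big_ord_recr/=.
by apply: L2D => //; exact: IH.
Qed.

Lemma cls_sum n (c : 'I_n -> cfun R) : (forall i, L2 (c i)) ->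
  cls (fun v => \sum_(i < n) c i v) = \sum_(i < n) cls (c i).
Proof.
elim: n c => [|n IH] c Lc.
  by rewrite big_ord0; under eq_fun do rewrite big_ord0; exact: cls0.
rewrite big_ord_recr/= -IH// -clsD//; last exact: L2_sum.
by congr cls; apply/funext => v; rewrite big_ord_recr.
Qed.

Lemma repD (f g : L2class) : rep (f + g) = (fun v => rep f v + rep g v) %[ae mu].
Proof. by apply: rep_cls; apply: L2D; exact: rep_L2. Qed.

Lemma repZ a (f : L2class) : rep (a *: f) = (fun v => a * rep f v) %[ae mu].
Proof. by apply: rep_cls; apply: L2Z; exact: rep_L2. Qed.

Lemma rep0 : rep 0 = (fun=> 0) %[ae mu].
Proof. by apply: rep_cls; exact: L2_0. Qed.

Definition ipL (f g : L2class) : R[i] := inner (rep f) (rep g).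

Lemma ipL_cls (f g : cfun R) : L2 f -> L2 g -> ipL (cls f) (cls g) = inner f g.
Proof.
move=> Lf Lg; apply: ae_inner => //; try exact: canonical_rep_L2; exact: rep_cls.
Qed.

Lemma ipL_inner_product : inner_product ipL.
Proof.
split.
- move=> a f g h; rewrite /ipL -inner_linear; try exact: rep_L2.
  apply: ae_inner; try exact: rep_L2; try exact: ae_refl.
    by apply: L2D; [apply: L2Z|]; exact: rep_L2.
  apply: ae_trans (repD _ _) _; apply: ae_eqD; last exact: ae_refl.
  exact: repZ.
- by move=> f g; exact: inner_conj.
- by move=> f; exact: inner_ge0.
- move=> f /(inner_eq0 (rep_L2 f)) f0; apply: rep_ae_inj.
  by apply: ae_trans f0 (ae_sym rep0).
Qed.

Definition conjL (f : L2class) : L2class := cls (cfconj (rep f)).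

Lemma ae_cfconj (f g : cfun R) : f = g %[ae mu] -> cfconj f = cfconj g %[ae mu].
Proof. by apply: filterS => v /(_ I) + _; rewrite /cfconj => ->. Qed.

Lemma conjL_cls (f : cfun R) : L2 f -> conjL (cls f) = cls (cfconj f).
Proof. by move=> Lf; apply: cls_ae; apply: ae_cfconj; exact: rep_cls. Qed.

Lemma ipL_conj (f g : L2class) : ipL (conjL f) (conjL g) = conjc (ipL f g).
Proof.
rewrite -(repK f) -(repK g) !conjL_cls ?ipL_cls; try exact: rep_L2;
  try (by apply: L2_conj; exact: rep_L2).
exact: inner_cfconj.
Qed.

Lemma conjLK (f : L2class) : conjL (conjL f) = f.
Proof.
have Lf := rep_L2 f; rewrite -(repK f) !conjL_cls//; last exact: L2_conj.
by congr cls; apply/funext => v; exact: conjcK.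
Qed.

Lemma conjLD (f g : L2class) : conjL (f + g) = conjL f + conjL g.
Proof.
have Lf := rep_L2 f; have Lg := rep_L2 g.
rewrite -(repK f) -(repK g) -clsD// !conjL_cls ?clsD//.
  rewrite -clsD; try exact: L2_conj.
  by congr cls; apply/funext => v; rewrite /cfconj conjcD.
exact: L2D.
Qed.

Lemma conjLZ a (f : L2class) : conjL (a *: f) = conjc a *: conjL f.
Proof.
have Lf := rep_L2 f; rewrite -(repK f) -clsZ// !conjL_cls//; last exact: L2Z.
rewrite -clsZ; last exact: L2_conj.
by congr cls; apply/funext => v; rewrite /cfconj conjcM.
Qed.

End L2Classes.

(** * Contraction semigroups and the Gronwall lemma *)

Section RealAnalysis.
Variable R : realType.

Lemma continuous_eps (f : R -> R) (x e : R) : {for x, continuous f} -> 0 < e ->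
  exists2 d, 0 < d & forall y, `|y - x| < d -> `|f y - f x| < e.
Proof.
move=> /cvgrPdist_lt/(_ _) fx e0; have := fx e e0 => /nbhs_ballP[d /= d0 H].
exists d => // y yx; rewrite distrC; apply: H; by rewrite /ball /= distrC.
Qed.

(* The set of times at which [phi t <= expR (- k t) (phi 0 + e t)] is closed, and the
   Dini condition forbids its supremum below [t] from being less than [t]. *)
Lemma dini_gronwall (phi : R -> R) (k : R) :
  (forall t, 0 <= t -> 0 <= phi t) ->
  (forall t e, 0 <= t -> 0 < e ->
     exists2 d, 0 < d & forall s, 0 <= s -> `|s - t| < d -> `|phi s - phi t| < e) ->
  (forall t e, 0 <= t -> 0 < e ->
     exists2 d, 0 < d & forall h, 0 < h < d ->
       phi (t + h) <= phi t * (1 - k * h) + e * h) ->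
  forall t, 0 <= t -> phi t <= expR (- k * t) * phi 0.
Proof.
move=> phi0 phic phiD T T0.
suff H : forall e, 0 < e -> phi T <= expR (- k * T) * (phi 0 + e * T).
  apply/ler_addgt0Pr => e e0.
  have pos : 0 < expR (- k * T) * (T + 1) by rewrite mulr_gt0 ?expR_gt0// ltr_wpDl.
  apply: le_trans (H (e / (expR (- k * T) * (T + 1))) (divr_gt0 e0 pos)) _.
  rewrite mulrDr lerD2l (_ : _ * (_ * T) = e * (T / (T + 1))); last first.
    by field; rewrite !gt_eqF ?expR_gt0 ?ltr_wpDl.
  by rewrite ler_piMr ?(ltW e0)// ler_pdivrMr ?ltr_wpDl// mul1r lerDl ler01.
move=> e e0; rewrite leNgt; apply/negP => bad.
pose chi t := expR (- k * t) * (phi 0 + e * t).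
have chic : continuous chi.
  move=> x; apply: cvgM.
    apply: (@continuous_comp _ _ _ (fun t => - k * t) expR).
      by apply: cvgM; [exact: cvg_cst|exact: cvg_id].
    exact: continuous_expR.
  apply: cvgD; first exact: cvg_cst.
  by apply: cvgM; [exact: cvg_cst|exact: cvg_id].
pose A := [set t : R | 0 <= t <= T /\ phi t <= chi t].
have A0 : A 0 by split; rewrite ?lexx// /chi !mulr0 expR0 mul1r addr0.
have hA : has_sup A by split; [exists 0|exists T => t [/andP[]]].
pose tau := sup A.
have tau0 : 0 <= tau by exact: (ub_le_sup hA.2 A0).
have tauT : tau <= T by apply: ge_sup; [exists 0|move=> t [/andP[]]].
have Atau : phi tau <= chi tau.
  rewrite leNgt; apply/negP => lt.
  have e2 : 0 < (phi tau - chi tau) / 2 by rewrite divr_gt0// subr_gt0.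
  have [d1 d10 H1] := phic _ _ tau0 e2.
  have [d2 d20 H2] := continuous_eps (chic tau) e2.
  have dm : 0 < Num.min d1 d2 by rewrite lt_min d10.
  have [s [/andP[s0 sT] As] sd] := sup_adherent dm hA.
  have st : s <= tau by apply: (ub_le_sup hA.2); split => //; apply/andP.
  have : `|s - tau| < Num.min d1 d2.
    by rewrite ler0_norm ?subr_le0// opprB ltrBlDr addrC -ltrBlDr.
  rewrite lt_min => /andP[/(H1 _ s0) + /H2].
  by rewrite !ltr_norml => /andP[h1 h2] /andP[h3 h4]; lra.
have tT : tau < T.
  rewrite lt_neqAle tauT andbT; apply/eqP => E; move: bad; rewrite -E.
  by rewrite ltNge => /negP; apply; exact: Atau.
(* Small enough that the Dini error [e' * h] over one step [h <= 1] stays below the growth of the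
   term [e * t] in [chi], whatever the sign of [k]. *)
pose e' := e * expR (- k * tau) / expR `|k|.
have e'0 : 0 < e' by rewrite !mulr_gt0 ?invr_gt0 ?expR_gt0.
have [d d0 H] := phiD _ _ tau0 e'0.
pose h := Num.min 1 (Num.min (d / 2) (T - tau)).
have h0 : 0 < h by rewrite !lt_min ltr01 divr_gt0//= subr_gt0.
have h1 : h <= 1 by rewrite ge_min lexx.
have hd : h < d by rewrite /h !gt_min (_ : d / 2 < d) ?orbT//; lra.
have hT : tau + h <= T.
  by rewrite -lerBrDl /h !ge_min lexx !orbT.
have bad' : ~ A (tau + h).
  by move=> /(ub_le_sup hA.2); rewrite -/tau gerDl leNgt h0.
apply: bad'; split; first by rewrite hT addr_ge0// ltW.
have hh : 0 < h < d by rewrite h0 hd.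
apply: le_trans (H _ hh) _.
have ekh : 1 - k * h <= expR (- (k * h)) by have := expR_ge1Dx (- (k * h)).
apply: (@le_trans _ _ (phi tau * expR (- (k * h)) + e' * h)).
  by rewrite lerD2r ler_wpM2l ?phi0.
rewrite /chi (_ : - k * (tau + h) = - k * tau + - (k * h)); last by ring.
rewrite expRD; set x := expR (- k * tau); set y := expR (- (k * h)).
have y0 : 0 < y := expR_gt0 _.
have x0 : 0 < x := expR_gt0 _.
have e'y : e' <= x * y * e.
  rewrite /e' -/x ler_pdivrMr ?expR_gt0//.
  rewrite (_ : x * y * e * _ = e * x * (y * expR `|k|)); last by ring.
  rewrite ler_peMr ?(ltW (mulr_gt0 e0 x0))// /y -expRD -[leLHS]expR0 ler_expR.
  have : k * h <= `|k|.
    by rewrite (le_trans (ler_norm _))// normrM (ger0_norm (ltW h0)) ler_piMr.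
  lra.
have := Atau; rewrite /chi -/x => At.
apply: (@le_trans _ _ (x * (phi 0 + e * tau) * y + x * y * e * h)).
  by apply: lerD; rewrite ler_pM2r.
by rewrite le_eqVlt; apply/orP; left; apply/eqP; ring.
Qed.

Lemma Re_cexp (z : R[i]) : Re (cexp z) = expR (Re z) * cos (Im z).
Proof. by rewrite /cexp Re_scale. Qed.

Lemma Im_cexp (z : R[i]) : Im (cexp z) = expR (Re z) * sin (Im z).
Proof. by rewrite /cexp Im_scale. Qed.

Lemma cexpD (z w : R[i]) : cexp (z + w) = cexp z * cexp w.
Proof.
rewrite /cexp Re_add Im_add expRD cosD sinD; apply: complex_ext;
  rewrite !(Re_mul, Im_mul) /=; ring.
Qed.

Lemma cexp0 : cexp (0 : R[i]) = 1.
Proof. by rewrite /cexp /= expR0 cos0 sin0; apply: complex_ext; rewrite !(Re_mul, Im_mul) /=; ring. Qed.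

Lemma normc_cexp (z : R[i]) : normc (cexp z) = expR (Re z).
Proof.
rewrite /cexp Normc.normcM normcR ger0_norm ?expR_ge0//= cos2Dsin2 sqrtr1 mulr1 //.
Qed.

Lemma derivable_at_right (f : R -> R) (l : R) : is_derive (0 : R) 1 f l -> forall e, 0 < e ->
  exists2 d, 0 < d & forall h, 0 < h < d -> `|f h - f 0 - h * l| <= e * h.
Proof.
move=> [df fl] e e0.
have : h^-1 *: (f (h *: 1 + 0) - f 0) @[h --> 0^'] --> l.
  by rewrite -fl; exact: df.
move=> /cvgrPdist_lt/(_ _ e0) [d /= d0 H].
exists d => // h /andP[h0 hd].
have := H h; rewrite /ball /= sub0r normrN gtr0_norm// => /(_ hd).
rewrite gt_eqF// => /(_ isT); rewrite /GRing.scale /= mulr1 addr0 => /ltW L.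
have -> : f h - f 0 - h * l = - ((l - h^-1 * (f h - f 0)) * h).
  by field; rewrite gt_eqF.
by rewrite normrN normrM (gtr0_norm h0) ler_pM2r.
Qed.

Lemma cexp_derivative (z : R[i]) (e : R) : 0 < e ->
  exists2 d, 0 < d & forall h, 0 < h < d ->
    normc (cexp (h%:C * z) - 1 - h%:C * z) <= e * h.
Proof.
move=> e0; have e2 : 0 < e / 2 by rewrite divr_gt0.
have d1 : is_derive (0 : R) 1 (fun h => expR (h * Re z) * cos (h * Im z)) (Re z).
  apply: is_derive_eq.
  rewrite /GRing.scale /= !mul0r expR0 cos0 sin0; ring.
have d2 : is_derive (0 : R) 1 (fun h => expR (h * Re z) * sin (h * Im z)) (Im z).
  apply: is_derive_eq.
  rewrite /GRing.scale /= !mul0r expR0 cos0 sin0; ring.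
have [a a0 Ha] := derivable_at_right d1 e2.
have [b b0 Hb] := derivable_at_right d2 e2.
exists (Num.min a b); first by rewrite lt_min a0.
move=> h /andP[h0]; rewrite lt_min => /andP[ha hb].
have := Ha h; rewrite h0 ha => /(_ isT); have := Hb h; rewrite h0 hb => /(_ isT).
rewrite !mul0r expR0 cos0 sin0 => Lb La.
apply: le_trans (normc_le_ReIm _) _.
have -> : e * h = e / 2 * h + e / 2 * h by field.
apply: lerD.
  apply: le_trans La.
  by rewrite !Re_add !Re_opp Re_cexp !Re_scale !Im_scale /= mulr1.
apply: le_trans Lb.
by rewrite !Im_add !Im_opp Im_cexp !Re_scale !Im_scale /= oppr0 mulr0 addr0 subr0.
Qed.

End RealAnalysis.

Section Semigroups.
Variables (R : realType) (E : lmodType R[i]) (ip : E -> E -> R[i]).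
Hypothesis hip : inner_product ip.
Local Notation N := (ipnorm ip).
Variables (D : E -> Prop) (B : E -> E) (S : R -> E -> E).

(** The limit is spelled out with epsilons because [E] carries no topology of its own, only the norm
    [N]. *)
Definition generates (f g : E) : Prop := forall e, 0 < e ->
  exists2 d, 0 < d & forall h, 0 < h < d -> N ((h^-1)%:C *: (S h f - f) - g) < e.

(** Only nonnegative times are constrained. The last clause is an equivalence, so the linearity of
    [D] and [B] and their invariance under [S t] are consequences. *)
Record contraction_group : Prop := {
  sg_linear : forall t a f g, 0 <= t -> S t (a *: f + g) = a *: S t f + S t g;
  sg_contract : forall t f, 0 <= t -> N (S t f) <= N f;
  sg_zero : forall f, S 0 f = f;
  sg_add : forall t s f, 0 <= t -> 0 <= s -> S (t + s) f = S t (S s f);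
  sg_cont : forall f e, 0 < e ->
    exists2 d, 0 < d & forall h, 0 < h < d -> N (S h f - f) < e;
  sg_gen : forall f g, (D f /\ B f = g) <-> generates f g }.

Hypothesis hS : contraction_group.

Lemma sgZD t a f g : 0 <= t -> S t (a *: f + g) = a *: S t f + S t g.
Proof. exact: sg_linear. Qed.

Lemma sg0 t : 0 <= t -> S t 0 = 0.
Proof.
by move=> t0; have := sgZD (-1) 0 0 t0; rewrite scaler0 addr0 scaleN1r addNr.
Qed.

Lemma sgD t f g : 0 <= t -> S t (f + g) = S t f + S t g.
Proof. by move=> t0; have := sgZD 1 f g t0; rewrite !scale1r. Qed.

Lemma sgZ t a f : 0 <= t -> S t (a *: f) = a *: S t f.
Proof. by move=> t0; have := sgZD a f 0 t0; rewrite sg0// !addr0. Qed.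

Lemma sgB t f g : 0 <= t -> S t (f - g) = S t f - S t g.
Proof. by move=> t0; rewrite sgD// -scaleN1r sgZ// scaleN1r. Qed.

Lemma sg_sum t n (F : 'I_n -> E) : 0 <= t ->
  S t (\sum_(i < n) F i) = \sum_(i < n) S t (F i).
Proof.
by move=> t0; elim/big_rec2: _ => [|i x y _ <-]; rewrite ?sg0 ?sgD.
Qed.

Lemma generates_linear a f f' g g' : generates f g -> generates f' g' ->
  generates (a *: f + f') (a *: g + g').
Proof.
move=> H H' e e0; have a0 : 0 < normc a + 1 by rewrite ltr_wpDl ?normc_ge0.
have e1 : 0 < e / (2 * (normc a + 1)) by rewrite divr_gt0// mulr_gt0.
have e2 : 0 < e / 2 by rewrite divr_gt0.
have [d d0 Hd] := H _ e1; have [d' d'0 Hd'] := H' _ e2.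
exists (Num.min d d'); first by rewrite lt_min d0.
move=> h /andP[h0]; rewrite lt_min => /andP[h1 h2].
have := Hd h; rewrite h0 h1 => /(_ isT) L1.
have := Hd' h; rewrite h0 h2 => /(_ isT) L2.
set x := _ *: _ in L1; set y := _ *: _ in L2.
rewrite (_ : _ - _ = a *: (x - g) + (y - g')); last first.
  rewrite sgZD ?ltW// opprD addrACA -scalerBr scalerDr scalerA mulrC -scalerA.
  by rewrite -/x -/y scalerBr opprD addrACA.
apply: le_lt_trans (ler_ipnormD hip _ _) _; rewrite (ipnormZ hip).
have : normc a * N (x - g) <= (normc a + 1) * (e / (2 * (normc a + 1))).
  by apply: ler_pM; rewrite ?normc_ge0 ?ipnorm_ge0 ?lerDl ?ler01 ?ltW.
rewrite (_ : _ * (e / _) = e / 2); last by field; rewrite gt_eqF.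
lra.
Qed.

Lemma dom_linear a f g : D f -> D g -> D (a *: f + g).
Proof.
move=> Df Dg; have [gf gg] := ((sg_gen hS f (B f)).1 (conj Df erefl),
  (sg_gen hS g (B g)).1 (conj Dg erefl)).
by have [] := (sg_gen hS _ _).2 (generates_linear a gf gg).
Qed.

Lemma gen_linear a f g : D f -> D g -> B (a *: f + g) = a *: B f + B g.
Proof.
move=> Df Dg; have [gf gg] := ((sg_gen hS f (B f)).1 (conj Df erefl),
  (sg_gen hS g (B g)).1 (conj Dg erefl)).
by have [] := (sg_gen hS _ _).2 (generates_linear a gf gg).
Qed.

Lemma dom0 : D 0.
Proof.
have : generates 0 0.
  move=> e e0; exists 1 => // h /andP[/ltW h0 _].
  by rewrite sg0// !subr0 scaler0 (ipnorm0 hip).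
by case/(sg_gen hS).
Qed.

Lemma domD f g : D f -> D g -> D (f + g).
Proof. by move=> Df Dg; rewrite -(scale1r f); exact: dom_linear. Qed.

Lemma domZ a f : D f -> D (a *: f).
Proof. by move=> Df; rewrite -[_ *: _]addr0; apply: dom_linear => //; exact: dom0. Qed.

Lemma domB' f g : D f -> D g -> D (f - g).
Proof. by move=> Df Dg; rewrite -scaleN1r addrC; exact: dom_linear. Qed.

Lemma gen0 : B 0 = 0.
Proof.
by have := gen_linear (-1) dom0 dom0; rewrite scaler0 addr0 scaleN1r addNr.
Qed.

Lemma genD f g : D f -> D g -> B (f + g) = B f + B g.
Proof. by move=> Df Dg; have := gen_linear 1 Df Dg; rewrite !scale1r. Qed.

Lemma genZ a f : D f -> B (a *: f) = a *: B f.
Proof. by move=> Df; have := gen_linear a Df dom0; rewrite gen0 !addr0. Qed.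

Lemma genB f g : D f -> D g -> B (f - g) = B f - B g.
Proof.
move=> Df Dg; rewrite -(scaleN1r g) genD ?genZ ?scaleN1r//.
by rewrite -scaleN1r; exact: domZ.
Qed.

Lemma dom_sum n (F : 'I_n -> E) : (forall i, D (F i)) -> D (\sum_(i < n) F i).
Proof.
move=> DF; elim/big_ind: _ => //; [exact: dom0|by move=> *; exact: domD].
Qed.

Lemma gen_sum n (F : 'I_n -> E) : (forall i, D (F i)) ->
  B (\sum_(i < n) F i) = \sum_(i < n) B (F i).
Proof.
move=> DF; suff : D (\sum_(i < n) F i) /\ B (\sum_(i < n) F i) = \sum_(i < n) B (F i).
  by case.
elim/big_rec2: _ => [|i x y _ [Dy <-]]; first by split; [exact: dom0|exact: gen0].
by split; [exact: domD|exact: genD].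
Qed.

Lemma dom_sg t f : 0 <= t -> D f -> D (S t f) /\ B (S t f) = S t (B f).
Proof.
move=> t0 Df; apply/(sg_gen hS) => e e0.
have [d d0 H] := (sg_gen hS f (B f)).1 (conj Df erefl) e e0.
exists d => // h hd; have /andP[h0 _] := hd; apply: le_lt_trans (H _ hd).
have h0' := ltW h0.
rewrite -(sg_add hS)// (addrC h) (sg_add hS)//.
by rewrite -sgB// -sgZ// -sgB// sg_contract.
Qed.

Lemma sg_increment t f e : 0 <= t -> D f -> 0 < e ->
  exists2 d, 0 < d & forall h, 0 < h < d ->
    N (S (t + h) f - S t f - h%:C *: B (S t f)) <= e * h.
Proof.
move=> t0 Df e0; have [Dt Bt] := dom_sg t0 Df.
have [d d0 H] := (sg_gen hS _ _).1 (conj Dt erefl) e e0.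
exists d => // h hd; have /andP[h0 _] := hd; have := H _ hd.
rewrite -(sg_add hS) 1?(ltW h0)// (addrC h) => /ltW L.
rewrite (_ : _ - _ = h%:C *: ((h^-1)%:C *: (S (t + h) f - S t f) - B (S t f))).
  rewrite (ipnormZ hip) normcR gtr0_norm// mulrC ler_pM2r//.
by rewrite scalerBr scalerA -rmorphM /= divff ?gt_eqF// scale1r.
Qed.

Lemma sg_continuous t f e : 0 <= t -> 0 < e ->
  exists2 d, 0 < d & forall s, 0 <= s -> `|s - t| < d -> N (S s f - S t f) < e.
Proof.
move=> t0 e0; have [d d0 H] := sg_cont hS f e0.
have K a b : 0 <= a -> a < b -> b - a < d -> N (S b f - S a f) < e.
  move=> a0 ab bad; have h0 : 0 < b - a by rewrite subr_gt0.
  have -> : S b f - S a f = S a (S (b - a) f - f).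
    by rewrite sgB// -(sg_add hS) ?(ltW h0)// (addrC a) subrK.
  by apply: le_lt_trans (sg_contract hS _ a0) _; apply: H; rewrite h0.
exists d => // s s0; have [st|ts|->] := ltgtP s t.
- by rewrite ltr0_norm ?subr_lt0// opprB (ipnormB hip) => ?; exact: K.
- by rewrite gtr0_norm ?subr_gt0// => ?; exact: K.
- by move=> _; rewrite subrr (ipnorm0 hip).
Qed.

(** A real quadratic form with its polarization. Symmetry is contained in [form_sqrD], read with [f]
    and [g] exchanged. *)
Record bounded_form (Q : E -> E -> R) : Prop := {
  form_sqrD : forall f g, Q (f + g) (f + g) = Q f f + 2 * Q f g + Q g g;
  form_addr : forall f g h, Q f (g + h) = Q f g + Q f h;
  form_scaler : forall (a : R) f g, Q f (a%:C *: g) = a * Q f g;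
  form_bounded : exists2 A, 0 <= A & forall f g, `|Q f g| <= A * (N f * N g) }.

(** Along an orbit the derivative of [Q f f] is [2 * Q f (B f)], so [dini_gronwall] turns
    dissipation into decay. The set [D'] is an invariant part of the domain: the whole of it, or its
    intersection with the spectral kernel. *)
Lemma sg_gronwall (Q : E -> E -> R) (k : R) (D' : E -> Prop) :
  bounded_form Q -> (forall f, 0 <= Q f f) ->
  (forall f, D' f -> D f) -> (forall t f, 0 <= t -> D' f -> D' (S t f)) ->
  (forall f, D' f -> 2 * Q f (B f) <= - k * Q f f) ->
  forall t f, 0 <= t -> D' f -> Q (S t f) (S t f) <= expR (- k * t) * Q f f.
Proof.
move=> hQ Q0 D'D D'S diss t f t0 D'f; have [A A0 bQ] := form_bounded hQ.
rewrite -{3 4}(sg_zero hS f).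
apply: (@dini_gronwall _ (fun t => Q (S t f) (S t f))) => // {t0}{}t e t0 e0.
  pose M := A * (2 * N (S t f) + 1) + 1.
  have M0 : 0 < M by rewrite ltr_wpDl// mulr_ge0// addr_ge0// mulr_ge0// ipnorm_ge0.
  have e1 : 0 < Num.min 1 (e / M) by rewrite lt_min ltr01 divr_gt0.
  have [d d0 H] := sg_continuous f t0 e1; exists d => // s s0 /(H _ s0).
  rewrite lt_min => /andP[w1 w2].
  pose w := S s f - S t f; rewrite -/w in w1 w2.
  have -> : S s f = S t f + w by rewrite /w addrC subrK.
  rewrite (form_sqrD hQ) (_ : _ + _ + _ - _ = 2 * Q (S t f) w + Q w w); last by ring.
  have b1 := bQ (S t f) w; have b2 := bQ w w.
  have w0 := ipnorm_ge0 ip w; have n0 := ipnorm_ge0 ip (S t f).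
  apply: le_lt_trans (ler_normD _ _) _.
  rewrite normrM ger0_norm//.
  apply: (@le_lt_trans _ _ (M * N w)); last by rewrite mulrC -ltr_pdivlMr.
  apply: (@le_trans _ _ (2 * (A * (N (S t f) * N w)) + A * (N w * N w))).
    by apply: lerD => //; rewrite ler_pM2l.
  have : A * (N w * N w) <= A * N w.
    by rewrite ler_wpM2l// ler_piMr// ltW.
  rewrite /M; move: w0; nra.
have [Dt Bt] := dom_sg t0 (D'D _ D'f).
(* [M] and [e1] make the cross term with the remainder [r] at most [e / 2 * h]; [M2] does the same
   for the term quadratic in the increment. *)
pose u := S t f; pose M := 2 * A * N u + 1.
have u0 := ipnorm_ge0 ip u.
have M0 : 0 < M by rewrite ltr_wpDl// !mulr_ge0.
pose e1 := e / (2 * M).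
have e10 : 0 < e1 by rewrite divr_gt0// mulr_gt0.
pose M2 := A * (N (B u) + e1) ^+ 2 + 1.
have M20 : 0 < M2 by rewrite ltr_wpDl// mulr_ge0// sqr_ge0.
have [d d0 H] := sg_increment t0 (D'D _ D'f) e10.
exists (Num.min d (e / (2 * M2))); first by rewrite lt_min d0 divr_gt0// mulr_gt0.
move=> h /andP[h0]; rewrite lt_min => /andP[hd hM2].
have := H h; rewrite h0 hd => /(_ isT).
set r := _ - _ => Lr; have r0 := ipnorm_ge0 ip r.
rewrite -/u (_ : S (t + h) f = u + (h%:C *: B u + r)); last first.
  by rewrite /r -/u !subrKC.
rewrite (form_sqrD hQ) (form_addr hQ) (form_scaler hQ).
have dis := diss _ (D'S _ _ t0 D'f); rewrite -/u in dis.
set w := h%:C *: B u + r.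
have Lw : N w <= h * (N (B u) + e1).
  apply: le_trans (ler_ipnormD hip _ _) _; rewrite (ipnormZ hip) normcR gtr0_norm//.
  by rewrite mulrDr lerD2l (mulrC h).
have w0 := ipnorm_ge0 ip w.
have bw : Q w w <= A * (h * (N (B u) + e1)) ^+ 2.
  apply: le_trans (ler_norm _) _; apply: le_trans (bQ _ _) _.
  by rewrite ler_wpM2l// -expr2 ler_pXn2r ?nnegrE// (le_trans w0).
have br : 2 * Q u r <= 2 * A * N u * (e1 * h).
  have := le_trans (ler_norm _) (bQ u r).
  have : A * (N u * N r) <= A * (N u * (e1 * h)) by rewrite !ler_wpM2l.
  lra.
have c1 : 2 * A * N u * (e1 * h) <= e / 2 * h.
  rewrite mulrA ler_pM2r// /e1.
  rewrite (_ : _ * (e / _) = e / 2 * (2 * A * N u / M)); last by field; rewrite gt_eqF.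
  by rewrite ler_piMr ?divr_ge0 ?(ltW e0)// ler_pdivrMr// mul1r lerDl.
have c2 : A * (h * (N (B u) + e1)) ^+ 2 <= e / 2 * h.
  rewrite (_ : _ * _ ^+ 2 = (M2 - 1) * h * h); last by rewrite /M2; ring.
  rewrite ler_pM2r// (@le_trans _ _ (M2 * (e / (2 * M2))))//.
    by apply: ler_pM; rewrite ?(ltW h0) ?(ltW hM2)// /M2 ?addrK ?lerDl// mulr_ge0// sqr_ge0.
  by rewrite le_eqVlt; apply/orP; left; apply/eqP; field; rewrite gt_eqF.
have c3 : 2 * h * Q u (B u) <= - k * Q u u * h.
  by have := ler_wpM2r (ltW h0) dis; lra.
move: bw br c1 c2 c3; lra.
Qed.

End Semigroups.

(** * Spectral projections *)

Section Spans.
Variables (R : realType) (E : lmodType R[i]).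
Implicit Types (e : nat -> E) (f g : E).

Definition spanned n e f : Prop := exists c : nat -> R[i], f = \sum_(i < n) c i *: e i.

Lemma spanned0 n e : spanned n e 0.
Proof. by exists (fun=> 0); rewrite big1// => i _; rewrite scale0r. Qed.

Lemma spannedD n e f g : spanned n e f -> spanned n e g -> spanned n e (f + g).
Proof.
move=> [c ->] [d ->]; exists (fun i => c i + d i); rewrite -big_split.
by apply: eq_bigr => i _; rewrite scalerDl.
Qed.

Lemma spannedZ n e a f : spanned n e f -> spanned n e (a *: f).
Proof.
move=> [c ->]; exists (fun i => a * c i); rewrite scaler_sumr.
by apply: eq_bigr => i _; rewrite scalerA.
Qed.

Lemma spannedB n e f g : spanned n e f -> spanned n e g -> spanned n e (f - g).
Proof. by move=> hf hg; rewrite -scaleN1r; apply: spannedD => //; exact: spannedZ. Qed.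

Lemma spanned_sum n e m (F : 'I_m -> E) : (forall i, spanned n e (F i)) ->
  spanned n e (\sum_(i < m) F i).
Proof.
move=> hF; elim/big_ind: _ => //; [exact: spanned0|by move=> *; exact: spannedD].
Qed.

Lemma spanned_elt n e i : (i < n)%N -> spanned n e (e i).
Proof.
move=> ilt; exists (fun j => (j == i)%:R); rewrite (bigD1 (Ordinal ilt))//= eqxx scale1r.
rewrite big1 ?addr0// => j ji; rewrite (_ : _ == _ = false) ?scale0r//.
by apply/negbTE; apply: contra ji => /eqP ji; apply/eqP/val_inj.
Qed.

Lemma spanned_mono m n e f : (m <= n)%N -> spanned m e f -> spanned n e f.
Proof.
move=> mn [c ->]; apply: spanned_sum => i; apply/spannedZ/spanned_elt.
exact: leq_trans (ltn_ord i) mn.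
Qed.

Lemma spanned_trans m n e e' f : (forall i, (i < m)%N -> spanned n e' (e i)) ->
  spanned m e f -> spanned n e' f.
Proof. by move=> h [c ->]; apply: spanned_sum => i; apply/spannedZ/h. Qed.

End Spans.

Section SpectralDecomposition.
Variables (R : realType) (E : lmodType R[i]) (ip : E -> E -> R[i]).
Hypothesis hip : inner_product ip.
Local Notation N := (ipnorm ip).
Variables (D : E -> Prop) (B : E -> E) (S : R -> E -> E).
Hypothesis hS : contraction_group ip D B S.
Variable J : E -> E.
Hypothesis JD : forall f g, J (f + g) = J f + J g.
Hypothesis JZ : forall a f, J (a *: f) = conjc a *: J f.
Hypothesis ipJ : forall f g, ip (J f) (J g) = conjc (ip f g).
Hypothesis JK : forall f, J (J f) = f.
Hypothesis csym : forall f g, D f -> D g -> ip (B f) (J g) = ip (B g) (J f).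
Variables (n : nat) (psi : nat -> E) (lam : nat -> R[i]).
Hypothesis psiD : forall k, (k < n)%N -> D (psi k).
Hypothesis psiB : forall k, (k < n)%N -> B (psi k) = lam k *: psi k.
Hypothesis psi_norm : forall j k, (j < n)%N -> (k < n)%N ->
  ip (psi j) (J (psi k)) = (j == k)%:R.

(** The pairing [ip f (J g)] is bilinear and symmetric, and [csym] says that the generator is
    symmetric for it. Hence the vectors [J (psi k)] act as left eigenvectors, and no adjoint
    operator has to be introduced. *)
Lemma ip_flip f g : ip f (J g) = ip g (J f).
Proof. by rewrite -(ip_conj hip) -ipJ JK. Qed.

Lemma J0 : J 0 = 0.
Proof. by have := JZ 0 0; rewrite conjc0 !scale0r. Qed.

Lemma ipnormJ f : N (J f) = N f.
Proof. by rewrite /ipnorm ipJ Re_conjc. Qed.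

Lemma J_sum m (F : 'I_m -> E) : J (\sum_(i < m) F i) = \sum_(i < m) J (F i).
Proof. by elim/big_rec2: _ => [|i x y _ <-]; rewrite ?J0 ?JD. Qed.

Definition sproj f := \sum_(j < n) ip f (J (psi j)) *: psi j.

Definition skernel f : Prop := forall j, (j < n)%N -> ip f (J (psi j)) = 0.

Lemma sprojD f g : sproj (f + g) = sproj f + sproj g.
Proof.
rewrite /sproj -big_split; apply: eq_bigr => j _.
by rewrite (ipDl hip) scalerDl.
Qed.

Lemma sprojZ a f : sproj (a *: f) = a *: sproj f.
Proof.
rewrite /sproj scaler_sumr; apply: eq_bigr => j _.
by rewrite (ipZl hip) scalerA.
Qed.

Lemma sprojB f g : sproj (f - g) = sproj f - sproj g.
Proof. by rewrite sprojD -scaleN1r sprojZ scaleN1r. Qed.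

Lemma ip_comb_psi (c : nat -> R[i]) k : (k < n)%N ->
  ip (\sum_(j < n) c j *: psi j) (J (psi k)) = c k.
Proof.
move=> kn; rewrite (ip_suml hip) (bigD1 (Ordinal kn))//=.
rewrite (ipZl hip) psi_norm// eqxx mulr1 big1 ?addr0// => j jk.
rewrite (ipZl hip) psi_norm// (_ : _ == _ = false) ?mulr0//.
by apply/negbTE; apply: contra jk => /eqP jk; apply/eqP/val_inj.
Qed.

Lemma skernel_sproj f : skernel (f - sproj f).
Proof.
by move=> j jn; rewrite (ipBl hip) (ip_comb_psi (fun j => ip f (J (psi j))))// subrr.
Qed.

Lemma sproj_skernel f : skernel f -> sproj f = 0.
Proof. by move=> h; rewrite /sproj big1// => j _; rewrite h// scale0r. Qed.

Lemma sproj_dom f : D (sproj f).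
Proof. by apply: (dom_sum hip hS) => j; apply: (domZ hip hS); exact: psiD. Qed.

Lemma sproj_bounded : exists2 A, 0 <= A & forall f, N (sproj f) <= A * N f.
Proof.
exists (\sum_(j < n) N (psi j) ^+ 2); first by apply: sumr_ge0 => j _; exact: sqr_ge0.
move=> f; apply: le_trans (ler_ipnorm_sum hip _ _ _) _.
rewrite mulr_suml; apply: ler_sum => j _; rewrite (ipnormZ hip).
have := cauchy_schwarz hip f (J (psi j)); rewrite ipnormJ => h.
by rewrite expr2 mulrAC ler_wpM2r ?ipnorm_ge0// mulrC.
Qed.

Lemma psi_neq0 k : (k < n)%N -> 0 < N (psi k).
Proof.
move=> kn; rewrite lt_neqAle ipnorm_ge0 andbT eq_sym; apply/eqP => /(ipnorm_eq0 hip) h.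
have := psi_norm kn kn; rewrite h (ip0l hip) eqxx => /eqP.
by rewrite eq_sym oner_eq0.
Qed.

Lemma ip_gen_psi f k : (k < n)%N -> D f -> ip (B f) (J (psi k)) = lam k * ip f (J (psi k)).
Proof.
move=> kn Df; have := csym Df (psiD kn).
by rewrite (psiB kn) (ipZl hip) (ip_flip (psi k) f).
Qed.

(** On the diagonal this is the squared modulus of the single coefficient [ip f g], to which
    [sg_gronwall] can then be applied. *)
Lemma bounded_form_rank1 g : bounded_form ip (fun f h => Re (ip f g * conjc (ip h g))).
Proof.
split.
- move=> f h; rewrite !(ipDl hip) !(Re_mul, Re_add, Im_add, Re_conjc, Im_conjc); ring.
- by move=> f h k; rewrite (ipDl hip) conjcD mulrDr Re_add.
- move=> a f h; rewrite (ipZl hip) conjcM conjc_real mulrCA.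
  by rewrite Re_scale.
- exists (N g ^+ 2); first exact: sqr_ge0.
  move=> f h; apply: le_trans (normr_Re_le _) _; rewrite Normc.normcM normc_conj.
  have h1 := cauchy_schwarz hip f g; have h2 := cauchy_schwarz hip h g.
  apply: le_trans (ler_pM _ _ h1 h2) _; rewrite ?normc_ge0//.
  by rewrite le_eqVlt; apply/orP; left; apply/eqP; ring.
Qed.

(** Along the flow the coefficient against [J (psi k)] obeys a scalar linear equation with rate
    [lam k]. Gronwall for its squared modulus, which is 0 at time 0, keeps it 0. *)
Lemma skernel_sg_dom t f : 0 <= t -> D f -> skernel f -> skernel (S t f).
Proof.
move=> t0 Df kf k kn.
have := sg_gronwall hip hS (bounded_form_rank1 (J (psi k))).
move=> /(_ (- (2 * Re (lam k))) D _ (fun _ => id)).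
have Q0 g : 0 <= Re (ip g (J (psi k)) * conjc (ip g (J (psi k)))).
  by rewrite mul_conjc /= sqr_ge0.
move=> /(_ Q0 _ _ _ _ t0 Df).
move=> /(_ (fun t g t0 Dg => (dom_sg hS t0 Dg).1)).
have dis g : D g -> 2 * Re (ip g (J (psi k)) * conjc (ip (B g) (J (psi k)))) <=
    - - (2 * Re (lam k)) * Re (ip g (J (psi k)) * conjc (ip g (J (psi k)))).
  move=> Dg; rewrite ip_gen_psi// conjcM mulrCA mul_conjc [in leLHS]Re_mul /= mulr0 subr0.
  by rewrite Re_conjc opprK mulrA.
move=> /(_ dis); rewrite (kf k kn) mul0r /= mulr0 mul_conjc /= => h.
apply/eqP; rewrite -normc_eq0 -sqrf_eq0 eq_le h sqr_ge0 //.
Qed.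

(** Removing the projection of an approximant leaves it in [D], since the [psi j] lie there, and
    costs only the factor [1 + A]. *)
Lemma skernel_dense (Ddense : forall f e, 0 < e -> exists2 g, D g & N (f - g) < e) f e :
  skernel f -> 0 < e -> exists g, [/\ D g, skernel g & N (f - g) < e].
Proof.
move=> kf e0; have [A A0 hA] := sproj_bounded.
have A1 : 0 < 1 + A by rewrite ltr_pwDl.
have [g Dg fg] := Ddense f (e / (1 + A)) (divr_gt0 e0 A1).
exists (g - sproj g); split.
- by apply: (domB' hip hS) => //; exact: sproj_dom.
- exact: skernel_sproj.
- have -> : f - (g - sproj g) = (f - g) - sproj (f - g).
    by rewrite sprojB (sproj_skernel kf) sub0r !opprK opprB addrCA addrC.
  apply: le_lt_trans (ler_ipnormB hip _ _) _.
  apply: le_lt_trans (lerD (lexx _) (hA _)) _.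
  by rewrite -{1}[N _]mul1r -mulrDl mulrC -ltr_pdivlMr.
Qed.

(** The error [w] is subadditive in time, because both flows are contractions, and it is [o(h)] for
    small [h]; cutting [[0, t]] into many equal steps shows that it vanishes. *)
Lemma sg_psi t k : (k < n)%N -> 0 <= t -> Re (lam k) <= 0 ->
  S t (psi k) = cexp (t%:C * lam k) *: psi k.
Proof.
move=> kn t0 lk; pose w s := S s (psi k) - cexp (s%:C * lam k) *: psi k.
have w0 : w 0 = 0 by rewrite /w (sg_zero hS) mul0r cexp0 scale1r subrr.
have wD s h : 0 <= s -> 0 <= h -> N (w (s + h)) <= N (w s) + N (w h).
  move=> s0 h0; have -> : w (s + h) = S s (w h) + cexp (h%:C * lam k) *: w s.
    rewrite /w (sgB hS)// (sgZ hS)// (sg_add hS)// scalerBr scalerA -cexpD.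
    by rewrite -mulrDl -rmorphD /= (addrC h) addrA subrK.
  apply: le_trans (ler_ipnormD hip _ _) _; rewrite addrC; apply: lerD.
    rewrite (ipnormZ hip) normc_cexp ler_piMl ?ipnorm_ge0// -[leRHS]expR0 ler_expR.
    by rewrite Re_scale mulr_ge0_le0.
  exact: (sg_contract hS).
have wn s m : 0 <= s -> N (w (m%:R * s)) <= m%:R * N (w s).
  move=> s0; elim: m => [|m IH]; first by rewrite !mul0r w0 (ipnorm0 hip).
  rewrite -addn1 natrD mulrDl mul1r (le_trans (wD _ _ _ _))// ?mulr_ge0//.
  by rewrite mulrDl mul1r lerD2r.
have [->|tn0] := eqVneq t 0; first by rewrite (sg_zero hS) mul0r cexp0 scale1r.
have tp : 0 < t by rewrite lt_neqAle eq_sym tn0.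
apply/eqP; rewrite -subr_eq0 -/(w t); apply/eqP/(ipnorm_eq0 hip)/eqP.
rewrite eq_le ipnorm_ge0 andbT; apply/ler_addgt0Pr => e e0; rewrite add0r.
have pk := psi_neq0 kn.
pose e' := e / (t * (1 + N (psi k))).
have c0 : 0 < 1 + N (psi k) by rewrite addr_gt0.
have e'0 : 0 < e' by rewrite divr_gt0// mulr_gt0.
have [d1 d10 H1] := sg_increment hip hS (lexx 0) (psiD kn) e'0.
have [d2 d20 H2] := cexp_derivative (lam k) e'0.
have dm : 0 < Num.min d1 d2 by rewrite lt_min d10.
pose m := (Num.truncn (t / Num.min d1 d2)).+1.
have hm : t / Num.min d1 d2 < m%:R by rewrite truncnS_gt.
have m0 : 0 < m%:R :> R by rewrite ltr0n.
have h0 : 0 < t / m%:R by rewrite divr_gt0.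
have hd : t / m%:R < Num.min d1 d2.
  by rewrite ltr_pdivrMr// mulrC -ltr_pdivrMr.
have tE : t = m%:R * (t / m%:R) by field; rewrite gt_eqF.
rewrite tE; apply: le_trans (wn _ _ (ltW h0)) _; set h := t / _ in h0 hd tE *.
move: hd; rewrite lt_min => /andP[hd1 hd2].
have := H1 h; rewrite h0 hd1 add0r (sg_zero hS) psiB// => /(_ isT) L1.
have := H2 h; rewrite h0 hd2 => /(_ isT) L2.
have : N (w h) <= e' * h + e' * h * N (psi k).
  have -> : w h = (S h (psi k) - psi k - h%:C *: (lam k *: psi k)) -
      (cexp (h%:C * lam k) - 1 - h%:C * lam k) *: psi k.
    rewrite !scalerBl scale1r scalerA /w !opprB.
    by rewrite [RHS]addrA subrK [RHS]addrA subrK.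
  apply: le_trans (ler_ipnormB hip _ _) _; apply: lerD => //.
  by rewrite (ipnormZ hip) ler_wpM2r// ipnorm_ge0.
have -> : e' * h + e' * h * N (psi k) = e / m%:R.
  by rewrite /e' /h; field; rewrite !gt_eqF.
by rewrite ler_pdivlMr// mulrC.
Qed.

Lemma sg_sproj t f : 0 <= t -> (forall k, (k < n)%N -> Re (lam k) <= 0) ->
  S t (sproj f) = \sum_(j < n) (cexp (t%:C * lam j) * ip f (J (psi j))) *: psi j.
Proof.
move=> t0 lam0; rewrite (sg_sum hS)//; apply: eq_bigr => j _.
by rewrite (sgZ hS)// sg_psi ?lam0// scalerA mulrC.
Qed.

(* Gram-Schmidt puts the generator on the span of the eigenfunctions into Schur form. *)
Lemma invariant_basis : exists e : nat -> E,
  [/\ orthonormal_family ip n e,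
      forall k, (k < n)%N -> D (e k) /\ spanned k e (B (e k) - lam k *: e k),
      forall k, (k < n)%N -> spanned n psi (e k) &
      forall k, (k < n)%N -> spanned n e (psi k)].
Proof.
have phil k : scalar (fun f => ip f (J (psi k))).
  by move=> a f g; rewrite (ipDl hip) (ipZl hip).
have phin j k : (j < n)%N -> (k < n)%N -> ip (psi j) (J (psi k)) = (j == k)%:R.
  exact: psi_norm.
have [e [t [eo et]]] := gram_schmidt hip phil phin.
have eE k : (k < n)%N ->
    e k = (t k)^-1 *: (psi k - \sum_(i < k) ip (psi k) (e i) *: e i).
  move=> kn; have [t0 pE] := et _ kn.
  have -> : psi k - \sum_(i < k) ip (psi k) (e i) *: e i = t k *: e k.
    by rewrite {1}pE addrK.
  by rewrite scalerA mulVf// scale1r.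
have espan k : (k < n)%N -> spanned n psi (e k).
  elim/ltn_ind: k => k IH kn; rewrite eE//; apply: spannedZ; apply: spannedB.
    exact: spanned_elt.
  apply: spanned_sum => i; apply: spannedZ; apply: IH => //.
  exact: ltn_trans (ltn_ord i) kn.
have eD k : (k < n)%N -> D (e k).
  move=> /espan[c ->]; apply: (dom_sum hip hS) => i; apply: (domZ hip hS).
  exact: psiD.
have pspan k : (k < n)%N -> spanned k.+1 e (psi k).
  move=> kn; have [_ ->] := et _ kn; apply: spannedD; first exact/spannedZ/spanned_elt.
  by apply: spanned_sum => i; apply/spannedZ/spanned_elt; exact: ltn_trans (ltn_ord i) _.
exists e; split => //; last first.
  by move=> k kn; apply: spanned_mono (pspan _ kn).
move=> k; elim/ltn_ind: k => k IH kn; split; first exact: eD.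
have [t0 pE] := et _ kn.
(* The eigenvector equation of [psi k], with its Gram-Schmidt expansion inserted, is solved for
   [B (e k)]; only earlier basis vectors remain. *)
have -> : B (e k) - lam k *: e k =
    (t k)^-1 *: \sum_(i < k) ip (psi k) (e i) *: (lam k *: e i - B (e i)).
  have Dk (i : 'I_k) : D (e i) by apply: eD; exact: ltn_trans (ltn_ord i) kn.
  have -> : \sum_(i < k) ip (psi k) (e i) *: (lam k *: e i - B (e i)) =
      lam k *: (\sum_(i < k) ip (psi k) (e i) *: e i)
      - B (\sum_(i < k) ip (psi k) (e i) *: e i).
    rewrite (gen_sum hip hS); last by move=> i; apply: (domZ hip hS).
    rewrite scaler_sumr -sumrB; apply: eq_bigr => i _.
    by rewrite (genZ hip hS)// scalerBr !scalerA mulrC.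
  set s := \sum_(i < k) _ in pE *.
  have Ds : D s by apply: (dom_sum hip hS) => i; apply: (domZ hip hS).
  have sE : s = psi k - t k *: e k by rewrite pE addrC addKr.
  rewrite sE (genB hip hS) ?psiB//; [|exact: psiD|by apply: (domZ hip hS); exact: eD].
  rewrite (genZ hip hS)//; last exact: eD.
  have -> : lam k *: (psi k - t k *: e k) - (lam k *: psi k - t k *: B (e k)) =
      t k *: (B (e k) - lam k *: e k).
    rewrite scalerBr opprB addrC addrA subrK scalerBr.
    by rewrite (scalerA (lam k)) mulrC -scalerA.
  by rewrite scalerA mulVf// scale1r.
apply: spannedZ; apply: spanned_sum => i; apply: spannedZ.
have ik : (i < k)%N := ltn_ord i.
have [_ si] := IH i ik (ltn_trans ik kn).
have -> : lam k *: e i - B (e i) = (lam k - lam i) *: e i - (B (e i) - lam i *: e i).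
  by rewrite scalerBl opprB addrA subrK.
apply: spannedB; first exact/spannedZ/spanned_elt.
exact: spanned_mono (ltnW ik) si.
Qed.

End SpectralDecomposition.

Lemma sum_cauchy_schwarz (R : realType) n (a b : 'I_n -> R) :
  (\sum_(i < n) a i * b i) ^+ 2 <= (\sum_(i < n) a i ^+ 2) * (\sum_(i < n) b i ^+ 2).
Proof.
elim: n a b => [|n IH] a b; first by rewrite !big_ord0 expr0n mulr0.
rewrite !big_ord_recr /=; have := IH (fun i => a (widen_ord (leqnSn n) i))
  (fun i => b (widen_ord (leqnSn n) i)).
set s := \sum_(i < n) _ * _; set A := \sum_(i < n) a _ ^+ 2; set B := \sum_(i < n) b _ ^+ 2.
have A0 : 0 <= A by apply: sumr_ge0 => i _; exact: sqr_ge0.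
have B0 : 0 <= B by apply: sumr_ge0 => i _; exact: sqr_ge0.
move: (a ord_max) (b ord_max) => x y sAB.
have X0 : 0 <= A * y ^+ 2 + x ^+ 2 * B by rewrite addr_ge0// mulr_ge0// sqr_ge0.
have : 2 * s * x * y <= A * y ^+ 2 + x ^+ 2 * B.
  apply: le_trans (ler_norm _) _; rewrite -(@ler_pXn2r _ 2) ?nnegrE//.
  rewrite real_normK ?num_real//.
  have : s ^+ 2 * (x ^+ 2 * y ^+ 2) <= A * B * (x ^+ 2 * y ^+ 2).
    by rewrite ler_wpM2r// mulr_ge0 ?sqr_ge0.
  have := sqr_ge0 (A * y ^+ 2 - x ^+ 2 * B); lra.
lra.
Qed.

(** * Closeness of the eigenspace to the null space *)

Section NearlyInvariantKernel.
Variables (R : realType) (E : lmodType R[i]) (ip : E -> E -> R[i]).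
Hypothesis hip : inner_product ip.
Local Notation N := (ipnorm ip).
Variables (D : E -> Prop) (B : E -> E) (S : R -> E -> E).
Hypothesis hS : contraction_group ip D B S.
Variable J : E -> E.
Hypothesis JD : forall f g, J (f + g) = J f + J g.
Hypothesis JZ : forall a f, J (a *: f) = conjc a *: J f.
Hypothesis ipJ : forall f g, ip (J f) (J g) = conjc (ip f g).
Hypothesis JK : forall f, J (J f) = f.
Hypothesis csym : forall f g, D f -> D g -> ip (B f) (J g) = ip (B g) (J f).
Variables (n : nat) (psi : nat -> E) (lam : nat -> R[i]).
Hypothesis psiD : forall k, (k < n)%N -> D (psi k).
Hypothesis psiB : forall k, (k < n)%N -> B (psi k) = lam k *: psi k.
Hypothesis psi_norm : forall j k, (j < n)%N -> (k < n)%N ->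
  ip (psi j) (J (psi k)) = (j == k)%:R.
Variables (nb : nat -> E) (mu : R).
Hypothesis nbo : orthonormal_family ip n nb.
Hypothesis mu0 : 0 < mu.
Local Notation P0 := (oproj ip n nb).
Hypothesis diss : forall f, D f -> Re (ip (B f) f) <= - mu * N (f - P0 f) ^+ 2.
Hypothesis P1J : forall f, N (J f - P0 (J f)) = N (f - P0 f).

Lemma eigen_dissip k : (k < n)%N -> Re (lam k) <= 0.
Proof.
move=> kn; have := diss (psiD kn); rewrite psiB// (ipZl hip) (ipff hip) Re_mul /= mulr0 subr0.
have pk := psi_neq0 hip psi_norm kn.
have : - mu * N (psi k - P0 (psi k)) ^+ 2 <= 0.
  by rewrite mulNr oppr_le0 mulr_ge0 ?sqr_ge0// ltW.
move=> h1 h2; have := le_trans h2 h1.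
by rewrite pmulr_lle0// exprn_gt0.
Qed.

Local Notation defect := (\sum_(k < n) - Re (lam k) / mu).

Lemma spanned_orth e f g : (forall k, (k < n)%N -> ip f (e k) = 0) ->
  spanned n e g -> ip f g = 0.
Proof.
by move=> h [c ->]; rewrite (ip_sumr hip) big1// => i _; rewrite (ipZr hip) h ?mulr0.
Qed.

(* The trace of the generator on the eigenspace, computed in the Schur basis, is
   the sum of the eigenvalues. *)
Lemma Schur_basis_defect e : orthonormal_family ip n e ->
  (forall k, (k < n)%N -> D (e k) /\ spanned k e (B (e k) - lam k *: e k)) ->
  \sum_(k < n) N (e k - P0 (e k)) ^+ 2 <= defect.
Proof.
move=> eo eB; apply: ler_sum => k _; have [Dk [c ck]] := eB _ (ltn_ord k).
have := diss Dk; rewrite -(subrK (lam k *: e k) (B (e k))) ck (ipDl hip).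
rewrite (ip_suml hip) big1 ?add0r; last first.
  move=> i _; rewrite (ipZl hip) eo ?(ltn_trans (ltn_ord i))// ltn_eqF ?mulr0//.
rewrite (ipZl hip) eo// eqxx mulr1 => h.
by rewrite ler_pdivlMr// mulrC; lra.
Qed.

(** The conjugates [u k = J (e k)] of a Schur basis are orthonormal, annihilate the kernel, and
    nearly lie in the span of the [nb]. Both spans have dimension [n], so conversely each [nb j] is
    close to the span of the [u k] and pairs weakly with the kernel. *)
Lemma skernel_P0 f : skernel ip J n psi f -> N (P0 f) ^+ 2 <= n%:R * defect * N f ^+ 2.
Proof.
move=> kf.
have [e [eo eB epsi psie]] := invariant_basis hip hS psiD psiB psi_norm.
have p_bound := Schur_basis_defect eo eB.
pose u k := J (e k).
have uo : orthonormal_family ip n u.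
  by move=> i j ilt jlt; rewrite /u ipJ eo// conjc_nat.
have fu k : (k < n)%N -> ip f (u k) = 0.
  move=> kn; have [c ck] := epsi k kn; rewrite /u ck (J_sum JD JZ) (ip_sumr hip) big1//.
  by move=> j _; rewrite JZ (ipZr hip) kf// mulr0.
have sumA : \sum_(k < n) \sum_(j < n) normc (ip (nb j) (u k)) ^+ 2 >= n%:R - defect.
  apply: (@le_trans _ _ (\sum_(k < n) (1 - N (e k - P0 (e k)) ^+ 2))).
    by rewrite sumrB sumr_const card_ord lerB.
  apply: ler_sum => k _.
  have := pythagoras hip nbo (u k); rewrite /u P1J (ipnormJ ipJ).
  have -> : N (e k) ^+ 2 = 1 by rewrite (sqr_ipnorm hip) eo// eqxx.
  rewrite (sqr_ipnorm_oproj hip nbo) => ->; rewrite addrK le_eqVlt.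
  by apply/orP; left; apply/eqP/eq_bigr => j _; rewrite -(ip_conj hip) normc_conj.
(* Double counting: the projections have total mass at least [n - defect], of which the [n - 1]
   other vectors [nb i] carry at most [n - 1]. *)
have dist j : (j < n)%N -> N (nb j - oproj ip n u (nb j)) ^+ 2 <= defect.
  move=> jn; have := pythagoras hip uo (nb j).
  have -> : N (nb j) ^+ 2 = 1 by rewrite (sqr_ipnorm hip) nbo// eqxx.
  rewrite (sqr_ipnorm_oproj hip uo) => pj.
  have : \sum_(i < n | i != Ordinal jn) \sum_(k < n) normc (ip (nb i) (u k)) ^+ 2 <= n%:R - 1.
    apply: (@le_trans _ _ (\sum_(i < n | i != Ordinal jn) 1)).
      apply: ler_sum => i _; have := bessel hip uo (nb i).
      by rewrite (sqr_ipnorm hip (nb i)) nbo// eqxx.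
    have : \sum_(i < n) (1 : R) = 1 + \sum_(i < n | i != Ordinal jn) 1.
      by rewrite (bigD1 (Ordinal jn)).
    by rewrite sumr_const card_ord => ->; rewrite addrC addKr.
  move: sumA; rewrite exchange_big/= [X in _ <= X -> _](bigD1 (Ordinal jn))//=.
  move: pj; lra.
have cs j : (j < n)%N -> normc (ip f (nb j)) ^+ 2 <= defect * N f ^+ 2.
  move=> jn; have -> : ip f (nb j) = ip f (nb j - oproj ip n u (nb j)).
    rewrite (ipBr hip) [X in _ = _ - X](spanned_orth fu) ?subr0//.
    by exists (fun i => ip (nb j) (u i)).
  have h := cauchy_schwarz hip f (nb j - oproj ip n u (nb j)).
  apply: (@le_trans _ _ ((N f * N (nb j - oproj ip n u (nb j))) ^+ 2)).
    by rewrite ler_pXn2r ?nnegrE ?normc_ge0// (le_trans (normc_ge0 _) h).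
  by rewrite exprMn mulrC ler_wpM2r ?sqr_ge0// dist.
rewrite (sqr_ipnorm_oproj hip nbo).
apply: le_trans (_ : \sum_(j < n) defect * N f ^+ 2 <= _).
  by apply: ler_sum => j _; exact: cs.
by rewrite sumr_const card_ord mulr_natl mulrnAl.
Qed.

(** The operator norm of [P_1] on the eigenspace is at most its Hilbert-Schmidt norm, which
    [Schur_basis_defect] bounds in an orthonormal basis. *)
Lemma eigenspace_P1 f : spanned n psi f -> N (f - P0 f) ^+ 2 <= defect * N f ^+ 2.
Proof.
move=> sf.
have [e [eo eB epsi psie]] := invariant_basis hip hS psiD psiB psi_norm.
have p_bound := Schur_basis_defect eo eB.
have [c ->] := spanned_trans psie sf.
have -> : \sum_(i < n) c i *: e i - P0 (\sum_(i < n) c i *: e i) =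
    \sum_(i < n) c i *: (e i - P0 (e i)).
  have -> : P0 (\sum_(i < n) c i *: e i) = \sum_(i < n) c i *: P0 (e i).
    have z : P0 0 = 0 by have := oprojZ hip n nb 0 0; rewrite !scale0r.
    elim/big_rec2: _ => [//|i x y _ <-].
    by rewrite (oprojD hip) (oprojZ hip).
  by rewrite -sumrB; apply: eq_bigr => i _; rewrite scalerBr.
rewrite (sqr_ipnorm_comb hip eo).
set a := \sum_(i < n) normc (c i) ^+ 2.
have hb : N (\sum_(i < n) c i *: (e i - P0 (e i))) <=
    \sum_(i < n) normc (c i) * N (e i - P0 (e i)).
  apply: le_trans (ler_ipnorm_sum hip _ _ _) _; apply: ler_sum => i _.
  by rewrite (ipnormZ hip).
apply: le_trans (_ : (\sum_(i < n) normc (c i) * N (e i - P0 (e i))) ^+ 2 <= _).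
  by rewrite ler_pXn2r ?nnegrE ?ipnorm_ge0// sumr_ge0// => i _;
     rewrite mulr_ge0 ?normc_ge0 ?ipnorm_ge0.
apply: (@le_trans _ _ (a * \sum_(k < n) N (e k - P0 (e k)) ^+ 2)); last first.
  by rewrite mulrC ler_wpM2r// sumr_ge0// => i _; exact: sqr_ge0.
exact: sum_cauchy_schwarz.
Qed.

End NearlyInvariantKernel.

(** * Decay from Lyapunov functionals *)

Section Decay.
Variables (R : realType) (E : lmodType R[i]) (ip : E -> E -> R[i]).
Hypothesis hip : inner_product ip.
Local Notation N := (ipnorm ip).
Variables (D : E -> Prop) (B : E -> E) (S : R -> E -> E).
Hypothesis hS : contraction_group ip D B S.

Lemma bounded_form_ip : bounded_form ip (fun f g => Re (ip f g)).
Proof.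
split.
- move=> f g; rewrite (ipDl hip) !(ipDr hip) !Re_add -(ip_conj hip f g) Re_conjc; ring.
- by move=> f g h; rewrite (ipDr hip) Re_add.
- by move=> a f g; rewrite (ipZr hip) conjc_real Re_scale.
- exists 1 => // f g; rewrite mul1r.
  exact: le_trans (normr_Re_le _) (cauchy_schwarz hip f g).
Qed.

Lemma bounded_formD (Q Q' : E -> E -> R) : bounded_form ip Q -> bounded_form ip Q' ->
  bounded_form ip (fun f g => Q f g + Q' f g).
Proof.
move=> h h'; split.
- by move=> f g; rewrite (form_sqrD h) (form_sqrD h'); ring.
- by move=> f g k; rewrite (form_addr h) (form_addr h'); ring.
- by move=> a f g; rewrite (form_scaler h) (form_scaler h'); ring.
- have [A A0 hA] := form_bounded h; have [A' A'0 hA'] := form_bounded h'.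
  exists (A + A'); first exact: addr_ge0.
  by move=> f g; rewrite (le_trans (ler_normD _ _))// mulrDl lerD.
Qed.

Lemma bounded_formZ (a : R) (Q : E -> E -> R) : bounded_form ip Q ->
  bounded_form ip (fun f g => a * Q f g).
Proof.
move=> h; split.
- by move=> f g; rewrite (form_sqrD h); ring.
- by move=> f g k; rewrite (form_addr h); ring.
- by move=> b f g; rewrite (form_scaler h); ring.
- have [A A0 hA] := form_bounded h.
  exists (`|a| * A); first exact: mulr_ge0.
  by move=> f g; rewrite normrM -mulrA ler_wpM2l.
Qed.

Lemma dense_decay (D' : E -> Prop) t (x : R) f : 0 <= t -> 0 <= x ->
  (forall g, D' g -> N (S t g) <= x * N g) ->
  (forall e, 0 < e -> exists2 g, D' g & N (f - g) < e) ->
  N (S t f) <= x * N f.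
Proof.
move=> t0 x0 h dense; apply/ler_addgt0Pr => e e0.
have x1 : 0 < x + 1 by rewrite ltr_wpDl.
have [g D'g fg] := dense (e / (x + 1)) (divr_gt0 e0 x1).
have gf : N g <= N f + N (f - g).
  have {1}-> : g = f - (f - g) by rewrite opprB addrC subrK.
  exact: ler_ipnormB.
have : N (S t f) <= N (S t g) + N (f - g).
  rewrite -{1}(subrK g f) (sgD hS)// addrC (le_trans (ler_ipnormD hip _ _))//.
  by rewrite lerD2l (sg_contract hS).
move=> /le_trans; apply; apply: le_trans (lerD (h _ D'g) (lexx _)) _.
apply: le_trans (lerD (ler_wpM2l x0 gf) (lexx _)) _.
rewrite mulrDr -addrA lerD2l -{2}[N _]mul1r -mulrDl mulrC -ler_pdivlMr//.
exact: ltW.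
Qed.

(** [Q] decays at rate [s / C]; the equivalence with the squared norm transfers this, the square
    root halving the rate and leaving the prefactor. *)
Lemma lyapunov_decay (Q : E -> E -> R) (c C s : R) :
  (forall f e, 0 < e -> exists2 g, D g & N (f - g) < e) ->
  bounded_form ip Q -> 0 < c -> 0 < C -> 0 < s ->
  (forall f, c * N f ^+ 2 <= Q f f <= C * N f ^+ 2) ->
  (forall f, D f -> 2 * Q f (B f) <= - s * N f ^+ 2) ->
  forall t f, 0 <= t -> N (S t f) <= Num.sqrt (C / c) * expR (- (s / C / 2) * t) * N f.
Proof.
move=> dense hQ c0 C0 s0 hQc diss t f t0.
apply: (dense_decay (D' := D)) => //; last exact: dense.
move=> g Dg; have N0 := ipnorm_ge0 ip.
rewrite -(@ler_pXn2r _ 2) ?nnegrE ?mulr_ge0 ?sqrtr_ge0 ?expR_ge0//.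
have Cc0 : 0 <= C / c by rewrite divr_ge0// ltW.
rewrite !exprMn (sqr_sqrtr Cc0).
rewrite [expR _ ^+ 2]expr2 -expRD (_ : _ + _ = - (s / C) * t); last by field; rewrite gt_eqF.
rewrite -(ler_pM2l c0).
apply: (@le_trans _ _ (Q (S t g) (S t g))); first by have /andP[] := hQc (S t g).
have Q0 f' : 0 <= Q f' f'.
  by have /andP[h _] := hQc f'; apply: le_trans h; rewrite mulr_ge0 ?sqr_ge0// ltW.
have := sg_gronwall hip hS hQ (k := s / C) (D' := D) Q0 (fun _ => id).
move=> /(_ (fun t g t0 Dg => (dom_sg hS t0 Dg).1)).
have dis g' : D g' -> 2 * Q g' (B g') <= - (s / C) * Q g' g'.
  move=> /diss h; apply: le_trans h _; have /andP[_ h] := hQc g'.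
  rewrite mulNr mulNr lerN2 -mulrA ler_pM2l// ler_pdivrMl//.
move=> /(_ dis t g t0 Dg) h; apply: le_trans h _.
have /andP[_ h] := hQc g.
apply: le_trans (ler_wpM2l (expR_ge0 _) h) _.
by rewrite le_eqVlt; apply/orP; left; apply/eqP; field; rewrite gt_eqF.
Qed.

Variable J : E -> E.
Hypothesis JD : forall f g, J (f + g) = J f + J g.
Hypothesis JZ : forall a f, J (a *: f) = conjc a *: J f.
Hypothesis ipJ : forall f g, ip (J f) (J g) = conjc (ip f g).
Hypothesis JK : forall f, J (J f) = f.
Hypothesis csym : forall f g, D f -> D g -> ip (B f) (J g) = ip (B g) (J f).
Variables (n : nat) (psi : nat -> E) (lam : nat -> R[i]).
Hypothesis psiD : forall k, (k < n)%N -> D (psi k).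
Hypothesis psiB : forall k, (k < n)%N -> B (psi k) = lam k *: psi k.
Hypothesis psi_norm : forall j k, (j < n)%N -> (k < n)%N ->
  ip (psi j) (J (psi k)) = (j == k)%:R.
Variables (nb : nat -> E) (mu : R).
Hypothesis nbo : orthonormal_family ip n nb.
Hypothesis mu0 : 0 < mu.
Local Notation P0 := (oproj ip n nb).
Hypothesis diss : forall f, D f -> Re (ip (B f) f) <= - mu * N (f - P0 f) ^+ 2.
Hypothesis P1J : forall f, N (J f - P0 (J f)) = N (f - P0 f).
Hypothesis Ddense : forall f e, 0 < e -> exists2 g, D g & N (f - g) < e.
Local Notation defect := (\sum_(k < n) - Re (lam k) / mu).
Local Notation sproj := (sproj ip J n psi).
Hypothesis small : n%:R * defect <= 9^-1.
Hypothesis small' : defect <= 36^-1.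

Lemma skernel_P0_small f : skernel ip J n psi f -> N (P0 f) <= 3^-1 * N f.
Proof.
move=> kf; have N0 := ipnorm_ge0 ip.
rewrite -(@ler_pXn2r _ 2) ?nnegrE ?mulr_ge0// exprMn.
have := skernel_P0 hip hS JD JZ ipJ psiD psiB psi_norm nbo mu0 diss P1J kf.
move=> /le_trans; apply; rewrite ler_wpM2r ?sqr_ge0//.
by apply: le_trans small _; rewrite le_eqVlt; apply/orP; left; apply/eqP; field.
Qed.

(** Let [e] be the projection. By [PB] its fluid part is at most [N f + N (f - e) / 3], and the rest
    at most [N e / 6]. Absorbing the terms in [N e] on the left gives the constant [8 / 3], rounded
    up to 3. *)
Lemma sproj_bound_small f : N (sproj f) <= 3 * N f.
Proof.
have N0 := ipnorm_ge0 ip.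
set e := sproj f.
have k1 := skernel_P0_small (skernel_sproj hip psi_norm f).
have k2 : N (e - P0 e) <= 6^-1 * N e.
  rewrite -(@ler_pXn2r _ 2) ?nnegrE ?mulr_ge0// exprMn.
  have se : spanned n psi e by exists (fun j => ip f (J (psi j))).
  have := eigenspace_P1 hip hS psiD psiB psi_norm mu0 diss se.
  move=> /le_trans; apply; rewrite ler_wpM2r ?sqr_ge0//.
  by apply: le_trans small' _; rewrite le_eqVlt; apply/orP; left; apply/eqP; field.
have PB : P0 e = P0 f - P0 (f - e).
  have -> : P0 (f - e) = P0 f - P0 e.
    by rewrite (oprojD hip) -(scaleN1r e) (oprojZ hip) scaleN1r.
  by rewrite opprB addrC subrK.
have k3 : N e <= N (P0 f) + N (P0 (f - e)) + N (e - P0 e).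
  rewrite -{1}(subrKC (P0 e) e); apply: le_trans (ler_ipnormD hip _ _) _.
  by rewrite lerD2r {1}PB ler_ipnormB.
have k4 := ipnorm_oproj_le hip nbo f.
have k5 := ler_ipnormB hip f e.
have fg0 := N0 f; move: k1 k2 k3 k4 k5; rewrite -/e; lra.
Qed.

(** On the kernel [N (h - P0 h) ^+ 2] is at least [8 / 9 * N h ^+ 2], so the squared norm decays at
    a rate of at least [16 / 9 * mu]; only the rate [mu] is kept. *)
Lemma skernel_decay t f : 0 <= t -> skernel ip J n psi f ->
  N (S t f) <= expR (- (mu / 2) * t) * N f.
Proof.
move=> t0 kf; have N0 := ipnorm_ge0 ip.
apply: (dense_decay (D' := fun g => D g /\ skernel ip J n psi g)) => //.
- move=> g [Dg kg].
  rewrite -(@ler_pXn2r _ 2) ?nnegrE ?mulr_ge0 ?expR_ge0//.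
  rewrite exprMn [expR _ ^+ 2]expr2 -expRD (_ : _ + _ = - mu * t); last by field.
  rewrite !(sqr_ipnorm hip).
  apply: (sg_gronwall hip hS bounded_form_ip (k := mu)
    (D' := fun g => D g /\ skernel ip J n psi g)) => //.
  + by move=> h; rewrite (ip_ge0 hip).
  + by move=> h [].
  + move=> s h s0 [Dh kh]; split; first exact: (dom_sg hS s0 Dh).1.
    exact: (skernel_sg_dom hip hS ipJ JK csym psiD psiB).
  + move=> h [Dh kh]; have d := diss Dh.
    have := skernel_P0_small kh; have := pythagoras hip nbo h.
    rewrite -(ip_conj hip (B h) h) Re_conjc -(sqr_ipnorm hip).
    move=> p k; have k2 : N (P0 h) ^+ 2 <= (3^-1 * N h) ^+ 2.
      by rewrite ler_pXn2r ?nnegrE ?mulr_ge0.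
    apply: (@le_trans _ _ (2 * (- mu * N (h - P0 h) ^+ 2))); first by rewrite ler_pM2l.
    have -> : N (h - P0 h) ^+ 2 = N h ^+ 2 - N (P0 h) ^+ 2 by rewrite p addrAC subrr add0r.
    have : mu * N (P0 h) ^+ 2 <= mu * (3^-1 * N h) ^+ 2 by rewrite ler_wpM2l// ltW.
    have : 0 <= mu * N h ^+ 2 by rewrite mulr_ge0 ?sqr_ge0// ltW.
    rewrite exprMn; lra.
move=> e e0; have [g [Dg kg fg]] := skernel_dense hip hS ipJ psiD psi_norm Ddense kf e0.
by exists g.
Qed.

(** The difference is [S t] applied to [f - sproj f], which lies in the kernel; the factor 4 is
    [1 + 3], with 3 from [sproj_bound_small]. *)
Lemma low_frequency_decay t f : 0 <= t ->
  N (S t f - \sum_(j < n) (cexp (t%:C * lam j) * ip f (J (psi j))) *: psi j)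
    <= 4 * expR (- (mu / 2) * t) * N f.
Proof.
move=> t0.
rewrite -(sg_sproj hip hS psiD psiB psi_norm)//; last first.
  by move=> k kn; exact: (eigen_dissip hip psiD psiB psi_norm mu0 diss).
rewrite -(sgB hS)//; apply: le_trans (skernel_decay t0 (skernel_sproj hip psi_norm f)) _.
rewrite mulrAC mulrC ler_wpM2r ?expR_ge0//.
have := ler_ipnormB hip f (sproj f); have := sproj_bound_small f; lra.
Qed.

End Decay.

(** * Multiplication operators *)

Section Multipliers.
Variable R : realType.
Local Notation mu := (@leb3 R).
Local Notation N := (ipnorm (@ipL R)).
Implicit Types (f g : cfun R) (h : vec3 R -> R) (v xi : vec3 R).

Lemma measurable_c1 : measurable_fun setT (fun v : vec3 R => v.1.1).
Proof. by apply: measurableT_comp measurable_fst measurable_fst. Qed.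

Lemma measurable_c2 : measurable_fun setT (fun v : vec3 R => v.1.2).
Proof. by apply: measurableT_comp measurable_snd measurable_fst. Qed.

Lemma measurable_c3 : measurable_fun setT (fun v : vec3 R => v.2).
Proof. exact: measurable_snd. Qed.

Lemma measurable_dot xi : measurable_fun setT (fun v => dot v xi).
Proof.
have m1 := measurable_c1; have m2 := measurable_c2; have m3 := measurable_c3.
by apply: measurable_funD; [apply: measurable_funD|]; apply: measurable_funM => //;
   exact: measurable_cst.
Qed.

Lemma measurable_dotvv : measurable_fun setT (fun v : vec3 R => dot v v).
Proof.
have m1 := measurable_c1; have m2 := measurable_c2; have m3 := measurable_c3.
by apply: measurable_funD; [apply: measurable_funD|]; apply: measurable_funM.
Qed.

Lemma dot_ge0 v : 0 <= dot v v.
Proof. by rewrite /dot -!expr2 !addr_ge0 ?sqr_ge0. Qed.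

Lemma sqr_vnorm v : vnorm v ^+ 2 = dot v v.
Proof. by rewrite sqr_sqrtr ?dot_ge0. Qed.

Lemma vnorm_ge0 v : 0 <= vnorm v.
Proof. exact: sqrtr_ge0. Qed.

Lemma sqrtME : exists2 c : R, 0 < c & forall v, sqrtM v = c * expR (- (dot v v) / 4).
Proof.
exists (Num.sqrt ((2 * pi) `^ (- (3 / 2)))).
  by rewrite sqrtr_gt0 powR_gt0// mulr_gt0// pi_gt0.
move=> v; rewrite /sqrtM /maxwellian sqrtrM ?powR_ge0// sqr_vnorm; congr (_ * _).
rewrite (_ : expR (- (dot v v / 2)) = expR (- dot v v / 4) ^+ 2).
  by rewrite sqrtr_sqr gtr0_norm ?expR_gt0.
by rewrite expr2 -expRD; congr expR; field.
Qed.

Lemma sqrtM_gt0 v : 0 < sqrtM v.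
Proof. by have [c c0 ->] := sqrtME; rewrite mulr_gt0 ?expR_gt0. Qed.

Lemma measurable_sqrtM : measurable_fun setT (@sqrtM R).
Proof.
have [c c0 /funext ->] := sqrtME.
apply: measurable_funM; first exact: measurable_cst.
apply: measurableT_comp; first exact: measurable_expR.
apply: measurable_funM; last exact: measurable_cst.
by apply: measurable_funN; exact: measurable_dotvv.
Qed.

Lemma measurable_sqrtMV : measurable_fun setT (fun v => (@sqrtM R v)^-1).
Proof.
have [c c0 sE] := sqrtME.
have -> : (fun v => (sqrtM v)^-1) = (fun v => c^-1 * expR (dot v v * 4^-1)).
  apply/funext => v; rewrite sE invfM -expRN; congr (_ * expR _); by rewrite mulNr opprK.
apply: measurable_funM; first exact: measurable_cst.
apply: measurableT_comp; first exact: measurable_expR.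
by apply: measurable_funM; [exact: measurable_dotvv|exact: measurable_cst].
Qed.

Lemma inner_mulR h f g :
  inner (fun v => (h v)%:C * f v) g = inner f (fun v => (h v)%:C * g v).
Proof.
by apply: eq_cint => v; rewrite conjcM conjc_real mulrCA mulrA.
Qed.

Lemma ae_mul (m : cfun R) f g : f = g %[ae mu] ->
  (fun v => m v * f v) = (fun v => m v * g v) %[ae mu].
Proof. by apply: filterS => v /(_ I) + _ => /= ->. Qed.

Lemma L2_ae_mul (m : cfun R) f g : cmeasurable m -> f = g %[ae mu] -> L2 f -> L2 g ->
  L2 (fun v => m v * f v) -> L2 (fun v => m v * g v).
Proof.
move=> mm fg Lf Lg Lmf.
have mg : cmeasurable (fun v => m v * g v) by apply: cmeasurableM => //; exact: L2_measurable.
apply/L2E; split => //.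
have [_ /integrableP[m1 i1]] := (L2E _).1 Lmf.
have mF : measurable_fun setT (EFin \o (fun v => normc (m v * g v) ^+ 2)).
  by apply/measurable_EFinP; exact: measurable_sqr_normc.
apply/integrableP; split => //.
rewrite (_ : (\int[mu]_x _ = \int[mu]_x
    (abse \o (EFin \o (fun v => (normc (m v * f v) ^+ 2)%R))) x)%E)//.
apply: ae_eq_integral => //.
- exact: measurableT_comp.
- exact: measurableT_comp.
- by move: fg; apply: filterS => v /(_ I) + _ => /= ->.
Qed.

Lemma normL_cls f : L2 f -> N (cls f) = L2norm f.
Proof. by move=> Lf; rewrite /ipnorm ipL_cls. Qed.

Lemma sqr_L2norm f : L2norm f ^+ 2 = (\int[mu]_v (normc (f v) ^+ 2))%R.
Proof. by rewrite /L2norm sqr_sqrtr ?inner_ge0// innerff. Qed.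

Lemma L2norm_mul_le (m : cfun R) (C : R) f : cmeasurable m -> 0 <= C ->
  (forall v, normc (m v) <= C) -> L2 f -> L2norm (fun v => m v * f v) <= C * L2norm f.
Proof.
move=> mm C0 mC Lf; rewrite -(@ler_pXn2r _ 2) ?nnegrE ?mulr_ge0 ?sqrtr_ge0//.
rewrite exprMn !sqr_L2norm -RintegralZl//; last exact: L2_integ.
apply: le_Rintegral => //.
- exact/L2_integ/(L2_mul mm mC).
- exact/integZ/L2_integ.
- move=> v _; rewrite Normc.normcM exprMn ler_wpM2r ?sqr_ge0//.
  by rewrite ler_pXn2r ?nnegrE ?normc_ge0.
Qed.

(** Dominated convergence with majorant [C ^+ 2 * |f| ^+ 2]. It serves both the density of the
    domain and the strong convergence of the resolvent multipliers. *)
Lemma L2norm_mul_cvg0 (m : nat -> cfun R) (C : R) f :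
  (forall n, cmeasurable (m n)) -> (forall n v, normc (m n v) <= C) ->
  (forall v, normc (m n v) @[n --> \oo] --> (0 : R)) -> L2 f ->
  L2norm (fun v => m n v * f v) @[n --> \oo] --> (0 : R).
Proof.
move=> mm mC m0 Lf.
have C0 : 0 <= C by exact: le_trans (normc_ge0 _) (mC 0%N (0, 0, 0)).
have Lm n := L2_mul (mm n) (mC n) Lf.
have cv : (\int[mu]_v ((normc (m n v * f v)) ^+ 2)%:E @[n --> \oo] -->
    \int[mu]_v (cst 0 v : \bar R))%E.
  apply: (@dominated_cvg _ _ _ mu setT measurableT _ _
    (fun v => (C ^+ 2 * normc (f v) ^+ 2)%:E)).
  - move=> n; have [_ +] := (L2E _).1 (Lm n).
    by move=> /measurable_int.
  - move=> v _; apply: cvg_EFin; first exact: nearW.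
    rewrite (_ : fine \o _ = fun n => normc (m n v) ^+ 2 * normc (f v) ^+ 2); last first.
      by apply/funext => n /=; rewrite Normc.normcM exprMn.
    rewrite -[X in _ --> X](mul0r (normc (f v) ^+ 2)).
    apply: cvgM; last exact: cvg_cst.
    rewrite -[X in _ --> X](mul0r 0); under eq_fun do rewrite expr2.
    by apply: cvgM; exact: m0.
  - by [].
  - exact/integZ/L2_integ.
  - move=> n v _; rewrite gee0_abs ?lee_fin ?sqr_ge0//.
    rewrite Normc.normcM exprMn ler_wpM2r ?sqr_ge0//.
    by rewrite ler_pXn2r ?nnegrE ?normc_ge0.
have cv2 : L2norm (fun v => m n v * f v) ^+ 2 @[n --> \oo] --> (0 : R).
  have := cv; rewrite integral_cst// mul0e => /fine_cvgP[_].
  by apply: cvg_trans; apply: near_eq_cvg; apply: nearW => n; rewrite sqr_L2norm.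
apply/cvgrPdist_lt => e e0; have e20 : 0 < e ^+ 2 by rewrite exprn_gt0.
move/cvgrPdist_lt: cv2 => /(_ _ e20); apply: filterS => n.
rewrite !sub0r !normrN !ger0_norm ?sqr_ge0 ?sqrtr_ge0//.
by rewrite ltr_pXn2r ?nnegrE ?sqrtr_ge0 ?ltW.
Qed.

End Multipliers.

(** * The linearized collision operator *)

Lemma cvg_at_right0P (R : realType) (F : R -> R) :
  (F t @[t --> 0^'+] --> (0 : R)) <->
  (forall e, 0 < e -> exists2 d, 0 < d & forall h, 0 < h < d -> `|F h| < e).
Proof.
split=> [/cvgrPdist_lt H e e0|H].
  have := H e e0 => /nbhs_ballP[d /= d0 Hd]; exists d => // h /andP[h0 hd].
  have := Hd h; rewrite /ball /= sub0r normrN gtr0_norm// => /(_ hd h0).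
  by rewrite sub0r normrN.
apply/cvgrPdist_lt => e e0; have [d d0 Hd] := H e e0.
apply/nbhs_ballP; exists d => //= h; rewrite /ball /= sub0r normrN => hd h0.
by rewrite sub0r normrN Hd// h0 -(gtr0_norm h0).
Qed.

Record kinetic_setting (R : realType) (gamma : R) (B : vec3 R -> vec3 R -> R)
    (K : cfun R -> cfun R) (nu0 nu1 mu : R) : Prop := {
  ks_kernel : collision_kernel gamma B;
  ks_split : L_splitting B K;
  ks_nu : forall v, nu0 * (1 + vnorm v) `^ gamma <= nu B v
                    /\ nu B v <= nu1 * (1 + vnorm v) `^ gamma;
  ks_null : orthonormal_basis (nullL B) (@chi R);
  ks_mu_gt0 : 0 < mu;
  ks_mu_le : mu <= nu0;
  ks_coercive : L_coercive B mu }.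

Section Setting.
Variables (R : realType) (gamma : R) (B : vec3 R -> vec3 R -> R).
Variables (K : cfun R -> cfun R) (nu0 nu1 mu : R).
Hypothesis hK : kinetic_setting gamma B K nu0 nu1 mu.
Local Notation leb := (@leb3 R).
Local Notation E := (L2class R).
Local Notation nuB := (nu B).
Implicit Types (v xi : vec3 R) (f g : E) (u w : cfun R).

Lemma gamma_bounds : 0 <= gamma <= 1.
Proof.
case: (ks_kernel hK) => [[-> _]|[/andP[-> /ltW ->] _]] //.
by rewrite ler01 lexx.
Qed.

Lemma mu_le_nu v : mu <= nuB v.
Proof.
have [h _] := ks_nu hK v; apply: le_trans h.
have nu0p : 0 <= nu0 := le_trans (ltW (ks_mu_gt0 hK)) (ks_mu_le hK).
apply: le_trans (ks_mu_le hK) _; rewrite ler_peMr//.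
have /andP[g0 _] := gamma_bounds.
have := @ler_powR _ (1 + vnorm v) _ 0 gamma g0.
by rewrite powRr0; apply; rewrite lerDl vnorm_ge0.
Qed.

Lemma nu_gt0 v : 0 < nuB v.
Proof. exact: lt_le_trans (ks_mu_gt0 hK) (mu_le_nu v). Qed.

Lemma nu_le_linear v : nuB v <= nu1 * (1 + vnorm v).
Proof.
have [_ h] := ks_nu hK v; apply: le_trans h _.
have v1 : 1 <= 1 + vnorm v by rewrite lerDl vnorm_ge0.
have p0 : 0 < (1 + vnorm v) `^ gamma by rewrite powR_gt0// (lt_le_trans ltr01).
have nu1p : 0 < nu1.
  have := lt_le_trans (nu_gt0 v) (ks_nu hK v).2.
  by rewrite pmulr_lgt0.
rewrite ler_pM2l// -{2}(@powRr1 _ (1 + vnorm v)) ?(le_trans ler01)//.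
by have /andP[_ g1] := gamma_bounds; apply: ler_powR.
Qed.

Lemma chi_null (j : 'I_5) : nullL B (chi j).
Proof. by have [] := ks_null hK. Qed.

Lemma chi_L2 (j : 'I_5) : L2 (@chi R j).
Proof. by have [[]] := chi_null j. Qed.

Lemma chi0E v : @chi R ord0 v = (sqrtM v)%:C.
Proof. by []. Qed.

(** Measurability is read off from the fact that [chi ord0] lies in the domain of [L]: the product
    of [nu] and [sqrtM] is measurable, and [sqrtM] is positive. *)
Lemma measurable_nu : measurable_fun setT nuB.
Proof.
have [[_ [m1 _ _]] _] := chi_null ord0.
have -> : nuB = fun v => Re ((nuB v)%:C * chi ord0 v) * (sqrtM v)^-1.
  apply/funext => v; rewrite chi0E Re_scale /= -mulrA mulfV ?mulr1//.
  by rewrite gt_eqF// sqrtM_gt0.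
by apply: measurable_funM => //; exact: measurable_sqrtMV.
Qed.

Lemma chi_orthonormal (i j : 'I_5) : inner (@chi R i) (chi j) = (i == j)%:R.
Proof. by have [_ + _] := ks_null hK; apply. Qed.

Definition Xn (k : nat) : E := cls (@chi R (inord k)).

Lemma Xn_orthonormal : orthonormal_family (@ipL R) 5 Xn.
Proof.
move=> i j i5 j5; rewrite ipL_cls ?chi_orthonormal; try exact: chi_L2.
by rewrite -val_eqE /= !inordK.
Qed.

Definition Kq f : E := cls (K (rep f)).

Lemma K_L2 u : L2 u -> L2 (K u).
Proof. by have [[+ _ _ _] _ _ _] := ks_split hK; apply. Qed.

Lemma K_ae u w : L2 u -> L2 w -> u = w %[ae leb] -> K u = K w %[ae leb].
Proof. by have [[_ + _ _] _ _ _] := ks_split hK; apply. Qed.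

Lemma Kq_cls u : L2 u -> Kq (cls u) = cls (K u).
Proof.
by move=> Lu; apply/cls_ae/K_ae => //; [exact: rep_L2|exact: rep_cls].
Qed.

Lemma Kq_linear a f g : Kq (a *: f + g) = a *: Kq f + Kq g.
Proof.
have Lf := rep_L2 f; have Lg := rep_L2 g.
have -> : a *: f + g = cls (fun v => a * rep f v + rep g v).
  by rewrite clsD ?clsZ ?repK//; exact: L2Z.
rewrite Kq_cls; last by apply: L2D => //; exact: L2Z.
have LKf := K_L2 Lf; have LKg := K_L2 Lg.
rewrite /Kq -clsZ// -clsD//; last exact: L2Z.
by apply: cls_ae; have [[_ _ + _] _ _ _] := ks_split hK; apply.
Qed.

Lemma KqB f g : Kq (f - g) = Kq f - Kq g.
Proof. by rewrite addrC -scaleN1r Kq_linear scaleN1r addrC. Qed.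

Lemma Kq_selfadjoint f g : ipL (Kq f) g = ipL f (Kq g).
Proof.
rewrite -(repK f) -(repK g) !Kq_cls; try exact: rep_L2.
rewrite !ipL_cls; try exact: rep_L2; try (apply: K_L2; exact: rep_L2).
by have [_ + _ _] := ks_split hK; apply; exact: rep_L2.
Qed.

Lemma Kq_bounded : exists2 C, 0 <= C & forall f, ipnorm (@ipL R) (Kq f) <= C * ipnorm (@ipL R) f.
Proof.
have [[_ _ _ [C HC]] _ _ _] := ks_split hK; exists `|C| => // f.
rewrite normL_cls; last exact/K_L2/rep_L2.
apply: le_trans (HC _ (rep_L2 f)) _; rewrite ler_wpM2r ?sqrtr_ge0 ?ler_norm//.
Qed.

(** Total, but multiplication by [m] only under [domM m f], which plays the part of the operator
    domain. *)
Definition Mq (m : vec3 R -> R) f : E := cls (fun v => (m v)%:C * rep f v).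

Lemma Mq_cls (m : vec3 R -> R) u : L2 u -> Mq m (cls u) = cls (fun v => (m v)%:C * u v).
Proof. by move=> Lu; apply/cls_ae/ae_mul/rep_cls. Qed.

Definition domM (m : vec3 R -> R) f : Prop := L2 (fun v => (m v)%:C * rep f v).

Lemma domM_cls (m : vec3 R -> R) u : measurable_fun setT m -> L2 u ->
  domM m (cls u) <-> L2 (fun v => (m v)%:C * u v).
Proof.
move=> mm Lu; have cm := cmeasurableR mm.
split; apply: L2_ae_mul => //; try exact: rep_L2; first exact: rep_cls.
by apply: ae_sym; exact: rep_cls.
Qed.

Lemma Mq_selfadjoint m f g : domM m f -> domM m g -> ipL (Mq m f) g = ipL f (Mq m g).
Proof.
move=> mf mg; have Lf := rep_L2 f; have Lg := rep_L2 g.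
have -> : ipL (Mq m f) g = inner (fun v => (m v)%:C * rep f v) (rep g).
  by rewrite -(ipL_cls mf Lg) repK.
have -> : ipL f (Mq m g) = inner (rep f) (fun v => (m v)%:C * rep g v).
  by rewrite -(ipL_cls Lf mg) repK.
exact: inner_mulR.
Qed.

Lemma Mq_conj m f : domM m f -> conjL (Mq m f) = Mq m (conjL f).
Proof.
move=> mf; rewrite /Mq conjL_cls// -/(Mq _ _).
rewrite -[in RHS](repK f) conjL_cls ?Mq_cls; try exact/L2_conj/rep_L2; try exact: rep_L2.
by congr cls; apply/funext => v; rewrite /cfconj conjcM conjc_real.
Qed.

Lemma domM_conj m f : measurable_fun setT m -> domM m f -> domM m (conjL f).
Proof.
move=> mm mf; apply/domM_cls => //; first exact/L2_conj/rep_L2.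
rewrite (_ : (fun v => _) = cfconj (fun v => (m v)%:C * rep f v)); first exact: L2_conj.
by apply/funext => v; rewrite /cfconj conjcM conjc_real.
Qed.

Definition Lq f : E := Kq f - Mq nuB f.

Lemma cls_Lop u : domL B u -> cls (Lop B u) = Lq (cls u).
Proof.
move=> Du; have [Lu Lnu] := Du; have [_ _ _ /(_ _ Du) h] := ks_split hK.
by rewrite (cls_ae h) /Lq Kq_cls// Mq_cls// clsB//; exact: K_L2.
Qed.

Lemma Lq_selfadjoint f g : domM nuB f -> domM nuB g -> ipL (Lq f) g = ipL f (Lq g).
Proof.
move=> Df Dg; have hip := ipL_inner_product R.
by rewrite (ipBl hip) (ipBr hip) Kq_selfadjoint Mq_selfadjoint.
Qed.

(** The kernel and the Maxwellian are real. The identity is pointwise and unconditional because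
    [cintegral_conj] is. *)
Lemma Lop_conj u : Lop B (cfconj u) = cfconj (Lop B u).
Proof.
apply/funext => v; rewrite /Lop /cfconj conjcM conjc_real conjcD; congr (_ * (_ + _)).
  rewrite /Qcoll /int_vec_sphere -cintegral_conj; congr cintegral; apply/funext => p.
  by rewrite !conjcM !conjc_real conjcD conjcN !conjcM !conjc_real.
rewrite /Qcoll /int_vec_sphere -cintegral_conj; congr cintegral; apply/funext => p.
by rewrite !conjcM !conjc_real conjcD conjcN !conjcM !conjc_real.
Qed.

(** The reality of [L] comes from the collision integral itself; the splitting does not say by
    itself that [K] commutes with conjugation. *)
Lemma Lq_conj f : domM nuB f -> conjL (Lq f) = Lq (conjL f).
Proof.
move=> Df; have Lf := rep_L2 f.
have Dr : domL B (rep f) by split.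
have Dc : domL B (cfconj (rep f)).
  split; first exact: L2_conj.
  rewrite (_ : (fun v => _) = cfconj (fun v => (nuB v)%:C * rep f v)); first exact: L2_conj.
  by apply/funext => v; rewrite /cfconj conjcM conjc_real.
rewrite -{2}(repK f) conjL_cls// -cls_Lop// -{1}(repK f) -cls_Lop//.
have [_ _ _ /(_ _ Dr) h] := ks_split hK.
have Lh : L2 (fun v => K (rep f) v - (nuB v)%:C * rep f v).
  by apply: L2B => //; exact: K_L2.
rewrite (cls_ae h) conjL_cls// Lop_conj; apply/cls_ae/ae_cfconj/ae_sym.
exact: h.
Qed.

Lemma Xn_domnu k : domM nuB (Xn k).
Proof. by have [[Lc Dc] _] := chi_null (inord k); apply/domM_cls => //; exact: measurable_nu. Qed.

Lemma Lq_Xn k : Lq (Xn k) = 0.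
Proof.
have [D h] := chi_null (inord k); rewrite -cls_Lop// (cls_ae h).
exact: cls0.
Qed.

Lemma chi_real (j : 'I_5) : cfconj (@chi R j) = chi j.
Proof. by apply/funext => v; rewrite /cfconj /chi conjc_real. Qed.

Lemma Xn_conj k : conjL (Xn k) = Xn k.
Proof. by rewrite conjL_cls ?chi_real//; exact: chi_L2. Qed.

End Setting.

(** * The generator at a fixed frequency *)

Section Fibre.
Variables (R : realType) (gamma : R) (B : vec3 R -> vec3 R -> R).
Variables (K : cfun R -> cfun R) (nu0 nu1 mu : R).
Hypothesis hK : kinetic_setting gamma B K nu0 nu1 mu.
Variable xi : vec3 R.
Local Notation leb := (@leb3 R).
Local Notation E := (L2class R).
Local Notation nuB := (nu B).
Local Notation hip := (ipL_inner_product R).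
Local Notation X0 := (Xn R 0).
Local Notation kappa := ((vnorm xi ^+ 2)^-1).
Implicit Types (v : vec3 R) (f g : E) (u w : cfun R).

Definition ipx f g : R[i] := inner_xi xi (rep f) (rep g).

Lemma kappa_ge0 : 0 <= kappa.
Proof. by rewrite invr_ge0 sqr_ge0. Qed.

Lemma PdE u : Pd u = fun v => (sqrtM v)%:C * inner u (@chi R ord0).
Proof.
apply/funext => v; rewrite /Pd /inner; congr (_ * _); apply: eq_cint => w.
by rewrite chi0E conjc_real.
Qed.

Lemma inner_xiE u w :
  inner_xi xi u w = inner u w + kappa%:C * (inner u (@chi R ord0) * conjc (inner w (@chi R ord0))).
Proof.
rewrite /inner_xi !PdE; congr (_ + _ * _).
have c0 := chi_L2 hK ord0.
have e : cint (fun v => chi ord0 v * conjc (chi ord0 v)) = inner (@chi R ord0) (chi ord0).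
  by [].
have := cintZ (inner u (@chi R ord0) * conjc (inner w (@chi R ord0))) (L2_mul_integ c0 c0).
rewrite e (chi_orthonormal hK) eqxx mulr1 => <-.
by apply: eq_cint => v; rewrite chi0E conjcM conjc_real; ring.
Qed.

Definition den f : R[i] := ipL f X0.

Lemma Xn0E : X0 = cls (@chi R ord0).
Proof. by rewrite /Xn; congr (cls (chi _)); apply: val_inj; rewrite /= inordK. Qed.

Lemma denE f : den f = inner (rep f) (@chi R ord0).
Proof. by rewrite /den Xn0E -{1}(repK f) ipL_cls//; [exact: rep_L2|exact: (chi_L2 hK)]. Qed.

Lemma ipxE f g : ipx f g = ipL f g + kappa%:C * (den f * conjc (den g)).
Proof. by rewrite /ipx inner_xiE -!denE. Qed.

Lemma ipx_cls u w : L2 u -> L2 w -> ipx (cls u) (cls w) = inner_xi xi u w.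
Proof.
move=> Lu Lw; rewrite ipxE inner_xiE ipL_cls// /den Xn0E !ipL_cls//; exact: (chi_L2 hK).
Qed.

Lemma ipx_inner_product : inner_product ipx.
Proof.
split.
- move=> a f g h; rewrite !ipxE /den (ip_linear hip) (ipDl hip) (ipZl hip); ring.
- move=> f g; rewrite !ipxE conjcD !conjcM conjcK conjc_real (ip_conj hip).
  by rewrite (mulrC (den g)).
- move=> f; rewrite ipxE Re_add Re_scale mul_conjc /=.
  by rewrite addr_ge0 ?(ip_ge0 hip)// mulr_ge0 ?kappa_ge0 ?sqr_ge0.
- move=> f; rewrite ipxE (ipff hip) mul_conjc => /(congr1 (@complex.Re R)).
  rewrite Re_add Re_scale /= => h; apply: (ipnorm_eq0 hip).
  apply/eqP; rewrite -sqrf_eq0 eq_le sqr_ge0 andbT -h lerDl.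
  by rewrite mulr_ge0 ?kappa_ge0 ?sqr_ge0.
Qed.

Local Notation NL := (ipnorm (@ipL R)).
Local Notation N := (ipnorm ipx).

Lemma norm_xi_cls u : L2 u -> norm_xi xi u = N (cls u).
Proof. by move=> Lu; rewrite /ipnorm ipx_cls. Qed.

Lemma norm_xi_rep f : norm_xi xi (rep f) = N f.
Proof. by rewrite norm_xi_cls ?repK//; exact: rep_L2. Qed.

Lemma norm_X0 : NL X0 = 1.
Proof. by rewrite /ipnorm (Xn_orthonormal hK)// eqxx sqrtr1. Qed.

Lemma den_le f : normc (den f) <= NL f.
Proof. by have := cauchy_schwarz hip f X0; rewrite norm_X0 mulr1. Qed.

Lemma sqr_normx f : N f ^+ 2 = NL f ^+ 2 + kappa * normc (den f) ^+ 2.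
Proof.
by rewrite (sqr_ipnorm ipx_inner_product) ipxE Re_add Re_scale mul_conjc (sqr_ipnorm hip).
Qed.

Lemma normL_le_normx f : NL f <= N f.
Proof.
rewrite -(@ler_pXn2r _ 2) ?nnegrE ?ipnorm_ge0// sqr_normx lerDl.
by rewrite mulr_ge0 ?kappa_ge0 ?sqr_ge0.
Qed.

(** The constant blows up as [xi] tends to 0, so this comparison serves only at a fixed frequency,
    for the density of the domain. *)
Lemma normx_le_normL f : N f <= (1 + kappa) * NL f.
Proof.
have k0 := kappa_ge0; have n0 := ipnorm_ge0 (@ipL R) f.
rewrite -(@ler_pXn2r _ 2) ?nnegrE ?ipnorm_ge0 ?mulr_ge0 ?addr_ge0//.
rewrite sqr_normx exprMn.
have : normc (den f) ^+ 2 <= NL f ^+ 2 by rewrite ler_pXn2r ?nnegrE ?normc_ge0 ?den_le.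
move=> /(ler_wpM2l k0); have := sqr_ge0 (NL f); have := mulr_ge0 k0 (sqr_ge0 (NL f)).
have := mulr_ge0 k0 (mulr_ge0 k0 (sqr_ge0 (NL f))); lra.
Qed.

(** The class of [(v . xi) sqrtM], the direction of the electric term, written in the null-space
    basis so that its orthogonality to [X0] is visible. *)
Definition Yxi : E :=
  (xi.1.1)%:C *: Xn R 1 + (xi.1.2)%:C *: Xn R 2 + (xi.2)%:C *: Xn R 3.

Local Notation vx := (fun v : vec3 R => dot v xi).

Lemma mvx : measurable_fun setT vx.
Proof. exact: measurable_dot. Qed.

Lemma Yxi_cls : L2 (fun v => (dot v xi)%:C * (@chi R ord0) v) /\
  cls (fun v => (dot v xi)%:C * (@chi R ord0) v) = Yxi.
Proof.
have c k := chi_L2 hK (inord k); have cZ (a : R) k := L2Z a%:C (c k).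
have -> : (fun v => (dot v xi)%:C * (@chi R ord0) v) = (fun v =>
    (xi.1.1)%:C * chi (inord 1) v + (xi.1.2)%:C * chi (inord 2) v + (xi.2)%:C * chi (inord 3) v).
  apply/funext => v; rewrite chi0E /chi /= !inordK//= -!rmorphM -!rmorphD /=; congr (_%:C).
  by rewrite /dot; ring.
split; first by apply: L2D; [apply: L2D|].
by rewrite !clsD ?clsZ//; exact: L2D.
Qed.

Definition Bdom f : Prop := domM nuB f /\ domM vx f.

Definition Bq f : E := cls (Bhat B xi (rep f)).

Lemma domB_rep f : domB B xi (rep f) <-> Bdom f.
Proof. by split=> [[]|[? ?]]; split => //; exact: rep_L2. Qed.

Lemma domB_cls u : L2 u -> domB B xi u <-> Bdom (cls u).
Proof.
move=> Lu; split=> [[_ h1 h2]|[/domM_cls h1 /domM_cls h2]].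
  by split; apply/domM_cls => //; [exact: (measurable_nu hK)|exact: mvx].
by split => //; [apply: h1 => //; exact: (measurable_nu hK)|apply: h2 => //; exact: mvx].
Qed.

Lemma cls_Bhat u : domB B xi u -> exists w, [/\ L2 w, Bhat B xi u = w %[ae leb] &
  cls w = Lq B K (cls u) - 'i%C *: Mq vx (cls u) - ('i%C * kappa%:C * den (cls u)) *: Yxi].
Proof.
move=> [Lu nLu vLu].
have [_ _ _ /(_ _ (conj Lu nLu)) h] := ks_split hK.
have [LY YE] := Yxi_cls.
have LKu := K_L2 hK Lu.
exists (fun v => ((K u v - (nuB v)%:C * u v) - 'i%C * ((dot v xi)%:C * u v))
  - ('i%C * kappa%:C * den (cls u)) * ((dot v xi)%:C * (@chi R ord0) v)).
have L1 : L2 (fun v => K u v - (nuB v)%:C * u v) by exact: L2B.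
have L2' : L2 (fun v => 'i%C * ((dot v xi)%:C * u v)) by exact: L2Z.
have L3 : L2 (fun v => ('i%C * kappa%:C * den (cls u)) * ((dot v xi)%:C * (@chi R ord0) v)).
  exact: L2Z.
have L4 : L2 (fun v => (K u v - (nuB v)%:C * u v) - 'i%C * ((dot v xi)%:C * u v)).
  exact: L2B.
split; first exact: L2B.
- move: h; apply: filterS => v /(_ I) + _; rewrite /Bhat PdE => ->.
  rewrite -/nuB /den Xn0E ipL_cls//; last exact: (chi_L2 hK).
  by rewrite chi0E [(dot v xi / _)%:C]rmorphM /=; ring.
- rewrite (clsB L4 L3) (clsB L1 L2') (clsB LKu nLu) (clsZ _ vLu) (clsZ _ LY) YE.
  by rewrite /Lq (Kq_cls hK Lu) (Mq_cls _ Lu) (Mq_cls _ Lu).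
Qed.

Lemma BqE f : Bdom f ->
  Bq f = Lq B K f - 'i%C *: Mq vx f - ('i%C * kappa%:C * den f) *: Yxi.
Proof.
move=> /domB_rep Df; have [w [Lw h wE]] := cls_Bhat Df.
rewrite (repK f) in wE.
rewrite /Bq.
rewrite (cls_ae h).
exact: wE.
Qed.

Lemma Bq_eq u w : domB B xi u -> L2 w ->
  (Bhat B xi u = w %[ae leb]) <-> Bq (cls u) = cls w.
Proof.
move=> Du Lw; have Lu : L2 u by case: Du.
have Dc : Bdom (cls u) by apply/domB_cls.
have [w' [Lw' h w'E]] := cls_Bhat Du.
rewrite BqE// -w'E; split=> [uw|/(ae_cls Lw' Lw) ww].
  by apply: cls_ae; apply: ae_trans (ae_sym h) uw.
exact: ae_trans h ww.
Qed.

Lemma Yxi_X0 : ipL Yxi X0 = 0.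
Proof.
by rewrite /Yxi !(ipDl hip) !(ipZl hip) !(Xn_orthonormal hK)// !mulr0 !addr0.
Qed.

Lemma Yxi_conj : conjL Yxi = Yxi.
Proof. by rewrite /Yxi !conjLD !conjLZ !conjc_real !(Xn_conj hK). Qed.

Lemma X0_domvx : domM vx X0 /\ Mq vx X0 = Yxi.
Proof.
have [LY YE] := Yxi_cls; rewrite Xn0E; split.
  by apply/domM_cls => //; [exact: mvx|exact: (chi_L2 hK)].
by rewrite Mq_cls//; exact: (chi_L2 hK).
Qed.

Lemma den_Lq f : domM nuB f -> den (Lq B K f) = 0.
Proof.
move=> Df; rewrite /den (Lq_selfadjoint hK)//; last exact: (Xn_domnu hK).
by rewrite (Lq_Xn hK) (ip0r hip).
Qed.

Lemma den_Mvx f : domM vx f -> den (Mq vx f) = ipL f Yxi.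
Proof.
by move=> Df; have [D0 <-] := X0_domvx; rewrite /den Mq_selfadjoint.
Qed.

(** The continuity equation: collisions conserve mass, and the electric term has zero density. *)
Lemma den_Bq f : Bdom f -> den (Bq f) = - 'i%C * ipL f Yxi.
Proof.
move=> [Dn Dv]; rewrite (BqE (conj Dn Dv)) /den (ipBZl hip) Yxi_X0 mulr0 subr0.
have hL : ipL (Lq B K f) X0 = 0 := den_Lq Dn.
have hM : ipL (Mq vx f) X0 = ipL f Yxi := den_Mvx Dv.
by rewrite hL hM sub0r mulNr.
Qed.

Lemma den_conj f : den (conjL f) = conjc (den f).
Proof. by rewrite /den -{1}(Xn_conj hK 0) ipL_conj. Qed.

Lemma ipx_conj f g : ipx (conjL f) (conjL g) = conjc (ipx f g).
Proof. by rewrite !ipxE ipL_conj !den_conj conjcD !conjcM conjc_real. Qed.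

Lemma ipL_flip f g : ipL f (conjL g) = ipL g (conjL f).
Proof. by rewrite -(ip_conj hip) -ipL_conj conjLK. Qed.

Lemma Bdom_conj f : Bdom f -> Bdom (conjL f).
Proof.
move=> [Dn Dv]; split; apply: domM_conj => //; [exact: (measurable_nu hK)|exact: mvx].
Qed.

(** [L] is real and self-adjoint, and [v . xi] is a real multiplier. The electric term is not
    symmetric alone: together with the weight of [ipx] it yields
    [den h * ipL k Yxi + ipL h Yxi * den k], symmetric in both arguments. *)
Lemma Bq_csym f g : Bdom f -> Bdom g -> ipx (Bq f) (conjL g) = ipx (Bq g) (conjL f).
Proof.
move=> Df Dg.
have key h k : Bdom h -> Bdom k -> ipx (Bq h) (conjL k) =
    ipL (Lq B K h) (conjL k) - 'i%C * ipL (Mq vx h) (conjL k)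
    - 'i%C * kappa%:C * (den h * ipL k Yxi + ipL h Yxi * den k).
  move=> Dh Dk; rewrite ipxE den_Bq// den_conj conjcK (BqE Dh) (ipBZl hip).
  have -> : ipL Yxi (conjL k) = ipL k Yxi by rewrite ipL_flip Yxi_conj.
  move: (ipL (Lq B K h) _) (ipL (Mq vx h) _) (ipL k Yxi) (ipL h Yxi) (den h) (den k).
  by move=> x1 x2 x3 x4 x5 x6; ring.
rewrite !key//; have [Dnf Dvf] := Df; have [Dng Dvg] := Dg.
have [Dncf Dvcf] := Bdom_conj Df; have [Dncg Dvcg] := Bdom_conj Dg.
have -> : ipL (Lq B K f) (conjL g) = ipL (Lq B K g) (conjL f).
  by rewrite (Lq_selfadjoint hK Dnf Dncg) -(Lq_conj hK Dng) ipL_flip.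
have -> : ipL (Mq vx f) (conjL g) = ipL (Mq vx g) (conjL f).
  by rewrite (Mq_selfadjoint Dvf Dvcg) -(Mq_conj Dvg) ipL_flip.
congr (_ - _ * _); move: (den f) (den g) (ipL f Yxi) (ipL g Yxi) => x1 x2 x3 x4; ring.
Qed.

End Fibre.

(** * Integrals of functions known only almost everywhere *)

Section AlmostEverywhere.
Import HBNNSimple.
Context d (T : measurableType d) (R : realType) (m : {measure set T -> \bar R}).

(* [Lop f] is only known to agree almost everywhere with a measurable function, so
   no measurability is assumed here: a simple function below [f] can be
   cut off on a null set without changing its integral. *)
Lemma ae_le_lower_integral (f g : T -> \bar R) : (forall x, 0 <= f x)%E ->
  (forall x, 0 <= g x)%E -> {ae m, forall x, f x = g x} ->
  (\int[m]_x f x <= \int[m]_x g x)%E.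
Proof.
move=> f0 g0 [N [mN N0 fgN]].
rewrite !ge0_integralTE//; apply: ge_ereal_sup => _ [h /= hf <-].
apply: ereal_sup_ubound; exists (proj_nnsfun h (measurableC mN)) => /=.
  move=> x; rewrite /= /mindic indicE.
  have [xN|xN] := boolP (x \in ~` N); last by rewrite mulr0.
  rewrite mulr1; have : f x = g x.
    by apply: contrapT => fg; move: xN; rewrite inE; apply; apply: fgN.
  by move=> <-.
rewrite -!integralT_nnsfun; apply: ae_eq_integral => //.
- by exact/measurable_EFinP.
- by exact/measurable_EFinP.
exists N; split => // x /= hx; apply: contrapT => xN; apply: hx => _.
  rewrite /= /mindic indicE mem_set// mulr1//.
Qed.

Lemma ae_eq_lower_integral (f g : T -> \bar R) :
  {ae m, forall x, f x = g x} -> (\int[m]_x f x = \int[m]_x g x)%E.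
Proof.
have H (f1 g1 : T -> \bar R) : (forall x, 0 <= f1 x)%E -> (forall x, 0 <= g1 x)%E ->
    {ae m, forall x, f1 x = g1 x} -> (\int[m]_x f1 x = \int[m]_x g1 x)%E.
  move=> f0 g0 fg; apply/eqP; rewrite eq_le !ae_le_lower_integral//.
  by move: fg; apply: filterS => x ->.
move=> fg; rewrite [LHS]integralE [RHS]integralE; congr (_ - _)%E; apply: H => //.
- by move: fg; apply: filterS => x; rewrite !funeposE => ->.
- by move: fg; apply: filterS => x; rewrite !funenegE => ->.
Qed.

End AlmostEverywhere.

(** This lets the coercivity hypothesis, which is stated for [Lop f], be read on the measurable
    function [K f - nu f]. *)
Lemma inner_ae_left (R : realType) (f g h : cfun R) : f = g %[ae @leb3 R] ->
  inner f h = inner g h.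
Proof.
move=> fg; apply: complex_ext; rewrite /= /Rintegral; congr fine;
  by apply: ae_eq_lower_integral; move: fg; apply: filterS => v /(_ I) ->.
Qed.

(** * Dissipation, density of the domain and the semigroup on classes *)

Section Fibre2.
Variables (R : realType) (gamma : R) (B : vec3 R -> vec3 R -> R).
Variables (K : cfun R -> cfun R) (nu0 nu1 mu : R).
Hypothesis hK : kinetic_setting gamma B K nu0 nu1 mu.
Variable xi : vec3 R.
Local Notation leb := (@leb3 R).
Local Notation E := (L2class R).
Local Notation nuB := (nu B).
Local Notation hip := (ipL_inner_product R).
Local Notation hipx := (ipx_inner_product hK xi).
Local Notation X0 := (Xn R 0).
Local Notation kappa := ((vnorm xi ^+ 2)^-1).
Local Notation vx := (fun v : vec3 R => dot v xi).
Local Notation NL := (ipnorm (@ipL R)).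
Local Notation N := (ipnorm (ipx xi)).
Local Notation Bdom := (Bdom B xi).
Local Notation Bq := (Bq B xi).
Implicit Types (v : vec3 R) (f g : E) (u w : cfun R).

Definition P0q f : E := oproj (@ipL R) 5 (Xn R) f.

Lemma cls_P0 u : L2 u -> L2 (P0 u) /\ cls (P0 u) = P0q (cls u).
Proof.
move=> Lu; have c k := chi_L2 hK k.
have cZ (k : 'I_5) : L2 (fun v => inner u (@chi R k) * @chi R k v) by exact: L2Z.
split; first exact: L2_sum.
rewrite /P0 /lincomb (cls_sum cZ) /P0q /oproj; apply: eq_bigr => k _.
have -> : Xn R k = cls (@chi R k) by rewrite /Xn inord_val.
rewrite (ipL_cls Lu (c k)).
exact: (clsZ (inner u (@chi R k)) (c k)).
Qed.

Lemma Lq_dissip f : domM nuB f -> Re (ipL (Lq B K f) f) <= - mu * NL (f - P0q f) ^+ 2.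
Proof.
move=> Df; have Lf := rep_L2 f; have DL : domL B (rep f) by split.
have H : Re (inner (Lop B (rep f)) (rep f)) <= - (mu * L2norm (P1 (rep f)) ^+ 2).
  by have := ks_coercive hK DL; rewrite lecE => /andP[_].
have [_ _ _ /(_ _ DL) h] := ks_split hK.
have Lh : L2 (fun v => K (rep f) v - (nuB v)%:C * rep f v) by apply: L2B => //; exact: (K_L2 hK).
move: H; rewrite (inner_ae_left _ h) -(ipL_cls Lh Lf) (clsB (K_L2 hK Lf) Df) (repK f).
have [LP0 P0E] := cls_P0 Lf.
have -> : L2norm (P1 (rep f)) = NL (f - P0q f).
  by rewrite -(normL_cls (L2B Lf LP0)) (clsB Lf LP0) P0E (repK f).
by rewrite mulNr.
Qed.

Lemma Bq_form f g : Bdom f -> Bdom g -> ipx xi (Bq f) g =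
  ipL (Lq B K f) g - 'i%C * (ipL (Mq vx f) g
    + kappa%:C * (den f * ipL (Yxi xi) g + ipL f (Yxi xi) * conjc (den g))).
Proof.
move=> Df Dg; rewrite (ipxE hK) (den_Bq hK Df) (BqE hK Df) (ipBZl hip).
move: (ipL (Lq B K f) _) (ipL (Mq vx f) _) (ipL (Yxi xi) g) (ipL f (Yxi xi)) (den f) (den g).
by move=> x1 x2 x3 x4 x5 x6; ring.
Qed.

(** For [g = f] the bracket in [Bq_form] is real: transport is skew, and the weight of [ipx]
    balances the work of the electric field against the change of the field energy. *)
Lemma Bq_dissip_L f : Bdom f -> Re (ipx xi (Bq f) f) = Re (ipL (Lq B K f) f).
Proof.
move=> Df; rewrite Bq_form// -(ip_conj hip f (Yxi xi)).
have [_ Dv] := Df; have := Mq_selfadjoint Dv Dv; rewrite -(ip_conj hip (Mq vx f) f) => r.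
have {r} : Im (ipL (Mq vx f) f) = 0 by have := congr1 (@complex.Im R) r; rewrite Im_conjc; lra.
move: (ipL (Lq B K f) _) (ipL (Mq vx f) _) (ipL f (Yxi xi)) (den f) => x1 x2 x3 x4 r.
rewrite Re_add Re_opp !(Re_mul, Im_mul, Re_add, Im_add, Re_conjc, Im_conjc) /= r; ring.
Qed.

(** Only [X0] has nonzero density, hence only [X0] must be rescaled to make the basis orthonormal
    for [ipx]. *)
Definition basx (k : nat) : E :=
  if k == 0 then (Num.sqrt (1 + kappa))^-1%:C *: X0 else Xn R k.

Lemma sqrt1k : 0 < Num.sqrt (1 + kappa).
Proof. by rewrite sqrtr_gt0 ltr_pwDl// kappa_ge0. Qed.

Lemma den_Xn k : (k < 5)%N -> den (Xn R k) = (k == 0)%:R.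
Proof. by move=> k5; rewrite /den (Xn_orthonormal hK). Qed.

Lemma ipx_Xn f k : (k < 5)%N ->
  ipx xi f (Xn R k) = (if k == 0 then 1 + kappa else 1)%:C * ipL f (Xn R k).
Proof.
move=> k5; rewrite (ipxE hK) den_Xn//; case: eqP => [->|_].
  by rewrite conjc1 mulr1 rmorphD /= mulrDl mul1r.
by rewrite conjc0 !mulr0 addr0 mul1r.
Qed.

Lemma basx_orthonormal : orthonormal_family (ipx xi) 5 basx.
Proof.
have s0 := sqrt1k.
have ss : (Num.sqrt (1 + kappa))^-1 * ((Num.sqrt (1 + kappa))^-1 * (1 + kappa)) = 1.
  rewrite -{3}(@sqr_sqrtr _ (1 + kappa)); last by rewrite addr_ge0// kappa_ge0.
  by field; rewrite gt_eqF.
move=> i j i5 j5; rewrite /basx.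
have := Xn_orthonormal hK i5 j5.
case: (eqVneq i 0) => [->|i0]; case: (eqVneq j 0) => [->|j0] o.
- rewrite (ipZl hipx) (ipZr hipx) conjc_real ipx_Xn//= o mulr1.
  by rewrite -!rmorphM /= ss.
- by rewrite (ipZl hipx) ipx_Xn// o /= !mulr0.
- by rewrite (ipZr hipx) ipx_Xn// o (negbTE i0) /= !mulr0.
- by rewrite ipx_Xn// (negbTE j0) o mul1r.
Qed.

(** The extra term of [ipx] sees only the coefficient on [X0], so the orthogonal projection onto the
    null space is the same for [ipL] and for every [ipx xi]. This carries the coercivity of [L] over
    to the weighted norm. *)
Lemma oproj_basx f : oproj (ipx xi) 5 basx f = P0q f.
Proof.
rewrite /P0q /oproj; apply: eq_bigr => k _; rewrite /basx.
case: eqP => [k0|k0].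
  rewrite (ipZr hipx) conjc_real ipx_Xn// eqxx scalerA k0; congr (_ *: _).
  rewrite -[RHS]mul1r; have s0 := sqrt1k.
  have -> : (1 : R[i]) = ((Num.sqrt (1 + kappa))^-1 * ((Num.sqrt (1 + kappa))^-1 * (1 + kappa)))%:C.
    rewrite -{3}(@sqr_sqrtr _ (1 + kappa)); last by rewrite addr_ge0// kappa_ge0.
    by rewrite (_ : _ * _ = 1)//; field; rewrite gt_eqF.
  by rewrite !rmorphM /=; ring.
by rewrite ipx_Xn//; case: eqP => // _; rewrite mul1r.
Qed.

Lemma den_P1q f : den (f - P0q f) = 0.
Proof.
rewrite /den (ipBl hip) /P0q (ip_oproj hip (Xn_orthonormal hK))//.
by rewrite subrr.
Qed.

Lemma normx_P1q f : N (f - P0q f) = NL (f - P0q f).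
Proof.
have n1 := ipnorm_ge0 (ipx xi) (f - P0q f); have n2 := ipnorm_ge0 (@ipL R) (f - P0q f).
apply/eqP; rewrite -(@eqrXn2 _ 2)// (sqr_normx hK) den_P1q Normc.normc0 expr0n /=.
by rewrite mulr0 addr0.
Qed.

Lemma Bq_dissip f : Bdom f -> Re (ipx xi (Bq f) f) <= - mu * N (f - P0q f) ^+ 2.
Proof. by move=> Df; rewrite Bq_dissip_L// normx_P1q; apply: Lq_dissip; case: Df. Qed.

Lemma P0q_conj f : conjL (P0q f) = P0q (conjL f).
Proof.
rewrite /P0q /oproj.
have J0 : conjL (0 : E) = 0 by have := conjLZ 0 (0 : E); rewrite conjc0 !scale0r.
have -> : conjL (\sum_(i < 5) ipL f (Xn R i) *: Xn R i) =
    \sum_(i < 5) conjL (ipL f (Xn R i) *: Xn R i).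
  by elim/big_rec2: _ => [//|i x y _ <-]; rewrite conjLD.
apply: eq_bigr => k _; rewrite conjLZ (Xn_conj hK); congr (_ *: _).
by rewrite -ipL_conj (Xn_conj hK).
Qed.

Lemma P1q_conj f : N (conjL f - P0q (conjL f)) = N (f - P0q f).
Proof.
rewrite -P0q_conj.
have -> : conjL f - conjL (P0q f) = conjL (f - P0q f).
  by rewrite conjLD -(scaleN1r (P0q f)) conjLZ conjcN conjc1 scaleN1r.
by rewrite /ipnorm (ipx_conj hK) Re_conjc.
Qed.

(** Cutting [f] off outside the set where [nu] and [|v . xi|] are at most [n] puts it into the
    domain, and the error tends to 0 by dominated convergence. *)
Lemma Bdom_dense f (e : R) : 0 < e -> exists2 g, Bdom g & N (f - g) < e.
Proof.
move=> e0; have k0 := kappa_ge0 xi.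
have mnu := measurable_nu hK; have mv := mvx xi.
pose good n v := (nuB v <= n%:R) && (`|dot v xi| <= n%:R).
have mgood n : measurable_fun setT (good n).
  apply: measurable_and; apply: measurable_fun_ler => //; try exact: measurable_cst.
  exact: measurableT_comp.
pose ind n v : R := if good n v then 1 else 0.
have mind n : measurable_fun setT (ind n).
  by apply: measurable_fun_ifT => //; exact: measurable_cst.
pose m n v : R[i] := (1 - ind n v)%:C.
have cm n : cmeasurable (m n).
  by apply: cmeasurableR; apply: measurable_funB => //; exact: measurable_cst.
have m1 n v : normc (m n v) <= 1.
  rewrite normcR /ind; case: ifP => _; rewrite ?subrr ?normr0// subr0 normr1//.
have m0 v : normc (m n v) @[n --> \oo] --> (0 : R).
  apply: cvg_near_cst; exists (Num.truncn (Num.max (nuB v) `|dot v xi|)).+1 => // n nn.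
  rewrite normcR /ind ifT ?subrr ?normr0//.
  have h : Num.max (nuB v) `|dot v xi| <= n%:R.
    by apply: ltW; apply: lt_le_trans (truncnS_gt _) _; rewrite ler_nat.
  by move: h; rewrite ge_max => /andP[h1 h2]; rewrite /good h1.
have Lf := rep_L2 f.
have := L2norm_mul_cvg0 cm m1 m0 Lf => /cvgrPdist_lt/(_ (e / (1 + kappa))).
have k1 : 0 < 1 + kappa by rewrite ltr_pwDl.
move=> /(_ (divr_gt0 e0 k1)) [n _ /(_ n (leqnn n))].
rewrite sub0r normrN ger0_norm ?sqrtr_ge0// => hn.
pose g v := (ind n v)%:C * rep f v.
have cind : cmeasurable (fun v => (ind n v)%:C) by exact: cmeasurableR.
have i1 v : normc (ind n v)%:C <= 1.
  by rewrite normcR /ind; case: ifP => _; rewrite ?normr0 ?normr1.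
have Lg : L2 g by exact: L2_mul cind i1 Lf.
have dg (h : vec3 R -> R) : measurable_fun setT h -> (forall v, good n v -> `|h v| <= n%:R) ->
    domM h (cls g).
  move=> mh hn'; apply/domM_cls => //.
  rewrite (_ : (fun v => _) = fun v => (h v * ind n v)%:C * rep f v); last first.
    by apply/funext => v; rewrite /g rmorphM /= mulrA.
  apply: (@L2_mul _ _ n%:R) => //.
    by apply: cmeasurableR; exact: measurable_funM.
  move=> v; rewrite (normcR (h v * ind n v)) /ind; case: ifP => gv; last by rewrite mulr0 normr0.
  by rewrite mulr1 hn'.
exists (cls g).
  split; apply: dg => //.
    move=> v /andP[h _]; rewrite ger0_norm//; exact: ltW (nu_gt0 hK v).
  by move=> v /andP[_].
apply: le_lt_trans (normx_le_normL hK xi _) _.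
rewrite mulrC -ltr_pdivlMr//; apply: le_lt_trans hn.
have Lm : L2 (fun v => m n v * rep f v) by exact: L2_mul (cm n) (m1 n) Lf.
rewrite -(normL_cls Lm) le_eqVlt; apply/orP; left; apply/eqP; congr (ipnorm _ _).
rewrite -{1}(repK f) -(clsB Lf Lg); congr cls; apply/funext => v.
by rewrite /m /g rmorphB /= mulrBl mul1r.
Qed.

Variable S : R -> cfun R -> cfun R.
Hypothesis hS : contraction_semigroup (norm_xi xi) S.
Hypothesis hG : generator_of (norm_xi xi) (domB B xi) (Bhat B xi) S.

Definition Sq t f : E := cls (S t (rep f)).

Lemma S_L2 t u : 0 <= t -> L2 u -> L2 (S t u).
Proof. by move=> t0; have [/(_ t t0) [+ _ _ _] _ _ _] := hS; apply. Qed.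

Lemma Sq_cls t u : 0 <= t -> L2 u -> Sq t (cls u) = cls (S t u).
Proof.
move=> t0 Lu; apply: cls_ae; have [/(_ t t0) [_ + _ _] _ _ _] := hS; apply => //.
  exact: rep_L2.
exact: rep_cls.
Qed.

Lemma Sq_contraction_group : contraction_group (ipx xi) Bdom Bq Sq.
Proof.
have [hS1 hS2 hS3 hS4] := hS.
split.
- move=> t a f g t0; have [s1 s2 s3 s4] := hS1 t t0.
  have Lf := rep_L2 f; have Lg := rep_L2 g.
  have E1 : a *: f + g = cls (fun v => a * rep f v + rep g v).
    by rewrite (clsD (L2Z a Lf) Lg) (clsZ a Lf) (repK f) (repK g).
  rewrite E1 Sq_cls//; last by apply: L2D => //; exact: L2Z.
  rewrite (cls_ae (s3 a _ _ Lf Lg)) (clsD (L2Z a (s1 _ Lf)) (s1 _ Lg)).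
  by rewrite (clsZ a (s1 _ Lf)).
- move=> t f t0; have [s1 s2 s3 s4] := hS1 t t0; have Lf := rep_L2 f.
  by rewrite /Sq -(norm_xi_cls hK xi (s1 _ Lf)) -(norm_xi_rep hK xi f); exact: s4.
- move=> f; have Lf := rep_L2 f.
  by rewrite /Sq (cls_ae (hS2 _ Lf)) (repK f).
- move=> t s f t0 s0; have Lf := rep_L2 f.
  rewrite /Sq (cls_ae (hS3 _ _ _ t0 s0 Lf)) -/(Sq _ _) Sq_cls//.
  exact: S_L2.
- move=> f e e0; have Lf := rep_L2 f.
  have /cvg_at_right0P/(_ e e0)[d d0 H] := hS4 _ Lf; exists d => // h hd.
  have /andP[/ltW h0 _] := hd; have LS := S_L2 h0 Lf.
  have := H h hd; rewrite (norm_xi_cls hK xi (L2B LS Lf)) (clsB LS Lf) (repK f).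
  by rewrite ger0_norm ?ipnorm_ge0.
- move=> f g; have Lf := rep_L2 f; have Lg := rep_L2 g.
  have E1 h : 0 <= h -> norm_xi xi (fun v => (h^-1)%:C * (S h (rep f) v - rep f v) - rep g v)
      = N ((h^-1)%:C *: (Sq h f - f) - g).
    move=> h0; have LS := S_L2 h0 Lf; have LB := L2B LS Lf.
    rewrite (norm_xi_cls hK xi (L2B (L2Z _ LB) Lg)) (clsB (L2Z _ LB) Lg) (clsZ _ LB).
    by rewrite (clsB LS Lf) (repK f) (repK g).
  have [G1 G2] := hG Lf Lg; split.
    move=> [/domB_rep Df BE].
    have : Bhat B xi (rep f) = rep g %[ae leb].
      by apply/(Bq_eq hK Df Lg); rewrite (repK f) (repK g).
    move=> /(conj Df)/G1/cvg_at_right0P H e e0.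
    have [d d0 Hd] := H e e0; exists d => // h hd; have /andP[/ltW h0 _] := hd.
    by have := Hd h hd; rewrite E1// ger0_norm ?ipnorm_ge0.
  move=> H; have [|Df h] := G2.
    apply/cvg_at_right0P => e e0; have [d d0 Hd] := H e e0; exists d => // h hd.
    have /andP[/ltW h0 _] := hd.
    by rewrite E1// ger0_norm ?ipnorm_ge0// Hd.
  split; first exact/domB_rep.
  by have /(Bq_eq hK Df Lg) := h; rewrite (repK f) (repK g).
Qed.

End Fibre2.

(** * Gaussian moments *)

Section GaussianMoments.
Variable R : realType.
Local Notation leb := (@lebesgue_measure R).
Implicit Types (x : R) (k : nat).

Definition integ1 (f : R -> R) : Prop := leb.-integrable setT (EFin \o f).

Definition gw x : R := normal_pdf 0 1 x.

Lemma gwE x : gw x = normal_peak 1 * expR (- x ^+ 2 / 2).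
Proof.
rewrite /gw normal_pdfE ?oner_eq0// /normal_fun subr0 expr1n; congr (_ * expR (_ / _)).
Qed.

Lemma gw_gt0 x : 0 < gw x.
Proof. by rewrite gwE mulr_gt0 ?expR_gt0// normal_peak_gt0 ?oner_eq0. Qed.

Lemma measurable_gw : measurable_fun setT gw.
Proof. exact: measurable_normal_pdf. Qed.

Lemma expr_gauss_bound k : exists2 C : R, 0 <= C &
  forall x, `|x ^+ k| * expR (- x ^+ 2 / 2) <= C * expR (- x ^+ 2 / 4).
Proof.
(* From the Taylor term of order [k.+1] of [expR y] at [y = x ^+ 2 / 4]. *)
pose C : R := 4 ^+ k.+1 * k.+1`!%:R.
have C0 : 0 <= C by rewrite mulr_ge0 ?exprn_ge0.
exists (1 + C); first by rewrite addr_ge0.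
move=> x; set y := x ^+ 2 / 4; have y0 : 0 <= y by rewrite divr_ge0 ?sqr_ge0.
have -> : - x ^+ 2 / 2 = - y + - y by rewrite /y; field.
have -> : - x ^+ 2 / 4 = - y by rewrite /y mulNr.
rewrite expRD mulrA ler_pM2r ?expR_gt0//.
have ey : 1 <= expR y by rewrite -expR0 ler_expR.
have h1 : (x ^+ 2) ^+ k.+1 <= C * expR y.
  have := expR_ge1Dxn k y0 => h.
  have : y ^+ k.+1 / k.+1`!%:R <= expR y by apply: le_trans h; rewrite lerDr.
  rewrite ler_pdivrMr ?ltr0n ?fact_gt0// => h2.
  have -> : x ^+ 2 = 4 * y by rewrite /y; field.
  by rewrite exprMn /C -mulrA ler_wpM2l ?exprn_ge0// mulrC.
have h2 : `|x ^+ k| <= 1 + (x ^+ 2) ^+ k.+1.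
  rewrite normrX -[x ^+ 2]real_normK ?num_real// -exprM.
  have [x1|/ltW x1] := leP `|x| 1.
    by rewrite (le_trans (exprn_ile1 _ _ x1))// lerDl exprn_ge0.
  rewrite (@le_trans _ _ (`|x| ^+ (2 * k.+1)))//; last by rewrite lerDr.
  by rewrite ler_weXn2l// (leq_trans (leqnSn k))// leq_pmull.
have e1 : expR y * expR (- y) = 1 by rewrite -expRD subrr expR0.
have -> : 1 + C = (1 + C) * expR y * expR (- y) by rewrite -mulrA e1 mulr1.
rewrite ler_pM2r ?expR_gt0//; apply: le_trans h2 _.
by rewrite [leRHS]mulrDl mul1r lerD.
Qed.

Lemma integ1_expr k : integ1 (fun x => x ^+ k * gw x).
Proof.
have [C C0 hC] := expr_gauss_bound k.
have s2 : Num.sqrt 2 != 0 :> R by rewrite gt_eqF// sqrtr_gt0.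
have s22 : Num.sqrt 2 ^+ 2 = 2 :> R by rewrite sqr_sqrtr.
have pk1 : 0 < @normal_peak R 1 by rewrite normal_peak_gt0// oner_eq0.
have pk2 : 0 < @normal_peak R (Num.sqrt 2) by rewrite normal_peak_gt0.
(* The majorant [expR (- x ^+ 2 / 4)] is, up to its constant, the normal density of variance 2. *)
have i0 := integrable_normal_pdf (0 : R) (Num.sqrt 2).
have i1 := integrableZl measurableT (normal_peak 1 * C / normal_peak (Num.sqrt 2)) i0.
apply: le_integrable i1 => //.
  apply/measurable_EFinP; apply: measurable_funM; last exact: measurable_gw.
  exact: measurable_funX.
move=> x _ /=; rewrite lee_fin normal_pdfE// /normal_fun s22 subr0.
rewrite gwE normrM (ger0_norm (mulr_ge0 (ltW pk1) (expR_ge0 _))).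
rewrite mulrCA; apply: le_trans (ler_wpM2l (ltW pk1) (hC x)) _.
rewrite ger0_norm; last by rewrite !mulr_ge0 ?invr_ge0 ?expR_ge0// ltW.
rewrite le_eqVlt; apply/orP; left; apply/eqP.
have -> : - x ^+ 2 / (2 *+ 2) = - x ^+ 2 / 4 by rewrite -mulr_natr -natrM.
by field; rewrite gt_eqF.
Qed.

Definition mom k : R := (\int[leb]_x (x ^+ k * gw x))%R.

Lemma mom0 : mom 0 = 1.
Proof.
rewrite /mom; under eq_Rintegral do rewrite expr0 mul1r.
by rewrite /Rintegral integral_normal_pdf.
Qed.

Lemma gwN x : gw (- x) = gw x.
Proof. by rewrite !gwE sqrrN. Qed.

Lemma mom_odd k : odd k -> mom k = 0.
Proof.
move=> ok; suff : mom k = - mom k by move=> h; lra.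
rewrite {1}/mom /Rintegral.
have -> : (\int[leb]_x (x ^+ k * gw x)%:E =
    \int[pushforward leb (-%R : R -> measurableTypeR R)]_x (x ^+ k * gw x)%:E)%E.
  by apply: eq_measure_integral => //= A mA AS; exact/esym/lebesgue_measureN.
have mN : measurable_fun setT (-%R : R -> measurableTypeR R).
  exact: measurable_funN.
have pull : leb.-integrable setT (EFin \o (fun x => (- x) ^+ k * gw (- x))).
  have := integ1_expr k => /integrableN.
  by apply: eq_integrable => // x _ /=; rewrite gwN exprNn -signr_odd ok mulN1r mulNr EFinN.
rewrite integral_pushforward//=.
- rewrite preimage_setT; rewrite -RintegralN /Rintegral; congr fine.
  by apply: eq_integral => x _ /=; rewrite gwN exprNn -signr_odd ok mulN1r mulNr.
- apply/measurable_EFinP; apply: measurable_funM; last exact: measurable_gw.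
  exact: measurable_funX.
Qed.

Lemma integ1D (f g : R -> R) : integ1 f -> integ1 g -> integ1 (fun x => f x + g x).
Proof. by move=> fi gi; have := integrableD measurableT fi gi. Qed.

Lemma integ1Z (c : R) (f : R -> R) : integ1 f -> integ1 (fun x => c * f x).
Proof. by move=> fi; have := integrableZl measurableT c fi. Qed.

(* [0 <= E (x^3 - 3 x)^2] *)
Lemma mom6_ge : mom 2 = 1 -> mom 4 = 3 -> 9 <= mom 6.
Proof.
move=> m2 m4; have := @Rintegral_ge0 _ _ _ leb setT (fun x => (x ^+ 3 - 3 * x) ^+ 2 * gw x).
move=> /(_ (fun x _ => mulr_ge0 (sqr_ge0 _) (ltW (gw_gt0 x)))).
have e x : (x ^+ 3 - 3 * x) ^+ 2 * gw x =
    x ^+ 6 * gw x + ((- 6) * (x ^+ 4 * gw x) + 9 * (x ^+ 2 * gw x)) by ring.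
under eq_Rintegral do rewrite e.
have i2 := integ1_expr 2; have i4 := integ1_expr 4; have i6 := integ1_expr 6.
have j2 := integ1Z 9 i2; have j4 := integ1Z (- 6) i4; have j := integ1D j4 j2.
rewrite RintegralD// RintegralD// !RintegralZl//.
by rewrite -/(mom 6) -/(mom 4) -/(mom 2) m2 m4; lra.
Qed.

End GaussianMoments.

(** * Integrals of tensor products *)

Section ProductIntegrals.
Context d1 d2 (T1 : measurableType d1) (T2 : measurableType d2) (R : realType).
Variables (m1 : {sigma_finite_measure set T1 -> \bar R}).
Variables (m2 : {sigma_finite_measure set T2 -> \bar R}).

Lemma integrable_tensor (f : T1 -> R) (g : T2 -> R) :
  m1.-integrable setT (EFin \o f) -> m2.-integrable setT (EFin \o g) ->
  (m1 \x m2)%E.-integrable setT (EFin \o (fun p => f p.1 * g p.2)) /\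
  (\int[(m1 \x m2)%E]_p (f p.1 * g p.2) = (\int[m1]_x f x) * (\int[m2]_y g y))%R.
Proof.
move=> fi gi.
have mf : measurable_fun setT f by apply/measurable_EFinP; exact: (measurable_int m1).
have mg : measurable_fun setT g by apply/measurable_EFinP; exact: (measurable_int m2).
have mfg : measurable_fun setT (fun p : T1 * T2 => f p.1 * g p.2).
  apply: measurable_funM; apply: measurableT_comp => //.
have ifg : (m1 \x m2)%E.-integrable setT (EFin \o (fun p => f p.1 * g p.2)).
  apply/(integrable12ltyP); first exact/measurable_EFinP.
  have -> : (\int[m1]_x \int[m2]_y `|(EFin \o (fun p => (f p.1 * g p.2)%R)) (x, y)| =
      \int[m1]_x (`|f x|%:E * \int[m2]_y `|g y|%:E))%E.
    apply: eq_integral => x _.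
    under eq_integral do rewrite /= normrM EFinM.
    rewrite ge0_integralZl//; first exact/measurable_EFinP/measurableT_comp.
  have /integrableP[_ gy] := gi; have /integrableP[_ fy] := fi.
  rewrite ge0_integralZr//.
  - by apply: lte_mul_pinfty => //; [exact: integral_ge0|rewrite ge0_fin_numE//; exact: integral_ge0].
  - exact/measurable_EFinP/measurableT_comp.
  - exact: integral_ge0.
split => //; rewrite /Rintegral -integral12_prod_meas1//.
rewrite /fubini_F /=.
have -> : (\int[m1]_x \int[m2]_y (f x * g y)%:E =
    \int[m1]_x ((f x)%:E * \int[m2]_y (g y)%:E))%E.
  apply: eq_integral => x _; under eq_integral do rewrite EFinM.
  by rewrite integralZl.
have gf : (\int[m2]_y (g y)%:E \is a fin_num)%E by exact: integrable_fin_num.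
rewrite -(fineK gf) integralZr// fineM//; exact: integrable_fin_num.
Qed.

End ProductIntegrals.

Section Plane.
Variable R : realType.
Local Notation leb := (@lebesgue_measure R).

(* The library's [SigmaFiniteMeasure] instance for products only covers
   sub-probabilities, hence this copy with an instance of its own. *)
Definition lebesgue2 : set (measurableTypeR R * measurableTypeR R)%type -> \bar R :=
  (leb \x leb)%E.

HB.instance Definition _ := Measure.on lebesgue2.

Let lebesgue2_sigma_finite : sigma_finite setT lebesgue2.
Proof.
have /sigma_finiteP[F [TF ndF Foo]] := sigma_finiteT leb.
exists (fun n => F n `*` F n).
  rewrite -setXTT {1 2}TF predeqE => -[x y]; split.
    move=> [/= [n _ Fnx] [k _ Gky]]; exists (maxn n k) => //; split.
    - by move: x Fnx; exact/subsetPset/ndF/leq_maxl.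
    - by move: y Gky; exact/subsetPset/ndF/leq_maxr.
  by move=> [n _ []/= ? ?]; split; exists n.
move=> k; have [mF Fk] := Foo k; split; first exact: measurableX.
by rewrite /lebesgue2 product_measure1E// lte_mul_pinfty// ge0_fin_numE.
Qed.

HB.instance Definition _ :=
  Measure_isSigmaFinite.Build _ _ _ lebesgue2 lebesgue2_sigma_finite.

End Plane.

(** * Polynomials against the Maxwellian *)

Section Polynomials.
Variable R : realType.
Local Notation leb := (@lebesgue_measure R).
Local Notation mu := (@leb3 R).
Implicit Types (v w : vec3 R) (l : seq (R * (nat * nat * nat))).

(* Polynomials in the three velocity components, as lists of coefficients and
   multi-exponents. *)
Definition evalp l v : R :=
  \sum_(m <- l) m.1 * (v.1.1 ^+ m.2.1.1 * v.1.2 ^+ m.2.1.2 * v.2 ^+ m.2.2).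

Definition gaussE l : R :=
  \sum_(m <- l) m.1 * (mom R m.2.1.1 * mom R m.2.1.2 * mom R m.2.2).

Definition mulp l l' : seq (R * (nat * nat * nat)) :=
  [seq (m.1 * m'.1, (m.2.1.1 + m'.2.1.1, m.2.1.2 + m'.2.1.2, m.2.2 + m'.2.2)%N)
    | m <- l, m' <- l'].

Lemma evalp_mul l l' v : evalp (mulp l l') v = evalp l v * evalp l' v.
Proof.
rewrite /evalp /mulp big_allpairs_dep/= mulr_suml; apply: eq_bigr => m _.
rewrite mulr_sumr; apply: eq_bigr => m' _ /=.
by rewrite !exprD; ring.
Qed.

Lemma maxwellianE v : maxwellian v = gw v.1.1 * gw v.1.2 * gw v.2.
Proof.
have p0 : 0 < @pi R := pi_gt0 R.
have p2 : 0 <= 2 * @pi R by rewrite mulr_ge0 ?ltW.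
have -> : maxwellian v = normal_peak 1 ^+ 3 * expR (- (dot v v) / 2).
  rewrite /maxwellian sqr_vnorm mulNr; congr (_ * _).
  rewrite powRN (_ : 3 / 2 = 2^-1 * 3%:R); last by rewrite mulrC.
  rewrite powRrM powR_mulrn ?powR_ge0// powR12_sqrt// -exprVn; congr (_ ^+ _).
  by rewrite /normal_peak expr1n mul1r mulr_natl.
rewrite !gwE.
rewrite (_ : - dot v v / 2 = - v.1.1 ^+ 2 / 2 + - v.1.2 ^+ 2 / 2 + - v.2 ^+ 2 / 2); last first.
  by rewrite /dot; field.
by rewrite !expRD; ring.
Qed.

Lemma sqr_sqrtM v : sqrtM v ^+ 2 = maxwellian v.
Proof.
by rewrite sqr_sqrtr// maxwellianE !mulr_ge0// ltW// gw_gt0.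
Qed.

Lemma integ_monomial a b c :
  integ (fun v : vec3 R => (v.1.1 ^+ a * v.1.2 ^+ b * v.2 ^+ c) * maxwellian v) /\
  (\int[mu]_v ((v.1.1 ^+ a * v.1.2 ^+ b * v.2 ^+ c) * maxwellian v) =
    mom R a * mom R b * mom R c)%R.
Proof.
have [i1 e1] := integrable_tensor (integ1_expr R a) (integ1_expr R b).
have [i2 e2] := @integrable_tensor _ _ _ _ R (@lebesgue2 R) leb _ _ i1 (integ1_expr R c).
have E (v : vec3 R) : (v.1.1 ^+ a * gw v.1.1 * (v.1.2 ^+ b * gw v.1.2)) * (v.2 ^+ c * gw v.2) =
    (v.1.1 ^+ a * v.1.2 ^+ b * v.2 ^+ c) * maxwellian v.
  by rewrite maxwellianE; ring.
split; first by apply: eq_integ i2 => v; exact: E.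
rewrite -[in RHS]e1 -[RHS]e2; apply: eq_Rintegral => v _.
by rewrite E.
Qed.

Lemma integ_evalp l : integ (fun v => evalp l v * maxwellian v) /\
  (\int[mu]_v (evalp l v * maxwellian v) = gaussE l)%R.
Proof.
elim: l => [|m l [i e]].
  split; first by apply: eq_integ (@integ0 R) => v; rewrite /evalp big_nil mul0r.
  rewrite /gaussE big_nil -[RHS](mul0r (fine (mu setT))) -Rintegral_cst//.
  by apply: eq_Rintegral => v _; rewrite /evalp big_nil mul0r.
have [i1 e1] := integ_monomial m.2.1.1 m.2.1.2 m.2.2.
have E (v : vec3 R) : evalp (m :: l) v * maxwellian v =
    m.1 * ((v.1.1 ^+ m.2.1.1 * v.1.2 ^+ m.2.1.2 * v.2 ^+ m.2.2) * maxwellian v) +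
    evalp l v * maxwellian v.
  by rewrite /evalp big_cons mulrDl; congr (_ + _); rewrite !mulrA.
split; first by apply: eq_integ (integD (integZ m.1 i1) i) => v; rewrite E.
under eq_Rintegral do rewrite E.
rewrite (RintegralD measurableT (integZ m.1 i1) i) (RintegralZl _ measurableT i1) e1 e.
by rewrite /gaussE big_cons.
Qed.

Lemma measurable_evalp l : measurable_fun setT (evalp l).
Proof.
elim: l => [|m l ih].
  rewrite (_ : evalp _ = cst 0); first exact: measurable_cst.
  by apply/funext => v; rewrite /evalp big_nil.
rewrite (_ : evalp _ = fun v : vec3 R => m.1 * (v.1.1 ^+ m.2.1.1 * v.1.2 ^+ m.2.1.2 * v.2 ^+ m.2.2)
  + evalp l v); last by apply/funext => v; rewrite /evalp big_cons.
apply: measurable_funD => //; apply: measurable_funM; first exact: measurable_cst.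
apply: measurable_funM; last by apply: measurable_funX; exact: measurable_c3.
by apply: measurable_funM; apply: measurable_funX; [exact: measurable_c1|exact: measurable_c2].
Qed.

Definition polyf l : cfun R := fun v => (evalp l v)%:C * (@chi R ord0) v.

Lemma polyfE l v : polyf l v = (evalp l v * sqrtM v)%:C.
Proof. by rewrite /polyf chi0E -rmorphM. Qed.

Lemma L2_dominated_polyf (m : vec3 R -> R) l : measurable_fun setT m ->
  (forall v, `|m v| <= `|evalp l v|) -> L2 (fun v => (m v)%:C * (@chi R ord0) v).
Proof.
move=> mm ml; apply: (L2_le _ _ (integ_evalp (mulp l l)).1).
  apply: cmeasurableM; apply: cmeasurableR => //; exact: measurable_sqrtM.
move=> v; rewrite chi0E -rmorphM normcR normrM exprMn evalp_mul -expr2.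
rewrite (ger0_norm (ltW (sqrtM_gt0 v))) sqr_sqrtM ler_wpM2r//.
  by rewrite -sqr_sqrtM sqr_ge0.
by rewrite -[leRHS]real_normK ?num_real// ler_pXn2r ?nnegrE ?normr_ge0.
Qed.

Lemma L2_polyf l : L2 (polyf l).
Proof. by apply: (@L2_dominated_polyf _ l) => //; exact: measurable_evalp. Qed.

Definition Pl l : L2class R := cls (polyf l).

Lemma ipL_Pl l l' : ipL (Pl l) (Pl l') = (gaussE (mulp l l'))%:C.
Proof.
rewrite (ipL_cls (L2_polyf l) (L2_polyf l')) -(integ_evalp (mulp l l')).2 -cintR.
apply: eq_cint => v; rewrite !polyfE conjc_real -rmorphM; congr (_%:C).
by rewrite evalp_mul -sqr_sqrtM; ring.
Qed.

Definition linp w : seq (R * (nat * nat * nat)) :=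
  [:: (w.1.1, (1, 0, 0)%N); (w.1.2, (0, 1, 0)%N); (w.2, (0, 0, 1)%N)].

Lemma evalp_linp w v : evalp (linp w) v = dot v w.
Proof. by rewrite /evalp /linp !big_cons big_nil /= /dot !expr0 !expr1; ring. Qed.

Lemma Mq_Pl w l : domM (fun v => dot v w) (Pl l) /\
  Mq (fun v => dot v w) (Pl l) = Pl (mulp (linp w) l).
Proof.
have E : (fun v => (dot v w)%:C * polyf l v) = polyf (mulp (linp w) l).
  by apply/funext => v; rewrite !polyfE evalp_mul evalp_linp -rmorphM mulrA.
split; last by rewrite (Mq_cls _ (L2_polyf l)) E.
apply/domM_cls; [exact: measurable_dot|exact: L2_polyf|rewrite E; exact: L2_polyf].
Qed.

Definition Xp (k : nat) : seq (R * (nat * nat * nat)) :=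
  let c : R := (Num.sqrt 6)^-1 in
  match k with
  | 0 => [:: (1, (0, 0, 0)%N)]
  | 1 => [:: (1, (1, 0, 0)%N)]
  | 2 => [:: (1, (0, 1, 0)%N)]
  | 3 => [:: (1, (0, 0, 1)%N)]
  | _ => [:: (c, (2, 0, 0)%N); (c, (0, 2, 0)%N); (c, (0, 0, 2)%N); (- 3 * c, (0, 0, 0)%N)]
  end.

Lemma Xn_Pl k : (k < 5)%N -> Xn R k = Pl (Xp k).
Proof.
move=> k5; rewrite /Xn /Pl; congr cls; apply/funext => v.
rewrite polyfE /chi /= inordK//.
case: k k5 => [|[|[|[|[|//]]]]] _; congr (_%:C);
  rewrite /evalp /Xp !big_cons big_nil /= ?expr0 ?expr1; try ring.
by rewrite sqr_vnorm /dot; field; rewrite gt_eqF// sqrtr_gt0.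
Qed.

End Polynomials.

(** * Gram matrix of the transport terms *)

Section MomentMatrix.
Variables (R : realType) (gamma : R) (B : vec3 R -> vec3 R -> R).
Variables (K : cfun R -> cfun R) (nu0 nu1 mu : R).
Hypothesis hK : kinetic_setting gamma B K nu0 nu1 mu.
Local Notation E := (L2class R).
Local Notation hip := (ipL_inner_product R).
Local Notation NL := (ipnorm (@ipL R)).
Variable omega : vec3 R.
Hypothesis omega1 : dot omega omega = 1.
Local Notation sixth := ((Num.sqrt 6)^-1 : R).

Let mom1 : mom R 1 = 0. Proof. exact: mom_odd. Qed.
Let mom3 : mom R 3 = 0. Proof. exact: mom_odd. Qed.
Let mom5 : mom R 5 = 0. Proof. exact: mom_odd. Qed.
Let mom0' : mom R 0 = 1. Proof. exact: mom0. Qed.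

Lemma sqr_sixth : sixth * sixth = 6^-1.
Proof. by rewrite -invfM -expr2 sqr_sqrtr. Qed.

Lemma gaussE_Xp i j : (i < 5)%N -> (j < 5)%N ->
  gaussE (mulp (Xp R i) (Xp R j)) = (i == j)%:R.
Proof.
move=> i5 j5; have := Xn_orthonormal hK i5 j5.
rewrite !Xn_Pl// ipL_Pl => /(congr1 (@complex.Re R)) /= ->.
by case: (i == j).
Qed.

(** No integration by parts: the moments of order 2 and 4 are forced by the orthonormality of the
    [chi j]. The sixth is only bounded below, by [mom6_ge]. *)
Lemma mom2 : mom R 2 = 1.
Proof.
have := @gaussE_Xp 1 1 isT isT.
rewrite /gaussE /mulp /= !big_cons big_nil /= /addn /= mom0'; lra.
Qed.

Lemma mom4 : mom R 4 = 3.
Proof.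
have := @gaussE_Xp 4 4 isT isT.
rewrite /gaussE /mulp /= !big_cons big_nil /= /addn /= mom0' mom2.
set m := mom R 4.
rewrite (_ : _ + _ = sixth * sixth * (3 * m - 3)); last by ring.
rewrite sqr_sixth; lra.
Qed.

Definition comp (k : nat) : R :=
  match k with 0 => omega.1.1 | 1 => omega.1.2 | _ => omega.2 end.

(** [VV] is the Gram matrix of the functions [(v . omega) chi_k], and [VX] holds their coefficients
    on the null space, both as Gaussian moments of polynomials. *)
Definition VV k j := gaussE (mulp (mulp (linp omega) (Xp R k)) (mulp (linp omega) (Xp R j))).
Definition VX k l := gaussE (mulp (mulp (linp omega) (Xp R k)) (Xp R l)).

(** A table up to 6, the highest exponent in the square of [(v . omega) chi_4], which lets [gaussE]
    be evaluated by reduction with the sixth moment left symbolic. *)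
Definition momn n : R := nth 0 [:: 1; 0; 1; 0; 3; 0; mom R 6] n.

Lemma gaussE_foldr (l : seq (R * (nat * nat * nat))) :
  all (fun m => [&& m.2.1.1 < 7, m.2.1.2 < 7 & m.2.2 < 7]%N) l ->
  gaussE l = foldr (fun m x => m.1 * (momn m.2.1.1 * momn m.2.1.2 * momn m.2.2) + x) 0 l.
Proof.
have E n : (n < 7)%N -> mom R n = momn n.
  by case: n => [|[|[|[|[|[|[|//]]]]]]] _; rewrite /momn /= ?mom0' ?mom1 ?mom2 ?mom3 ?mom4 ?mom5.
elim: l => [|m l ih] /=; first by rewrite /gaussE big_nil.
by move=> /andP[/and3P[h1 h2 h3] /ih <-]; rewrite /gaussE big_cons !E.
Qed.

Ltac gauss := rewrite /VV /VX gaussE_foldr // /momn /=.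

Lemma VV_low k j : (k < 3)%N -> (j < 3)%N ->
  VV k.+1 j.+1 = (k == j)%:R + 2 * comp k * comp j.
Proof.
have := omega1; rewrite /dot => o1.
by case: k => [|[|[|//]]] _; case: j => [|[|[|//]]] _; gauss; rewrite /comp /=; lra.
Qed.

Lemma VV_4 k : (k < 3)%N -> VV k.+1 4 = 0 /\ VV 4 k.+1 = 0.
Proof. by case: k => [|[|[|//]]] _; split; gauss; ring. Qed.

Lemma VV_44 : VV 4 4 = (mom R 6 - 1) / 6.
Proof.
have := omega1; rewrite /dot => o1; gauss; set m := mom R 6.
rewrite (_ : _ + _ = sixth * sixth * (m - 1) * (omega.1.1 * omega.1.1 + omega.1.2 * omega.1.2
  + omega.2 * omega.2)); last by ring.
by rewrite o1 sqr_sixth; field.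
Qed.

Lemma VV_00 : VV 0 0 = 1.
Proof. by have := omega1; rewrite /dot => o1; gauss; lra. Qed.

Lemma VX_00 : VX 0 0 = 0.
Proof. by gauss; ring. Qed.

Lemma VX_low k l : (k < 3)%N -> (l < 5)%N -> VX k.+1 l =
  match l with 0 => comp k | 4 => 2 * sixth * comp k | _ => 0 end.
Proof.
by case: k => [|[|[|//]]] _; case: l => [|[|[|[|[|//]]]]] _; gauss; rewrite /comp /=; ring.
Qed.

Lemma VX_4 l : (l < 5)%N -> VX 4 l =
  match l with 0 | 4 => 0 | l'.+1 => 2 * sixth * comp l' end.
Proof.
by case: l => [|[|[|[|[|//]]]]] _; gauss; rewrite /comp /=; ring.
Qed.

Definition Vg (k : nat) : E := Mq (fun v => dot v omega) (Xn R k).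
(** The microscopic part of the flux of the [k]-th fluid quantity; for [k] from 1 to 4 these carry
    the viscous and heat-conducting effects. *)
Definition Wg (k : nat) : E := Vg k - P0q (Vg k).

Lemma ipL_Vg k j : (k < 5)%N -> (j < 5)%N -> ipL (Vg k) (Vg j) = (VV k j)%:C.
Proof.
move=> k5 j5; rewrite /Vg !Xn_Pl// (Mq_Pl omega (Xp R k)).2 (Mq_Pl omega (Xp R j)).2.
exact: ipL_Pl.
Qed.

Lemma ipL_VgX k l : (k < 5)%N -> (l < 5)%N -> ipL (Vg k) (Xn R l) = (VX k l)%:C.
Proof.
move=> k5 l5; rewrite /Vg !Xn_Pl// (Mq_Pl omega (Xp R k)).2.
exact: ipL_Pl.
Qed.

Lemma ipL_Wg k j : (k < 5)%N -> (j < 5)%N ->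
  ipL (Wg k) (Wg j) = (VV k j - \sum_(l < 5) VX k l * VX j l)%:C.
Proof.
move=> k5 j5; rewrite /Wg (ipBr hip) (ip_oproj_orth hip (Xn_orthonormal hK)) subr0.
rewrite (ipBl hip) ipL_Vg// rmorphB /=; congr (_ - _).
rewrite /P0q /oproj (ip_suml hip) rmorph_sum; apply: eq_bigr => l _.
rewrite (ipZl hip) ipL_VgX// -(ip_conj hip (Vg j)) ipL_VgX// conjc_real.
by rewrite -rmorphM.
Qed.

Definition Gram k j : R := VV k j - \sum_(l < 5) VX k l * VX j l.

Lemma Gram_low k j : (k < 3)%N -> (j < 3)%N ->
  Gram k.+1 j.+1 = (k == j)%:R + 3^-1 * comp k * comp j.
Proof.
move=> k3 j3; rewrite /Gram VV_low// !big_ord_recl big_ord0 !VX_low//=.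
have s := sqr_sixth; set c := sixth in s *.
have -> : 2 * c * comp k * (2 * c * comp j) = 4 * (c * c) * comp k * comp j by ring.
by rewrite s; field.
Qed.

Lemma Gram_4 k : (k < 3)%N -> Gram k.+1 4 = 0 /\ Gram 4 k.+1 = 0.
Proof.
move=> k3; have [h1 h2] := VV_4 k3; rewrite /Gram h1 h2.
have V l (l5 : (l < 5)%N) := VX_low k3 l5; have W l (l5 : (l < 5)%N) := VX_4 l5.
by rewrite !big_ord_recl !big_ord0 !V// !W//=; split; ring.
Qed.

Lemma Gram_44 : Gram 4 4 = (mom R 6 - 5) / 6.
Proof.
rewrite /Gram VV_44 !big_ord_recl big_ord0 !VX_4//=.
have := omega1; rewrite /dot => o1.
have s := sqr_sixth; set c := sixth in s *.
have E1 x : 2 * c * x * (2 * c * x) = 4 * (c * c) * (x * x) by ring.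
by rewrite /bump /= !E1 s; move: o1; set m := mom R 6; lra.
Qed.

Definition Wcomb (a : nat -> R[i]) : E := \sum_(k < 4) a k *: Wg k.+1.

(** The Gram matrix splits into the block [1 + omega omega^T / 3] of the momenta, at least 1, and
    the temperature entry [(mom R 6 - 5) / 6], at least [2 / 3] because the sixth moment is at least
    9. *)
Lemma Wcomb_lower (a : nat -> R[i]) :
  2 / 3 * \sum_(k < 4) normc (a k) ^+ 2 <= NL (Wcomb a) ^+ 2.
Proof.
have G44 : 2 / 3 <= Gram 4 4.
  by rewrite Gram_44; have := mom6_ge mom2 mom4; lra.
rewrite (sqr_ipnorm hip).
have -> : ipL (Wcomb a) (Wcomb a) =
    \sum_(k < 4) \sum_(j < 4) a k * conjc (a j) * (Gram k.+1 j.+1)%:C.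
  rewrite {1}/Wcomb (ip_suml hip); apply: eq_bigr => k _.
  rewrite (ipZl hip) (ip_sumr hip) mulr_sumr; apply: eq_bigr => j _.
  have k5 : (k.+1 < 5)%N := ltn_ord k; have j5 : (j.+1 < 5)%N := ltn_ord j.
  by rewrite (ipZr hip) (ipL_Wg k5 j5) mulrA.
rewrite !big_ord_recl !big_ord0 /=.
have [b1 b2 b3] : [/\ bump 0 0 = 1%N, bump 0 1 = 2%N & bump 0 2 = 3%N] by [].
rewrite !b1 !b2 !b3.
have [g1 g1'] := @Gram_4 0 isT; have [g2 g2'] := @Gram_4 1 isT; have [g3 g3'] := @Gram_4 2 isT.
have G k j (k3 : (k < 3)%N) (j3 : (j < 3)%N) := Gram_low k3 j3.
rewrite g1 g1' g2 g2' g3 g3' (G 0 0)// (G 0 1)// (G 0 2)// (G 1 0)// (G 1 1)//.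
rewrite (G 1 2)// (G 2 0)// (G 2 1)// (G 2 2)//.
move: G44; set g := Gram 4 4 => G44.
rewrite (sqr_normcE (a 0%N)) (sqr_normcE (a 1%N)) (sqr_normcE (a 2%N)) (sqr_normcE (a 3%N)).
move: (a 0%N) (a 1%N) (a 2%N) (a 3%N) => [x0 y0] [x1 y1] [x2 y2] [x3 y3].
have s1 := sqr_ge0 (omega.1.1 * x0 + omega.1.2 * x1 + omega.2 * x2).
have s2 := sqr_ge0 (omega.1.1 * y0 + omega.1.2 * y1 + omega.2 * y2).
have s3 : 0 <= (g - 2 / 3) * (x3 ^+ 2 + y3 ^+ 2).
  by rewrite mulr_ge0 ?subr_ge0 ?addr_ge0 ?sqr_ge0.
have t0 := sqr_ge0 x0; have t1 := sqr_ge0 x1; have t2 := sqr_ge0 x2.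
have u0 := sqr_ge0 y0; have u1 := sqr_ge0 y1; have u2 := sqr_ge0 y2.
move: s1 s2 s3 t0 t1 t2 u0 u1 u2; rewrite /comp /=; lra.
Qed.

End MomentMatrix.

(** * Decay away from zero frequency *)

Section Domination.
Variable R : realType.
Local Notation NL := (ipnorm (@ipL R)).
Implicit Types (l q : seq (R * (nat * nat * nat))).

Lemma L2norm_dominated (u w : cfun R) (c : R) : cmeasurable u -> L2 w -> 0 <= c ->
  (forall v, normc (u v) <= c * normc (w v)) -> L2 u /\ L2norm u <= c * L2norm w.
Proof.
move=> mu Lw c0 uw.
have sq v : normc (u v) ^+ 2 <= c ^+ 2 * normc (w v) ^+ 2.
  by rewrite -exprMn ler_pXn2r ?nnegrE ?mulr_ge0 ?normc_ge0.
have iw := integZ (c ^+ 2) (L2_integ Lw).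
have Lu : L2 u by exact: L2_le mu sq iw.
split => //; rewrite -(@ler_pXn2r _ 2) ?nnegrE ?mulr_ge0 ?sqrtr_ge0//.
rewrite exprMn !sqr_L2norm -(RintegralZl _ measurableT (L2_integ Lw)).
by apply: le_Rintegral => //; exact: L2_integ.
Qed.

Lemma Mq_dominated (m : vec3 R -> R) (c : R) q l : measurable_fun setT m -> 0 <= c ->
  (forall v, `|m v| <= c * evalp q v) ->
  domM m (Pl l) /\ NL (Mq m (Pl l)) <= c * NL (Pl (mulp q l)).
Proof.
move=> mm c0 mq; have Ll := L2_polyf l; have Lql := L2_polyf (mulp q l).
have mf : cmeasurable (fun v => (m v)%:C * polyf l v).
  by apply: cmeasurableM; [exact: cmeasurableR|exact: L2_measurable].
have h v : normc ((m v)%:C * polyf l v) <= c * normc (polyf (mulp q l) v).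
  rewrite !polyfE -rmorphM !normcR evalp_mul !normrM !mulrA.
  rewrite -[leRHS]mulrA -[leLHS]mulrA ler_wpM2r ?mulr_ge0//.
  by apply: le_trans (mq v) _; rewrite ler_wpM2l// ler_norm.
have [Lm hm] := L2norm_dominated mf Lql c0 h.
split; first by apply/domM_cls.
by rewrite (Mq_cls _ Ll) (normL_cls Lm) (normL_cls Lql).
Qed.

(** The weight [1 + |v|^2]. It dominates [|v . w|] for every unit [w], and [nu] up to a constant,
    which makes the bounds below uniform in the direction. *)
Definition qp : seq (R * (nat * nat * nat)) :=
  [:: (1, (0, 0, 0)%N); (1, (2, 0, 0)%N); (1, (0, 2, 0)%N); (1, (0, 0, 2)%N)].

Lemma evalp_qp (v : vec3 R) : evalp qp v = 1 + dot v v.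
Proof. by rewrite /evalp /qp !big_cons big_nil /= /dot !expr0; ring. Qed.

Lemma normr_dot_unit (v w : vec3 R) : dot w w = 1 -> `|dot v w| <= 1 + dot v v.
Proof.
move=> w1.
have h : dot v w ^+ 2 <= dot v v.
  rewrite -[leRHS]mulr1 -w1 /dot.
  have := sqr_ge0 (v.1.1 * w.1.2 - v.1.2 * w.1.1).
  have := sqr_ge0 (v.1.1 * w.2 - v.2 * w.1.1).
  have := sqr_ge0 (v.1.2 * w.2 - v.2 * w.1.2); lra.
rewrite ler_norml.
have h1 := sqr_ge0 (dot v w - 1); have h2 := sqr_ge0 (dot v w + 1).
have h3 := dot_ge0 v.
by apply/andP; split; lra.
Qed.

End Domination.

Section UniformBounds.
Variables (R : realType) (gamma : R) (B : vec3 R -> vec3 R -> R).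
Variables (K : cfun R -> cfun R) (nu0 nu1 mu : R).
Hypothesis hK : kinetic_setting gamma B K nu0 nu1 mu.
Local Notation E := (L2class R).
Local Notation hip := (ipL_inner_product R).
Local Notation NL := (ipnorm (@ipL R)).
Local Notation nuB := (nu B).
Local Notation vw w := (fun v : vec3 R => dot v w).

Lemma nu1_gt0 : 0 < nu1.
Proof.
have := lt_le_trans (nu_gt0 hK (0, 0, 0)) (nu_le_linear hK (0, 0, 0)).
by rewrite pmulr_lgt0// ltr_pwDl// vnorm_ge0.
Qed.

Lemma nu_dominated v : `|nuB v| <= 2 * nu1 * evalp (qp R) v.
Proof.
rewrite (ger0_norm (ltW (nu_gt0 hK v))); apply: le_trans (nu_le_linear hK v) _.
rewrite -mulrA mulrCA ler_pM2l ?nu1_gt0// evalp_qp -sqr_vnorm.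
have := sqr_ge0 (vnorm v - 1); have := vnorm_ge0 v; have := sqr_ge0 (vnorm v); lra.
Qed.

Lemma Mq_comp (m m' : vec3 R -> R) (f : E) : measurable_fun setT m -> domM m' f ->
  domM (fun v => m v * m' v) f ->
  domM m (Mq m' f) /\ Mq m (Mq m' f) = Mq (fun v => m v * m' v) f.
Proof.
move=> mm h h2.
have e : (fun v => (m v)%:C * ((m' v)%:C * rep f v)) = (fun v => (m v * m' v)%:C * rep f v).
  by apply/funext => v; rewrite mulrA -rmorphM.
split; last by rewrite [in LHS]/Mq -/(Mq m _) (Mq_cls m h) e.
by apply/(domM_cls mm h); rewrite e.
Qed.

Lemma domM_linear (m : vec3 R -> R) a (f g : E) : measurable_fun setT m ->
  domM m f -> domM m g -> domM m (a *: f + g) /\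
  Mq m (a *: f + g) = a *: Mq m f + Mq m g.
Proof.
move=> mm mf mg; have Lf := rep_L2 f; have Lg := rep_L2 g.
have e : a *: f + g = cls (fun v => a * rep f v + rep g v).
  by rewrite (clsD (L2Z a Lf) Lg) (clsZ a Lf) (repK f) (repK g).
have Lfg := L2D (L2Z a Lf) Lg.
have E2 : (fun v => (m v)%:C * (a * rep f v + rep g v)) =
    (fun v => a * ((m v)%:C * rep f v) + (m v)%:C * rep g v).
  by apply/funext => v; rewrite mulrDr mulrCA.
have Lm : L2 (fun v => (m v)%:C * (a * rep f v + rep g v)).
  by rewrite E2; exact: L2D (L2Z a mf) mg.
split; last by rewrite e (Mq_cls m Lfg) E2 (clsD (L2Z a mf) mg) (clsZ a mf).
by rewrite e; apply/domM_cls.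
Qed.

Lemma domM_sum (m : vec3 R -> R) n (c : nat -> R[i]) (e : nat -> E) : measurable_fun setT m ->
  (forall k, (k < n)%N -> domM m (e k)) -> domM m (\sum_(k < n) c k *: e k) /\
  Mq m (\sum_(k < n) c k *: e k) = \sum_(k < n) c k *: Mq m (e k).
Proof.
move=> mm; elim: n => [|n ih] h.
  rewrite !big_ord0.
  have L0 := @L2_0 R.
  have e0 : (fun v => (m v)%:C * (0 : R[i])) = (fun=> 0) by apply/funext => v; rewrite mulr0.
  have z0 : (0 : E) = cls (fun=> 0) by [].
  split; last by rewrite [in LHS]z0 (Mq_cls m L0) e0.
  by rewrite z0; apply/(domM_cls mm L0); rewrite e0.
have [|D1 E1] := ih; first by move=> k kn; apply: h; exact: ltnW.
have [D2 E2] := domM_linear (c n) mm (h n (ltnSn n)) D1.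
rewrite !big_ord_recr /= (addrC _ (c n *: e n)) (addrC _ (c n *: Mq m (e n))).
by split=> //; rewrite E2 E1.
Qed.

Lemma domM_vw_Xn w k : (k < 5)%N -> domM (vw w) (Xn R k).
Proof. by move=> k5; rewrite Xn_Pl//; exact: (Mq_Pl w (Xp R k)).1. Qed.

Lemma Vg_bounds : exists2 C, 1 <= C & forall w, dot w w = 1 -> forall k, (k < 5)%N ->
  [/\ NL (Vg w k) <= C,
      domM (vw w) (Vg w k) /\ NL (Mq (vw w) (Vg w k)) <= C &
      domM nuB (Vg w k) /\ NL (Mq nuB (Vg w k)) <= C].
Proof.
have [C1 C1E c10] : exists2 C1 : nat -> R,
    forall k, C1 k = NL (Pl (mulp (qp R) (Xp R k))) & forall k, 0 <= C1 k.
  exists (fun k => NL (Pl (mulp (qp R) (Xp R k)))) => [k|k]; [reflexivity|exact: ipnorm_ge0].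
have [C2 C2E c20] : exists2 C2 : nat -> R,
    forall k, C2 k = NL (Pl (mulp (mulp (qp R) (qp R)) (Xp R k))) & forall k, 0 <= C2 k.
  exists (fun k => NL (Pl (mulp (mulp (qp R) (qp R)) (Xp R k)))) => [k|k];
    [reflexivity|exact: ipnorm_ge0].
have n10 := nu1_gt0.
have [c cE c0] : exists2 c : nat -> R,
    forall k, c k = C1 k + (1 + 2 * nu1) * C2 k & forall k, 0 <= c k.
  by exists (fun k => C1 k + (1 + 2 * nu1) * C2 k) => // k; have := c10 k; have := c20 k; nra.
exists (1 + \sum_(k < 5) c k); first by rewrite lerDl sumr_ge0.
move=> w w1 k k5.
have cS : c k <= 1 + \sum_(j < 5) c j.
  rewrite (bigD1 (Ordinal k5))//= addrCA lerDl addr_ge0// sumr_ge0//.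
have h1 : C1 k <= 1 + \sum_(j < 5) c j.
  by apply: le_trans cS; have := c10 k; have := c20 k; rewrite cE; nra.
have h2 : 1 * C2 k <= 1 + \sum_(j < 5) c j.
  by apply: le_trans cS; have := c10 k; have := c20 k; rewrite cE; nra.
have h3 : 2 * nu1 * C2 k <= 1 + \sum_(j < 5) c j.
  by apply: le_trans cS; have := c10 k; have := c20 k; rewrite cE; nra.
have mvw : measurable_fun setT (vw w) := mvx w.
have mnu := measurable_nu hK.
have dv v : `|dot v w| <= 1 * evalp (qp R) v.
  by rewrite mul1r evalp_qp normr_dot_unit.
have dD := domM_vw_Xn w k5.
have q0 v : 0 <= evalp (qp R) v by rewrite evalp_qp addr_ge0// dot_ge0.
have comp (m : vec3 R -> R) (d : R) : measurable_fun setT m -> 0 <= d ->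
    (forall v, `|m v| <= d * evalp (qp R) v) ->
    d * C2 k <= 1 + \sum_(j < 5) c j ->
    domM m (Vg w k) /\ NL (Mq m (Vg w k)) <= 1 + \sum_(j < 5) c j.
  move=> mm d0 md le.
  have mm2 : measurable_fun setT (fun v => m v * dot v w) by exact: measurable_funM.
  have hm v : `|m v * dot v w| <= d * evalp (mulp (qp R) (qp R)) v.
    rewrite normrM evalp_mul mulrA; apply: ler_pM => //.
    by have := dv v; rewrite mul1r.
  have [D2 E2] := Mq_dominated (Xp R k) mm2 d0 hm.
  rewrite -(Xn_Pl R k5) -C2E in D2 E2.
  have [D3 E3] := Mq_comp mm dD D2.
  split => //; rewrite E3; exact: le_trans E2 le.
split; [|apply: (comp _ 1) => //; exact: ler01|apply: (comp _ (2 * nu1)) => //].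
- have [_ h] := Mq_dominated (Xp R k) mvw ler01 dv.
  by rewrite -(Xn_Pl R k5) -C1E mul1r in h; exact: le_trans h h1.
- by rewrite mulr_ge0// ltW.
- exact: nu_dominated.
Qed.

Lemma Wg_bounds : exists2 C, 1 <= C & forall w, dot w w = 1 -> forall k, (k < 5)%N ->
  [/\ NL (Vg w k) <= C, domM (vw w) (Vg w k) /\ NL (Mq (vw w) (Vg w k)) <= C,
      NL (Wg w k) <= C, domM (vw w) (Wg w k) /\ NL (Mq (vw w) (Wg w k)) <= C &
      [/\ domM nuB (Vg w k), domM nuB (Wg w k), NL (Lq B K (Vg w k)) <= C &
          Lq B K (Wg w k) = Lq B K (Vg w k)]].
Proof.
have [C C1 HV] := Vg_bounds; have [CK CK0 HK] := Kq_bounded hK.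
have C0 : 0 <= C by lra.
have CC0 : 0 <= CK * C by exact: mulr_ge0.
have le : C <= C + 5 * (C * C) + CK * C by nra.
have lev x y : x <= C -> y <= 5 * (C * C) -> x + y <= C + 5 * (C * C) + CK * C by move=> *; lra.
have leu x y : x <= CK * C -> y <= C -> x + y <= C + 5 * (C * C) + CK * C by move=> *; nra.
(* The summands pay for the bounds on [Vg], for [v . w] applied to the five null-space components of
   [Vg], and for [K]. *)
exists (C + 5 * (C * C) + CK * C); first exact: le_trans le.
move=> w w1 k k5; have [v1 [v2 v3] [v4 v5]] := HV w w1 k k5.
have Dvw j : (j < 5)%N -> domM (vw w) (Xn R j) by exact: domM_vw_Xn.
have mvw : measurable_fun setT (vw w) := mvx w.
have mnu := measurable_nu hK.
have cb j : (j < 5)%N -> normc (ipL (Vg w k) (Xn R j)) <= C.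
  move=> j5; apply: le_trans (cauchy_schwarz hip _ _) _.
  have -> : NL (Xn R j) = 1 by rewrite /ipnorm (Xn_orthonormal hK)// eqxx sqrtr1.
  by rewrite mulr1.
have eW : Wg w k = (-1) *: P0q (Vg w k) + Vg w k by rewrite scaleN1r addrC.
have [P1 P2] := domM_sum (fun j => ipL (Vg w k) (Xn R j)) mvw Dvw.
have [Q1 Q2] := domM_sum (fun j => ipL (Vg w k) (Xn R j)) (n := 5) mnu (fun j _ => Xn_domnu hK j).
have [W1 W2] := domM_linear (-1) mvw P1 v2.
have [U1 U2] := domM_linear (-1) mnu Q1 v4.
split.
- exact: le_trans v1 le.
- by split => //; exact: le_trans v3 le.
- apply: le_trans le; apply: (le_trans _ v1).
  exact: (ipnorm_oprojC_le hip (Xn_orthonormal hK) (Vg w k)).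
- rewrite eW; split; first exact: W1.
  rewrite W2 scaleN1r addrC; apply: le_trans (ler_ipnormB hip _ _) _.
  apply: lev; [exact: v3|rewrite P2].
  have : NL (\sum_(j < 5) ipL (Vg w k) (Xn R j) *: Mq (vw w) (Xn R j)) <= 5 * (C * C).
    apply: le_trans (ler_ipnorm_sum hip _ _ _) _.
    rewrite (_ : 5 * (C * C) = \sum_(j < 5) (C * C)); last first.
      by rewrite !big_ord_recl big_ord0; ring.
    apply: ler_sum => j _; have [h _ _] := HV w w1 j (ltn_ord j).
    rewrite (ipnormZ hip (ipL (Vg w k) (Xn R j))).
    apply: ler_pM; [exact: normc_ge0|exact: ipnorm_ge0|exact: cb|exact: h].
  exact.
- split; first exact: v4.
  + by rewrite eW; exact: U1.
  + rewrite /Lq; apply: le_trans (ler_ipnormB hip _ _) _; apply: leu; [|exact: v5].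
    by apply: le_trans (HK _) _; apply: (ler_wpM2l CK0); exact: v1.
  have LP : Lq B K (P0q (Vg w k)) = 0.
    have LE n : Lq B K (\sum_(j < n) ipL (Vg w k) (Xn R j) *: Xn R j) = 0.
      elim: n => [|n ih].
        rewrite big_ord0; have := Lq_Xn hK 0 => h.
        have [D0 E0] := domM_sum (fun=> 0) (n := 0) mnu (fun j _ => Xn_domnu hK j).
        rewrite !big_ord0 in D0 E0; rewrite /Lq E0 subr0.
        by have := Kq_linear hK (-1) 0 0; rewrite scaler0 addr0 scaleN1r addNr.
      rewrite big_ord_recr /= addrC /Lq.
      have [D1 E1] := domM_sum (fun j => ipL (Vg w k) (Xn R j)) (n := n) mnu
        (fun j _ => Xn_domnu hK j).
      have [D2 E2] := domM_linear (ipL (Vg w k) (Xn R n)) mnu (Xn_domnu hK n) D1.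
      rewrite E2 (Kq_linear hK); move: ih (Lq_Xn hK n); rewrite /Lq => /eqP + /eqP.
      rewrite !subr_eq0 => /eqP -> /eqP ->; exact: subrr.
    exact: LE.
  rewrite eW /Lq U2 (Kq_linear hK).
  move: LP; rewrite /Lq => /eqP; rewrite subr_eq0 => /eqP LP.
  by rewrite !scaleN1r LP opprD addrACA subrr add0r.
Qed.

End UniformBounds.

(** * Macroscopic and microscopic parts *)

Section MacroMicro.
Variables (R : realType) (gamma : R) (B : vec3 R -> vec3 R -> R).
Variables (K : cfun R -> cfun R) (nu0 nu1 mu : R).
Hypothesis hK : kinetic_setting gamma B K nu0 nu1 mu.
Local Notation E := (L2class R).
Local Notation hip := (ipL_inner_product R).
Local Notation NL := (ipnorm (@ipL R)).
Local Notation nuB := (nu B).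
Local Notation X := (Xn R).
Variables (omega : vec3 R) (s : R).
Hypotheses (omega1 : dot omega omega = 1) (s0 : 0 < s).
Local Notation xi := (vscale s omega).
Local Notation vx := (fun v : vec3 R => dot v xi).
Local Notation vw := (fun v : vec3 R => dot v omega).
Local Notation N := (ipnorm (ipx xi)).
Local Notation kap := (s ^- 2).

Lemma dot_vscale v : dot v xi = s * dot v omega.
Proof. by rewrite /dot /vscale /=; ring. Qed.

Lemma kappa_vscale : (vnorm xi ^+ 2)^-1 = kap.
Proof.
rewrite sqr_vnorm dot_vscale (_ : dot xi omega = s); first by rewrite -expr2.
by rewrite -[RHS]mulr1 -omega1 /dot /vscale /=; ring.
Qed.

Lemma domM_vscale f : domM vx f <-> domM vw f.
Proof.
rewrite /domM; have e v : (dot v xi)%:C * rep f v = s%:C * ((dot v omega)%:C * rep f v).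
  by rewrite dot_vscale rmorphM mulrA.
split=> h; last by rewrite (_ : (fun v => _) = (fun v => s%:C * ((dot v omega)%:C * rep f v)));
  [exact: L2Z|apply/funext].
rewrite (_ : (fun v => _) = (fun v => (s^-1)%:C * ((dot v xi)%:C * rep f v))); first exact: L2Z.
by apply/funext => v; rewrite e mulrA -rmorphM mulVf ?mul1r// gt_eqF.
Qed.

Lemma Mq_vscale f : domM vw f -> Mq vx f = s%:C *: Mq vw f.
Proof.
move=> Df; rewrite /Mq -(clsZ s%:C Df); congr cls; apply/funext => v.
by rewrite dot_vscale rmorphM mulrA.
Qed.

Lemma X0_domvw : domM vw (X 0).
Proof. exact: domM_vw_Xn. Qed.

Lemma Yxi_vscale : Yxi xi = s%:C *: Vg omega 0.
Proof. by rewrite -(X0_domvx hK xi).2 (Mq_vscale X0_domvw). Qed.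

(** A moment equation: all unbounded operators are moved to the test function [g], so that only the
    [L^2] size of [f] enters the estimates. *)
Lemma ipL_Bq f g : Bdom B xi f -> domM nuB g -> domM vw g ->
  ipL (Bq B xi f) g = ipL f (Lq B K g) - 'i%C * s%:C * ipL f (Mq vw g)
    - 'i%C * (kap * s)%:C * den f * ipL (Vg omega 0) g.
Proof.
move=> Df Dng Dvg; have [Dn Dv] := Df; have Dw := (domM_vscale f).1 Dv.
rewrite (BqE hK Df) (ipBZl hip) (Lq_selfadjoint hK Dn Dng).
rewrite (Mq_vscale Dw) (ipZl hip) (Mq_selfadjoint Dw Dvg) Yxi_vscale (ipZl hip) kappa_vscale.
move: (ipL f (Lq B K g)) (ipL f (Mq vw g)) (den f) (ipL (Vg omega 0) g) => x1 x2 x3 x4.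
by rewrite rmorphM; ring.
Qed.

(** The fluid part without the density, which is kept apart because its coefficient carries the
    weight [1 + s ^- 2] in the norm. *)
Definition macro (f : E) : E := \sum_(k < 4) ipL f (X k.+1) *: X k.+1.
Definition micro (f : E) : E := f - P0q f.
Definition macro_norm (f : E) : R := Num.sqrt (\sum_(k < 4) normc (ipL f (X k.+1)) ^+ 2).

Lemma P0qE f : P0q f = den f *: X 0 + macro f.
Proof. by rewrite /P0q /oproj big_ord_recl. Qed.

Lemma split_fluid f : f = den f *: X 0 + macro f + micro f.
Proof. by rewrite -P0qE addrC subrK. Qed.

Lemma sqr_macro_norm f : macro_norm f ^+ 2 = \sum_(k < 4) normc (ipL f (X k.+1)) ^+ 2.
Proof. by rewrite sqr_sqrtr// sumr_ge0// => k _; exact: sqr_ge0. Qed.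

Lemma norm_macro f : NL (macro f) = macro_norm f.
Proof.
have oX : orthonormal_family (@ipL R) 4 (fun k => X k.+1).
  by move=> i j i4 j4; rewrite (Xn_orthonormal hK).
have := sqr_ipnorm_comb hip oX (fun k => ipL f (X k.+1)).
rewrite -/(macro f) -sqr_macro_norm => /eqP.
by rewrite eqrXn2 ?ipnorm_ge0 ?sqrtr_ge0// => /eqP.
Qed.

Lemma coef_le_macro f k : (k < 4)%N -> normc (ipL f (X k.+1)) <= macro_norm f.
Proof.
move=> k4; rewrite -(@ler_pXn2r _ 2) ?nnegrE ?normc_ge0 ?sqrtr_ge0// sqr_macro_norm.
by rewrite (bigD1 (Ordinal k4))//= lerDl sumr_ge0// => i _; exact: sqr_ge0.
Qed.

Lemma sqr_normx_split f :
  N f ^+ 2 = (1 + kap) * normc (den f) ^+ 2 + macro_norm f ^+ 2 + NL (micro f) ^+ 2.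
Proof.
rewrite (sqr_normx hK) kappa_vscale (pythagoras hip (Xn_orthonormal hK)).
rewrite (sqr_ipnorm_oproj hip (Xn_orthonormal hK)) big_ord_recl sqr_macro_norm.
rewrite -/(den f) -/(micro f); ring.
Qed.

Lemma micro_orth f k : (k < 5)%N -> ipL (micro f) (X k) = 0.
Proof. by move=> k5; rewrite (ipBl hip) (ip_oproj hip (Xn_orthonormal hK))// subrr. Qed.

Lemma Wg_orth k j : (j < 5)%N -> ipL (X j) (Wg omega k) = 0.
Proof. by move=> j5; rewrite -(ip_conj hip) (micro_orth (Vg omega k) j5) conjc0. Qed.

(** [Vg omega 0] is a multiple of [Yxi] and thus lies in the null space. This removes the electric
    field from the equations tested with the [Wg]. *)
Lemma Vg0_Wg k : ipL (Vg omega 0) (Wg omega k) = 0.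
Proof.
have Y := Yxi_vscale; have : ipL (Yxi xi) (Wg omega k) = 0.
  by rewrite /Yxi !(ipDl hip) !(ipZl hip) !Wg_orth// !mulr0 !addr0.
rewrite Y (ipZl hip) => /eqP; rewrite mulf_eq0 => /orP[/eqP/(congr1 (@complex.Re R)) /= s00|/eqP//].
by move: s0; rewrite s00 ltxx.
Qed.

Lemma ipL_Wg_micro f k : ipL f (Wg omega k) = ipL (micro f) (Wg omega k).
Proof.
rewrite {1}(split_fluid f) 2!(ipDl hip) (ipZl hip) (Wg_orth k)// mulr0 add0r.
by rewrite /macro (ip_suml hip) big1 ?add0r// => j _; rewrite (ipZl hip) Wg_orth ?mulr0// ltnS.
Qed.

Lemma ipL_Lq_micro f g : domM nuB g -> ipL f (Lq B K g) = ipL (micro f) (Lq B K g).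
Proof.
move=> Dg.
have Z k : ipL (X k) (Lq B K g) = 0.
  by rewrite -(Lq_selfadjoint hK (Xn_domnu hK k) Dg) (Lq_Xn hK) (ip0l hip).
rewrite {1}(split_fluid f) 2!(ipDl hip) (ipZl hip) Z mulr0 add0r.
by rewrite /macro (ip_suml hip) big1 ?add0r// => j _; rewrite (ipZl hip) Z mulr0.
Qed.

Lemma ipL_X_Mq k g : (k < 5)%N -> domM vw g -> ipL (X k) (Mq vw g) = ipL (Vg omega k) g.
Proof. by move=> k5 Dg; rewrite -(Mq_selfadjoint (domM_vw_Xn omega k5) Dg). Qed.

Lemma ipL_Vg_Wg k j : (k < 5)%N -> ipL (Vg omega k) (Wg omega j) = ipL (Wg omega k) (Wg omega j).
Proof.
by move=> k5; rewrite ipL_Wg_micro.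
Qed.

(** Moving [v . omega] back to the fluid components of [f] produces the vectors [Wg] again, hence
    their Gram matrix: the source of positivity in the Lyapunov functional. *)
Lemma ipL_Mq_Wg f k : (k < 5)%N -> domM vw (Wg omega k) ->
  ipL f (Mq vw (Wg omega k)) =
    ipL (Wcomb omega (fun j => ipL f (X j.+1))) (Wg omega k) + ipL (micro f) (Mq vw (Wg omega k)).
Proof.
move=> k5 Dk.
rewrite {1}(split_fluid f) 2!(ipDl hip) (ipZl hip) ipL_X_Mq// Vg0_Wg mulr0 add0r.
have -> : ipL (macro f) (Mq vw (Wg omega k)) =
    ipL (Wcomb omega (fun j => ipL f (X j.+1))) (Wg omega k); last by [].
rewrite (ip_suml hip) [RHS](ip_suml hip); apply: eq_bigr => j _.
have j5 : (j.+1 < 5)%N by rewrite ltnS.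
rewrite (ipZl hip (ipL f (X j.+1)) (X j.+1)) (ipZl hip (ipL f (X j.+1)) (Wg omega j.+1)).
by rewrite (ipL_X_Mq j5 Dk) (ipL_Vg_Wg k j5).
Qed.

End MacroMicro.

Lemma normc_i_scale (R : realType) (p : R) (x : R[i]) : 0 <= p ->
  normc ('i%C * p%:C * x) = p * normc x.
Proof. by move=> p0; rewrite !Normc.normcM normc_i normcR mul1r ger0_norm. Qed.

Lemma normc_i_scale2 (R : realType) (p : R) (x y : R[i]) : 0 <= p ->
  normc ('i%C * p%:C * x * y) = p * normc x * normc y.
Proof. by move=> p0; rewrite Normc.normcM normc_i_scale. Qed.

(** * Bounded forms of rank two *)

Section Rank2Forms.
Variables (R : realType) (E : lmodType R[i]) (ip : E -> E -> R[i]).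
Hypothesis hip : inner_product ip.
Local Notation N := (ipnorm ip).

(** The symmetrization of the real part of [i * l f * conjc (l' f)]. The factor [i] turns the
    imaginary transport term [- i * s * (v . omega)] into one with a sign. *)
Definition rank2_form (l l' : E -> R[i]) (f h : E) : R :=
  2^-1 * Re ('i%C * (l f * conjc (l' h) + l h * conjc (l' f))).

Lemma rank2_formM2 l l' f h :
  2 * rank2_form l l' f h = Re ('i%C * (l f * conjc (l' h) + l h * conjc (l' f))).
Proof. by rewrite /rank2_form mulrA mulfV ?mul1r// pnatr_eq0. Qed.

Lemma bounded_form_rank2 (l l' : E -> R[i]) (A A' : R) :
  (forall a f g, l (a *: f + g) = a * l f + l g) ->
  (forall a f g, l' (a *: f + g) = a * l' f + l' g) ->
  0 <= A -> 0 <= A' -> (forall f, normc (l f) <= A * N f) ->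
  (forall f, normc (l' f) <= A' * N f) -> bounded_form ip (rank2_form l l').
Proof.
move=> L L' A0 A'0 b b'.
have lD f g : l (f + g) = l f + l g by have := L 1 f g; rewrite scale1r mul1r.
have l'D f g : l' (f + g) = l' f + l' g by have := L' 1 f g; rewrite scale1r mul1r.
have l0 : l 0 = 0.
  by have := lD 0 0; rewrite addr0 => /eqP; rewrite -subr_eq subrr eq_sym => /eqP.
have l'0 : l' 0 = 0.
  by have := l'D 0 0; rewrite addr0 => /eqP; rewrite -subr_eq subrr eq_sym => /eqP.
have lZ a f : l (a *: f) = a * l f by have := L a f 0; rewrite !addr0 l0 addr0.
have l'Z a f : l' (a *: f) = a * l' f by have := L' a f 0; rewrite !addr0 l'0 addr0.
split.
- move=> f g; rewrite /rank2_form !lD !l'D.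
  rewrite !(Re_mul, Im_mul, Re_add, Im_add, Re_conjc, Im_conjc) /=; by field.
- move=> f g h; rewrite /rank2_form !lD !l'D.
  rewrite !(Re_mul, Im_mul, Re_add, Im_add, Re_conjc, Im_conjc) /=; by field.
- move=> a f g; rewrite /rank2_form !lZ !l'Z.
  rewrite !(Re_mul, Im_mul, Re_add, Im_add, Re_conjc, Im_conjc) /=; by field.
- exists (A * A'); first exact: mulr_ge0.
  move=> f g; rewrite /rank2_form normrM ger0_norm ?invr_ge0//.
  have h1 : normc (l f * conjc (l' g)) <= A * A' * (N f * N g).
    rewrite Normc.normcM normc_conj mulrACA; apply: ler_pM; rewrite ?normc_ge0//.
  have h2 : normc (l g * conjc (l' f)) <= A * A' * (N f * N g).
    rewrite Normc.normcM normc_conj (mulrC (N f)) mulrACA; apply: ler_pM; rewrite ?normc_ge0//.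
  have h3 : `|Re ('i%C * (l f * conjc (l' g) + l g * conjc (l' f)))| <=
      normc (l f * conjc (l' g)) + normc (l g * conjc (l' f)).
    apply: le_trans (normr_Re_le _) _; rewrite Normc.normcM normc_i mul1r.
    exact: le_normcD.
  by move: h1 h2 h3; lra.
Qed.

Lemma bounded_form_sum n (Q : nat -> E -> E -> R) :
  (forall k, (k < n)%N -> bounded_form ip (Q k)) ->
  bounded_form ip (fun f g => \sum_(k < n) Q k f g).
Proof.
elim: n => [|n ih] h.
  rewrite (_ : (fun f g => _) = (fun _ _ => 0)); last first.
    by apply/funext => f; apply/funext => g; rewrite big_ord0.
  split; do ?by move=> *; rewrite !(addr0, mulr0).
  by exists 0 => // f g; rewrite mul0r normr0.
rewrite (_ : (fun f g => _) = (fun f g => (\sum_(k < n) Q k f g) + Q n f g)); last first.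
  by apply/funext => f; apply/funext => g; rewrite big_ord_recr.
apply: bounded_formD; last exact: h.
by apply: ih => k kn; apply: h; exact: ltnW.
Qed.

End Rank2Forms.

Section Dissipation.
Variables (R : realType) (gamma : R) (B : vec3 R -> vec3 R -> R).
Variables (K : cfun R -> cfun R) (nu0 nu1 mu : R).
Hypothesis hK : kinetic_setting gamma B K nu0 nu1 mu.
Local Notation E := (L2class R).
Local Notation hip := (ipL_inner_product R).
Local Notation NL := (ipnorm (@ipL R)).
Local Notation nuB := (nu B).
Local Notation X := (Xn R).
Variables (omega : vec3 R) (s C : R).
Hypotheses (omega1 : dot omega omega = 1) (s0 : 0 < s) (C1 : 1 <= C).
Local Notation xi := (vscale s omega).
Local Notation vw := (fun v : vec3 R => dot v omega).
Local Notation N := (ipnorm (ipx xi)).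
Local Notation kap := (s ^- 2).
Local Notation hipx := (ipx_inner_product hK xi).
Hypothesis bnd : forall k, (k < 5)%N ->
  [/\ NL (Vg omega k) <= C, domM vw (Vg omega k) /\ NL (Mq vw (Vg omega k)) <= C,
      NL (Wg omega k) <= C, domM vw (Wg omega k) /\ NL (Mq vw (Wg omega k)) <= C &
      [/\ domM nuB (Vg omega k), domM nuB (Wg omega k), NL (Lq B K (Vg omega k)) <= C &
          Lq B K (Wg omega k) = Lq B K (Vg omega k)]].

Lemma kap_gt0 : 0 < kap.
Proof. by rewrite invr_gt0 exprn_gt0. Qed.

Lemma ipL_le f g (x y : R) : NL f <= x -> NL g <= y -> normc (ipL f g) <= x * y.
Proof.
move=> h1 h2; apply: le_trans (cauchy_schwarz hip f g) _.
by apply: ler_pM => //; exact: ipnorm_ge0.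
Qed.

(** Each fluid coefficient except the density is coupled with its own microscopic flux. *)
Definition macro_form (f h : E) : R :=
  \sum_(k < 4) rank2_form (fun g => ipL g (Wg omega k.+1)) (fun g => ipL g (X k.+1)) f h.

(** The density is coupled with the current in the direction [omega], which is a fluid quantity: the
    microscopic flux of the density is zero. *)
Definition density_form (f h : E) : R := rank2_form (fun g => ipL g (Vg omega 0)) (@den R) f h.

Lemma norm_X k : (k < 5)%N -> NL (X k) = 1.
Proof. by move=> k5; rewrite /ipnorm (Xn_orthonormal hK)// eqxx sqrtr1. Qed.

Lemma bounded_form_ipL (g g' : E) : 
  bounded_form (ipx xi) (rank2_form (fun f => ipL f g) (fun f => ipL f g')).
Proof.
have h (k f : E) : normc (ipL f k) <= NL k * N f.
  apply: le_trans (cauchy_schwarz hip f k) _; rewrite mulrC ler_wpM2l ?ipnorm_ge0//.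
  exact: (normL_le_normx hK).
apply: (bounded_form_rank2 (A := NL g) (A' := NL g')); rewrite ?ipnorm_ge0//.
- by move=> a f1 f2; rewrite (ipDl hip) (ipZl hip).
- by move=> a f1 f2; rewrite (ipDl hip) (ipZl hip).
Qed.

Lemma macro_form_bounded : bounded_form (ipx xi) macro_form.
Proof.
pose Q (k : nat) := rank2_form (fun g : E => ipL g (Wg omega k.+1)) (fun g => ipL g (X k.+1)).
have hQ k : (k < 4)%N -> bounded_form (ipx xi) (Q k) by move=> _; exact: bounded_form_ipL.
exact: bounded_form_sum hQ.
Qed.

Lemma density_form_bounded : bounded_form (ipx xi) density_form.
Proof. exact: bounded_form_ipL. Qed.

Lemma macro_term_lower (w d l c r a : R[i]) :
  s * Re (c * conjc a) - (normc w * normc d + normc l * normc a + s * (normc r * normc a)) <=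
  Re ('i%C * (w * conjc d + (l - 'i%C * s%:C * (c + r)) * conjc a)).
Proof.
have h1 := le_trans (ler_norm _) (normr_Re_le (- ('i%C * (w * conjc d)))).
have h2 := le_trans (ler_norm _) (normr_Re_le (- ('i%C * (l * conjc a)))).
have h3 := le_trans (ler_norm _) (normr_Re_le (- (r * conjc a))).
rewrite !normcN !Normc.normcM normc_i !mul1r !normc_conj in h1 h2 h3.
have -> : 'i%C * (w * conjc d + (l - 'i%C * s%:C * (c + r)) * conjc a) =
    'i%C * (w * conjc d) + 'i%C * (l * conjc a) + s%:C * (c * conjc a) + s%:C * (r * conjc a).
  have i2 : 'i%C * 'i%C = -1 :> R[i] by rewrite -expr2 sqr_i.
  transitivity ('i%C * (w * conjc d) + 'i%C * (l * conjc a)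
     - ('i%C * 'i%C) * (s%:C * (c * conjc a) + s%:C * (r * conjc a))); first ring.
  by rewrite i2; ring.
rewrite !Re_add !Re_scale.
have h4 := ler_wpM2l (ltW s0) h3.
rewrite !Re_opp in h1 h2 h4.
by move: h1 h2 h4; move: (Re _) (Re _) (Re _) (Re _) => *; lra.
Qed.

(** The positive term is [Wcomb_lower]. Every error carries the factor [NL (micro f)], which the
    coercivity of [L] can absorb. *)
Lemma macro_form_dissip f : Bdom B xi f ->
  s * (2 / 3 * macro_norm f ^+ 2 - 4 * C * (NL (micro f) * macro_norm f))
  - 4 * C * (NL (micro f) * macro_norm f)
  - 4 * C ^+ 2 * s * (NL (micro f) * (N f + kap * normc (den f)))
  <= 2 * macro_form f (Bq B xi f).
Proof.
move=> Df; rewrite /macro_form mulr_sumr.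
set n1 := NL (micro f); set S := macro_norm f; set F := N f; set A0 := normc (den f).
pose a k := ipL f (X k.+1).
have C0 : 0 <= C := le_trans ler01 C1.
have n10 : 0 <= n1 by exact: ipnorm_ge0.
have S0 : 0 <= S by exact: sqrtr_ge0.
have A00 : 0 <= A0 by exact: normc_ge0.
have F0 : 0 <= F by exact: ipnorm_ge0.
have k0 := ltW kap_gt0.
have NLF : NL f <= F by exact: (normL_le_normx hK).
have term (k : 'I_4) : s * Re (ipL (Wcomb omega a) (Wg omega k.+1) * conjc (a k))
    - (C * n1 * (s * C * (F + kap * A0)) + C * n1 * S + s * (C * n1 * S)) <=
    2 * rank2_form (fun g => ipL g (Wg omega k.+1)) (fun g => ipL g (X k.+1)) f (Bq B xi f).
  have k5 : (k.+1 < 5)%N by rewrite ltnS.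
  have [bV _ bW [dW bMW] [_ dnW bLV LE]] := bnd k5.
  have [bV0 _ _ _ _] := bnd (isT : (0 < 5)%N).
  rewrite rank2_formM2.
  rewrite (ipL_Bq hK omega1 s0 Df dnW dW) (Vg0_Wg hK omega s0) mulr0 subr0.
  rewrite (ipL_Mq_Wg hK s0 f k5 dW) (ipL_Lq_micro hK f dnW) LE (ipL_Wg_micro hK omega f).
  apply: le_trans (macro_term_lower _ _ _ _ _ _).
  rewrite lerD2l lerN2.
  have w1 : normc (ipL (micro f) (Wg omega k.+1)) <= C * n1.
    by rewrite mulrC; exact: (ipL_le (lexx _) bW).
  have l1 : normc (ipL (micro f) (Lq B K (Vg omega k.+1))) <= C * n1.
    by rewrite mulrC; exact: (ipL_le (lexx _) bLV).
  have r1 : normc (ipL (micro f) (Mq vw (Wg omega k.+1))) <= C * n1.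
    by rewrite mulrC; exact: (ipL_le (lexx _) bMW).
  have a1 : normc (ipL f (X k.+1)) <= S := coef_le_macro f (ltn_ord k).
  have d1 : normc (ipL (Bq B xi f) (X k.+1)) <= s * C * (F + kap * A0).
    have Dvw := domM_vw_Xn omega k5.
    rewrite (ipL_Bq hK omega1 s0 Df (Xn_domnu hK k.+1) Dvw) (Lq_Xn hK) (ip0r hip) sub0r.
    have p1 : normc (ipL f (Mq vw (X k.+1))) <= F * C := ipL_le NLF bV.
    have p2 : normc (ipL (Vg omega 0) (X k.+1)) <= C * 1.
      by apply: (ipL_le bV0); rewrite norm_X.
    rewrite -opprD normcN; apply: le_trans (le_normcD _ _) _.
    rewrite (normc_i_scale (ipL f (Mq vw (X k.+1))) (ltW s0)).
    rewrite (normc_i_scale2 (den f) (ipL (Vg omega 0) (X k.+1)) (mulr_ge0 k0 (ltW s0))).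
    have q1 := ler_wpM2l (ltW s0) p1.
    have q2 := ler_wpM2l (mulr_ge0 (mulr_ge0 k0 (ltW s0)) A00) p2.
    have -> : s * C * (F + kap * A0) = s * (F * C) + kap * s * A0 * (C * 1) by ring.
    exact: lerD.
  have e1 := ler_pM (normc_ge0 _) (normc_ge0 _) w1 d1.
  have e2 := ler_pM (normc_ge0 _) (normc_ge0 _) l1 a1.
  have e3 := ler_wpM2l (ltW s0) (ler_pM (normc_ge0 _) (normc_ge0 _) r1 a1).
  exact: lerD (lerD e1 e2) e3.
have := ler_sum (index_enum 'I_4) (P := xpredT) (fun k _ => term k).
rewrite sumrB; apply: le_trans.
have -> : \sum_(k < 4) s * Re (ipL (Wcomb omega a) (Wg omega k.+1) * conjc (a k)) =
    s * NL (Wcomb omega a) ^+ 2.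
  rewrite -mulr_sumr (sqr_ipnorm hip) {3}/Wcomb (ip_sumr hip) Re_sum; congr (_ * _).
  by apply: eq_bigr => k _; rewrite (ipZr hip) mulrC.
have h1 := ler_wpM2l (ltW s0) (Wcomb_lower hK omega1 a).
rewrite -sqr_macro_norm -/S in h1.
rewrite !big_ord_recl big_ord0; move: h1; move: (NL _ ^+ 2) => z; nra.
Qed.

Lemma ipL_Vg00 : ipL (Vg omega 0) (Vg omega 0) = 1.
Proof.
by rewrite ipL_Vg// (VV_00 hK omega1).
Qed.

Lemma density_term_lower (k : R) (b l r a : R[i]) : 0 <= k ->
  s * (1 + k) * normc a ^+ 2 - s * (normc r * normc a) - normc l * normc a
    - s * normc b ^+ 2 <=
  Re ('i%C * (b * conjc (- ('i%C * s%:C * b)) +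
    (l - 'i%C * s%:C * (a + r) - 'i%C * (k * s)%:C * a * 1) * conjc a)).
Proof.
move=> k0.
have h2 := le_trans (ler_norm _) (normr_Re_le (- ('i%C * (l * conjc a)))).
have h3 := le_trans (ler_norm _) (normr_Re_le (- (r * conjc a))).
rewrite !normcN !Normc.normcM normc_i !mul1r !normc_conj in h2 h3.
have -> : 'i%C * (b * conjc (- ('i%C * s%:C * b)) +
    (l - 'i%C * s%:C * (a + r) - 'i%C * (k * s)%:C * a * 1) * conjc a) =
    'i%C * (l * conjc a) + (s * (1 + k))%:C * (a * conjc a) + s%:C * (r * conjc a)
    + (- s)%:C * (b * conjc b).
  have i2 : 'i%C * 'i%C = -1 :> R[i] by rewrite -expr2 sqr_i.
  have ic : conjc 'i%C = - 'i%C :> R[i] by apply: complex_ext => /=; rewrite ?oppr0.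
  rewrite conjcN !conjcM conjc_real ic rmorphN !rmorphM rmorphD rmorph1 /=.
  transitivity ('i%C * (l * conjc a) - ('i%C * 'i%C) * (s%:C * (1 + k%:C) * (a * conjc a)
    + s%:C * (r * conjc a) - s%:C * (b * conjc b))); first ring.
  by rewrite i2; ring.
rewrite !Re_add !Re_scale !mul_conjc.
have h4 := ler_wpM2l (ltW s0) h3.
rewrite !Re_opp in h2 h4.
change (Re (normc a ^+ 2)%:C) with (normc a ^+ 2).
change (Re (normc b ^+ 2)%:C) with (normc b ^+ 2).
by move: h2 h4; move: (Re _) (Re _) => *; lra.
Qed.

Lemma ipL_macro_micro_le f g (c : R) : NL g <= c ->
  normc (ipL (macro f) g + ipL (micro f) g) <= c * (macro_norm f + NL (micro f)).
Proof.
move=> gc; apply: le_trans (le_normcD _ _) _; rewrite mulrDr.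
by apply: lerD; rewrite mulrC; apply: (ipL_le _ gc); rewrite ?(norm_macro hK).
Qed.

(** The summand 1 of [1 + kap] comes from transport of the density, the summand [kap] from the
    electric force, both through [ipL_Vg00]. There are errors in [macro_norm] alone, so this form
    must enter with a small weight relative to [macro_form]. *)
Lemma density_form_dissip f : Bdom B xi f ->
  s * (1 + kap) * normc (den f) ^+ 2
  - s * (C * (macro_norm f + NL (micro f)) * normc (den f))
  - C * NL (micro f) * normc (den f) - s * (C * (macro_norm f + NL (micro f))) ^+ 2
  <= 2 * density_form f (Bq B xi f).
Proof.
move=> Df; have C0 : 0 <= C := le_trans ler01 C1.
have k0 := ltW kap_gt0.
have [bV [dV bMV] _ _ [dnV _ bLV _]] := bnd (isT : (0 < 5)%N).
have D0 := domM_vw_Xn omega (isT : (0 < 5)%N).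
have VX0 : ipL (Vg omega 0) (X 0) = 0.
  by rewrite (@ipL_VgX R omega 0 0 isT isT) (VX_00 hK).
rewrite /density_form rank2_formM2.
have -> : den (Bq B xi f) = - ('i%C * s%:C * ipL f (Vg omega 0)).
  rewrite /den (ipL_Bq hK omega1 s0 Df (Xn_domnu hK 0) D0) (Lq_Xn hK) (ip0r hip).
  by rewrite VX0 mulr0 subr0 sub0r.
rewrite (ipL_Bq hK omega1 s0 Df dnV dV) (ipL_Lq_micro hK f dnV) ipL_Vg00.
have -> : ipL f (Mq vw (Vg omega 0)) =
    den f + (ipL (macro f) (Mq vw (Vg omega 0)) + ipL (micro f) (Mq vw (Vg omega 0))).
  rewrite {1}(split_fluid f) 2!(ipDl hip) (ipZl hip) (ipL_X_Mq (isT : (0 < 5)%N) dV) ipL_Vg00.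
  by rewrite mulr1 addrA.
apply: le_trans (density_term_lower _ _ _ _ k0).
have b1 : normc (ipL f (Vg omega 0)) <= C * (macro_norm f + NL (micro f)).
  rewrite {1}(split_fluid f) 2!(ipDl hip) (ipZl hip) -(ip_conj hip (Vg omega 0)) VX0.
  by rewrite conjc0 mulr0 add0r; exact: ipL_macro_micro_le bV.
have r1 := ipL_macro_micro_le f bMV.
have l1 : normc (ipL (micro f) (Lq B K (Vg omega 0))) <= C * NL (micro f).
  by rewrite mulrC; exact: (ipL_le (lexx _) bLV).
have a0 := normc_ge0 (den f).
have r2 := ler_wpM2l (ltW s0) (ler_wpM2r a0 r1).
have l2 := ler_wpM2r a0 l1.
have b2 : normc (ipL f (Vg omega 0)) ^+ 2 <= (C * (macro_norm f + NL (micro f))) ^+ 2.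
  by rewrite !expr2; exact: (ler_pM (normc_ge0 _) (normc_ge0 _) b1 b1).
have b3 := ler_wpM2l (ltW s0) b2.
exact: (lerB (lerB (lerB (lexx _) r2) l2) b3).
Qed.

End Dissipation.

(** * Choice of the constants in the Lyapunov functional *)

Section LyapunovInequality.
Variable R : realType.

(** Here [F], [A], [S], [n] stand for the full norm, the density, [macro_norm] and the microscopic
    norm. Division by [s] makes the rate uniform; the singular factor [s ^- 2 * A] is harmless
    because [s^-1 * A <= F]. *)
Lemma macro_rate (u C s F A S n D : R) : 0 < s -> s^-1 <= u -> 1 <= C -> 0 <= F ->
  0 <= A -> 0 <= S -> 0 <= n -> S <= F -> s^-1 * A <= F ->
  s * (2 / 3 * S ^+ 2 - 4 * C * (n * S)) - 4 * C * (n * S)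
    - 4 * C ^+ 2 * s * (n * (F + s ^- 2 * A)) <= D ->
  2 / 3 * S ^+ 2 - (4 * C + 4 * C * u + 4 * C ^+ 2 * (1 + u)) * (n * F) <= s^-1 * D.
Proof.
move=> s0 su C1 F0 A0 S0 n0 SF tA hD.
have t0 : 0 < s^-1 by rewrite invr_gt0.
have st : s^-1 * s = 1 by rewrite mulVf// gt_eqF.
have := ler_wpM2l (ltW t0) hD; apply: le_trans.
have -> : s ^- 2 = s^-1 * s^-1 by rewrite -exprVn expr2.
set t := s^-1 in su tA t0 st *.
have -> : t * (s * (2 / 3 * S ^+ 2 - 4 * C * (n * S)) - 4 * C * (n * S)
    - 4 * C ^+ 2 * s * (n * (F + t * t * A))) =
  (t * s) * (2 / 3 * S ^+ 2 - 4 * C * (n * S) - 4 * C ^+ 2 * (n * (F + t * (t * A))))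
    - t * (4 * C * (n * S)) by ring.
rewrite st mul1r.
have h1 : n * S <= n * F by rewrite ler_wpM2l.
have nF0 : 0 <= n * F by rewrite mulr_ge0.
have nS0 : 0 <= n * S by rewrite mulr_ge0.
have h2 : t * (n * S) <= u * (n * F) by apply: ler_pM => //; exact: ltW.
have h3 : t * (n * (t * A)) <= u * (n * F).
  by apply: ler_pM; rewrite ?mulr_ge0 ?(ltW t0)// ler_wpM2l.
have h4 : C * (n * S) <= C * (n * F) by rewrite ler_wpM2l//; lra.
have h5 : C * (t * (n * S)) <= C * (u * (n * F)) by rewrite ler_wpM2l//; lra.
have h6 : C ^+ 2 * (t * (n * (t * A))) <= C ^+ 2 * (u * (n * F)).
  by rewrite ler_wpM2l// sqr_ge0.
move: h4 h5 h6; rewrite !mulrDr !mulrDl.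
set x1 := C ^+ 2; lra.
Qed.

Lemma density_rate (u C s F A S n D : R) : 0 < s -> s^-1 <= u -> 1 <= C -> 0 <= F ->
  0 <= A -> 0 <= S -> 0 <= n -> A <= F -> n <= F ->
  s * (1 + s ^- 2) * A ^+ 2 - s * (C * (S + n) * A) - C * n * A
    - s * (C * (S + n)) ^+ 2 <= D ->
  2^-1 * ((1 + s ^- 2) * A ^+ 2) - 5 / 2 * C ^+ 2 * S ^+ 2
    - (C + C * u + 2 * C ^+ 2) * (n * F) <= s^-1 * D.
Proof.
move=> s0 su C1 F0 A0 S0 n0 AF nF hD.
have t0 : 0 < s^-1 by rewrite invr_gt0.
have st : s^-1 * s = 1 by rewrite mulVf// gt_eqF.
have k0 : 0 <= s ^- 2 by rewrite invr_ge0 exprn_ge0// ltW.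
have := ler_wpM2l (ltW t0) hD; apply: le_trans.
set t := s^-1 in su t0 st *; set k := s ^- 2 in k0 *.
have -> : t * (s * (1 + k) * A ^+ 2 - s * (C * (S + n) * A) - C * n * A
    - s * (C * (S + n)) ^+ 2) =
  (t * s) * ((1 + k) * A ^+ 2 - C * (S + n) * A - (C * (S + n)) ^+ 2) - C * (t * (n * A)) by ring.
rewrite st mul1r.
have h1 : n * A <= n * F by rewrite ler_wpM2l.
have nA0 : 0 <= n * A by rewrite mulr_ge0.
have h2 : C * (t * (n * A)) <= C * (u * (n * F)).
  by rewrite ler_wpM2l ?(le_trans ler01 C1)//; apply: ler_pM => //; exact: ltW.
have h3 : C * (n * A) <= C * (n * F) by rewrite ler_wpM2l// (le_trans ler01 C1).
have h4 : C ^+ 2 * (n * n) <= C ^+ 2 * (n * F) by rewrite !ler_wpM2l// sqr_ge0.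
have h5 := sqr_ge0 (A - C * S).
have h6 := sqr_ge0 (C * (S - n)).
have h7 : 0 <= k * A ^+ 2 by rewrite mulr_ge0// sqr_ge0.
rewrite (_ : (A - C * S) ^+ 2 = A ^+ 2 - 2 * (C * (S * A)) + C ^+ 2 * S ^+ 2) in h5; last by ring.
rewrite (_ : (C * (S - n)) ^+ 2 = C ^+ 2 * S ^+ 2 - 2 * (C ^+ 2 * (S * n)) + C ^+ 2 * (n * n)) in h6;
  last by ring.
rewrite (_ : (C * (S + n)) ^+ 2 = C ^+ 2 * S ^+ 2 + 2 * (C ^+ 2 * (S * n)) + C ^+ 2 * (n * n));
  last by ring.
rewrite (_ : C * (S + n) * A = C * (S * A) + C * (n * A)); last by ring.
rewrite (_ : (C + C * u + 2 * C ^+ 2) * (n * F) =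
  C * (n * F) + C * (u * (n * F)) + 2 * (C ^+ 2 * (n * F))); last by ring.
rewrite (_ : (1 + k) * A ^+ 2 = A ^+ 2 + k * A ^+ 2); last by ring.
rewrite (_ : 5 / 2 * C ^+ 2 * S ^+ 2 = 5 / 2 * (C ^+ 2 * S ^+ 2)); last by ring.
move: h2 h3 h4 h5 h6 h7.
move: (C ^+ 2 * S ^+ 2) (C ^+ 2 * (S * n)) (C ^+ 2 * (n * n)) (C ^+ 2 * (n * F)) (C * (n * F))
  (C * (u * (n * F))) (C * (S * A)) (C * (n * A)) (C * (t * (n * A))) (k * A ^+ 2) (A ^+ 2).
by move=> *; lra.
Qed.

Lemma lyapunov_constants (s0 C mu : R) : 0 < s0 -> 1 <= C -> 0 < mu ->
  exists e eta d : R, [/\ 0 < e, 0 < eta, 0 < d, e * (4 * C + eta * C) <= s0 / 2 &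
    forall s F A S n D1 D2 : R, s0 <= s -> 0 <= F -> 0 <= A -> 0 <= S -> 0 <= n ->
    F ^+ 2 = (1 + s ^- 2) * A ^+ 2 + S ^+ 2 + n ^+ 2 ->
    s * (2 / 3 * S ^+ 2 - 4 * C * (n * S)) - 4 * C * (n * S)
      - 4 * C ^+ 2 * s * (n * (F + s ^- 2 * A)) <= D1 ->
    s * (1 + s ^- 2) * A ^+ 2 - s * (C * (S + n) * A) - C * n * A
      - s * (C * (S + n)) ^+ 2 <= D2 ->
    - (2 * mu) * n ^+ 2 - e * (s^-1 * (D1 + eta * D2)) <= - d * F ^+ 2].
Proof.
move=> s00 C1 mu0; set u := s0^-1.
have u0 : 0 < u by rewrite invr_gt0.
(* Then [eta * (5 / 2 * C ^+ 2) = 3^-1]: the error of the density estimate costs half of the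
   macroscopic rate [2 / 3]. *)
pose eta := 2 / (15 * C ^+ 2).
have C20 : 1 <= C ^+ 2 by rewrite exprn_ege1.
have eta0 : 0 < eta by rewrite divr_gt0// mulr_gt0//; lra.
have etaC : eta * C ^+ 2 = 2 / 15 by rewrite /eta; field; rewrite gt_eqF//; lra.
have eta1 : eta <= 2 / 15 by rewrite -etaC ler_peMr// ltW.
pose c1 := 4 * C + 4 * C * u + 4 * C ^+ 2 * (1 + u).
pose c2 := C + C * u + 2 * C ^+ 2.
pose c3 := c1 + eta * c2.
(* The common rate for the density and the macroscopic part; by Young's inequality half of it pays
   for the cross terms [c3 * (n * F)]. *)
pose h := eta / 2; have h0 : 0 < h by rewrite divr_gt0.
pose c5 := h + c3 ^+ 2 / (2 * h).
have c50 : 0 < c5 by rewrite ltr_pwDl// divr_ge0 ?sqr_ge0// mulr_ge0// ltW.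
have q0 : 0 < 4 * C + eta * C by nra.
(* The first bound lets the coercivity of [L] absorb the microscopic terms; the second keeps the
   corrected functional equivalent to the squared norm. *)
pose e := Num.min (2 * mu / c5) (s0 / 2 / (4 * C + eta * C)).
have e0 : 0 < e by rewrite lt_min !divr_gt0// mulr_gt0.
have e1 : e * c5 <= 2 * mu by rewrite -ler_pdivlMr// ge_min lexx.
have e2 : e * (4 * C + eta * C) <= s0 / 2 by rewrite -ler_pdivlMr// ge_min lexx orbT.
exists e, eta, (e * (h / 2)); split => //; first by rewrite mulr_gt0// divr_gt0.
move=> s F A S n D1 D2 ss F0 A0 S0 n0 hF h1 h2.
have sp : 0 < s by exact: lt_le_trans ss.
have t0 : 0 < s^-1 by rewrite invr_gt0.
have su : s^-1 <= u by rewrite lef_pV2.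
have tt : s ^- 2 = s^-1 * s^-1 by rewrite -exprVn expr2.
have kA : 0 <= s ^- 2 * A ^+ 2 by rewrite mulr_ge0 ?sqr_ge0// tt mulr_ge0// ltW.
have leF x : 0 <= x -> x ^+ 2 <= F ^+ 2 -> x <= F.
  by move=> x0; rewrite ler_pXn2r// nnegrE.
have A2 := sqr_ge0 A; have S2 := sqr_ge0 S; have n2 := sqr_ge0 n.
have SF : S <= F by apply: leF => //; rewrite hF; lra.
have AF : A <= F by apply: leF => //; rewrite hF; lra.
have nF : n <= F by apply: leF => //; rewrite hF; lra.
have tA : s^-1 * A <= F.
  apply: leF; first by rewrite mulr_ge0// ltW.
  by rewrite hF exprMn expr2 -tt; lra.
have r1 := macro_rate sp su C1 F0 A0 S0 n0 SF tA h1.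
have r2 := density_rate sp su C1 F0 A0 S0 n0 AF nF h2.
rewrite -/c1 in r1; rewrite -/c2 in r2.
have r3 := ler_wpM2l (ltW eta0) r2.
have eS : eta * (5 / 2 * C ^+ 2 * S ^+ 2) = 3^-1 * S ^+ 2.
  rewrite (_ : eta * _ = 5 / 2 * (eta * C ^+ 2) * S ^+ 2); last by ring.
  by rewrite etaC; field.
have hA : (1 + s ^- 2) * A ^+ 2 = F ^+ 2 - S ^+ 2 - n ^+ 2 by rewrite hF; ring.
rewrite hA in r3.
have r4 : h * (F ^+ 2 - n ^+ 2) - c3 * (n * F) <= s^-1 * (D1 + eta * D2).
  have hS : h * S ^+ 2 <= 3^-1 * S ^+ 2 by rewrite ler_wpM2r// /h; lra.
  rewrite [leRHS]mulrDr (mulrCA s^-1); apply: le_trans (lerD r1 r3).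
  rewrite !mulrBr eS /c3 /h in hS *.
  move: hS; rewrite !mulrA mulrDl; lra.
have r5 : c3 * (n * F) <= h / 2 * F ^+ 2 + c3 ^+ 2 / (2 * h) * n ^+ 2.
  have := sqr_ge0 (h * F - c3 * n).
  have h2V : 0 < (2 * h)^-1 by rewrite invr_gt0 mulr_gt0.
  move=> /(ler_wpM2l (ltW h2V)); rewrite mulr0.
  have -> : (2 * h)^-1 * (h * F - c3 * n) ^+ 2 =
    h / 2 * F ^+ 2 + c3 ^+ 2 / (2 * h) * n ^+ 2 - c3 * (n * F) by field; rewrite gt_eqF.
  by lra.
have r6 : h / 2 * F ^+ 2 - c5 * n ^+ 2 <= s^-1 * (D1 + eta * D2).
  apply: le_trans r4; rewrite /c5 mulrDl; move: r5; lra.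
have r7 := ler_wpM2l (ltW e0) r6.
have r8 := ler_wpM2r n2 e1.
move: r7 r8; rewrite mulrBr !mulrA; lra.
Qed.

End LyapunovInequality.

(** * The Lyapunov functional *)

Section HighFrequency.
Variables (R : realType) (gamma : R) (B : vec3 R -> vec3 R -> R).
Variables (K : cfun R -> cfun R) (nu0 nu1 mu : R).
Hypothesis hK : kinetic_setting gamma B K nu0 nu1 mu.
Local Notation E := (L2class R).
Local Notation hip := (ipL_inner_product R).
Local Notation NL := (ipnorm (@ipL R)).

Lemma rank2_form_le (l l' : E -> R[i]) f (x y : R) : normc (l f) <= x -> normc (l' f) <= y ->
  `|rank2_form l l' f f| <= x * y.
Proof.
move=> hx hy; have -> : rank2_form l l' f f = Re ('i%C * (l f * conjc (l' f))).
  rewrite /rank2_form -mulr2n mulrnAr mulr2n Re_add; by field.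
apply: le_trans (normr_Re_le _) _; rewrite !Normc.normcM normc_i mul1r normc_conj.
by apply: ler_pM; rewrite ?normc_ge0.
Qed.

Theorem high_frequency_decay (s0 : R) : 0 < s0 -> exists C sg : R, [/\ 0 < C, 0 < sg &
  forall omega s, dot omega omega = 1 -> s0 <= s -> forall S,
    contraction_group (ipx (vscale s omega)) (Bdom B (vscale s omega))
      (Bq B (vscale s omega)) S ->
    forall t f, 0 <= t ->
      ipnorm (ipx (vscale s omega)) (S t f)
        <= C * expR (- sg * t) * ipnorm (ipx (vscale s omega)) f].
Proof.
move=> s00; have [C C1 bnd] := Wg_bounds hK; have mu0 := ks_mu_gt0 hK.
have C0 : 0 <= C := le_trans ler01 C1.
have [e [eta [d [e0 eta0 d0 eC H]]]] := lyapunov_constants s00 C1 mu0.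
exists (Num.sqrt (3 / 2 / 2^-1)), (d / (3 / 2) / 2); split.
- by rewrite sqrtr_gt0 !divr_gt0.
- by rewrite !divr_gt0.
move=> omega s o1 ss S hS t f t0.
have sp : 0 < s := lt_le_trans s00 ss.
set xi := vscale s omega in hS *; have hipx := ipx_inner_product hK xi.
have hb k (k5 : (k < 5)%N) := bnd omega o1 k k5.
(* The correction is subtracted because the derivatives of both forms are bounded below by the fluid
   part. The division by [s] cancels the factor [s] of transport, and [eC] places [Q] between
   [1 / 2] and [3 / 2] times the squared norm. *)
pose Q f h := Re (ipx xi f h) +
  (- (e / s)) * (macro_form omega f h + eta * density_form omega f h).
have bQ : bounded_form (ipx xi) Q.
  apply: bounded_formD; first exact: bounded_form_ip.
  apply/bounded_formZ/bounded_formD; first exact: (macro_form_bounded hK).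
  apply/bounded_formZ; exact: (density_form_bounded hK).
have es : 0 < e / s by rewrite divr_gt0.
have small g : e / s * `|macro_form omega g g + eta * density_form omega g g|
    <= 2^-1 * ipnorm (ipx xi) g ^+ 2.
  set F := ipnorm (ipx xi) g; have F0 : 0 <= F := ipnorm_ge0 _ _.
  have gF : NL g <= F := normL_le_normx hK xi g.
  have m1 : `|macro_form omega g g| <= 4 * C * F ^+ 2.
    apply: le_trans (ler_norm_sum _ _ _) _.
    rewrite (_ : 4 * C * F ^+ 2 = \sum_(k < 4) (F * C * F)); last first.
      by rewrite !big_ord_recl big_ord0; ring.
    apply: ler_sum => k _; have k5 : (k.+1 < 5)%N by rewrite ltnS.
    have [_ _ bW _ _] := hb _ k5.
    apply: rank2_form_le; first exact: (ipL_le gF bW).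
    rewrite -(mulr1 F); apply: (ipL_le gF); rewrite (norm_X hK k5); exact: lexx.
  have m2 : `|density_form omega g g| <= C * F ^+ 2.
    have [bV _ _ _ _] := hb 0 isT.
    rewrite (_ : C * F ^+ 2 = F * C * F); last by ring.
    apply: rank2_form_le; first exact: (ipL_le gF bV).
    exact: le_trans (den_le hK g) gF.
  have m3 : `|macro_form omega g g + eta * density_form omega g g|
      <= (4 * C + eta * C) * F ^+ 2.
    apply: le_trans (ler_normD _ _) _; rewrite normrM (gtr0_norm eta0) mulrDl -!mulrA.
    apply: lerD; first by rewrite mulrA.
    exact: (ler_wpM2l (ltW eta0) m2).
  apply: le_trans (ler_wpM2l (ltW es) m3) _.
  rewrite mulrA; apply: ler_wpM2r; first exact: sqr_ge0.
  rewrite mulrAC ler_pdivrMr//; apply: le_trans eC _.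
  by rewrite mulrC ler_wpM2l// invr_ge0.
apply: (lyapunov_decay hipx hS (Q := Q) (c := 2^-1) (C := 3 / 2) (s := d)) => //.
- by move=> g x x0; exact: (Bdom_dense hK).
- move=> g; have := small g; have := sqr_ipnorm hipx g.
  rewrite /Q; set F2 := ipnorm _ _ ^+ 2; move=> <-.
  set z := macro_form _ _ _ + _; move=> hz.
  have h1 : e / s * z <= e / s * `|z| := ler_wpM2l (ltW es) (ler_norm z).
  have h2 : e / s * - z <= e / s * `|z| by rewrite -normrN; exact: (ler_wpM2l (ltW es) (ler_norm (- z))).
  rewrite mulNr; rewrite mulrN in h2.
  move: hz h1 h2; move: (e / s * z) (e / s * `|z|) => *.
  by apply/andP; split; lra.
- move=> g Dg; rewrite /Q.
  have d1 := macro_form_dissip hK o1 sp C1 hb Dg.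
  have d2 := density_form_dissip hK o1 sp C1 hb Dg.
  have h := H s _ _ _ _ _ _ ss (ipnorm_ge0 _ _) (normc_ge0 _) (sqrtr_ge0 _) (ipnorm_ge0 _ _)
    (sqr_normx_split hK s o1 g) d1 d2.
  apply: le_trans h.
  have dis := Bq_dissip hK Dg.
  have e1 : ipx xi g (Bq B xi g) = conjc (ipx xi (Bq B xi g) g) by rewrite (ip_conj hipx).
  rewrite e1 Re_conjc -/(micro g).
  rewrite (normx_P1q hK) -/(micro g) in dis.
  move: dis; move: (Re _) (macro_form _ _ _) (density_form _ _ _) (NL _ ^+ 2) => x1 x2 x3 x4.
  move=> dis; rewrite mulrDr; apply: lerD; first lra.
  by rewrite le_eqVlt; apply/orP; left; apply/eqP; field; rewrite gt_eqF.
Qed.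

End HighFrequency.

(** * Spans of eigenvectors *)

Section Dependence.
Variables (R : realType) (E : lmodType R[i]).
Implicit Types (g b e : nat -> E).

Lemma sum_comb n m (u : nat -> R[i]) (c : nat -> nat -> R[i]) b :
  \sum_(i < n) u i *: (\sum_(l < m) c i l *: b l) =
  \sum_(l < m) (\sum_(i < n) u i * c i l) *: b l.
Proof.
under eq_bigr do rewrite scaler_sumr.
rewrite exchange_big; apply: eq_bigr => l _; rewrite scaler_suml.
by apply: eq_bigr => i _; rewrite scalerA.
Qed.

Lemma spanned_family n m g b : (forall i, (i < n)%N -> spanned m b (g i)) ->
  exists c : nat -> nat -> R[i], forall i, (i < n)%N -> g i = \sum_(l < m) c i l *: b l.
Proof.
move=> h; have /choice[c hc] : forall i, exists c : nat -> R[i],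
    (i < n)%N -> g i = \sum_(l < m) c l *: b l.
  move=> i; case: (ltnP i n) => [/h[c ->]|_]; first by exists c.
  by exists (fun=> 0).
by exists c.
Qed.

Lemma spanned_dependent m g b : (forall i, (i < m.+1)%N -> spanned m b (g i)) ->
  exists u : nat -> R[i], (exists2 i, (i < m.+1)%N & u i != 0) /\
    \sum_(i < m.+1) u i *: g i = 0.
Proof.
move=> /spanned_family[c gE]; pose A : 'M[R[i]]_(m.+1, m) := \matrix_(i, l) c i l.
have : kermx A != 0.
  rewrite -mxrank_eq0 mxrank_ker subn_eq0 -ltnNge.
  exact: leq_ltn_trans (rank_leq_col A) (ltnSn m).
move=> /rowV0Pn[v /sub_kermxP vA v0].
exists (fun i => v 0 (inord i)); split.
  have /rV0Pn[i vi] := v0; exists i => //; by rewrite inord_val.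
rewrite (eq_bigr (fun i : 'I_m.+1 => v 0 (inord i) *: \sum_(l < m) c i l *: b l)); last first.
  by move=> i _; rewrite gE.
rewrite (sum_comb _ _ (fun i => v 0 (inord i))) big1// => l _.
have := congr1 (fun M : 'rV_m => M 0 l) vA; rewrite !mxE => h.
rewrite (_ : \sum_(i < m.+1) _ = 0) ?scale0r// -[RHS]h.
by apply: eq_bigr => i _; rewrite mxE inord_val.
Qed.

Lemma square_injective n (A : 'M[R[i]]_n) : (forall u : 'rV_n, u *m A = 0 -> u = 0) ->
  forall x : 'cV_n, A *m x = 0 -> x = 0.
Proof.
move=> h x Ax; have fA : A \in unitmx.
  rewrite -row_free_unit -kermx_eq0; apply/eqP/row_matrixP => i; rewrite row0.
  by apply: h; rewrite -row_mul mulmx_ker row0.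
by rewrite -(mulKmx fA x) Ax mulmx0.
Qed.

End Dependence.

Section SpectralSpan.
Variables (R : realType) (E : lmodType R[i]) (ip : E -> E -> R[i]).
Hypothesis hip : inner_product ip.
Local Notation N := (ipnorm ip).
Variables (D : E -> Prop) (B : E -> E) (S : R -> E -> E).
Hypothesis hS : contraction_group ip D B S.
Variable J : E -> E.
Hypothesis JD : forall f g, J (f + g) = J f + J g.
Hypothesis JZ : forall a f, J (a *: f) = conjc a *: J f.
Hypothesis ipJ : forall f g, ip (J f) (J g) = conjc (ip f g).
Hypothesis JK : forall f, J (J f) = f.
Hypothesis csym : forall f g, D f -> D g -> ip (B f) (J g) = ip (B g) (J f).
Variables (n : nat) (psi : nat -> E) (lam : nat -> R[i]).
Hypothesis psiD : forall k, (k < n)%N -> D (psi k).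
Hypothesis psiB : forall k, (k < n)%N -> B (psi k) = lam k *: psi k.
Hypothesis psi_norm : forall j k, (j < n)%N -> (k < n)%N ->
  ip (psi j) (J (psi k)) = (j == k)%:R.
Local Notation sproj := (sproj ip J n psi).

Lemma spanned_sproj f : spanned n psi f -> f = sproj f.
Proof.
move=> [c ->]; rewrite /sproj; apply: eq_bigr => j _; congr (_ *: _).
by rewrite (ip_comb_psi hip psi_norm c).
Qed.

(* If [(B - z) f] lies in the span of the [psi j], removing the spectral projection of [f]
   leaves an eigenvector. *)
Lemma eigen_sproj z f : D f -> spanned n psi (B f - z *: f) ->
  [/\ D (f - sproj f), B (f - sproj f) = z *: (f - sproj f) & skernel ip J n psi (f - sproj f)].
Proof.
move=> Df /spanned_sproj h.
have Ds : D (sproj f) := sproj_dom hip hS J psiD f.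
split; [exact: (domB' hip hS)| |exact: (skernel_sproj hip psi_norm)].
have Bs : B (sproj f) = \sum_(j < n) (lam j * ip f (J (psi j))) *: psi j.
  rewrite /sproj (gen_sum hip hS); last by move=> j; apply: (domZ hip hS); exact: psiD.
  apply: eq_bigr => j _.
  by rewrite (genZ hip hS _ (psiD (ltn_ord j))) (psiB (ltn_ord j)) scalerA mulrC.
have hs : sproj (B f - z *: f) = B (sproj f) - z *: sproj f.
  rewrite Bs {2}/sproj scaler_sumr /sproj -sumrB; apply: eq_bigr => j _.
  rewrite (ipBl hip) (ipZl hip) (ip_gen_psi hip ipJ JK csym psiD psiB)// scalerA.
  by rewrite -[RHS]scalerBl.
rewrite hs in h; rewrite (genB hip hS Df Ds) scalerBr.
apply/eqP; rewrite -subr_eq0; apply/eqP.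
transitivity (B f - z *: f - (B (sproj f) - z *: sproj f)); last by rewrite h subrr.
by rewrite !opprB addrACA [in RHS]addrACA; congr (_ + _); rewrite addrC.
Qed.

(** An eigenvector [h] in the kernel of the projection, added to the [m] vectors [psi j] with
    eigenvalue [z], gives [m + 1] vectors spanned by [m]. In a linear relation the dual functionals
    annihilate every coefficient but that of [h], so [h = 0]. *)
Lemma eigenspace_span z b :
  (forall f, D f -> B f = z *: f -> spanned (count (fun j => lam j == z) (iota 0 n)) b f) ->
  forall f, D f -> B f = z *: f -> spanned n psi f.
Proof.
move=> hb f Df Bf.
have [|Dh Bh kh] := eigen_sproj (z := z) Df; first by rewrite Bf subrr; exact: spanned0.
set h := f - sproj f in Dh Bh kh.
suff h0 : h = 0.
  by rewrite -(subrK (sproj f) f) -/h h0 add0r; exists (fun j => ip f (J (psi j))).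
pose idx := [seq j <- iota 0 n | lam j == z].
have sz : size idx = count (fun j => lam j == z) (iota 0 n) by rewrite size_filter.
set m := count _ _ in sz hb.
have idxP i : (i < m)%N -> (nth 0 idx i < n)%N /\ lam (nth 0 idx i) = z.
  move=> im; have : nth 0%N idx i \in idx by rewrite mem_nth// sz.
  by rewrite mem_filter mem_iota add0n => /andP[/eqP -> /andP[_ ->]].
pose g i := if (i < m)%N then psi (nth 0%N idx i) else h.
have [|u [[i im ui] usum]] := @spanned_dependent _ _ m g b.
  move=> i _; rewrite /g; case: ifP => [im|_]; last exact: hb.
  have [h1 h2] := idxP i im; apply: hb; first exact: psiD.
  by rewrite psiB// h2.
have uk k : (k < m)%N -> u k = 0.
  move=> km; have [kn _] := idxP k km.
  have := congr1 (fun x => ip x (J (psi (nth 0%N idx k)))) usum.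
  rewrite /= (ip0l hip) (ip_suml hip) (bigD1 (Ordinal (ltnW km : (k < m.+1)%N)))//=.
  rewrite (ipZl hip) {1}/g km psi_norm// eqxx mulr1 big1 ?addr0// => j jk.
  rewrite (ipZl hip) /g; case: ifP => [jm|_]; last by rewrite kh// mulr0.
  have [jn _] := idxP j jm; rewrite psi_norm//.
  rewrite (_ : _ == _ = false) ?mulr0//; apply/negbTE; apply: contra jk => /eqP e.
  apply/eqP/val_inj => /=; apply/eqP; rewrite -(@nth_uniq _ 0%N idx) ?sz ?e//.
  by rewrite filter_uniq// iota_uniq.
have iE : i = m.
  apply/eqP; rewrite eqn_leq -ltnS im /= leqNgt; apply/negP => /uk u0.
  by rewrite u0 eqxx in ui.
move: usum; rewrite big_ord_recr /= big1 ?add0r => [|j _]; last by rewrite uk// scale0r.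
rewrite /g ltnn -iE => uh.
by rewrite -(scalerK ui h) uh scaler0.
Qed.

(** By induction and triangularity each [e k] is an eigenvector modulo the span of the [psi];
    [eigen_sproj] turns it into a genuine one, to which the hypothesis on eigenvectors applies. *)
Lemma Schur_span (e : nat -> E) (z : nat -> R[i]) :
  (forall k, (k < n)%N -> D (e k) /\ spanned k e (B (e k) - z k *: e k)) ->
  (forall k f, (k < n)%N -> D f -> B f = z k *: f -> spanned n psi f) ->
  forall k, (k < n)%N -> spanned n psi (e k).
Proof.
move=> he hz k; elim/ltn_ind: k => k IH kn; have [Dk sk] := he k kn.
have [|Dh Bh _] := eigen_sproj (z := z k) Dk.
  apply: spanned_trans sk => i ik; apply: IH => //; exact: ltn_trans kn.
rewrite -(subrK (sproj (e k)) (e k)); apply: spannedD; first exact: hz kn Dh Bh.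
by exists (fun j => ip (e k) (J (psi j))).
Qed.

(** The [e k] are [n] independent combinations of the [n] vectors [psi j], so the coefficient matrix
    is invertible. Vanishing pairings with the [e k] pass to the [psi j], where the pairing is the
    identity matrix. *)
Lemma skernel_span (e : nat -> E) g : orthonormal_family ip n e ->
  (forall k, (k < n)%N -> spanned n psi (e k)) -> spanned n psi g ->
  (forall k, (k < n)%N -> ip g (J (e k)) = 0) -> g = 0.
Proof.
move=> eo /spanned_family[A eA] /spanned_sproj gE gJ.
pose M : 'M[R[i]]_n := \matrix_(k, j) A k j.
pose x : 'cV[R[i]]_n := \col_j ip g (J (psi j)).
have Minj (u : 'rV_n) : u *m M = 0 -> u = 0.
  move=> uM; pose c k := if insub k is Some i then u 0 i else 0 : R[i].
  have cE (i : 'I_n) : c i = u 0 i by rewrite /c valK.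
  have sum0 : \sum_(k < n) c k *: e k = 0.
    rewrite (eq_bigr (fun k : 'I_n => c k *: \sum_(l < n) A k l *: psi l)); last first.
      by move=> k _; rewrite eA.
    rewrite sum_comb big1// => l _.
    have := congr1 (fun M : 'rV_n => M 0 l) uM; rewrite !mxE => h.
    rewrite (_ : \sum_(i < n) _ = 0) ?scale0r// -[RHS]h.
    by apply: eq_bigr => i _; rewrite mxE cE.
  apply/rowP => i; rewrite mxE -cE -(ip_comb_orthonormal hip eo c (ltn_ord i)) sum0.
  exact: (ip0l hip).
have Mx : M *m x = 0.
  apply/colP => k; rewrite !mxE -[RHS](gJ k (ltn_ord k)) eA// (J_sum JD JZ) (ip_sumr hip).
  apply: eq_bigr => j _; rewrite !mxE JZ (ipZr hip) conjcK; congr (_ * _).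
have := square_injective Minj Mx => x0.
rewrite gE /sproj big1// => j _.
have := congr1 (fun M : 'cV_n => M j 0) x0; rewrite !mxE => ->; exact: scale0r.
Qed.

End SpectralSpan.

(** * Convergent subsequences *)

Definition reindexing (phi : nat -> nat) : Prop := forall n, (phi n < phi n.+1)%N.

Section Reindexing.
Implicit Types phi theta : nat -> nat.

Lemma reindexing_ge phi n : reindexing phi -> (n <= phi n)%N.
Proof. by move=> h; elim: n => // n ih; exact: leq_ltn_trans ih (h n). Qed.

Lemma reindexing_lt phi m n : reindexing phi -> (m < n)%N -> (phi m < phi n)%N.
Proof.
move=> h; elim: n => // n ih; rewrite ltnS leq_eqVlt => /orP[/eqP ->|/ih mn]; first exact: h.
exact: ltn_trans mn (h n).
Qed.

Lemma reindexing_comp phi theta : reindexing phi -> reindexing theta ->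
  reindexing (phi \o theta).
Proof. by move=> h1 h2 n; exact: reindexing_lt h1 (h2 n). Qed.

Lemma cvg_reindexing phi : reindexing phi -> phi @ \oo --> \oo.
Proof.
move=> h A [N _ NA]; exists N => // n /= Nn; apply: NA => /=.
exact: leq_trans Nn (reindexing_ge n h).
Qed.

Lemma extract_all m (Q : nat -> (nat -> nat) -> Prop) :
  (forall i phi, (i < m)%N -> reindexing phi ->
    exists2 theta, reindexing theta & Q i (phi \o theta)) ->
  (forall i phi theta, reindexing theta -> Q i phi -> Q i (phi \o theta)) ->
  exists2 phi, reindexing phi & forall i, (i < m)%N -> Q i phi.
Proof.
move=> hex hsub; elim: m hex => [|m ih] hex.
  by exists id => // n; exact: ltnSn.
have [|phi hphi Qphi] := ih; first by move=> i p im; apply: hex; exact: ltnW.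
have [theta htheta Qt] := hex m phi (ltnSn m) hphi.
exists (phi \o theta); first exact: reindexing_comp.
move=> i; rewrite ltnS leq_eqVlt => /orP[/eqP -> //|im].
by apply: hsub => //; exact: Qphi.
Qed.

Lemma bounded_extract (R : realType) (M : R) (u : nat -> R) : (forall n, `|u n| <= M) ->
  exists2 theta, reindexing theta & cvgn (u \o theta).
Proof.
move=> uM; have [|f fi cf] := @bolzano_weierstrass R u.
  rewrite /bounded_fun; exists M; split; first exact: num_real.
  by move=> x Mx n _; exact: le_trans (uM n) (ltW Mx).
by exists f => // n; rewrite (leqW_mono fi).
Qed.

End Reindexing.

Section ScalarLimits.
Variable R : realType.
Implicit Types (x y : nat -> R) (c d : nat -> R[i]).

Lemma cvg0_le x y : (forall n, 0 <= x n <= y n) -> y @ \oo --> (0 : R) -> x @ \oo --> (0 : R).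
Proof.
move=> h; apply: (@squeeze_cvgr _ _ _ _ (fun=> 0)); last exact: cvg_cst.
by apply: nearW.
Qed.

Lemma cvg0D x y : x @ \oo --> (0 : R) -> y @ \oo --> (0 : R) ->
  (fun n => x n + y n) @ \oo --> (0 : R).
Proof. by move=> hx hy; rewrite -[X in _ --> X](addr0 0); exact: cvgD. Qed.

Lemma cvg0Z (a : R) x : x @ \oo --> (0 : R) -> (fun n => a * x n) @ \oo --> (0 : R).
Proof. by move=> hx; rewrite -[X in _ --> X](mulr0 a); exact: cvgMl_tmp. Qed.

Lemma cvg0M x y : x @ \oo --> (0 : R) -> y @ \oo --> (0 : R) ->
  (fun n => x n * y n) @ \oo --> (0 : R).
Proof. by move=> hx hy; rewrite -[X in _ --> X](mulr0 0); exact: cvgM. Qed.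

(** Convergence is expressed by a real sequence of moduli; [cvgE] does the same for vectors, whose
    space has no topology. *)
Definition cvgC c (l : R[i]) : Prop := (fun n => normc (c n - l)) @ \oo --> (0 : R).

Lemma cvgC_cst (l : R[i]) : cvgC (fun=> l) l.
Proof. by rewrite /cvgC subrr Normc.normc0; exact: cvg_cst. Qed.

Lemma cvgC_le c l y : (forall n, normc (c n - l) <= y n) -> y @ \oo --> (0 : R) -> cvgC c l.
Proof. by move=> h; apply: cvg0_le => n; rewrite normc_ge0 h. Qed.

Lemma cvgCD c d l k : cvgC c l -> cvgC d k -> cvgC (fun n => c n + d n) (l + k).
Proof.
move=> h1 h2; apply: (cvgC_le _ (cvg0D h1 h2)) => n.
by rewrite opprD addrACA le_normcD.
Qed.

Lemma cvgCM c d l k : cvgC c l -> cvgC d k -> cvgC (fun n => c n * d n) (l * k).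
Proof.
move=> h1 h2.
apply: (cvgC_le _ (cvg0D (cvg0D (cvg0M h1 h2) (cvg0Z (normc k) h1)) (cvg0Z (normc l) h2))) => n.
have -> : c n * d n - l * k = (c n - l) * (d n - k) + k * (c n - l) + l * (d n - k) by ring.
rewrite -!Normc.normcM; apply: le_trans (le_normcD _ _) _; rewrite lerD2r; exact: le_normcD.
Qed.

Lemma cvgC_conj c l : cvgC c l -> cvgC (fun n => conjc (c n)) (conjc l).
Proof.
by apply: cvg0_le => n; rewrite normc_ge0 -normc_conj conjcD conjcN !conjcK lexx.
Qed.

Lemma cvgC_real x (l : R) : x @ \oo --> l -> cvgC (fun n => (x n)%:C) l%:C.
Proof.
move=> h.
have h1 : (fun n => x n - l) @ \oo --> (0 : R).
  by rewrite -[X in _ --> X](subrr l); apply: cvgB => //; exact: cvg_cst.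
have h2 : (fun n => `|x n - l|) @ \oo --> (0 : R).
  by rewrite -[X in _ --> X](@normr0 _ R); exact: cvg_norm.
by apply: (cvg0_le _ h2) => n; rewrite normc_ge0 -rmorphB normcR lexx.
Qed.

Lemma cvgC_ReIm c : cvgn (fun n => Re (c n)) -> cvgn (fun n => Im (c n)) -> exists l, cvgC c l.
Proof.
move=> /cvgC_real h1 /cvgC_real h2.
have := cvgCD h1 (cvgCM (cvgC_cst 'i%C) h2); set l := (_ + _) => h; exists l.
apply: (cvg0_le _ h) => n; have cE : c n = (Re (c n))%:C + 'i%C * (Im (c n))%:C.
  by apply: complex_ext; rewrite ?(Re_add, Im_add, Re_mul, Im_mul) /=; ring.
by rewrite normc_ge0 -cE /=.
Qed.

Lemma cvgC_uniq c l k : cvgC c l -> cvgC c k -> l = k.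
Proof.
move=> h1 h2; apply/eqP; rewrite -subr_eq0 -normc_eq0; apply/eqP.
have := cvg0_le (x := fun=> normc (l - k)) _ (cvg0D h1 h2) => /(_ _)/cvg_lim <- //.
  by rewrite lim_cst.
move=> n; rewrite normc_ge0 /=.
have -> : l - k = - (c n - l) + (c n - k) by ring.
by apply: le_trans (le_normcD _ _) _; rewrite normcN.
Qed.

Lemma cvgC_bounded_extract (M : R) c : (forall n, normc (c n) <= M) ->
  exists2 theta, reindexing theta & exists l, cvgC (c \o theta) l.
Proof.
move=> cM.
have [t1 h1 c1] := @bounded_extract R M (fun n => Re (c n))
  (fun n => le_trans (normr_Re_le _) (cM n)).
have [t2 h2 c2] := @bounded_extract R M (fun n => Im (c (t1 n)))
  (fun n => le_trans (normr_Im_le _) (cM _)).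
exists (t1 \o t2); first exact: reindexing_comp.
apply: cvgC_ReIm; last exact: c2.
apply/cvg_ex; move/cvg_ex: c1 => [l hl]; exists l.
exact: cvg_comp (cvg_reindexing h2) hl.
Qed.

Lemma cvgC_reindexing c l theta : reindexing theta -> cvgC c l -> cvgC (c \o theta) l.
Proof. by move=> ht hc; exact: (cvg_comp _ _ (cvg_reindexing ht) hc). Qed.

End ScalarLimits.

Section VectorLimits.
Variables (R : realType) (E : lmodType R[i]) (ip : E -> E -> R[i]).
Hypothesis hip : inner_product ip.
Local Notation N := (ipnorm ip).
Implicit Types (u w : nat -> E) (f g : E) (c : nat -> R[i]).

Definition cvgE u f : Prop := (fun n => N (u n - f)) @ \oo --> (0 : R).

Lemma cvgE_le u f y : (forall n, N (u n - f) <= y n) -> y @ \oo --> (0 : R) -> cvgE u f.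
Proof. by move=> h; apply: cvg0_le => n; rewrite ipnorm_ge0 h. Qed.

Lemma cvgE_cst f : cvgE (fun=> f) f.
Proof. by rewrite /cvgE subrr (ipnorm0 hip); exact: cvg_cst. Qed.

Lemma cvgED u w f g : cvgE u f -> cvgE w g -> cvgE (fun n => u n + w n) (f + g).
Proof.
move=> h1 h2; apply: (cvgE_le _ (cvg0D h1 h2)) => n.
by rewrite opprD addrACA (ler_ipnormD hip).
Qed.

Lemma cvgEZ c u l f : cvgC c l -> cvgE u f -> cvgE (fun n => c n *: u n) (l *: f).
Proof.
move=> h1 h2.
apply: (cvgE_le _ (cvg0D (cvg0D (cvg0M h1 h2) (cvg0Z (N f) h1)) (cvg0Z (normc l) h2))) => n.
have -> : c n *: u n - l *: f = (c n - l) *: (u n - f) + (c n - l) *: f + l *: (u n - f).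
  rewrite -scalerDr subrK scalerBl scalerBr addrA subrK //.
apply: le_trans (ler_ipnormD hip _ _) _; rewrite (ipnormZ hip l) lerD2r.
apply: le_trans (ler_ipnormD hip _ _) _.
by rewrite !(ipnormZ hip) (mulrC (N f)).
Qed.

Lemma cvgEN u f : cvgE u f -> cvgE (fun n => - u n) (- f).
Proof. by apply: cvg0_le => n; rewrite ipnorm_ge0 -(ipnormN hip) opprB opprK addrC lexx. Qed.

Lemma cvgE_sum m (U : 'I_m -> nat -> E) (F : 'I_m -> E) : (forall i, cvgE (U i) (F i)) ->
  cvgE (fun n => \sum_(i < m) U i n) (\sum_(i < m) F i).
Proof.
elim: m U F => [|m ih] U F h.
  rewrite big_ord0; under eq_fun do rewrite big_ord0; exact: cvgE_cst.
rewrite big_ord_recr; under eq_fun do rewrite big_ord_recr /=.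
by apply: cvgED; [exact: ih (fun i => h (widen_ord (leqnSn m) i))|exact: h].
Qed.

Lemma cvgE_ip u w f g : cvgE u f -> cvgE w g -> cvgC (fun n => ip (u n) (w n)) (ip f g).
Proof.
move=> h1 h2.
apply: (cvgC_le _ (cvg0D (cvg0D (cvg0M h1 h2) (cvg0Z (N g) h1)) (cvg0Z (N f) h2))) => n.
have -> : ip (u n) (w n) - ip f g = ip (u n - f) (w n - g) + ip (u n - f) g + ip f (w n - g).
  rewrite 2!(ipBl hip) 2!(ipBr hip).
  move: (ip (u n) (w n)) (ip (u n) g) (ip f (w n)) (ip f g) => *; ring.
apply: le_trans (le_normcD _ _) _; apply: lerD; last exact: cauchy_schwarz.
apply: le_trans (le_normcD _ _) _; apply: lerD; first exact: cauchy_schwarz.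
by rewrite mulrC; exact: cauchy_schwarz.
Qed.

Lemma cvgE_reindexing u f theta : reindexing theta -> cvgE u f -> cvgE (u \o theta) f.
Proof. by move=> ht hc; exact: (cvg_comp _ _ (cvg_reindexing ht) hc). Qed.

End VectorLimits.

(** * Limits of invariant bases *)

Section ResolventMultiplier.
Variables (R : realType) (gamma : R) (B : vec3 R -> vec3 R -> R).
Variables (K : cfun R -> cfun R) (nu0 nu1 mu : R).
Hypothesis hK : kinetic_setting gamma B K nu0 nu1 mu.
Local Notation E := (L2class R).
Local Notation hip := (ipL_inner_product R).
Local Notation NL := (ipnorm (@ipL R)).
Local Notation nuB := (nu B).
Local Notation leb := (@leb3 R).

Definition Cq (m : cfun R) (f : E) : E := cls (fun v => m v * rep f v).

Lemma Cq_cls (m : cfun R) u : L2 u -> Cq m (cls u) = cls (fun v => m v * u v).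
Proof. by move=> Lu; apply/cls_ae/ae_mul/rep_cls. Qed.

Lemma Cq_bounded (m : cfun R) C f : cmeasurable m -> 0 <= C -> (forall v, normc (m v) <= C) ->
  NL (Cq m f) <= C * NL f.
Proof.
move=> mm C0 mC; have Lf := rep_L2 f.
rewrite /Cq (normL_cls (L2_mul mm mC Lf)); apply: le_trans (L2norm_mul_le mm C0 mC Lf) _.
by rewrite -(normL_cls Lf) (repK f).
Qed.

Lemma CqB (m : cfun R) C f g : cmeasurable m -> (forall v, normc (m v) <= C) ->
  Cq m (f - g) = Cq m f - Cq m g.
Proof.
move=> mm mC; have Lf := rep_L2 f; have Lg := rep_L2 g.
have e : f - g = cls (fun v => rep f v - rep g v) by rewrite (clsB Lf Lg) (repK f) (repK g).
have Lfg := L2B Lf Lg.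
have E2 : (fun v => m v * (rep f v - rep g v)) =
  (fun v => m v * rep f v - m v * rep g v) by apply/funext => v; rewrite mulrBr.
by rewrite e (Cq_cls m Lfg) E2 (clsB (L2_mul mm mC Lf) (L2_mul mm mC Lg)).
Qed.

Lemma cmeasurable_inv (d : cfun R) : cmeasurable d -> (forall v, 0 < Re (d v)) ->
  cmeasurable (fun v => (d v)^-1).
Proof.
move=> md d0.
have nz v : 0 < normc (d v) ^+ 2.
  by rewrite sqr_normcE ltr_pwDl ?sqr_ge0// exprn_gt0.
have -> : (fun v => (d v)^-1) =
    (fun v => (((normc (d v) ^+ 2) `^ (-1))%:C) * conjc (d v)).
  apply/funext => v; rewrite powR_inv1 ?(ltW (nz v))//.
  have dz : d v != 0 by rewrite -normc_eq0; apply/eqP => e; have := nz v; rewrite e expr0n ltxx.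
  apply: (mulfI dz); rewrite mulfV// mulrCA mul_conjc -rmorphM mulVf ?gt_eqF//.
apply: cmeasurableM; last exact: cmeasurable_conj.
apply: cmeasurableR; apply: (@measurableT_comp _ _ _ _ _ _ (fun x : R => x `^ (-1)) _
  (fun v => normc (d v) ^+ 2)); first exact: measurable_powR.
have [m1 m2] := md.
rewrite (_ : (fun v => _) = (fun v => Re (d v) * Re (d v) + Im (d v) * Im (d v))); last first.
  by apply/funext => v; rewrite sqr_normcE -!expr2.
by apply: measurable_funD; apply: measurable_funM.
Qed.

(** The symbol of [z] minus the multiplication part of the generator; its inverse [rmul] is the
    resolvent once [K] and the electric term are removed. *)
Definition rden (z : R[i]) (xi : vec3 R) : cfun R :=
  fun v => z + (nuB v)%:C + 'i%C * (dot v xi)%:C.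
Definition rmul z xi : cfun R := fun v => (rden z xi v)^-1.

Lemma Re_rden z xi v : Re (rden z xi v) = Re z + nuB v.
Proof. by rewrite /rden !Re_add Re_mul /=; ring. Qed.

Lemma Im_rden z xi v : Im (rden z xi v) = Im z + dot v xi.
Proof. by rewrite /rden !Im_add Im_mul /=; ring. Qed.

Section FixedParameters.
Variables (z : R[i]) (xi : vec3 R).
Hypothesis zmu : - mu / 2 <= Re z.

(** Since [mu <= nu], half of [nu] survives the shift by [Re z >= - mu / 2]. All multiplier bounds
    rest on this. *)
Lemma Re_rden_ge v : nuB v / 2 <= Re (rden z xi v).
Proof. by have := mu_le_nu hK v; have := zmu; rewrite Re_rden; lra. Qed.

Lemma Re_rden_gt0 v : 0 < Re (rden z xi v).
Proof. by apply: lt_le_trans (Re_rden_ge v); rewrite divr_gt0// (nu_gt0 hK). Qed.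

Lemma rden_neq0 v : rden z xi v != 0.
Proof. by apply/eqP => h; have := Re_rden_gt0 v; rewrite h ltxx. Qed.

Lemma normc_rden_gt0 v : 0 < normc (rden z xi v).
Proof. by rewrite normc_gt0 rden_neq0. Qed.

Lemma normc_rmul v : normc (rmul z xi v) = (normc (rden z xi v))^-1.
Proof.
have n0 := normc_rden_gt0 v.
apply: (mulfI (lt0r_neq0 n0)); rewrite mulfV ?gt_eqF// -Normc.normcM /rmul mulfV ?rden_neq0//.
exact: Normc.normc1.
Qed.

Lemma nu_le_rden v : nuB v <= 2 * normc (rden z xi v).
Proof. by have := Re_rden_ge v; have := Re_le_normc (rden z xi v); lra. Qed.

Lemma rmul_le v : normc (rmul z xi v) <= 2 / mu.
Proof.
have mu0 := ks_mu_gt0 hK; rewrite normc_rmul -[leRHS]invrK invf_div lef_pV2.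
- by have := nu_le_rden v; have := mu_le_nu hK v; lra.
- by rewrite posrE normc_rden_gt0.
- by rewrite posrE divr_gt0.
Qed.

Lemma nu_rmul_le v : normc ((nuB v)%:C * rmul z xi v) <= 2.
Proof.
rewrite Normc.normcM normcR gtr0_norm ?(nu_gt0 hK)// normc_rmul.
by rewrite ler_pdivrMr ?normc_rden_gt0// nu_le_rden.
Qed.

(** [v . xi] is the imaginary part of the denominator up to [Im z], so the quotient stays bounded
    although [nu] need not control [v . xi]. *)
Lemma dot_rmul_le v : normc ((dot v xi)%:C * rmul z xi v) <= 1 + normc z * (2 / mu).
Proof.
have n0 := normc_rden_gt0 v.
have h : `|dot v xi| <= normc (rden z xi v) + normc z.
  have -> : dot v xi = Im (rden z xi v) - Im z by rewrite Im_rden; ring.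
  by apply: le_trans (ler_normB _ _) _; apply: lerD; exact: normr_Im_le.
rewrite Normc.normcM normcR normc_rmul.
apply: le_trans (ler_wpM2r _ h) _; first by rewrite invr_ge0 ltW.
rewrite mulrDl mulfV ?gt_eqF// lerD2l ler_wpM2l ?normc_ge0// -normc_rmul.
exact: rmul_le.
Qed.

Lemma cmeasurable_rden : cmeasurable (rden z xi).
Proof.
apply: cmeasurableD; first apply: cmeasurableD.
- exact: cmeasurable_cst.
- apply: cmeasurableR; exact: (measurable_nu hK).
- apply: cmeasurableM; first exact: cmeasurable_cst.
  apply: cmeasurableR; exact: measurable_dot.
Qed.

Lemma cmeasurable_rmul : cmeasurable (rmul z xi).
Proof. exact: cmeasurable_inv cmeasurable_rden Re_rden_gt0. Qed.

Lemma rden_Mq f : domM nuB f -> domM (fun v => dot v xi) f ->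
  L2 (fun v => rden z xi v * rep f v) /\
  cls (fun v => rden z xi v * rep f v) =
    z *: f + Mq nuB f + 'i%C *: Mq (fun v => dot v xi) f.
Proof.
move=> Dn Dv; have Lf := rep_L2 f.
have e : (fun v => rden z xi v * rep f v) = (fun v =>
    z * rep f v + (nuB v)%:C * rep f v + 'i%C * ((dot v xi)%:C * rep f v)).
  by apply/funext => v; rewrite /rden !mulrDl mulrA.
have L1 := L2Z z Lf; have L12 := L2D L1 Dn; have L3 := L2Z 'i%C Dv.
rewrite e; split; first exact: L2D.
by rewrite (clsD L12 L3) (clsD L1 Dn) (clsZ z Lf) (clsZ 'i%C Dv) (repK f).
Qed.

Lemma rmul_inverse f w : domM nuB f -> domM (fun v => dot v xi) f ->
  z *: f + Mq nuB f + 'i%C *: Mq (fun v => dot v xi) f = w -> f = Cq (rmul z xi) w.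
Proof.
move=> Dn Dv <-; have [L <-] := rden_Mq Dn Dv; rewrite (Cq_cls _ L).
rewrite -[LHS](repK f); congr cls; apply/funext => v.
by rewrite mulrA /rmul mulVf ?mul1r// rden_neq0.
Qed.

Lemma rmul_solves w : let f := Cq (rmul z xi) w in
  [/\ domM nuB f, domM (fun v => dot v xi) f &
      z *: f + Mq nuB f + 'i%C *: Mq (fun v => dot v xi) f = w].
Proof.
have Lw := rep_L2 w; have Lf := L2_mul cmeasurable_rmul rmul_le Lw.
have cm := cmeasurable_rmul.
have mnu := measurable_nu hK; have mdot : measurable_fun setT (fun v => dot v xi) := measurable_dot xi.
have D1 : L2 (fun v => (nuB v)%:C * (rmul z xi v * rep w v)).
  rewrite (_ : (fun v => _) = (fun v => ((nuB v)%:C * rmul z xi v) * rep w v)).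
    apply: (L2_mul _ nu_rmul_le Lw); apply: cmeasurableM => //; exact: cmeasurableR.
  by apply/funext => v; rewrite mulrA.
have D2 : L2 (fun v => (dot v xi)%:C * (rmul z xi v * rep w v)).
  rewrite (_ : (fun v => _) = (fun v => ((dot v xi)%:C * rmul z xi v) * rep w v)).
    apply: (L2_mul _ dot_rmul_le Lw); apply: cmeasurableM => //; exact: cmeasurableR.
  by apply/funext => v; rewrite mulrA.
have Dn : domM nuB (Cq (rmul z xi) w) by apply/(domM_cls mnu Lf).
have Dv : domM (fun v => dot v xi) (Cq (rmul z xi) w) by apply/(domM_cls mdot Lf).
split => //; rewrite /Cq (Mq_cls nuB Lf) (Mq_cls (fun v => dot v xi) Lf).
rewrite -(clsZ z Lf) -(clsZ 'i%C D2) -(clsD (L2Z z Lf) D1) -(clsD (L2D (L2Z z Lf) D1) (L2Z 'i%C D2)).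
rewrite -[RHS](repK w); congr cls; apply/funext => v.
rewrite -[RHS]mul1r -(mulfV (rden_neq0 v)) -/(rmul z xi v) [in RHS]/rden.
by move: (rmul z xi v) (rep w v) => *; ring.
Qed.

End FixedParameters.

(** The multipliers converge only pointwise, as [v . xi] is unbounded. Dominated convergence treats
    the fixed vector [w'], and the uniform bound [2 / mu] the difference [w n - w']. *)
Lemma cvg_Cq_rmul (z : nat -> R[i]) (xi : nat -> vec3 R) (w : nat -> E) z' xi' w' :
  (forall n, - mu / 2 <= Re (z n)) -> - mu / 2 <= Re z' ->
  cvgC z z' -> (forall v, (fun n => dot v (xi n)) @ \oo --> dot v xi') ->
  cvgE (@ipL R) w w' ->
  cvgE (@ipL R) (fun n => Cq (rmul (z n) (xi n)) (w n)) (Cq (rmul z' xi') w').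
Proof.
move=> zmu zmu' zz xx ww; have mu0 := ks_mu_gt0 hK.
have m2 : 0 <= 2 / mu by rewrite divr_ge0// ltW.
pose m n v := rmul (z n) (xi n) v - rmul z' xi' v.
have Lw := rep_L2 w'.
have cm n : cmeasurable (m n).
  apply: cmeasurableD; first exact: (cmeasurable_rmul (xi n) (zmu n)).
  rewrite (_ : (fun v => _) = (fun v => (-1) * rmul z' xi' v)).
    by apply: cmeasurableM; [exact: cmeasurable_cst|exact: (cmeasurable_rmul xi' zmu')].
  by apply/funext => v; rewrite mulN1r.
have mb n v : normc (m n v) <= 2 / mu + 2 / mu.
  apply: le_trans (le_normcD _ _) _; rewrite normcN.
  by apply: lerD; [exact: (rmul_le _ (zmu n))|exact: (rmul_le _ zmu')].
have mE n v : m n v = rmul (z n) (xi n) v * rmul z' xi' v * (rden z' xi' v - rden (z n) (xi n) v).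
  have n1 := rden_neq0 (xi n) (zmu n) v; have n2 := rden_neq0 xi' zmu' v.
  rewrite /m /rmul; move: n1 n2; move: (rden _ _ _) (rden _ _ _) => a b n1 n2.
  by field; rewrite n1 n2.
have m0 v : normc (m n v) @[n --> \oo] --> (0 : R).
  have h1 := zz; have h2 := cvgCM (cvgC_cst 'i%C) (cvgC_real (xx v)).
  have h := cvg0Z (2 / mu * (2 / mu)) (cvg0D h1 h2).
  apply: (cvg0_le _ h) => n; rewrite normc_ge0 mE !Normc.normcM /=.
  apply: ler_pM; rewrite ?mulr_ge0 ?normc_ge0//.
    apply: ler_pM; rewrite ?normc_ge0//; [exact: (rmul_le _ (zmu n))|exact: (rmul_le _ zmu')].
  rewrite (_ : rden z' xi' v - rden (z n) (xi n) v =
    - ((z n - z') + ('i%C * (dot v (xi n))%:C - 'i%C * (dot v xi')%:C))).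
    by rewrite normcN; exact: le_normcD.
  by rewrite /rden; ring.
have c1 := L2norm_mul_cvg0 cm mb m0 Lw.
have c2 := cvg0Z (2 / mu) ww.
apply: (cvgE_le _ (cvg0D c2 c1)) => n.
have L1 := L2_mul (cmeasurable_rmul (xi n) (zmu n)) (rmul_le (xi n) (zmu n)) Lw.
have L2' := L2_mul (cmeasurable_rmul xi' zmu') (rmul_le xi' zmu') Lw.
have Lm := L2_mul (cm n) (mb n) Lw.
have -> : Cq (rmul (z n) (xi n)) (w n) - Cq (rmul z' xi') w' =
    Cq (rmul (z n) (xi n)) (w n - w') + cls (fun v => m n v * rep w' v).
  rewrite (CqB _ _ (cmeasurable_rmul (xi n) (zmu n)) (rmul_le (xi n) (zmu n))).
  rewrite (_ : (fun v => m n v * rep w' v) =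
    (fun v => rmul (z n) (xi n) v * rep w' v - rmul z' xi' v * rep w' v)); last first.
    by apply/funext => v; rewrite -mulrBl.
  rewrite (clsB L1 L2' : _ = Cq (rmul (z n) (xi n)) w' - Cq (rmul z' xi') w').
  by move: (Cq _ _) (Cq _ _) (Cq _ _) => x1 x2 x3; rewrite addrA subrK.
apply: le_trans (ler_ipnormD hip _ _) _; apply: lerD.
  exact: Cq_bounded (cmeasurable_rmul _ (zmu n)) m2 (rmul_le _ (zmu n)).
by rewrite (normL_cls Lm).
Qed.

End ResolventMultiplier.

(** * Extraction lemmas and bounds on Schur coefficients *)

Section CompactnessTools.
Variables (R : realType) (gamma : R) (B : vec3 R -> vec3 R -> R).
Variables (K : cfun R -> cfun R) (nu0 nu1 mu : R).
Hypothesis hK : kinetic_setting gamma B K nu0 nu1 mu.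
Local Notation E := (L2class R).
Local Notation hip := (ipL_inner_product R).
Local Notation NL := (ipnorm (@ipL R)).
Local Notation nuB := (nu B).

Lemma extract_scalars m (M : R) (U : nat -> nat -> R[i]) :
  (forall i n, (i < m)%N -> normc (U i n) <= M) ->
  exists2 theta, reindexing theta & forall i, (i < m)%N -> exists l, cvgC (U i \o theta) l.
Proof.
move=> UM; apply: (extract_all (Q := fun i phi => exists l, cvgC (U i \o phi) l)).
  by move=> i phi im hphi; apply: (cvgC_bounded_extract (c := U i \o phi)) => n; exact: UM.
by move=> i phi theta ht [l hl]; exists l; exact: (cvgC_reindexing ht hl).
Qed.

Lemma Kq_extract (u : nat -> E) (C : R) : (forall n, NL (u n) <= C) ->
  exists2 theta, reindexing theta &
    exists g, cvgE (@ipL R) (fun n => Kq K (u (theta n))) g.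
Proof.
move=> uC; have [_ _ cK _] := ks_split hK.
have Lu n := rep_L2 (u n).
have [|phi [g [hphi Lg cg]]] := cK (fun n => rep (u n)) Lu.
  by exists C => n; rewrite -(normL_cls (Lu n)) (repK (u n)).
exists phi => //; exists (cls g).
apply: (cvgE_le _ cg) => n; have LKu := K_L2 hK (Lu (phi n)).
rewrite /Kq -(clsB LKu Lg) (normL_cls (L2B LKu Lg)); exact: lexx.
Qed.

Lemma Kq_extract_all m (u : nat -> nat -> E) (C : R) :
  (forall k n, (k < m)%N -> NL (u k n) <= C) ->
  exists2 theta, reindexing theta & forall k, (k < m)%N ->
    exists g, cvgE (@ipL R) (fun n => Kq K (u k (theta n))) g.
Proof.
move=> uC; apply: (extract_all (Q := fun k phi =>
    exists g, cvgE (@ipL R) (fun n => Kq K (u k (phi n))) g)).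
  move=> k phi km hphi; apply: (Kq_extract (u := fun n => u k (phi n)) (C := C)) => n.
  exact: uC.
move=> k phi theta ht [g hg]; exists g; exact: (cvgE_reindexing ht hg).
Qed.

Lemma cvgE_Kq (u : nat -> E) f : cvgE (@ipL R) u f -> cvgE (@ipL R) (fun n => Kq K (u n)) (Kq K f).
Proof.
move=> uf; have [C C0 HC] := Kq_bounded hK.
apply: (cvgE_le _ (cvg0Z C uf)) => n; rewrite -(KqB hK); exact: HC.
Qed.

Lemma Lq_linear a f g : domM nuB f -> domM nuB g ->
  domM nuB (a *: f + g) /\ Lq B K (a *: f + g) = a *: Lq B K f + Lq B K g.
Proof.
move=> Df Dg; have [D1 E1] := domM_linear a (measurable_nu hK) Df Dg; split => //.
by rewrite /Lq E1 (Kq_linear hK) opprD addrACA -scalerBr.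
Qed.

(** Polarization of a nonnegative form: testing [a *: g + f] with [a] among [1], [-1], [i], [-i]
    bounds the real and imaginary parts by [(x + y) / 2] each. *)
Lemma Lq_form_le f g (x y : R) : domM nuB f -> domM nuB g ->
  - Re (ipL (Lq B K f) f) <= x -> - Re (ipL (Lq B K g) g) <= y ->
  normc (ipL (Lq B K f) g) <= x + y.
Proof.
move=> Df Dg hx hy.
have h (a : R[i]) : normc a = 1 -> 2 * Re (a * conjc (ipL (Lq B K f) g)) <= x + y.
  move=> a1; have [Da La] := Lq_linear a Dg Df.
  have := Lq_dissip hK Da; rewrite La.
  have mu0 := ks_mu_gt0 hK; have q0 := sqr_ge0 (NL (a *: g + f - P0q (a *: g + f))).
  have {}q0 := mulr_ge0 (ltW mu0) q0.
  rewrite mulNr; move: q0; move: (mu * _) => q q0.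
  have sa : ipL (Lq B K g) f = conjc (ipL (Lq B K f) g).
    by rewrite (ip_conj hip) -(Lq_selfadjoint hK Dg Df).
  move: sa hx hy; move: (Lq B K f) (Lq B K g) => F G sa hx hy.
  rewrite (ipDl hip) (ipZl hip) !(ipDr hip) !(ipZr hip) sa.
  move: hx hy; move: (ipL F f) (ipL G g) (ipL F g) => u w p hx hy.
  have aa : a * conjc a = 1 by rewrite mul_conjc a1 expr1n.
  rewrite mulrDr mulrA aa mul1r !Re_add => hq.
  have e : Re (a * conjc p) = Re (conjc a * p) by rewrite -Re_conjc conjcM conjcK.
  by rewrite -e in hq; move: hq hx hy q0; move: (Re u) (Re w) (Re _) => *; lra.
have h1 := h 1 (Normc.normc1 _).
have h2 : 2 * Re (- 1 * conjc (ipL (Lq B K f) g)) <= x + y.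
  by apply: h; rewrite normcN Normc.normc1.
have h3 := h 'i%C (@normc_i R).
have h4 : 2 * Re (- 'i%C * conjc (ipL (Lq B K f) g)) <= x + y.
  by apply: h; rewrite normcN normc_i.
apply: le_trans (normc_le_ReIm _) _.
move: h1 h2 h3 h4; move: (ipL (Lq B K f) g) => p.
rewrite !Re_mul !Re_opp !Im_opp Re_conjc Im_conjc /= => h1 h2 h3 h4.
have k1 : `|Re p| <= (x + y) / 2 by rewrite ler_norml; apply/andP; split; lra.
have k2 : `|Im p| <= (x + y) / 2 by rewrite ler_norml; apply/andP; split; lra.
by move: k1 k2; move: `|_| `|_| => *; lra.
Qed.

(** Transport and field are skew for [ipx], so twice the symmetric part of the generator is twice
    the form of [L]. *)
Lemma Bq_skew xi f g : Bdom B xi f -> Bdom B xi g ->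
  ipx xi (Bq B xi f) g + conjc (ipx xi (Bq B xi g) f) = 2 * ipL (Lq B K f) g.
Proof.
move=> Df Dg; have [fn fv] := Df; have [gn gv] := Dg.
rewrite !(Bq_form hK)//.
have sL : conjc (ipL (Lq B K g) f) = ipL (Lq B K f) g.
  by rewrite (ip_conj hip) (Lq_selfadjoint hK fn gn).
have sM : conjc (ipL (Mq (fun v => dot v xi) g) f) = ipL (Mq (fun v => dot v xi) f) g.
  by rewrite (ip_conj hip) (Mq_selfadjoint fv gv).
have s1 : conjc (ipL (Yxi xi) f) = ipL f (Yxi xi) by exact: (ip_conj hip).
have s2 : conjc (ipL g (Yxi xi)) = ipL (Yxi xi) g by exact: (ip_conj hip).
move: sL sM s1 s2; move: (ipL (Lq B K g) f) (ipL (Lq B K f) g) => p1 p2.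
move: (ipL (Mq (fun v => dot v xi) g) f) (ipL (Mq (fun v => dot v xi) f) g) => q1 q2.
move: (ipL (Yxi xi) f) (ipL f (Yxi xi)) (ipL g (Yxi xi)) (ipL (Yxi xi) g) => y1 y2 y3 y4.
move: (den f) (den g) ((vnorm xi ^+ 2)^-1) => df dg k sL sM s1 s2.
have ic : conjc 'i%C = - 'i%C :> R[i] by apply: complex_ext => /=; rewrite ?oppr0.
by rewrite conjcD conjcN !(conjcM, conjcD) !conjcK conjc_real ic sL sM s1 s2; ring.
Qed.

Section SchurBasis.
Variables (xi : vec3 R) (m : nat) (e : nat -> E) (z : nat -> R[i]).
Hypothesis eo : orthonormal_family (ipx xi) m e.
Hypothesis eB : forall k, (k < m)%N ->
  Bdom B xi (e k) /\ spanned k e (Bq B xi (e k) - z k *: e k).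
Hypothesis zmu : forall k, (k < m)%N -> - mu / 2 <= Re (z k).
Local Notation hipx := (ipx_inner_product hK xi).

Lemma Schur_upper i k : (i <= k)%N -> (k < m)%N ->
  ipx xi (Bq B xi (e i)) (e k) = if i == k then z k else 0.
Proof.
move=> ik km; have im := leq_ltn_trans ik km; have [Di [c ci]] := eB im.
have -> : Bq B xi (e i) = z i *: e i + (Bq B xi (e i) - z i *: e i) by rewrite addrC subrK.
rewrite ci (ipDl hipx) (ipZl hipx) (eo im km) (ip_suml hipx) big1 => [|j _]; last first.
  have jm := ltn_trans (ltn_ord j) im.
  by rewrite (ipZl hipx) (eo jm km) ltn_eqF ?mulr0// (leq_trans (ltn_ord j)).
by rewrite addr0; case: eqP => [->|_]; rewrite ?mulr1 ?mulr0.
Qed.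

Lemma Schur_expand k : (k < m)%N -> Bq B xi (e k) =
  z k *: e k + \sum_(i < k) ipx xi (Bq B xi (e k)) (e i) *: e i.
Proof.
move=> km; have [Dk [c ck]] := eB km.
have eE : Bq B xi (e k) = \sum_(i < k) c i *: e i + z k *: e k by rewrite -ck subrK.
have cE (i : 'I_k) : ipx xi (Bq B xi (e k)) (e i) = c i.
  have im := ltn_trans (ltn_ord i) km.
  have ok : orthonormal_family (ipx xi) k e.
    by move=> a b ak bk; apply: eo; [exact: ltn_trans ak km|exact: ltn_trans bk km].
  rewrite eE (ipDl hipx) (ipZl hipx) (ip_comb_orthonormal hipx ok c (ltn_ord i)).
  by rewrite (eo km im) gtn_eqF ?mulr0 ?addr0.
by rewrite {1}eE addrC; congr (_ + _); apply: eq_bigr => i _; rewrite cE.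
Qed.

(** The transposed entry vanishes by triangularity, so [Bq_skew] makes this entry twice an
    off-diagonal value of the form of [L]. The latter is bounded by the diagonal values
    [- Re (z k) <= mu / 2]. *)
Lemma Schur_coef_le i k : (i < k)%N -> (k < m)%N ->
  normc (ipx xi (Bq B xi (e k)) (e i)) <= 2 * mu.
Proof.
move=> ik km; have im := ltn_trans ik km.
have [[Dkn Dkv] _] := eB km; have [[Din Div] _] := eB im.
have h := Bq_skew (conj Dkn Dkv) (conj Din Div).
rewrite (Schur_upper (ltnW ik) km) ltn_eqF// conjc0 addr0 in h.
have re j (jm : (j < m)%N) : - Re (ipL (Lq B K (e j)) (e j)) <= mu / 2.
  have [Dj _] := eB jm; rewrite -(Bq_dissip_L hK Dj) (Schur_upper (leqnn j) jm) eqxx.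
  by have := zmu jm; lra.
rewrite h Normc.normcM (_ : normc (2 : R[i]) = 2); last first.
  by rewrite -(rmorph_nat (real_complex R)) normcR normr_nat.
have := Lq_form_le Dkn Din (re k km) (re i im).
by move: (normc _) => y; lra.
Qed.

End SchurBasis.

End CompactnessTools.

(** * Limits of Schur bases along converging frequencies *)

Section SchurLimit.
Variables (R : realType) (gamma : R) (B : vec3 R -> vec3 R -> R).
Variables (K : cfun R -> cfun R) (nu0 nu1 mu : R).
Hypothesis hK : kinetic_setting gamma B K nu0 nu1 mu.
Local Notation E := (L2class R).
Local Notation hip := (ipL_inner_product R).
Local Notation NL := (ipnorm (@ipL R)).
Local Notation nuB := (nu B).
Local Notation cvgL := (cvgE (@ipL R)).

Definition cvg_vec (u : nat -> vec3 R) (l : vec3 R) : Prop :=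
  [/\ (fun n => (u n).1.1) @ \oo --> l.1.1, (fun n => (u n).1.2) @ \oo --> l.1.2 &
      (fun n => (u n).2) @ \oo --> l.2].

Lemma cvg_vec_dot u l v : cvg_vec u l -> (fun n => dot v (u n)) @ \oo --> dot v l.
Proof.
move=> [h1 h2 h3]; apply: cvgD; first apply: cvgD; by apply: cvgMl_tmp.
Qed.

Lemma cvg_vec_scale (s : nat -> R) s' u l : s @ \oo --> s' -> cvg_vec u l ->
  cvg_vec (fun n => vscale (s n) (u n)) (vscale s' l).
Proof. by move=> hs [h1 h2 h3]; split; apply: cvgM. Qed.

Lemma cvg_vec_Yxi u l : cvg_vec u l -> cvgL (fun n => Yxi (u n)) (Yxi l).
Proof.
move=> [h1 h2 h3]; apply: (cvgED hip); first apply: (cvgED hip);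
  by apply: (cvgEZ hip); [exact: cvgC_real|exact: (cvgE_cst hip)].
Qed.

Lemma cvg_den u f : cvgL u f -> cvgC (fun n => den (u n)) (den f).
Proof. by move=> h; apply: (cvgE_ip hip h); exact: (cvgE_cst hip). Qed.

Lemma cvgE_unique (u : nat -> E) f g : cvgL u f -> cvgL u g -> f = g.
Proof.
move=> h1 h2; apply/eqP; rewrite -subr_eq0; apply/eqP/(ip_definite hip).
have e h : ipL f h = ipL g h.
  by apply: (cvgC_uniq (cvgE_ip hip h1 (cvgE_cst hip h)) (cvgE_ip hip h2 (cvgE_cst hip h))).
by rewrite (ipBl hip) e subrr.
Qed.

Section Sequence.
Variables (s0 r0 : R) (m : nat) (om : nat -> vec3 R) (s : nat -> R) (e : nat -> nat -> E).
Variables (Lam : nat -> R -> R[i]) (om' : vec3 R) (s' : R).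
Hypothesis s00 : 0 < s0.
Hypothesis s_rng : forall n, s0 <= s n <= r0.
Hypothesis om1 : forall n, dot (om n) (om n) = 1.
Local Notation xi n := (vscale (s n) (om n)).
Local Notation xi' := (vscale s' om').
Hypothesis eo : forall n, orthonormal_family (ipx (xi n)) m (e n).
Hypothesis eB : forall n k, (k < m)%N -> Bdom B (xi n) (e n k) /\
  spanned k (e n) (Bq B (xi n) (e n k) - Lam k (s n) *: e n k).
Hypothesis Lmu : forall k x, (k < m)%N -> s0 <= x <= r0 -> - mu / 2 <= Re (Lam k x).
Hypothesis Lcont : forall k x (u : nat -> R), (k < m)%N -> (forall n, s0 <= u n <= r0) ->
  s0 <= x <= r0 -> u @ \oo --> x -> cvgC (fun n => Lam k (u n)) (Lam k x).
Hypothesis ss' : s @ \oo --> s'.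
Hypothesis oo' : cvg_vec om om'.
Hypothesis Kconv : forall k, (k < m)%N -> exists g, cvgL (fun n => Kq K (e n k)) g.
Hypothesis dconv : forall k, (k < m)%N -> exists d, cvgC (fun n => den (e n k)) d.
Variable T : nat -> nat -> R[i].
Hypothesis Tconv : forall k i, (i < k)%N -> (k < m)%N ->
  cvgC (fun n => ipx (xi n) (Bq B (xi n) (e n k)) (e n i)) (T k i).

Lemma limit_rng : s0 <= s' <= r0.
Proof.
have cs : cvgn s by apply/cvg_ex; exists s'.
rewrite -(cvg_lim _ ss')//; apply/andP; split.
  by apply: limr_ge => //; apply: nearW => n; case/andP: (s_rng n).
by apply: limr_le => //; apply: nearW => n; case/andP: (s_rng n).
Qed.

Lemma limit_gt0 : 0 < s'.
Proof. by have /andP[h _] := limit_rng; exact: lt_le_trans h. Qed.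

Lemma limit_unit : dot om' om' = 1.
Proof.
have [h1 h2 h3] := oo'.
have : (fun n => dot (om n) (om n)) @ \oo --> dot om' om'.
  by apply: cvgD; first apply: cvgD; apply: cvgM.
rewrite (_ : (fun n => _) = (fun=> 1)); last by apply/funext => n; rewrite om1.
by move/cvg_lim => <- //; rewrite lim_cst.
Qed.

Lemma cvg_kappa : cvgC (fun n => (s n ^- 2)%:C) (s' ^- 2)%:C.
Proof.
apply: cvgC_real; have h : (fun n => s n ^+ 2) @ \oo --> s' ^+ 2.
  by rewrite expr2; under eq_fun do rewrite expr2; exact: cvgM.
by apply: (cvgV _ h); rewrite gt_eqF// exprn_gt0// limit_gt0.
Qed.

(** Convergence of vectors is always measured in [ipL], since [ipx (xi n)] varies with [n]; the
    weights converge because the limit frequency is nonzero. *)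
Lemma cvg_ipx u w f g : cvgL u f -> cvgL w g ->
  cvgC (fun n => ipx (xi n) (u n) (w n)) (ipx xi' f g).
Proof.
move=> uf wg; rewrite (ipxE hK) (kappa_vscale s' limit_unit).
rewrite (_ : (fun n => _) = (fun n => ipL (u n) (w n) +
  (s n ^- 2)%:C * (den (u n) * conjc (den (w n))))); last first.
  by apply/funext => n; rewrite (ipxE hK) (kappa_vscale (s n) (om1 n)).
apply: cvgCD; first exact: (cvgE_ip hip).
apply: cvgCM; first exact: cvg_kappa.
by apply: cvgCM; [exact: cvg_den|apply: cvgC_conj; exact: cvg_den].
Qed.

(** The triangular relation solved for [e n k]: the multiplier acts on a compact term, on a scalar
    times [Yxi], and on earlier basis vectors. Each of them converges, which makes strong
    convergence of the [e n k] an induction on [k]. *)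
Lemma Schur_fixpoint n k : (k < m)%N -> e n k = Cq (rmul B (Lam k (s n)) (xi n))
  (Kq K (e n k) - ('i%C * (s n ^- 2)%:C * den (e n k)) *: Yxi (xi n)
   - \sum_(i < k) ipx (xi n) (Bq B (xi n) (e n k)) (e n i) *: e n i).
Proof.
move=> km; have [[Dn Dv] _] := eB n km.
apply: (rmul_inverse hK (Lmu km (s_rng n)) Dn Dv).
have eqB := BqE hK (conj Dn Dv).
rewrite (kappa_vscale (s n) (om1 n)) (Schur_expand hK (eo n) (fun k km => eB n km) km) /Lq in eqB.
move: eqB; move: (Lam k (s n) *: _) (\sum_(i < k) _) (Kq K _) (Mq nuB _) (_ *: Mq _ _) (_ *: Yxi _).
move=> a b x y w t h.
have -> : x = a + b + t + w + y by rewrite h !subrK.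
by rewrite [X in _ = X - t - b](ACl (1*5*4*2*3)) !addrK.
Qed.

Lemma cvg_Schur_source k e' g d : (k < m)%N ->
  (forall i, (i < k)%N -> cvgL (fun n => e n i) (e' i)) ->
  cvgL (fun n => Kq K (e n k)) g -> cvgC (fun n => den (e n k)) d ->
  cvgL (fun n => e n k) (Cq (rmul B (Lam k s') xi')
    (g - ('i%C * (s' ^- 2)%:C * d) *: Yxi xi' - \sum_(i < k) T k i *: e' i)).
Proof.
move=> km he hg hd.
have xx : cvg_vec (fun n => xi n) xi' := cvg_vec_scale ss' oo'.
rewrite (_ : (fun n => e n k) = (fun n => Cq (rmul B (Lam k (s n)) (xi n))
  (Kq K (e n k) - ('i%C * (s n ^- 2)%:C * den (e n k)) *: Yxi (xi n)
   - \sum_(i < k) ipx (xi n) (Bq B (xi n) (e n k)) (e n i) *: e n i))); last first.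
  by apply/funext => n; exact: Schur_fixpoint.
apply: (cvg_Cq_rmul hK).
- by move=> n; exact: Lmu.
- exact: Lmu km limit_rng.
- exact: Lcont km s_rng limit_rng ss'.
- by move=> v; exact: cvg_vec_dot.
have h2 : cvgL (fun n => ('i%C * (s n ^- 2)%:C * den (e n k)) *: Yxi (xi n))
    (('i%C * (s' ^- 2)%:C * d) *: Yxi xi').
  apply: (cvgEZ hip); last exact: cvg_vec_Yxi.
  by apply: cvgCM => //; apply: cvgCM; [exact: cvgC_cst|exact: cvg_kappa].
have h3 : cvgL (fun n => \sum_(i < k) ipx (xi n) (Bq B (xi n) (e n k)) (e n i) *: e n i)
    (\sum_(i < k) T k i *: e' i).
  apply: (cvgE_sum hip (U := fun (i : 'I_k) n =>
    ipx (xi n) (Bq B (xi n) (e n k)) (e n i) *: e n i)) => i.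
  by apply: (cvgEZ hip); [exact: Tconv|exact: he].
exact: (cvgED hip (cvgED hip hg (cvgEN hip h2)) (cvgEN hip h3)).
Qed.

Lemma Schur_limit_exists : exists e' : nat -> E,
  forall k, (k < m)%N -> cvgL (fun n => e n k) (e' k).
Proof.
have H k : (k < m)%N -> exists f, cvgL (fun n => e n k) f.
  elim/ltn_ind: k => k IH km.
  have /choice[e' he'] : forall i, exists f, (i < k)%N -> cvgL (fun n => e n i) f.
    move=> i; case: (ltnP i k) => [ik|_]; last by exists 0.
    by have [f hf] := IH i ik (ltn_trans ik km); exists f.
  have [g hg] := Kconv km; have [d hd] := dconv km.
  by eexists; exact: cvg_Schur_source km he' hg hd.
have /choice[e' he'] : forall k, exists f, (k < m)%N -> cvgL (fun n => e n k) f.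
  move=> k; case: (ltnP k m) => [km|_]; last by exists 0.
  by have [f hf] := H k km; exists f.
by exists e'.
Qed.

(** The limit obeys the limiting fixed-point equation, from which [rmul_solves] recovers both
    membership in the domain and the triangular relation. *)
Lemma Schur_limit e' : (forall k, (k < m)%N -> cvgL (fun n => e n k) (e' k)) ->
  orthonormal_family (ipx xi') m e' /\ forall k, (k < m)%N -> Bdom B xi' (e' k) /\
    spanned k e' (Bq B xi' (e' k) - Lam k s' *: e' k).
Proof.
move=> he; split.
  move=> i j im jm; have := cvg_ipx (he i im) (he j jm).
  rewrite (_ : (fun n => _) = (fun=> (i == j)%:R)); last by apply/funext => n; exact: eo.
  by move=> h; rewrite (cvgC_uniq (cvgC_cst _) h).
move=> k km; have hK' := cvgE_Kq hK (he k km).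
have := cvg_Schur_source km (fun i ik => he i (ltn_trans ik km)) hK' (cvg_den (he k km)).
set w := (_ - _ - _) => h; have ek := cvgE_unique (he k km) h.
have := rmul_solves hK xi' (Lmu km limit_rng) w; rewrite /= -ek => -[Dn Dv eqn].
split; first by split.
exists (T k); rewrite (BqE hK (conj Dn Dv)) (kappa_vscale s' limit_unit) /Lq.
move: eqn; rewrite /w.
move: (Lam k s' *: _) (\sum_(i < k) _) (Kq K _) (Mq nuB _) (_ *: Mq _ _) (_ *: Yxi _).
move=> a b x y v t h1.
have -> : x = b + a + t + v + y.
  rewrite -[LHS](subrK t) -[X in X + t](subrK b) -h1.
  by rewrite (ACl (4*1*5*3*2)).
by rewrite !addrK.
Qed.

End Sequence.

End SchurLimit.

(** * Uniform bound on the spectral projections *)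

Section UniformProjections.
Variables (R : realType) (gamma : R) (B : vec3 R -> vec3 R -> R).
Variables (K : cfun R -> cfun R) (nu0 nu1 mu : R).
Hypothesis hK : kinetic_setting gamma B K nu0 nu1 mu.
Local Notation E := (L2class R).
Local Notation hip := (ipL_inner_product R).
Local Notation NL := (ipnorm (@ipL R)).
Local Notation cvgL := (cvgE (@ipL R)).

Lemma conjL_isometry f : NL (conjL f) = NL f.
Proof. by rewrite /ipnorm ipL_conj Re_conjc. Qed.

Lemma cvgE_conjL (u : nat -> E) f : cvgL u f -> cvgL (fun n => conjL (u n)) (conjL f).
Proof.
move=> h; apply: (cvgE_le _ h) => n.
have -> : conjL (u n) - conjL f = conjL (u n - f).
  by rewrite conjLD -(scaleN1r f) conjLZ conjcN conjc1 scaleN1r.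
by rewrite conjL_isometry lexx.
Qed.

Lemma Bq_csymmetric xi : forall f g, Bdom B xi f -> Bdom B xi g ->
  ipx xi (Bq B xi f) (conjL g) = ipx xi (Bq B xi g) (conjL f).
Proof. by move=> f g; exact: (Bq_csym hK). Qed.

Section Family.
Variables (s0 r0 : R) (m : nat) (psi : R -> vec3 R -> nat -> E) (Lam : nat -> R -> R[i]).
Variable S : vec3 R -> R -> E -> E.
Hypothesis s00 : 0 < s0.
Local Notation xi s om := (vscale s om).
Hypothesis hS : forall s om, s0 <= s <= r0 -> dot om om = 1 ->
  contraction_group (ipx (xi s om)) (Bdom B (xi s om)) (Bq B (xi s om)) (S (xi s om)).
Hypothesis psiD : forall s om, s0 <= s <= r0 -> dot om om = 1 ->
  forall k, (k < m)%N -> Bdom B (xi s om) (psi s om k).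
Hypothesis psiB : forall s om, s0 <= s <= r0 -> dot om om = 1 ->
  forall k, (k < m)%N -> Bq B (xi s om) (psi s om k) = Lam k s *: psi s om k.
Hypothesis psi_norm : forall s om, s0 <= s <= r0 -> dot om om = 1 ->
  forall j k, (j < m)%N -> (k < m)%N ->
  ipx (xi s om) (psi s om j) (conjL (psi s om k)) = (j == k)%:R.
Hypothesis psi_span : forall s om, s0 <= s <= r0 -> dot om om = 1 ->
  forall k f, (k < m)%N -> Bdom B (xi s om) f -> Bq B (xi s om) f = Lam k s *: f ->
  spanned m (psi s om) f.
Hypothesis Lmu : forall k x, (k < m)%N -> s0 <= x <= r0 -> - mu / 2 <= Re (Lam k x).
Hypothesis Lcont : forall k x (u : nat -> R), (k < m)%N -> (forall n, s0 <= u n <= r0) ->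
  s0 <= x <= r0 -> u @ \oo --> x -> cvgC (fun n => Lam k (u n)) (Lam k x).

(** A unit vector of the invariant span whose bilinear pairings with a Schur basis are at most [d].
    The record mentions the Schur basis and not the [psi], for which no bound is available;
    [ad_coef] makes the coefficients extractable. *)
Record almost_degenerate (d : R) (s : R) (om : vec3 R) (e : nat -> E) (c : nat -> R[i]) :
    Prop := {
  ad_rng : s0 <= s <= r0;
  ad_unit : dot om om = 1;
  ad_orth : orthonormal_family (ipx (xi s om)) m e;
  ad_schur : forall k, (k < m)%N -> Bdom B (xi s om) (e k) /\
    spanned k e (Bq B (xi s om) (e k) - Lam k s *: e k);
  ad_coef : forall k, (k < m)%N -> normc (c k) <= 1;
  ad_norm : ipnorm (ipx (xi s om)) (\sum_(k < m) c k *: e k) = 1;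
  ad_small : forall k, (k < m)%N ->
    normc (ipx (xi s om) (\sum_(j < m) c j *: e j) (conjL (e k))) <= d }.

(** The witness is the normalized projection [P] of [f]. [P] and [f] have the same pairings with the
    span, so those of [P] are at most the norm of [f], which is small against that of [P]. *)
Lemma large_projection_degenerate (d : R) s om f : s0 <= s <= r0 -> dot om om = 1 -> 0 < d ->
  d^-1 * ipnorm (ipx (xi s om)) f <
    ipnorm (ipx (xi s om)) (sproj (ipx (xi s om)) (@conjL R) m (psi s om) f) ->
  exists e c, almost_degenerate d s om e c.
Proof.
move=> srng om1 d0; set ip := ipx (xi s om); set P := sproj _ _ _ _ f => big.
have hipx : inner_product ip := ipx_inner_product hK (xi s om).
have [e [eo eB es se]] := invariant_basis hipx (hS srng om1) (psiD srng om1) (psiB srng om1)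
  (psi_norm srng om1).
have NP : 0 < ipnorm ip P.
  by apply: le_lt_trans big; rewrite mulr_ge0 ?ipnorm_ge0// invr_ge0 ltW.
pose a : R[i] := ((ipnorm ip P)^-1)%:C; pose g := a *: P.
have Ng : ipnorm ip g = 1.
  rewrite (ipnormZ hipx) normcR gtr0_norm ?invr_gt0// mulVf// gt_eqF//.
have gs : spanned m e g.
  apply: spannedZ; apply: (spanned_trans se).
  by exists (fun j => ip f (conjL (psi s om j))).
have gE : \sum_(k < m) ip g (e k) *: e k = g.
  have [c cE] := gs; rewrite {2}cE; apply: eq_bigr => k _; congr (_ *: _).
  by rewrite cE (ip_comb_orthonormal hipx eo c (ltn_ord k)).
have Ne k : (k < m)%N -> ipnorm ip (e k) = 1.
  by move=> km; rewrite /ipnorm eo// eqxx sqrtr1.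
have ipP j : (j < m)%N -> ip P (conjL (psi s om j)) = ip f (conjL (psi s om j)).
  exact: (ip_comb_psi hipx (psi_norm srng om1) (fun j => ip f (conjL (psi s om j)))).
exists e, (fun k => ip g (e k)); split; [exact: srng|exact: om1|exact: eo|exact: eB| | |].
- move=> k km; apply: le_trans (cauchy_schwarz hipx _ _) _.
  by rewrite Ng (Ne k km) mulr1.
- by rewrite gE; exact: Ng.
- move=> k km; rewrite gE -/ip /g (ipZl hipx).
  have [b bE] := es k km.
  have -> : ip P (conjL (e k)) = ip f (conjL (e k)).
    rewrite bE (J_sum (@conjLD R) (@conjLZ R)) !(ip_sumr hipx); apply: eq_bigr => j _.
    rewrite (conjLZ (b j)) (ipZr hipx (conjc (b j)) P) (ipZr hipx (conjc (b j)) f).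
    by rewrite (ipP j (ltn_ord j)).
  rewrite Normc.normcM normcR gtr0_norm ?invr_gt0//.
  have h : normc (ip f (conjL (e k))) <= ipnorm ip f.
    have NJ : ipnorm ip (conjL (e k)) = 1.
      by rewrite /ipnorm /ip (ipx_conj hK) Re_conjc; exact: Ne km.
    have := cauchy_schwarz hipx f (conjL (e k)).
    by rewrite NJ mulr1.
  have pure (x n F : R) : 0 < n -> d^-1 * F < n -> x <= F -> n^-1 * x <= d.
    move=> n0 Fn xF; rewrite mulrC ler_pdivrMr//; apply: le_trans xF _.
    by apply: ltW; rewrite -ltr_pdivrMl.
  exact: pure NP big h.
Qed.

Lemma dot_unit_le (om : vec3 R) : dot om om = 1 ->
  [/\ `|om.1.1| <= 1, `|om.1.2| <= 1 & `|om.2| <= 1].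
Proof.
rewrite /dot => h.
have h1 := sqr_ge0 om.1.1; have h2 := sqr_ge0 om.1.2; have h3 := sqr_ge0 om.2.
rewrite !expr2 in h1 h2 h3.
have k (x : R) : x * x <= 1 -> `|x| <= 1.
  by move=> hx; rewrite -(@ler_pXn2r _ 2) ?nnegrE// real_normK ?num_real// expr1n expr2.
by split; apply: k; lra.
Qed.

Lemma extract_degenerate (s : nat -> R) (om : nat -> vec3 R) (e : nat -> nat -> E)
    (c : nat -> nat -> R[i]) (d : nat -> R) :
  (forall p, almost_degenerate (d p) (s p) (om p) (e p) (c p)) ->
  exists2 phi, reindexing phi &
  [/\ exists (s' : R) (om' : vec3 R), (s \o phi) @ \oo --> s' /\ cvg_vec (om \o phi) om',
      forall k, (k < m)%N -> exists g, cvgL (fun p => Kq K (e (phi p) k)) g,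
      forall k, (k < m)%N -> exists l, cvgC (fun p => den (e (phi p) k)) l,
      forall k, (k < m)%N -> exists l, cvgC (fun p => c (phi p) k) l &
      forall k i, (i < k)%N -> (k < m)%N -> exists l, cvgC (fun p =>
        ipx (xi (s (phi p)) (om (phi p))) (Bq B (xi (s (phi p)) (om (phi p))) (e (phi p) k))
          (e (phi p) i)) l].
Proof.
move=> ad.
pose xp p := xi (s p) (om p).
have Ne p k : (k < m)%N -> NL (e p k) <= 1.
  move=> km; apply: le_trans (normL_le_normx hK (xp p) (e p k)) _.
  by rewrite /ipnorm (ad_orth (ad p))// eqxx sqrtr1.
(* The pair [(k, i)] is coded as [q = k * m + i], so that extraction over a single index applies;
   indices outside the triangle get 0. *)
pose T p q := let k := (q %/ m)%N in let i := (q %% m)%N in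
  if (i < k)%N && (k < m)%N then ipx (xp p) (Bq B (xp p) (e p k)) (e p i) else 0.
have T_le p q : normc (T p q) <= 2 * mu.
  rewrite /T; case: ifP => [/andP[ik km]|_]; last first.
    by rewrite Normc.normc0 mulr_ge0// ltW// (ks_mu_gt0 hK).
  apply: (Schur_coef_le hK (ad_orth (ad p)) (ad_schur (ad p)) _ ik km) => j jm.
  exact: Lmu jm (ad_rng (ad p)).
have den1 p k : (k < m)%N -> normc (den (e p k)) <= 1.
  by move=> km; apply: le_trans (den_le hK _) (Ne p k km).
pose coord i p : R := match i with 0 => s p | 1 => (om p).1.1 | 2 => (om p).1.2 | _ => (om p).2 end.
have coord_le i p : `|coord i p| <= `|r0| + 1.
  have [w1 w2 w3] := dot_unit_le (ad_unit (ad p)).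
  have h1 : 1 <= `|r0| + 1 by rewrite lerDr.
  case: i => [|[|[|i]]] /=.
  - have /andP[h2 h3] := ad_rng (ad p).
    rewrite gtr0_norm ?(lt_le_trans s00 h2)//; apply: le_trans h3 _.
    by apply: le_trans (ler_norm _) _; rewrite lerDl.
  - exact: le_trans w1 h1.
  - exact: le_trans w2 h1.
  - exact: le_trans w3 h1.
(* Five groups are extracted in turn: the frequency parameters, the images under [K], the densities,
   the coefficients, and the Schur entries. *)
pose Q i (phi : nat -> nat) : Prop := match i with
  | 0 => forall j, (j < 4)%N -> cvgn (coord j \o phi)
  | 1 => forall k, (k < m)%N -> exists g, cvgL (fun p => Kq K (e (phi p) k)) g
  | 2 => forall k, (k < m)%N -> exists l, cvgC (fun p => den (e (phi p) k)) l
  | 3 => forall k, (k < m)%N -> exists l, cvgC (fun p => c (phi p) k) l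
  | _ => forall q, (q < m * m)%N -> exists l, cvgC (fun p => T (phi p) q) l
  end.
have [] := @extract_all 5 Q.
- case=> [|[|[|[|[|//]]]]] phi _ hphi.
  + apply: (@extract_all 4 (fun j t => cvgn (coord j \o (phi \o t)))) => [j t _ _|j t u hu].
      have [u hu cu] := bounded_extract (u := coord j \o (phi \o t)) (fun p => coord_le j _).
      by exists u.
    move=> /cvg_ex[l hl]; apply/cvg_ex; exists l.
    exact: (cvg_comp _ _ (cvg_reindexing hu) hl).
  + by apply: (Kq_extract_all hK (u := fun k p => e (phi p) k) (C := 1)) => k p; exact: Ne.
  + apply: (extract_scalars (M := 1) (U := fun k p => den (e (phi p) k))) => k p.
    exact: den1.
  + apply: (extract_scalars (M := 1) (U := fun k p => c (phi p) k)) => k p km.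
    by apply: (ad_coef (ad (phi p))).
  + by apply: (extract_scalars (M := 2 * mu) (U := fun q p => T (phi p) q)) => q p _.
- case=> [|[|[|[|i]]]] phi t ht h k km.
  + have /cvg_ex[l hl] := h k km; apply/cvg_ex; exists l.
    exact: (cvg_comp _ _ (cvg_reindexing ht) hl).
  + have [l hl] := h k km; exists l; exact: (cvgE_reindexing ht hl).
  + have [l hl] := h k km; exists l; exact: (cvgC_reindexing ht hl).
  + have [l hl] := h k km; exists l; exact: (cvgC_reindexing ht hl).
  + have [l hl] := h k km; exists l; exact: (cvgC_reindexing ht hl).
move=> phi hphi hQ; exists phi => //; split.
- have c0 := hQ 0 isT; have /cvg_ex[s' hs] := c0 0 isT; have /cvg_ex[x1 h1] := c0 1 isT.
  have /cvg_ex[x2 h2] := c0 2 isT; have /cvg_ex[x3 h3] := c0 3 isT.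
  by exists s', (x1, x2, x3).
- exact: hQ 1 isT.
- exact: hQ 2 isT.
- exact: hQ 3 isT.
- move=> k i ik km; have im := ltn_trans ik km.
  have m0 : (0 < m)%N := leq_ltn_trans (leq0n k) km.
  have qm : (k * m + i < m * m)%N.
    apply: (@leq_trans (k.+1 * m)%N); first by rewrite mulSn addnC ltn_add2r.
    by rewrite leq_mul2r km orbT.
  have [l hl] := hQ 4 isT _ qm; exists l; move: hl.
  by rewrite /T divnMDl// modnMDl (divn_small im) (modn_small im) addn0 ik km.
Qed.

Theorem sproj_uniform_bound : exists2 C : R, 0 < C & forall s om, s0 <= s <= r0 ->
  dot om om = 1 -> forall f,
  ipnorm (ipx (xi s om)) (sproj (ipx (xi s om)) (@conjL R) m (psi s om) f)
    <= C * ipnorm (ipx (xi s om)) f.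
Proof.
apply: contrapT => nC.
have /choice[a ha] : forall p : nat, exists a : R * vec3 R * (nat -> E) * (nat -> R[i]),
    almost_degenerate (p.+1%:R^-1) a.1.1.1 a.1.1.2 a.1.2 a.2.
  move=> p; apply: contrapT => na; apply: nC; exists p.+1%:R => // s om srng om1 f.
  rewrite leNgt; apply/negP => big; apply: na.
  have d0 : 0 < (p.+1%:R)^-1 :> R by rewrite invr_gt0.
  rewrite -[X in X * _](invrK p.+1%:R) in big.
  have [e [c hec]] := large_projection_degenerate srng om1 d0 big.
  by exists (s, om, e, c).
have [phi hphi [[s' [om' [hs hom]]] hKc hd hc hT]] := extract_degenerate ha.
pose s p := (a (phi p)).1.1.1; pose om p := (a (phi p)).1.1.2; pose e p := (a (phi p)).1.2.
pose c p := (a (phi p)).2.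
have ad p : almost_degenerate ((phi p).+1%:R^-1) (s p) (om p) (e p) (c p) := ha (phi p).
have srng p := ad_rng (ad p); have om1 p := ad_unit (ad p).
have eo p := ad_orth (ad p); have eB p := ad_schur (ad p).
have /choice[T hT'] : forall k, exists t : nat -> R[i], forall i, (i < k)%N -> (k < m)%N ->
    cvgC (fun p => ipx (xi (s p) (om p)) (Bq B (xi (s p) (om p)) (e p k)) (e p i)) (t i).
  move=> k; suff /choice[t ht] : forall i, exists l, (i < k)%N -> (k < m)%N ->
      cvgC (fun p => ipx (xi (s p) (om p)) (Bq B (xi (s p) (om p)) (e p k)) (e p i)) l.
    by exists t.
  move=> i; case: (ltnP i k) => [ik|_]; last by exists 0.
  case: (ltnP k m) => [km|_]; last by exists 0.
  by have [l hl] := hT k i ik km; exists l.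
have /choice[c' hc'] : forall k, exists l, (k < m)%N -> cvgC (fun p => c p k) l.
  move=> k; case: (ltnP k m) => [km|_]; last by exists 0.
  by have [l hl] := hc k km; exists l.
have [e' he'] := Schur_limit_exists hK s00 srng om1 eo eB Lmu Lcont hs hom hKc hd hT'.
have [eo' eB'] := Schur_limit hK s00 srng om1 eo eB Lmu Lcont hs hom hT' he'.
have srng' := limit_rng srng hs; have om1' := limit_unit om1 hom.
have hipx := ipx_inner_product hK (xi s' om').
have es := Schur_span hipx (hS srng' om1') (ipx_conj hK (xi s' om')) (@conjLK R)
  (Bq_csymmetric (xi := xi s' om')) (psiD srng' om1') (psiB srng' om1') (psi_norm srng' om1')
  eB' (psi_span srng' om1').
pose g' := \sum_(k < m) c' k *: e' k.
have hg : cvgL (fun p => \sum_(k < m) c p k *: e p k) g'.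
  apply: (cvgE_sum hip (U := fun (k : 'I_m) p => c p k *: e p k)) => k.
  by apply: (cvgEZ hip); [exact: hc'|exact: he'].
have cipx := cvg_ipx hK s00 srng om1 hs hom.
(* All pairings of [g'] with the limit span vanish, since those along the sequence are at most
   [p.+1%:R^-1]; but norm one also passes to the limit, which is the contradiction. *)
have g0 : g' = 0.
  apply: (skernel_span hipx (@conjLD R) (@conjLZ R) (psi_norm srng' om1') eo' es).
    by apply: spanned_sum => k; apply: spannedZ; exact: es.
  move=> k km; have h := cipx _ _ _ _ hg (cvgE_conjL (he' k km)).
  apply: (cvgC_uniq h).
  apply: (cvgC_le (y := fun p => (p.+1%:R)^-1 : R)); last exact: cvg_harmonic.
  move=> p; rewrite subr0; apply: le_trans (ad_small (ad p) km) _.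
  by rewrite lef_pV2 ?posrE// ler_nat ltnS; exact: reindexing_ge.
have h := cipx _ _ _ _ hg hg.
have e1 : ipx (xi s' om') g' g' = 1.
  apply: (cvgC_uniq h); rewrite (_ : (fun p => _) = (fun=> 1)); first exact: cvgC_cst.
  apply/funext => p; rewrite (ipff (ipx_inner_product hK (xi (s p) (om p)))).
  by rewrite (ad_norm (ad p)) expr1n.
by move: e1; rewrite g0 (ip0l hipx) => /eqP; rewrite eq_sym oner_eq0.
Qed.

End Family.

End UniformProjections.

(** * Uniform decay *)

Section SmallEigenvalues.
Variable R : realType.

Lemma eq_upto_o2_Re (p q : R -> R[i]) (a e : R) : eq_upto_o2 p q ->
  (forall s, Re (q s) = - (a * s ^+ 2)) -> 0 < a -> 0 < e ->
  exists2 d, 0 < d & forall s, 0 < s < d -> - Re (p s) <= e.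
Proof.
move=> /cvg_at_right0P/(_ 1 ltr01)[d d0 hd] qE a0 e0.
have a1 : 0 < a + 1 by rewrite addr_gt0.
(* For [s < 1] one has [- Re (p s) <= (a + 1) * s ^+ 2 <= (a + 1) * s]. *)
exists (Num.min d (Num.min 1 (e / (a + 1)))).
  by rewrite !lt_min d0 ltr01 divr_gt0.
move=> s /andP[s0]; rewrite !lt_min => /andP[sd /andP[s1 se]].
have := hd s; rewrite s0 sd => /(_ isT); have s2 : 0 < s ^+ 2 by rewrite exprn_gt0.
rewrite ger0_norm; last by rewrite divr_ge0 ?normc_ge0// ltW.
rewrite ltr_pdivrMr// mul1r => h.
have := le_trans (ler_norm _) (normr_Re_le (- (p s - q s))).
rewrite normcN Re_opp Re_add Re_opp qE => h2.
have s3 : s ^+ 2 <= s by rewrite expr2 ler_piMl// ltW.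
rewrite ltr_pdivlMr// in se.
have := ler_wpM2r (ltW a1) s3; move: h h2 se; move: (normc _) => z; lra.
Qed.

(** The difference quotient at [y] is bounded near [y] within [I], which gives a Lipschitz estimate
    there. *)
Lemma smooth_on_continuous (I : set R) (u : R -> R[i]^o) :
  smooth_on (E := R[i]^o) (fun=> True) (@Normc.normc R) I u ->
  forall (x : nat -> R) y, (forall n, I (x n)) -> I y -> x @ \oo --> y ->
  cvgC (fun n => u (x n)) (u y).
Proof.
move=> [d [d0 dS]] x y Ix Iy xy.
have [_ /cvgrPdist_lt/(_ 1 ltr01) H] := dS 0 y Iy.
have [r r0 hr] : exists2 r : R, 0 < r & forall z, I z -> `|y - z| < r ->
    normc (u z - u y) <= (normc (d 1 y) + 1) * `|y - z|.
  have /nbhs_ballP[r /= r0 hr] := H; exists r => // z Iz yz.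
  have [->|zy] := eqVneq z y; first by rewrite !subrr Normc.normc0 normr0 mulr0.
  have := hr z yz zy Iz; rewrite sub0r normrN ger0_norm ?normc_ge0// (d0 _ Iz) (d0 _ Iy).
  set D := d 1 y; set w := u z - u y => h.
  have zy0 : z - y != 0 by rewrite subr_eq0.
  have wE : w = (z - y)%:C * (((z - y)^-1)%:C * w - D + D).
    by rewrite subrK mulrA -rmorphM mulfV// mul1r.
  rewrite wE Normc.normcM normcR distrC mulrC ler_wpM2r//.
  apply: le_trans (le_normcD _ _) _; rewrite addrC lerD2l; exact: ltW.
apply/cvgrPdist_lt => e e0; set M := normc (d 1 y) + 1 in hr.
have M0 : 0 < M by rewrite ltr_wpDl ?normc_ge0.
have e1 : 0 < Num.min r (e / M) by rewrite lt_min r0 divr_gt0.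
have /cvgrPdist_lt/(_ _ e1)[N _ hN] := xy; exists N => // n Nn.
have := hN n Nn; rewrite lt_min => /andP[h1 h2].
rewrite sub0r normrN ger0_norm ?normc_ge0//; apply: le_lt_trans (hr _ (Ix n) h1) _.
by rewrite mulrC -ltr_pdivlMr.
Qed.

End SmallEigenvalues.

(** * Eigenfunctions as classes *)

Section EigenFamily.
Variables (R : realType) (gamma : R) (B : vec3 R -> vec3 R -> R).
Variables (K : cfun R -> cfun R) (nu0 nu1 mu : R).
Hypothesis hK : kinetic_setting gamma B K nu0 nu1 mu.
Variables (r0 a0 a1 a2 b1 : R) (lambda : int -> R -> R[i]).
Variable psi : int -> R -> vec3 R -> cfun R.
Hypothesis hE : low_freq_eigendata B mu r0 a0 a1 a2 b1 lambda psi.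
Local Notation E := (L2class R).

Definition mode (k : nat) : int := k%:Z - 1.
Definition psiq (s : R) (om : vec3 R) (k : nat) : E := cls (psi (mode k) s om).
Definition lam (k : nat) (s : R) : R[i] := lambda (mode k) s.

Lemma modesE : modes = [seq mode k | k <- iota 0 5].
Proof. by []. Qed.

Lemma mem_mode k : (k < 5)%N -> mode k \in modes.
Proof. by move=> k5; rewrite modesE map_f// mem_iota. Qed.

Lemma mode_eq j k : (mode j == mode k) = (j == k).
Proof. by rewrite /mode (can_eq (subrK 1)). Qed.

Lemma small_eigenvalues e : 0 < a0 -> 0 < a1 -> 0 < a2 -> 0 < e ->
  exists2 d, 0 < d & forall k s, (k < 5)%N -> 0 < s < d -> s <= r0 -> - Re (lam k s) <= e.
Proof.
move=> a00 a10 a20 e0.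
have q1 s : Re ('i%C + (- a1 +i* b1) * (s ^+ 2)%:C) = - (a1 * s ^+ 2).
  by rewrite Re_add Re_mul /=; ring.
have qN s : Re (- 'i%C + (- a1 -i* b1) * (s ^+ 2)%:C) = - (a1 * s ^+ 2).
  by rewrite Re_add Re_mul /=; ring.
have q0 (a s : R) : Re (- a * s ^+ 2)%:C = - (a * s ^+ 2) by rewrite /= mulNr.
have [d1 d10 h1] := eq_upto_o2_Re (lfe_lambda1 hE) q1 a10 e0.
have [dN dN0 hN] := eq_upto_o2_Re (lfe_lambdaN1 hE) qN a10 e0.
have [d0 d00 h0] := eq_upto_o2_Re (lfe_lambda0 hE) (q0 a0) a00 e0.
have [d2 d20 h2] := eq_upto_o2_Re (lfe_lambda2 hE) (q0 a2) a20 e0.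
exists (Num.min (Num.min d1 dN) (Num.min d0 d2)); first by rewrite !lt_min d10 dN0 d00 d20.
move=> k s k5 /andP[s0]; rewrite !lt_min => /andP[/andP[l1 lN] /andP[l0 l2]] sr.
have l2' : - Re (lambda 2 s) <= e by apply: h2; rewrite s0.
case: k k5 => [|[|[|[|[|//]]]]] _; rewrite /lam.
- by apply: hN; rewrite s0.
- by apply: h0; rewrite s0.
- by apply: h1; rewrite s0.
- exact: l2'.
- by rewrite -(lfe_lambda23 hE) ?s0.
Qed.

Lemma lam_continuous s0 : 0 < s0 -> forall k x (u : nat -> R), (k < 5)%N ->
  (forall n, s0 <= u n <= r0) -> s0 <= x <= r0 -> u @ \oo --> x ->
  cvgC (fun n => lam k (u n)) (lam k x).
Proof.
move=> s00 k x u k5 hu hx ux.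
have I y : s0 <= y <= r0 -> `]0, r0]%classic y.
  by move=> /andP[h1 h2]; rewrite /= in_itv /= h2 (lt_le_trans s00 h1).
apply: (smooth_on_continuous (lfe_lambda_smooth hE (mem_mode k5))) ux => [n|]; exact: I.
Qed.

Section Frequency.
Variables (s : R) (om : vec3 R).
Hypotheses (s_rng : 0 < s <= r0) (om1 : dot om om = 1).
Local Notation xi := (vscale s om).

Let om1' : vnorm om = 1. Proof. by rewrite /vnorm om1 sqrtr1. Qed.

Lemma psi_domB k : (k < 5)%N -> domB B xi (psi (mode k) s om).
Proof. by move=> k5; have [] := lfe_eigenfunction hE (mem_mode k5) s_rng om1'. Qed.

Lemma psi_L2 k : (k < 5)%N -> L2 (psi (mode k) s om).
Proof. by move=> /psi_domB[]. Qed.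

Lemma psiq_dom k : (k < 5)%N -> Bdom B xi (psiq s om k).
Proof. by move=> k5; apply/(domB_cls hK xi (psi_L2 k5)); exact: psi_domB. Qed.

Lemma psiq_eigen k : (k < 5)%N -> Bq B xi (psiq s om k) = lam k s *: psiq s om k.
Proof.
move=> k5; have Lp := psi_L2 k5; rewrite /psiq -(clsZ (lam k s) Lp).
apply/(Bq_eq hK (psi_domB k5) (L2Z (lam k s) Lp)).
by have [] := lfe_eigenfunction hE (mem_mode k5) s_rng om1'.
Qed.

Lemma psiq_norm j k : (j < 5)%N -> (k < 5)%N ->
  ipx xi (psiq s om j) (conjL (psiq s om k)) = (j == k)%:R.
Proof.
move=> j5 k5; rewrite /psiq (conjL_cls (psi_L2 k5)) (ipx_cls hK xi (psi_L2 j5)); last first.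
  exact: L2_conj (psi_L2 k5).
by rewrite (lfe_normalized hE (mem_mode j5) (mem_mode k5) s_rng om1') mode_eq.
Qed.

Lemma lam_halfplane k : (k < 5)%N -> - mu / 2 < Re (lam k s).
Proof. by move=> k5; exact: (lfe_halfplane hE (mem_mode k5) s_rng). Qed.

(** Eigenvectors are generalized eigenvectors of order 1, so the algebraic multiplicity bounds the
    geometric one. It is a count because eigenvalues may coincide. *)
Lemma eigenvector_spanned z : - mu / 2 < Re z ->
  exists b : nat -> E, forall g, Bdom B xi g -> Bq B xi g = z *: g ->
    spanned (count (fun j => lam j s == z) (iota 0 5)) b g.
Proof.
move=> zmu.
have : multiplicity (domB B xi) (Bhat B xi) z (count (fun j => lambda j s == z) modes).
  exact (lfe_multiplicity hE s_rng om1' zmu).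
rewrite modesE count_map.
set n := count _ _ => -[e [eW _ espan]].
have Le i : L2 (e i) by have [] := eW i.
exists (fun i => if insub i is Some j then cls (e j) else 0) => g Dg Bg.
have Dr := (domB_rep B xi g).2 Dg; have Lg := rep_L2 g.
have hB : Bhat B xi (rep g) = (fun v => z * rep g v) %[ae @leb3 R].
  by apply/(Bq_eq hK Dr (L2Z z Lg)); rewrite (clsZ z Lg) (repK g).
have [c hc] : exists c, rep g = lincomb c e %[ae @leb3 R].
  apply: espan; split => //; exists 1%N; split => //=.
  by move: hB; apply: filterS => v /(_ I) h _; rewrite h subrr.
exists (fun i => if insub i is Some j then c j else 0).
have Lc i : L2 (fun v => c i * e i v) := L2Z (c i) (Le i).
rewrite -{1}(repK g) (cls_ae hc) (cls_sum Lc); apply: eq_bigr => i _.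
by rewrite valK (clsZ (c i) (Le i)).
Qed.

End Frequency.
End EigenFamily.

(** * Combination of the three regimes *)

Section UniformDecay.
Variables (R : realType) (gamma : R) (B : vec3 R -> vec3 R -> R).
Variables (K : cfun R -> cfun R) (nu0 nu1 mu : R).
Hypothesis hK : kinetic_setting gamma B K nu0 nu1 mu.
Variables (r0 a0 a1 a2 b1 : R) (lambda : int -> R -> R[i]).
Variable psi : int -> R -> vec3 R -> cfun R.
Hypothesis hE : low_freq_eigendata B mu r0 a0 a1 a2 b1 lambda psi.
Hypotheses (r00 : 0 < r0) (a00 : 0 < a0) (a10 : 0 < a1) (a20 : 0 < a2).
Variable S : vec3 R -> R -> cfun R -> cfun R.
Hypothesis hS : forall xi : vec3 R, xi != 0 ->
  contraction_semigroup (norm_xi xi) (S xi)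
  /\ generator_of (norm_xi xi) (domB B xi) (Bhat B xi) (S xi).
Local Notation E := (L2class R).
Local Notation pq := (psiq psi).
Local Notation lm := (lam lambda).

Lemma vscale_neq0 s (om : vec3 R) : 0 < s -> dot om om = 1 -> vscale s om != 0.
Proof.
move=> s0 om1; apply/eqP => h.
have : s * dot om om = 0.
  have -> : s * dot om om = dot (vscale s om) om by rewrite /dot /vscale /=; ring.
  by rewrite h /dot /= !mul0r !addr0.
by rewrite om1 mulr1 => s00; rewrite s00 ltxx in s0.
Qed.

Lemma group_xi s om : 0 < s -> dot om om = 1 ->
  contraction_group (ipx (vscale s om)) (Bdom B (vscale s om)) (Bq B (vscale s om))
    (Sq (S (vscale s om))).
Proof.
move=> s0 om1; have [h1 h2] := hS (vscale_neq0 s0 om1).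
exact: (Sq_contraction_group hK h1 h2).
Qed.

Definition spectral_part s om t (f : E) : E :=
  \sum_(k < 5) (cexp (t%:C * lm k s) * ipx (vscale s om) f (conjL (pq s om k))) *: pq s om k.

Lemma basis_dissip xi f : Bdom B xi f -> Re (ipx xi (Bq B xi f) f) <=
  - mu * ipnorm (ipx xi) (f - oproj (ipx xi) 5 (basx xi) f) ^+ 2.
Proof. by move=> Df; rewrite (oproj_basx hK); exact: (Bq_dissip hK). Qed.

Lemma lam_Re_le0 s (om : vec3 R) k : 0 < s <= r0 -> dot om om = 1 -> (k < 5)%N -> Re (lm k s) <= 0.
Proof.
move=> srng om1; have hipx := ipx_inner_product hK (vscale s om).
exact: (eigen_dissip hipx (psiq_dom hK hE srng om1) (psiq_eigen hK hE srng om1)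
  (psiq_norm hK hE srng om1) (ks_mu_gt0 hK) (@basis_dissip (vscale s om))).
Qed.

Lemma low_decay : exists2 s1, 0 < s1 & forall s (om : vec3 R) t f, 0 < s < s1 -> s <= r0 ->
  dot om om = 1 -> 0 <= t ->
  ipnorm (ipx (vscale s om)) (Sq (S (vscale s om)) t f - spectral_part s om t f)
    <= 4 * expR (- (mu / 2) * t) * ipnorm (ipx (vscale s om)) f.
Proof.
have mu0 := ks_mu_gt0 hK.
(* Five eigenvalues with [- Re / mu <= 225^-1] give a defect of at most [45^-1]; then
   [5 * 45^-1 = 9^-1] and [45^-1 <= 36^-1], as [low_frequency_decay] requires. *)
have e0 : 0 < mu / 225 by apply: divr_gt0 mu0 _; rewrite ltr0n.
have [d d0 hd] := small_eigenvalues hE a00 a10 a20 e0.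
exists d => // s om t f /andP[s0 sd] sr om1 t0.
have srng : 0 < s <= r0 by rewrite s0 sr.
have hipx := ipx_inner_product hK (vscale s om).
have defect : \sum_(k < 5) - Re (lm k s) / mu <= 45^-1.
  apply: (@le_trans _ _ (\sum_(k < 5) 225^-1)); last by rewrite !big_ord_recl big_ord0; lra.
  apply: ler_sum => k _; rewrite ler_pdivrMr// mulrC; apply: hd => //.
  by rewrite s0 sd.
have P1J g : ipnorm (ipx (vscale s om)) (conjL g - oproj (ipx (vscale s om)) 5
    (basx (vscale s om)) (conjL g)) =
    ipnorm (ipx (vscale s om)) (g - oproj (ipx (vscale s om)) 5 (basx (vscale s om)) g).
  rewrite (oproj_basx hK (vscale s om) (conjL g)) (oproj_basx hK (vscale s om) g).
  exact: (P1q_conj hK).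
apply: (low_frequency_decay hipx (group_xi s0 om1) (@conjLD R) (@conjLZ R)
  (ipx_conj hK (vscale s om)) (@conjLK R) (Bq_csymmetric hK (xi := vscale s om))
  (psiq_dom hK hE srng om1) (psiq_eigen hK hE srng om1) (psiq_norm hK hE srng om1)
  (basx_orthonormal hK (vscale s om)) mu0 (@basis_dissip (vscale s om)) P1J
  (fun f e => @Bdom_dense _ _ _ _ _ _ _ hK (vscale s om) f e)) => //; lra.
Qed.

Lemma uniform_decay : exists C sg : R, [/\ 0 < C, 0 < sg & forall s (om : vec3 R) t f, 0 < s ->
  dot om om = 1 -> 0 <= t ->
  ipnorm (ipx (vscale s om)) (Sq (S (vscale s om)) t f -
      (if s <= r0 then spectral_part s om t f else 0))
    <= C * expR (- sg * t) * ipnorm (ipx (vscale s om)) f].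
Proof.
have mu0 := ks_mu_gt0 hK.
have [s1 s10 low] := low_decay.
(* Since [s0 <= r0], every [s < s0] lies where the spectral part is present, and the Lyapunov decay
   covers all [s >= s0], on either side of [r0]. *)
pose s0 := Num.min (s1 / 2) r0.
have s00 : 0 < s0 by rewrite lt_min r00 divr_gt0.
have rng s : s0 <= s <= r0 -> 0 < s <= r0.
  by move=> /andP[h ->]; rewrite (lt_le_trans s00 h).
have [C1 [sg1 [C10 sg10 high]]] := high_frequency_decay hK s00.
have grp s om (h : s0 <= s <= r0) (om1 : dot om om = 1) : contraction_group
    (ipx (vscale s om)) (Bdom B (vscale s om)) (Bq B (vscale s om)) (Sq (S (vscale s om))).
  by have /andP[sp _] := rng s h; exact: group_xi.
have span s om : s0 <= s <= r0 -> dot om om = 1 -> forall k f, (k < 5)%N ->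
    Bdom B (vscale s om) f -> Bq B (vscale s om) f = lm k s *: f -> spanned 5 (pq s om) f.
  move=> h om1 k f k5 Df Bf; have hr := rng s h.
  have [b hb] := eigenvector_spanned hK hE hr om1 (lam_halfplane hE hr k5).
  exact: (eigenspace_span (ipx_inner_product hK _) (grp s om h om1)
    (ipx_conj hK (vscale s om)) (@conjLK R) (Bq_csymmetric hK (xi := vscale s om))
    (psiq_dom hK hE hr om1) (psiq_eigen hK hE hr om1) (psiq_norm hK hE hr om1) hb Df Bf).
have [C2 C20 proj] := sproj_uniform_bound hK s00
  (S := fun xi => Sq (S xi)) grp
  (fun s om h om1 => psiq_dom hK hE (rng s h) om1)
  (fun s om h om1 => psiq_eigen hK hE (rng s h) om1)
  (fun s om h om1 => psiq_norm hK hE (rng s h) om1) span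
  (fun k x k5 h => ltW (lam_halfplane hE (rng x h) k5)) (lam_continuous hE s00).
(* 4 serves small [s], [C1] alone [s > r0], and [C1 * (1 + C2)] the middle range, where the decay of
   the semigroup is applied to [f] minus its projection. *)
pose C := 4 + C1 * (1 + C2); pose sg := Num.min (mu / 2) sg1.
have C2p : 0 < C1 * (1 + C2) by rewrite mulr_gt0// addr_gt0.
exists C, sg; split; [by rewrite addr_gt0|by rewrite lt_min sg10 divr_gt0|].
move=> s om t f sp om1 t0; set N := ipnorm _; have N0 : 0 <= N f := ipnorm_ge0 _ _.
have weaken C' sg' x : 0 <= C' -> C' <= C -> sg <= sg' ->
    x <= C' * expR (- sg' * t) * N f -> x <= C * expR (- sg * t) * N f.
  move=> C'0 C'C sgsg' /le_trans; apply; rewrite ler_wpM2r//.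
  by apply: ler_pM => //; rewrite ?expR_ge0// ler_expR ler_wpM2r// lerN2.
have [sg_l sg_r] : sg <= mu / 2 /\ sg <= sg1 by split; rewrite ge_min lexx ?orbT.
have [ss|ss] := ltP s s0.
  have /andP[l1 l2] : (s < s1 / 2) && (s < r0) by rewrite -lt_min.
  rewrite (ltW l2); apply: (weaken 4 (mu / 2)) => //; first by rewrite lerDl ltW.
  have ss1 : s < s1 by lra.
  by apply: low => //; [rewrite sp|exact: ltW].
have hg := group_xi sp om1.
case: ifPn => [sr|_]; last first.
  rewrite subr0; apply: (weaken C1 sg1); [exact: ltW| |exact: sg_r|exact: high].
  by rewrite /C mulrDr mulr1; have := mulr_gt0 C10 C20; lra.
have h : s0 <= s <= r0 by rewrite ss sr.
have hr := rng s h; have hipx := ipx_inner_product hK (vscale s om).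
rewrite /spectral_part -(sg_sproj hipx hg (psiq_dom hK hE hr om1) (psiq_eigen hK hE hr om1)
  (psiq_norm hK hE hr om1) f t0 (fun k => lam_Re_le0 hr om1)).
rewrite -(sgB hg f _ t0).
apply: (weaken (C1 * (1 + C2)) sg1); [exact: ltW|by rewrite lerDr|exact: sg_r|].
apply: le_trans (high _ _ om1 ss _ hg t _ t0) _.
have pure (x y z : R) : 0 <= x -> y <= (1 + C2) * z -> C1 * x * y <= C1 * (1 + C2) * x * z.
  move=> x0 yz; rewrite mulrAC [leRHS]mulrAC ler_wpM2r//.
  by rewrite -[leRHS]mulrA ler_pM2l.
apply: (pure _ _ _ (expR_ge0 _)).
apply: le_trans (ler_ipnormB hipx f _) _; rewrite mulrDl mul1r lerD2l.
exact: (proj s om h om1 f).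
Qed.

Lemma S1_cls s (om : vec3 R) t u : 0 < s <= r0 -> dot om om = 1 -> L2 u ->
  let S1u := fun v => \sum_(j <- modes) cexp (t%:C * lambda j s)
      * inner_xi (vscale s om) u (cfconj (psi j s om)) * psi j s om v in
  L2 S1u /\ cls S1u = spectral_part s om t (cls u).
Proof.
move=> srng om1 Lu S1u.
pose c (k : nat) := cexp (t%:C * lm k s) * ipx (vscale s om) (cls u) (conjL (pq s om k)).
have SE : S1u = fun v => \sum_(k < 5) c k * psi (mode k) s om v.
  apply/funext => v; rewrite /S1u modesE big_map -[iota 0 5]/(index_iota 0 5) big_mkord.
  apply: eq_bigr => k _; have Lp := psi_L2 hE srng om1 (ltn_ord k).
  by rewrite /c /psiq (conjL_cls Lp) (ipx_cls hK _ Lu (L2_conj Lp)).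
have Lc (k : 'I_5) : L2 (fun v => c k * psi (mode k) s om v).
  by apply: L2Z; exact: (psi_L2 hE srng om1 (ltn_ord k)).
rewrite SE; split; first exact: L2_sum.
rewrite (cls_sum Lc); apply: eq_bigr => k _.
by rewrite (clsZ (c k) (psi_L2 hE srng om1 (ltn_ord k))).
Qed.

End UniformDecay.

Theorem theorem3p4 (R : realType)
    (gamma : R) (B : vec3 R -> vec3 R -> R) (K : cfun R -> cfun R)
    (nu0 nu1 mu : R) (S : vec3 R -> R -> cfun R -> cfun R)
    (r0 a0 a1 a2 b1 : R) (lambda : int -> R -> R[i])
    (psi : int -> R -> vec3 R -> cfun R) :
  collision_kernel gamma B ->
  L_splitting B K ->
  (forall v, nu0 * (1 + vnorm v) `^ gamma <= nu B v
             /\ nu B v <= nu1 * (1 + vnorm v) `^ gamma) ->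
  orthonormal_basis (nullL B) (@chi R) ->
  0 < mu -> mu <= nu0 -> nu0 <= nu B 0 ->
  L_coercive B mu ->
  (forall xi : vec3 R, xi != 0 ->
     contraction_semigroup (norm_xi xi) (S xi)
     /\ generator_of (norm_xi xi) (domB B xi) (Bhat B xi) (S xi)) ->
  0 < r0 -> 0 < a0 -> 0 < a1 -> 0 < a2 -> 0 < b1 ->
  low_freq_eigendata B mu r0 a0 a1 a2 b1 lambda psi ->
  (forall (xi : vec3 R) (t : R) (f : cfun R), xi != 0 -> 0 < t -> L2 f ->
     S xi t f = S1 r0 lambda psi xi t f \+ S2 r0 lambda psi S xi t f
       %[ae @leb3 R])
  /\ exists C sigma0 : R, 0 < C /\ 0 < sigma0 /\
     forall (xi : vec3 R) (t : R) (f : cfun R), xi != 0 -> 0 <= t -> L2 f ->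
       norm_xi xi (S2 r0 lambda psi S xi t f)
         <= C * expR (- sigma0 * t) * norm_xi xi f.
Proof.
move=> hker hsplit hnu hnull mu0 munu _ hco hS r00 a00 a10 a20 _ hE.
have hK : kinetic_setting gamma B K nu0 nu1 mu by split.
split.
  move=> xi t f _ _ _.
  rewrite (_ : S1 _ _ _ _ _ _ \+ _ = S xi t f); first exact: ae_refl.
  by apply/funext => v; rewrite /S2 /= addrC subrK.
have [C [sg [C0 sg0 dec]]] := uniform_decay hK hE r00 a00 a10 a20 hS.
exists C, sg; split => //; split => // xi t f xi0 t0 Lf.
pose s := vnorm xi; pose om := vscale s^-1 xi.
have sp : 0 < s.
  rewrite lt_neqAle vnorm_ge0 andbT eq_sym; apply/eqP => h.
  have /eqP : dot xi xi = 0 by rewrite -sqr_vnorm -/s h expr0n.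
  rewrite /dot -!expr2 !paddr_eq0 ?addr_ge0 ?sqr_ge0// !sqrf_eq0 => /andP[/andP[]].
  case: xi xi0 {h s om} => [[x1 x2] x3] /= + /eqP e1 /eqP e2 /eqP e3.
  by rewrite e1 e2 e3 => /eqP; apply.
have xiE : vscale s om = xi.
  rewrite /om /vscale /= !mulrA !mulfV ?gt_eqF// !mul1r.
  by case: (xi) => [[x1 x2] x3].
have om1 : dot om om = 1.
  have -> : dot om om = s^-1 * (s^-1 * dot xi xi) by rewrite /om /dot /vscale /=; ring.
  by rewrite -sqr_vnorm -/s; field; rewrite gt_eqF.
have [hS' _] := hS xi xi0.
have LS := S_L2 hS' t0 Lf.
have := dec s om t (cls f) sp om1 t0; rewrite xiE (Sq_cls hS' t0 Lf) -(norm_xi_cls hK xi Lf).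
have [L1 <-] : L2 (S1 r0 lambda psi xi t f) /\ cls (S1 r0 lambda psi xi t f) =
    if s <= r0 then spectral_part lambda psi s om t (cls f) else 0.
  rewrite /S1 -/s -/om; case: ifPn => sr.
    have srng : 0 < s <= r0 by rewrite sp sr.
    by have := S1_cls hK hE t srng om1 Lf; rewrite /= xiE.
  by split; [exact: L2_0|].
by rewrite -(clsB LS L1) -(norm_xi_cls hK xi (L2B LS L1)).
Qed.
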